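(* Let $\{X,\mathbb{P}_x\}$ be a self-similar Markov process (ssMp) with values in $H$, with index $\alpha\ge0$ and lifetime $\zeta_c$, and let $\{(\theta,\xi),P_{y,z}\}$ be the Markov additive process (MAP) in $S\times\mathbb{R}$ associated to $\{X,\mathbb{P}_x\}$ by the extended Lamperti transformation. Define the process \[\widehat{X}_t=\begin{cases}\dfrac{X_{\gamma_t}}{\|X_{\gamma_t}\|^2}, & \text{if } t<\int_0^{\zeta_c}\frac{ds}{\|X_s\|^{2\alpha}},\\[2mm] 0, & \text{if } t\ge\int_0^{\zeta_c}\frac{ds}{\|X_s\|^{2\alpha}},\end{cases}\] where $\gamma_t=\inf\{s:\int_0^s\|X_u\|^{-2\alpha}\,du>t\}$ for $t<\int_0^{\zeta_c}\frac{ds}{\|X_s\|^{2\alpha}}$. Define also the probability measures $\widehat{\mathbb{P}}_x:=\mathbb{P}_{x/\|x\|^2}$ for $x\in H$ and $\widehat{\mathbb{P}}_0:=\mathbb{P}_0$. Then: (a) $\{\widehat{X},\widehat{\mathbb{P}}_x\}$ is a ssMp with values in $H$, with index $\alpha$ and lifetime $\int_0^{\zeta_c}\frac{ds}{\|X_s\|^{2\alpha}}$. (b) The MAP associated to $\{\widehat{X},\widehat{\mathbb{P}}_x\}$ by the extended Lamperti transformation is $\{(\theta,-\xi),P_{y,-z}\}$. (c) For a $\sigma$-finite measure $\pi$ on $S$, the processes $\{X,\mathbb{P}_x\}$ and $\{\widehat{X},\widehat{\mathbb{P}}_x\}$ are in duality with respect to the measure $\nu_\pi^\alpha(dx)=\|x\|^\alpha\Lambda_\pi(dx)$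 on $H$ if and only if the MAP $\{(\theta,\xi),P_{y,z}\}$ is reversible with respect to the measure $\pi(ds)dx$ on $S\times\mathbb{R}$.
   Context: Let $d\ge1$; $\|\cdot\|$ is the Euclidean norm, $S_{d-1}$ the unit sphere of $\mathbb{R}^d$ ($S_0=\{-1,+1\}$), $S$ a locally compact subspace of $S_{d-1}$, $\phi(y,z)=ye^z$ and $H=\phi(S\times\mathbb{R})\subset\mathbb{R}^d\setminus\{0\}$. Markov processes: an ''$E$-valued Markov process absorbed at $\delta$'', denoted $\{Z,P_x\}$, is a standard Markov process with a reference measure, i.e.: $E$ is locally compact with countable base, $\delta$ is an isolated extra state; $Z$ is a strong Markov process with values in $E\cup\{\delta\}$ on a completed filtered probability space $(\Omega,\mathcal{F},(\mathcal{F}_t),(P_x)_{x\in E\cup\{\delta\}})$, $P_x(Z_0=x)=1$; $Z_t=\delta$ for all $t\ge\zeta(Z):=\inf\{t:Z_t=\delta\}$ (lifetime); paths are right continuous, with left limits and quasi-left continuous on $[0,\zeta)$; and there is a $\sigma$-finite measure $\mu$ on $E$ such that for every $x\in E$ the potential measure $E_x(\int_0^\zeta 1_{\{Z_t\in dy\}}dt)$ is equivalent to $\mu$. ssMp: an $H$-valued ssMp with index $\alpha\ge0$ is an $H$-valued Markov process $\{X,\mathbb{P}_x\}$ absorbed at $0$ ($0$ being treated as the isolated extra state) such that for all $a>0$, $x\in H$, the law of $X$ under $\mathbb{P}_x$ equals that of $(aX_{a^{-\alpha}t},t\ge0)$ under $\mathbb{P}_{a^{-1}x}$. MAP: a MAP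 $\{(\theta,\xi),P_{y,z}\}$ in $S\times\mathbb{R}$ is an $S\times\mathbb{R}$-valued Markov process absorbed at an extra state $\delta$, with lifetime $\zeta_p$, such that for all $y\in S$, $z\in\mathbb{R}$, $s,t\ge0$ and positive measurable $f$, $E_{y,z}(f(\theta_{t+s},\xi_{t+s}-\xi_t),t+s<\zeta_p\,|\,\mathcal{F}_t)=E_{\theta_t,0}(f(\theta_s,\xi_s),s<\zeta_p)1_{\{t<\zeta_p\}}$. The MAP $\{(\theta,-\xi),P_{y,-z}\}$ is the process, with the same lifetime, obtained by replacing $\xi$ by $-\xi$; started from $(y,z)$ it has the law of $(\theta,-\xi)$ under $P_{y,-z}$. Extended Lamperti transformation: the MAP associated to an $H$-valued ssMp $\{X,\mathbb{P}_x\}$ of index $\alpha$ and lifetime $\zeta_c$ is $\xi_t=\log\|X_{A_t}\|$, $\theta_t=X_{A_t}/\|X_{A_t}\|$ for $t<\int_0^{\zeta_c}\|X_s\|^{-\alpha}ds$, and $(\theta_t,\xi_t)=\delta$ afterwards, where $A_t=\inf\{s:\int_0^s\|X_u\|^{-\alpha}du>t\}$, with $P_{y,z}=\mathbb{P}_{ye^z}$ and $P_\delta=\mathbb{P}_0$. Conversely $X_t=\theta_{\tau_t}e^{\xi_{\tau_t}}$ for $t<\int_0^{\zeta_p}e^{\alpha\xi_s}ds$ and $X_t=0$ afterwards, where $\tau_t=\inf\{s:\int_0^se^{\alpha\xi_u}du>t\}$. This is a one-to-one correspondence between $H$-valued ssMp's with index $\alpha$ and MAP's in $S\times\mathbb{R}$.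 Duality: two $E$-valued Markov processes absorbed at $\delta$, with semigroups $(P_t)$, $(\widehat P_t)$, are in duality (meaning weak duality) with respect to a $\sigma$-finite measure $m$ on $E$ if $\int_E g\,P_tf\,dm=\int_E f\,\widehat P_tg\,dm$ for all $t\ge0$ and all positive measurable $f,g$ (functions vanish at $\delta$). Reversibility: $\{(\theta,\xi),P_{y,z}\}$ is reversible with respect to $\pi(ds)dx$ ($\pi$ a $\sigma$-finite measure on $S$, $dx$ Lebesgue measure on $\mathbb{R}$) if for all $t\ge0$, $P_{y,0}(\theta_t\in dy_1,\xi_t\in dz)\,\pi(dy)=P_{y_1,0}(\theta_t\in dy,\xi_t\in dz)\,\pi(dy_1)$ as measures in $(y,z,y_1)$ on $S\times\mathbb{R}\times S$. $\Lambda_\pi$ is the image on $H$ of the measure $\pi(dy)dz$ on $S\times\mathbb{R}$ under $\phi$. *)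

(* Defs.v *)
From HB Require Import structures.
From mathcomp Require Import all_boot all_order all_algebra.
From mathcomp Require Import all_classical all_reals all_analysis.
From mathcomp Require Import measurable_realfun.

Set Implicit Arguments.
Unset Strict Implicit.
Unset Printing Implicit Defensive.

Import Order.TTheory GRing.Theory Num.Theory.
Import numFieldNormedType.Exports.

Local Open Scope classical_set_scope.
Local Open Scope ring_scope.

HB.instance Definition _ (U V : ptopologicalType) := Pointed.on (U * V)%type.

Notation borel V := (g_sigma_algebraType (@open V)).

(* A state space [E] is a subset of an ambient space [V], carrying the topology
   and the Borel sigma-algebra induced by those of [V].  States of
   [E \cup {delta}] are elements of [option V], [None] being the isolated extra
   state [delta].  Time is [R], only the times [t >= 0] being meaningful. *)

Section markov.
Context {R : realType} {V : ptopologicalType}.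

Definition with_cemetery (E : set V) : set (option V) :=
  [set o | if o is Some v then E v else True].

(* The neighbourhood filter of [o], [None] being isolated. *)
Definition cemetery_nbhs (o : option V) : set_system (option V) :=
  if o is Some v then Some @ v else principal_filter None.

(* As [None] is isolated, it imposes no constraint on a Borel set. *)
Definition cemetery_borel : set (set (option V)) :=
  [set B | measurable (Some @^-1` B : set (borel V))].

Definition vanish_at_cemetery (f : V -> \bar R) (o : option V) : \bar R :=
  if o is Some v then f v else 0%E.

Section process.
Context {d : measure_display} {Omega : measurableType d}.
Implicit Types (F : R -> set (set Omega)) (Z : R -> Omega -> option V).
Implicit Types (P : option V -> probability Omega R) (T : Omega -> \bar R).

Definition lifetime Z (w : Omega) : \bar R :=
  ereal_inf [set t%:E | t in [set t | 0 <= t /\ Z t w = None]].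

Definition stopping_time F T :=
  (forall w, (0 <= T w)%E) /\
  (forall t, 0 <= t -> F t [set w | (T w <= t%:E)%E]).

Definition stopped_sigma_algebra F T : set (set Omega) :=
  [set A | measurable A /\
    forall t, 0 <= t -> F t (A `&` [set w | (T w <= t%:E)%E])].

(* Completeness is with respect to the whole family [P]: [F 0] contains the sets
   which are negligible for each of its laws. *)
Record usual_filtration (E : set V) F P : Prop := UsualFiltration {
  filtration_sigma_algebra : forall t : R, 0 <= t -> sigma_algebra setT (F t) ;
  filtration_measurable : forall t : R, 0 <= t -> F t `<=` measurable ;
  filtration_nondecreasing : forall s t : R, 0 <= s -> s <= t -> F s `<=` F t ;
  filtration_right_continuous : forall t : R, 0 <= t ->
    \bigcap_(s in [set s | t < s]) F s `<=` F t ;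
  filtration_complete : forall N : set Omega,
    (forall o, with_cemetery E o -> (P o).-negligible N) -> F 0 N
}.

(* Only used where [T w] is finite. *)
Definition at_time Z T (w : Omega) : option V := Z (fine (T w)) w.

Definition semigroup Z P (t : R) (f : V -> \bar R) (v : V) : \bar R :=
  (\int[P (Some v)]_w vanish_at_cemetery f (Z t w))%E.

Definition potential Z P (v : V) (B : set V) : \bar R :=
  (\int[P (Some v)]_w \int[lebesgue_measure]_(t in [set t : R | (0 <= t)%R])
     (\1_(Some @` B) (Z t w))%:E)%E.

(* A standard Markov process with a reference measure.  The properties of the
   paths are required of every path, except quasi-left continuity, which is an
   almost sure property.  [set_type E] carries the topology induced by [V],
   whereas [locally_compact E] would allow compact sets not included in [E]. *)
Record markov_process (E : set V) F Z P : Prop := MarkovProcess {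
  markov_locally_compact : locally_compact [set: set_type E] ;
  markov_countable_base : @second_countable (set_type E) ;
  markov_filtration : usual_filtration E F P ;
  markov_adapted : forall (t : R) B, 0 <= t -> cemetery_borel B ->
    F t (Z t @^-1` B) ;
  markov_state : forall (t : R) w, 0 <= t -> with_cemetery E (Z t w) ;
  markov_start : forall o, with_cemetery E o ->
    P o [set w | Z 0 w = o] = 1%E ;
  markov_absorbed : forall (t : R) w, 0 <= t -> (lifetime Z w <= t%:E)%E ->
    Z t w = None ;
  markov_right_continuous : forall (t : R) w, 0 <= t -> (t%:E < lifetime Z w)%E ->
    Z s w @[s --> t^'+] --> cemetery_nbhs (Z t w) ;
  markov_left_limit : forall (t : R) w, 0 < t -> (t%:E < lifetime Z w)%E ->
    exists2 v, E v & Z s w @[s --> t^'-] --> cemetery_nbhs (Some v) ;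
  markov_kernel : forall (t : R) B, 0 <= t -> cemetery_borel B ->
    measurable_fun (E : set (borel V)) (fun v : borel V => P (Some v) (Z t @^-1` B)) ;
  markov_strong : forall T, stopping_time F T ->
    forall o (s : R) A B, with_cemetery E o -> 0 <= s ->
    stopped_sigma_algebra F T A -> cemetery_borel B ->
    P o (A `&` [set w | (T w < +oo)%E] `&`
         [set w | B (Z (fine (T w) + s) w)]) =
    (\int[P o]_(w in A `&` [set w | (T w < +oo)%E])
       P (at_time Z T w) (Z s @^-1` B))%E ;
  markov_quasi_left_continuous : forall (Tn : nat -> Omega -> \bar R) T,
    (forall k, stopping_time F (Tn k)) -> stopping_time F T ->
    (forall w, {homo Tn ^~ w : k l / (k <= l)%N >-> (k <= l)%E}) ->
    (forall w, Tn ^~ w @ \oo --> T w) ->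
    forall o, with_cemetery E o ->
    {ae P o, forall w, (T w < lifetime Z w)%E ->
      at_time Z (Tn k) w @[k --> \oo] --> cemetery_nbhs (at_time Z T w)} ;
  markov_reference_measure :
    exists mu : {sigma_finite_measure set (borel V) -> \bar R},
    forall v, E v -> forall B : set (borel V), measurable B -> B `<=` E ->
      potential Z P v B = 0%E <-> mu B = 0%E
}.

End process.

Definition in_duality (E : set V) (m : {measure set (borel V) -> \bar R})
    d1 (Omega1 : measurableType d1) (Z1 : R -> Omega1 -> option V)
    (P1 : option V -> probability Omega1 R)
    d2 (Omega2 : measurableType d2) (Z2 : R -> Omega2 -> option V)
    (P2 : option V -> probability Omega2 R) :=
  sigma_finite (E : set (borel V)) m /\
  forall (t : R) (f g : borel V -> \bar R), 0 <= t ->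
    measurable_fun setT f -> measurable_fun setT g ->
    (forall v, (0 <= f v)%E) -> (forall v, (0 <= g v)%E) ->
    (\int[m]_(v in E) (g v * semigroup Z1 P1 t f v) =
     \int[m]_(v in E) (f v * semigroup Z2 P2 t g v))%E.

End markov.

Section polar.
Context {R : realType} {n : nat}.
Local Notation vec := 'rV[R]_n.+1.

(* The library norm of ['rV[R]_n.+1] is the sup norm; both norms induce the
   topology of ['rV[R]_n.+1]. *)
Definition enorm (x : vec) : R := Num.sqrt (\sum_i x ord0 i ^+ 2).

Definition sphere : set vec := [set x | enorm x = 1].

Definition phi (p : vec * R) : vec := expR p.2 *: p.1.

Definition cone (S : set vec) : set vec := phi @` (S `*` setT).

Definition inversion (x : vec) : vec := (enorm x ^+ 2)^-1 *: x.

Local Notation rational_box q :=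
  (ball (map_mx ratr q.1 : vec) (q.2.+1%:R^-1 : R)).

Lemma open_vec_bigcup (A : set vec) : open A ->
  A = \bigcup_(q in [set q : 'rV[rat]_n.+1 * nat | rational_box q `<=` A])
        rational_box q.
Proof.
move=> oA; apply/seteqP; split=> [x Ax|x [q qA /qA]//].
have /nbhs_ballP[e /= e0 eA] : nbhs x A by exact: open_nbhs_nbhs.
have e2 : 0 < e / 2 by rewrite divr_gt0.
have [k ke] : exists k : nat, k.+1%:R^-1 + k.+1%:R^-1 < e.
  near \oo => k; exists k.
  have ke : k.+1%:R^-1 < e / 2 by near: k; exact: (near_infty_natSinv_lt (PosNum e2)).
  by rewrite [ltRHS]splitr ltrD.
have k0 : 0 < k.+1%:R^-1 :> R by rewrite invr_gt0.
have /choice[r rP] : forall i, exists r : rat,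
    ball (x ord0 i) k.+1%:R^-1 (ratr r).
  move=> i; have [r] := @rat_in_itvoo R _ _ (ltr_pwDr k0 (lexx (x ord0 i))).
  rewrite in_itv/= => /andP[xr rx]; exists r; rewrite /ball/= ltr_distlC.
  by rewrite rx andbT (le_lt_trans _ xr)// gerBl ltW.
have xq : ball (map_mx ratr (\row_i r i) : vec) k.+1%:R^-1 x.
  by split => // i j; rewrite (ord1 i) !mxE; apply: ball_sym.
exists (\row_i r i, k) => //= y /= qy; apply: eA; apply: le_ball (ltW ke) _ _.
by apply: ball_triangle qy; exact: ball_sym.
Unshelve. all: by end_near. Qed.

Lemma measurable_fun_borel_vec d (T : measurableType d) (f : T -> borel vec) :
  (forall i, measurable_fun setT (fun t => (f t : vec) ord0 i)) ->
  measurable_fun setT f.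
Proof.
move=> mf; apply: (@measurability _ _ T (borel vec) _ _ (@open vec)) => //.
move=> _ [A oA <-].
rewrite setTI (open_vec_bigcup oA) preimage_bigcup bigcup_mkcond.
apply: countable_bigcupT_measurable => // q; case: ifPn => // _.
have -> : f @^-1` rational_box q =
    \bigcap_(i in [set: 'I_n.+1])
      (fun t => (f t : vec) ord0 i) @^-1` ball (ratr (q.1 ord0 i) : R) q.2.+1%:R^-1.
  apply/seteqP; split=> [t [_ ft] i _|t ft].
    by have := ft ord0 i; rewrite mxE.
  split=> [|i j]; first by rewrite invr_gt0.
  by rewrite (ord1 i) mxE; exact: ft.
apply: fin_bigcap_measurable => // i _.
rewrite -[X in measurable X]setTI; apply: mf => //.
exact: measurable_ball.
Qed.

Lemma measurable_coord (i : 'I_n.+1) :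
  measurable_fun setT (fun x : borel vec => (x : vec) ord0 i).
Proof.
apply: (measurability _ (RGenOpens.measurableE R)) => _ [_ [a [b ->]] <-].
rewrite setTI; apply: sub_sigma_algebra; apply: open_comp (@itv_open _ _ a b).
by move=> x _; exact: coord_continuous.
Qed.

Lemma measurable_phi :
  measurable_fun setT (phi : borel vec * measurableTypeR R -> borel vec).
Proof.
apply: measurable_fun_borel_vec => i.
under eq_fun do rewrite /phi mxE.
apply: measurable_funM; first exact: measurableT_comp.
exact: (measurableT_comp (measurable_coord i)).
Qed.

Lemma measurable_enorm : measurable_fun setT (enorm : borel vec -> R).
Proof.
have msqrt := continuous_measurable_fun (@sqrt_continuous R).
apply: (measurableT_comp msqrt).
by apply: measurable_sum => i; apply: measurable_funX; exact: measurable_coord.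
Qed.

Section measures.
Local Open Scope ereal_scope.

(* A measure on [S] is a Borel measure [pi] on the ambient space such that
   [pi (~` S) = 0]; then [Lambda pi] is carried by [cone S]. *)
Definition Lambda (pi : {measure set (borel vec) -> \bar R}) :
    set (borel vec) -> \bar R :=
  pushforward (pi \x @lebesgue_measure R)
    (phi : borel vec * measurableTypeR R -> borel vec).

Section Lambda.
Variable pi : {measure set (borel vec) -> \bar R}.

Let Lambda0 : Lambda pi set0 = 0.
Proof. by rewrite /Lambda /pushforward preimage_set0 measure0. Qed.

Let Lambda_ge0 A : 0 <= Lambda pi A.
Proof. by rewrite /Lambda /pushforward measure_ge0. Qed.

Let Lambda_sigma_additive : semi_sigma_additive (Lambda pi).
Proof.
by apply: measure_semi_sigma_additive; exact: measurable_phi.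
Qed.

HB.instance Definition _ := isMeasure.Build _ _ _ (Lambda pi)
  Lambda0 Lambda_ge0 Lambda_sigma_additive.

End Lambda.

Definition nu (alpha : R) (pi : {measure set (borel vec) -> \bar R})
    (A : set (borel vec)) : \bar R :=
  \int[Lambda pi]_(x in A) (enorm x `^ alpha)%:E.

Section nu.
Variables (alpha : R) (pi : {measure set (borel vec) -> \bar R}).

Let nu0 : nu alpha pi set0 = 0.
Proof. exact: integral_set0. Qed.

Let nu_ge0 A : 0 <= nu alpha pi A.
Proof. by apply: integral_ge0 => x _; rewrite lee_fin powR_ge0. Qed.

Let nu_sigma_additive : semi_sigma_additive (nu alpha pi).
Proof.
move=> F mF tF mUF; rewrite /nu ge0_integral_bigcup//=; last 2 first.
- apply: measurable_funTS; apply/measurable_EFinP.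
  exact: (measurableT_comp (measurable_powR _) measurable_enorm).
- by move=> x _; rewrite lee_fin powR_ge0.
apply: is_cvg_ereal_nneg_natsum => k _.
by apply: integral_ge0 => x _; rewrite lee_fin powR_ge0.
Qed.

HB.instance Definition _ := isMeasure.Build _ _ _ (nu alpha pi)
  nu0 nu_ge0 nu_sigma_additive.

End nu.
End measures.
End polar.

Section processes.
Context {R : realType} {n : nat}.
Local Notation vec := 'rV[R]_n.+1.
Context {d : measure_display} {Omega : measurableType d}.
Implicit Types (S : set vec) (X : R -> Omega -> vec).
Implicit Types (P : vec -> probability Omega R).
Implicit Types (Y : R -> Omega -> option (vec * R)).
Implicit Types (Q : option (vec * R) -> probability Omega R).

(* Processes killed at the origin of ['rV[R]_n.+1] take the value [0] there;
   [absorb] and [absorb_law] turn the state [0] into the isolated state. *)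
Definition absorb X (t : R) (w : Omega) : option vec :=
  if X t w == 0 then None else Some (X t w).

Definition absorb_law P (o : option vec) : probability Omega R :=
  P (if o is Some x then x else 0).

(* The product sigma-algebra on the space of paths indexed by [t >= 0]. *)
Definition path_sigma_algebra : set (set (R -> vec)) :=
  <<s [set C | exists t : R, exists B : set (borel vec),
         [/\ 0 <= t, measurable B & C = [set p | B (p t)]] ] >>.

Definition is_ssMp S (alpha : R) X P :=
  (exists F, markov_process (cone S) F (absorb X) (absorb_law P)) /\
  forall (a : R) (x : vec), 0 < a -> cone S x ->
    forall C, path_sigma_algebra C ->
      P x [set w | C (X ^~ w)] =
      P (a^-1 *: x) [set w | C (fun t => a *: X (a `^ (- alpha) * t) w)].

(* {(theta, xi), P_{y,z}} is encoded by the process [Y] and the laws [Q]. *)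
Definition is_MAP S Y Q :=
  exists2 F, markov_process (S `*` setT) F Y Q &
  forall (y : vec) (z s t : R) (f : borel (vec * R)%type -> \bar R)
      (A : set Omega),
    S y -> 0 <= s -> 0 <= t ->
    measurable_fun setT f -> (forall p, (0 <= f p)%E) -> F t A ->
    (\int[Q (Some (y, z))]_(w in A)
       (match Y t w, Y (t + s)%R w with
        | Some (_, z0), Some (y1, z1) => f (y1, z1 - z0)%R
        | _, _ => 0
        end) =
     \int[Q (Some (y, z))]_(w in A)
       (if Y t w is Some (y0, _)
        then semigroup Y Q s f (y0, 0%R) else 0))%E.

(* [clock beta X s w] and [total_clock beta X w] are the integrals of ||X_u||^beta
   over [0, s] and over [0, lifetime); [inv_clock] is the right inverse of the
   former.  After the lifetime [X] is 0, and [clock] integrates the library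
   value of [0 `^ beta]; this has no effect on [inv_clock] at the times
   [t < total_clock], the only ones at which it is used. *)
Definition clock (beta : R) X (s : R) (w : Omega) : \bar R :=
  (\int[lebesgue_measure]_(u in `[0%R, s]) (enorm (X u w) `^ beta)%:E)%E.

Definition total_clock (beta : R) X (w : Omega) : \bar R :=
  (\int[lebesgue_measure]_(u in [set u : R | (0 <= u)%R /\
     (u%:E < lifetime (absorb X) w)%E]) (enorm (X u w) `^ beta)%:E)%E.

Definition inv_clock (beta : R) X (t : R) (w : Omega) : R :=
  inf [set s : R | 0 <= s /\ (t%:E < clock beta X s w)%E].

Definition lamperti (alpha : R) X (t : R) (w : Omega) : option (vec * R) :=
  if (t%:E < total_clock (- alpha) X w)%E then
    let x := X (inv_clock (- alpha) X t w) w in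
    Some ((enorm x)^-1 *: x, ln (enorm x))
  else None.

Definition associated_MAP S (alpha : R) X P Y Q :=
  [/\ is_MAP S Y Q,
      forall (t : R) w, 0 <= t -> Y t w = lamperti alpha X t w,
      forall y z, S y -> Q (Some (y, z)) = P (expR z *: y) &
      Q None = P 0].

Definition opp_xi (o : option (vec * R)) : option (vec * R) :=
  if o is Some (y, z) then Some (y, - z) else None.

Definition opp_MAP Y (t : R) (w : Omega) := opp_xi (Y t w).

Definition opp_MAP_law Q (o : option (vec * R)) := Q (opp_xi o).

Definition hat (alpha : R) X (t : R) (w : Omega) : vec :=
  if (t%:E < total_clock (- (2 * alpha)) X w)%E
  then inversion (X (inv_clock (- (2 * alpha)) X t w) w) else 0.

(* The law at 0 is [P 0], since [inversion 0 = 0]. *)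
Definition hat_law P (x : vec) : probability Omega R := P (inversion x).

(* [C] is a set of triples (y, z, y1): the process starts from the first component
   on the left-hand side, from the last one on the right-hand side. *)
Definition reversible S (pi : {measure set (borel vec) -> \bar R}) Y Q :=
  forall (t : R) (C : set (borel vec * measurableTypeR R * borel vec)),
    0 <= t -> measurable C -> C `<=` (S `*` setT) `*` S ->
    (\int[pi]_(y in S) Q (Some (y, 0%R))
       [set w | if Y t w is Some (theta, xi) then C (y, xi, theta) else False] =
     \int[pi]_(y1 in S) Q (Some (y1, 0%R))
       [set w | if Y t w is Some (theta, xi) then C (theta, xi, y1) else False])%E.

End processes.

(* Main.v *)
(* Write [tc b p] for the path [p] run at the inverse of the clock
   [\int ||p_u||^b du].  These time changes compose additively,
   [tc b2 (tc b1 p) = tc (b1 + b2) p], and the inversion [x -> x / ||x||^2], which is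
   an involution of the cone, turns [b] into [- b].  The process [hat alpha X] is the
   inversion of [tc (- 2 alpha) X], and the MAP of [X] is [tc (- alpha) X] in polar
   coordinates.  Hence [tc (- alpha)] of [hat alpha X] is the inversion of
   [tc (- alpha) X], which is the MAP with [xi] replaced by [- xi].  The times of the
   new process being stopping times of [X], the time change of a Markov process is
   again a Markov process.

   For (c), duality with respect to [m] says that the law of the path on [0, s] under
   [m] is that of the reversed path of the dual process, and the clock is invariant
   under reversal.  Hence [X1], [X2] are in duality with respect to [m] if and only if
   [tc b X1], [tc b X2] are in duality with respect to [||x||^b m(dx)].  With
   [b = - alpha] the question is reduced to the duality of the two MAP's with respect
   to [Lambda pi], which is reversibility: by self-similarity, the joint law of the
   endpoints under [pi(dy) dz] is determined, up to a common dilation, by the starting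
   points of norm 1. *)

Require Import Defs.
From HB Require Import structures.
From mathcomp Require Import all_boot all_order all_algebra.
From mathcomp Require Import all_classical all_reals all_analysis.
From mathcomp Require Import measurable_realfun.
From mathcomp Require Import lra ring.

Set Implicit Arguments.
Unset Strict Implicit.
Unset Printing Implicit Defensive.

Import Order.TTheory GRing.Theory Num.Theory.
Import numFieldNormedType.Exports.

Local Open Scope classical_set_scope.
Local Open Scope ring_scope.

(** Duality speaks of fixed times, while a time change substitutes a random time that depends on the
    whole past. This forces the passage to laws of paths: the transition operators are moved one by
    one to the other side, which reverses the finite-dimensional laws, hence the law of the path
    alive at [s]. Reversal turns right-continuous paths into left-continuous ones, so the clock of a
    reversed path has to be read from Riemann sums.

    The substitution of the clock is available only under an integral over all times, so that it
    gives a duality integrated in time. A test function that completes each duration [r] to a fixed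
    total [t] extracts from it the duality at [t] itself.

    For reversibility, the invariance of [Lambda pi] under dilations has to be divided out: a window
    of length 1 for the logarithm of the starting norm does it.

    The cemetery is the vector 0, which lies outside the cone. Measurability of all random times
    comes from reading right-continuous paths on countable meshes and at rational times. Since time
    changes are invertible, the two implications between the dualities are one lemma with opposite
    exponents. *)

Section measure_theory.
Local Open Scope ereal_scope.

(** * Integrals of nonnegative functions against mixtures, densities and images of measures *)

Section induction.
Context d (T : measurableType d) (R : realType).

Import HBNNSimple.

(** Holds because a nonnegative measurable function is the increasing limit of nonnegative simple
    functions. It lifts identities between measures to identities between integrals. *)
Lemma ge0_measurable_ind (K : (T -> \bar R) -> Prop) :
  (forall A, measurable A -> K (fun x => (\1_A x)%:E)) ->
  (forall r f, (0 <= r)%R -> measurable_fun setT f -> (forall x, 0 <= f x) ->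
    K f -> K (fun x => r%:E * f x)) ->
  (forall f g, measurable_fun setT f -> (forall x, 0 <= f x) ->
    measurable_fun setT g -> (forall x, 0 <= g x) ->
    K f -> K g -> K (fun x => f x + g x)) ->
  (forall u : (T -> \bar R)^nat, (forall n, measurable_fun setT (u n)) ->
    (forall n x, 0 <= u n x) -> (forall x, nondecreasing_seq (u ^~ x)) ->
    (forall n, K (u n)) -> K (fun x => limn (u ^~ x))) ->
  forall f, measurable_fun setT f -> (forall x, 0 <= f x) -> K f.
Proof.
move=> K1 KZ KD Klim f mf f0.
pose f_ := nnsfun_approx measurableT mf.
have -> : f = fun x => limn (fun n => (f_ n x)%:E).
  apply/funext => x; apply/esym/cvg_lim => //.
  exact: cvg_nnsfun_approx.
apply: Klim => [n|n x|x m n mn|n].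
- exact/measurable_EFinP.
- by rewrite lee_fin.
- by rewrite lee_fin; exact/lefP/nd_nnsfun_approx.
- rewrite (_ : (fun x => _) = fun x => \sum_(y <- finmap.enum_fset (fset_set (range (f_ n))))
      y%:E * (\1_(f_ n @^-1` [set y]) x)%:E); last first.
    apply/funext => x; rewrite fimfunE -fsumEFin//.
    by rewrite fsbig_finite//; apply: eq_bigr => y _; rewrite EFinM.
  have : all (fun y => 0 <= y)%R (finmap.enum_fset (fset_set (range (f_ n)))).
    by apply/allP => y; rewrite in_fset_set// inE => -[x _ <-].
  move: (finmap.enum_fset _) => s.
  (* Measurability and sign of the partial sums are carried along because the hypothesis on sums
     asks for them. The empty sum is written as 0 times the indicator of the whole space, so that it
     too comes from the hypotheses. *)
  have H s' : all (fun y => 0 <= y)%R s' ->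
     [/\ measurable_fun setT (fun x => \sum_(y <- s')
           y%:E * (\1_(f_ n @^-1` [set y]) x)%:E),
        forall x, 0 <= \sum_(y <- s') y%:E * (\1_(f_ n @^-1` [set y]) x)%:E &
        K (fun x => \sum_(y <- s') y%:E * (\1_(f_ n @^-1` [set y]) x)%:E)].
    elim: s' => [_|y s' IH /= /andP[y0 /IH[mg g0 Kg]]].
      under eq_fun do rewrite big_nil.
      split=> //; first by move=> x; rewrite big_nil.
      rewrite (_ : (fun=> _) = fun x => 0%:E * (\1_setT x)%:E).
        apply: KZ => //; [exact/measurable_EFinP|].
        exact: (K1 _ measurableT).
      by apply/funext => x; rewrite mul0e.
    have m1 : measurable_fun setT (fun x : T => (\1_(f_ n @^-1` [set y]) x)%:E :> \bar R).
      exact/measurable_EFinP.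
    have m2 : measurable_fun setT (fun x : T => y%:E * (\1_(f_ n @^-1` [set y]) x)%:E).
      exact: measurable_funeM.
    have p2 x : 0 <= y%:E * (\1_(f_ n @^-1` [set y]) x)%:E.
      by rewrite mule_ge0// lee_fin.
    under eq_fun do rewrite big_cons.
    split.
    + exact: emeasurable_funD.
    + by move=> x; rewrite big_cons adde_ge0.
    + apply: KD => //; apply: KZ => //.
      by apply: K1; exact: measurable_funPTI.
  by case/H.
Qed.

End induction.

(** Measurability of the inner integral and the value of the outer one are proved in one induction:
    additivity and monotone convergence of the outer integral use the former. *)
Lemma ge0_integral_mixture d1 d2 (T1 : measurableType d1) (T2 : measurableType d2)
    (R : realType) (mu : {measure set T1 -> \bar R}) (D : set T1)
    (k : T1 -> {measure set T2 -> \bar R}) (nu : {measure set T2 -> \bar R}) :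
  measurable D ->
  (forall B, measurable B -> measurable_fun D (k ^~ B)) ->
  (forall B, measurable B -> nu B = \int[mu]_(x in D) k x B) ->
  forall f, measurable_fun setT f -> (forall y, 0 <= f y) ->
    measurable_fun D (fun x => \int[k x]_y f y) /\
    \int[nu]_y f y = \int[mu]_(x in D) \int[k x]_y f y.
Proof.
move=> mD mk nuE; apply: ge0_measurable_ind.
- move=> A mA; under eq_fun do rewrite integral_indic// setIT.
  by rewrite integral_indic// setIT nuE//; split; first exact: mk.
- move=> r f r0 mf f0 [mk1 nu1].
  under eq_fun do rewrite ge0_integralZl//.
  rewrite ge0_integralZl// nu1 -ge0_integralZl//; last first.
    by move=> x _; apply: integral_ge0.
  by split; first exact: measurable_funeM.
- move=> f g mf f0 mg g0 [mf1 f1] [mg1 g1].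
  under eq_fun do rewrite ge0_integralD//.
  rewrite ge0_integralD// f1 g1 -ge0_integralD//; last 2 first.
  + by move=> x _; apply: integral_ge0.
  + by move=> x _; apply: integral_ge0.
  by split; first exact: emeasurable_funD.
- move=> u mu_ u0 ndu H.
  have E x : \int[k x]_y limn (u ^~ y) = limn (fun n => \int[k x]_y u n y).
    by rewrite monotone_convergence// => y _; exact: ndu.
  have ndi x : nondecreasing_seq (fun n => \int[k x]_y u n y).
    by move=> m n mn; apply: ge0_le_integral => // y _; exact: ndu.
  split.
    under eq_fun do rewrite E.
    apply: (@emeasurable_fun_cvg _ _ _ _ (fun n x => \int[k x]_y u n y)).
      by move=> n; have [] := H n.
    by move=> x _; apply: ereal_nondecreasing_is_cvgn; exact: ndi.
  rewrite monotone_convergence//.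
  under [in LHS]eq_fun do rewrite (H _).2.
  rewrite -monotone_convergence//.
  + by apply: eq_integral => x _; rewrite E.
  + by move=> n; have [] := H n.
  + by move=> n x _; apply: integral_ge0.
Qed.

Lemma ge0_integral_density d (T : measurableType d) (R : realType)
    (mu nu : {measure set T -> \bar R}) (h : T -> R) :
  measurable_fun setT h -> (forall x, 0 <= h x)%R ->
  (forall A, measurable A -> nu A = \int[mu]_(x in A) (h x)%:E) ->
  forall f, measurable_fun setT f -> (forall x, 0 <= f x) ->
    \int[nu]_x f x = \int[mu]_x (f x * (h x)%:E).
Proof.
move=> mh h0 nuE; have mEh : measurable_fun setT (EFin \o h) by exact/measurable_EFinP.
 apply: ge0_measurable_ind.
- move=> A mA; rewrite integral_indic// setIT nuE// integral_mkcond.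
  apply: eq_integral => x _; rewrite patchE indicE.
  by case: ifP => _; rewrite ?mul1e ?mul0e.
- move=> r f r0 mf f0 E.
  rewrite ge0_integralZl// E -ge0_integralZl//.
  + by apply: eq_integral => x _; rewrite muleA.
  + exact: emeasurable_funM.
  + by move=> x _; rewrite mule_ge0// lee_fin.
- move=> f g mf f0 mg g0 Ef Eg.
  rewrite ge0_integralD// Ef Eg -ge0_integralD//; last 4 first.
  + by move=> x _; rewrite mule_ge0// lee_fin.
  + exact: emeasurable_funM.
  + by move=> x _; rewrite mule_ge0// lee_fin.
  + exact: emeasurable_funM.
  by apply: eq_integral => x _; rewrite ge0_muleDl.
- move=> u mu_ u0 ndu H.
  rewrite monotone_convergence//.
  under [in LHS]eq_fun do rewrite H.
  rewrite -monotone_convergence//; last 3 first.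
  + by move=> n; exact: emeasurable_funM.
  + by move=> n x _; rewrite mule_ge0// lee_fin.
  + by move=> x _ m n mn; apply: lee_wpmul2r; [rewrite lee_fin|exact: ndu].
  apply: eq_integral => x _; apply/cvg_lim => //.
  rewrite muleC; under eq_fun do rewrite muleC.
  by apply: cvgeZl => //; exact: ereal_nondecreasing_is_cvgn.
Qed.

Lemma ge0_integral_mrestr d (T : measurableType d) (R : realType)
    (mu : {measure set T -> \bar R}) (D : set T) (mD : measurable D) f :
  measurable_fun setT f -> (forall x, 0 <= f x) ->
  \int[mrestr mu mD]_x f x = \int[mu]_(x in D) f x.
Proof.
move=> mf f0; rewrite (@ge0_integral_density _ _ _ mu _ (\1_D : T -> R))//.
  rewrite [RHS]integral_mkcond; apply: eq_integral => x _.
  by rewrite patchE indicE; case: ifP => _; rewrite ?mule1 ?mule0.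
by move=> A mA; rewrite integral_indic// setIC.
Qed.

Lemma measurable_integral_kernel d1 d2 (T1 : measurableType d1)
    (T2 : measurableType d2) (R : realType) (D : set T1)
    (k : T1 -> {measure set T2 -> \bar R}) f :
  measurable D -> (forall B, measurable B -> measurable_fun D (k ^~ B)) ->
  measurable_fun setT f -> (forall y, 0 <= f y) ->
  measurable_fun D (fun x => \int[k x]_y f y).
Proof.
move=> mD mk mf f0.
(* Only the measurability half of the mixture lemma is wanted; with the zero measure as mixing
   measure its other hypothesis is trivial. *)
have mz (B : set T2) : measurable B ->
    (mzero B : \bar R) = \int[mzero]_(x in D) k x B.
  by move=> _; rewrite integral_measure_zero.
by have [] := @ge0_integral_mixture _ _ _ _ _ mzero D k mzero mD mk mz f mf f0.
Qed.

End measure_theory.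

Section mixture.
Local Open Scope ereal_scope.
Context d1 d2 (T1 : measurableType d1) (T2 : measurableType d2) (R : realType).
Variables (mu : {measure set T1 -> \bar R}) (D : set T1) (mD : measurable D).
Variables (k : T1 -> {measure set T2 -> \bar R}).
Hypothesis mk : forall B, measurable B -> measurable_fun D (k ^~ B).

Definition mixture (B : set T2) : \bar R := \int[mu]_(x in D) k x B.

Let mixture0 : mixture set0 = 0.
Proof. by rewrite /mixture integral0_eq// => x _; rewrite measure0. Qed.

Let mixture_ge0 B : 0 <= mixture B.
Proof. by apply: integral_ge0 => x _. Qed.

Let mixture_sigma_additive : semi_sigma_additive mixture.
Proof.
move=> F mF tF mUF; rewrite /mixture.
have -> : \int[mu]_(x in D) k x (\bigcup_n F n) =
    \sum_(0 <= i <oo) \int[mu]_(x in D) k x (F i).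
  rewrite -integral_nneseries//; last by move=> i; exact: mk.
  apply: eq_integral => x _; apply/esym/cvg_lim => //.
  exact: measure_semi_sigma_additive.
apply: is_cvg_ereal_nneg_natsum => i _.
by apply: integral_ge0 => x _.
Qed.

HB.instance Definition _ := isMeasure.Build _ _ _ mixture
  mixture0 mixture_ge0 mixture_sigma_additive.

Definition mixm : {measure set T2 -> \bar R} := mixture.

End mixture.

Section density.
Context d (T : measurableType d) (R : realType).
Local Open Scope ereal_scope.
Variables (mu : {measure set T -> \bar R}) (h : {mfun T >-> R}).

(** The absolute value makes this a measure for every measurable [h], whatever its sign; it is used
    with nonnegative [h]. *)
Definition mdensity (A : set T) : \bar R := \int[mu]_(x in A) `|h x|%:E.

Let mdensity0 : mdensity set0 = 0.
Proof. exact: integral_set0. Qed.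

Let mdensity_ge0 A : 0 <= mdensity A.
Proof. by apply: integral_ge0 => x _; rewrite lee_fin. Qed.

Let mdensity_sigma_additive : semi_sigma_additive mdensity.
Proof.
move=> F mF tF mUF; rewrite /mdensity ge0_integral_bigcup//=.
  apply: is_cvg_ereal_nneg_natsum => k _.
  by apply: integral_ge0 => x _; rewrite lee_fin.
apply: measurable_funTS; apply/measurable_EFinP.
exact: measurableT_comp.
Qed.

HB.instance Definition _ := isMeasure.Build _ _ _ mdensity
  mdensity0 mdensity_ge0 mdensity_sigma_additive.

Lemma ge0_integral_mdensity f : measurable_fun setT f -> (forall x, 0 <= f x) ->
  \int[mdensity]_x f x = \int[mu]_x (f x * `|h x|%:E).
Proof.
move=> mf f0; apply: (@ge0_integral_density _ _ _ _ _ (fun x => `|h x|%R)) => //.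
exact: measurableT_comp.
Qed.

End density.

(** Keeps the proof of measurability as an argument, so that an image measure can be formed inside a
    term. *)
Definition pushm d1 d2 (T1 : measurableType d1) (T2 : measurableType d2)
    (R : realType) (m : {measure set T1 -> \bar R}) (f : T1 -> T2)
    (mf : measurable_fun setT f) : {measure set T2 -> \bar R} :=
  measure_function_pushforward__canonical__measure_function_Measure m mf.

Lemma ge0_integral_pushm d1 d2 (T1 : measurableType d1) (T2 : measurableType d2)
    (R : realType) (m : {measure set T1 -> \bar R}) (f : T1 -> T2)
    (mf : measurable_fun setT f) (g : T2 -> \bar R) :
  measurable_fun setT g -> (forall y, (0 <= g y)%E) ->
  (\int[pushm m mf]_y g y = \int[m]_x g (f x))%E.
Proof. by move=> mg g0; rewrite ge0_integral_pushforward. Qed.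

Section affine.
Context (R : realType).
Local Open Scope ereal_scope.
Local Notation mu := (@lebesgue_measure R).

(** Uniqueness of Lebesgue measure: [c] times its image under [x -> c * x + d] gives every half-open
    interval its length. *)
Lemma ge0_integral_affine (c d : R) (f : R -> \bar R) :
  (0 < c)%R -> measurable_fun setT (f : measurableTypeR R -> _) ->
  (forall x, 0 <= f x) ->
  \int[mu]_x f x = c%:E * \int[mu]_x f (c * x + d)%R.
Proof.
move=> c0 mf f0.
pose g := (fun x : R => c * x + d)%R : measurableTypeR R -> measurableTypeR R.
have mg : measurable_fun setT g.
  by apply: measurable_funD => //; exact: measurable_funM.
pose c' := NngNum (ltW c0).
have E A : measurable A -> mu A = mscale c' (pushm mu mg) A.
  move=> mA; have := @lebesgue_measure_unique R (mscale c' (pushm mu mg)).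
  apply => // _ [[a b]] _ <- /=.
  rewrite /mscale /pushm /= /pushforward (_ : g @^-1` _ = `]((a - d) / c)%R, ((b - d) / c)%R]%classic); last first.
    apply/seteqP; split => x /=; rewrite !in_itv/= /g.
      by move=> /andP[h1 h2]; rewrite ltr_pdivrMr// ler_pdivlMr//; apply/andP; split; lra.
    by rewrite ltr_pdivrMr// ler_pdivlMr// => /andP[h1 h2]; apply/andP; split; lra.
  rewrite !lebesgue_measure_itv/= !lte_fin ltr_pM2r ?invr_gt0// ltrD2r.
  case: ifPn => _; last by rewrite mule0.
  rewrite !EFinN -!EFinB -EFinM; congr EFin; field.
  by rewrite gt_eqF.
transitivity (\int[mscale c' (pushm mu mg)]_x f x).
  by apply: eq_measure_integral => A mA _; exact: E.
rewrite ge0_integral_mscale//= ge0_integral_pushforward//.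
Qed.

End affine.

(** * Euclidean norm, its powers as weights, and the inversion *)

Section enorm.
Context {R : realType} {n : nat}.
Local Notation vec := 'rV[R]_n.+1.
Implicit Types (x y : vec) (b : R).

Lemma enorm_ge0 x : 0 <= enorm x.
Proof. exact: sqrtr_ge0. Qed.

Lemma enorm_eq0 x : (enorm x == 0) = (x == 0).
Proof.
apply/idP/idP => [|/eqP ->]; last first.
  rewrite /enorm big1 ?sqrtr0// => i _.
  by rewrite mxE expr0n.
have s0 : 0 <= \sum_i x ord0 i ^+ 2 by apply: sumr_ge0 => i _; exact: sqr_ge0.
rewrite sqrtr_eq0 => s1.
have /eqP : \sum_i x ord0 i ^+ 2 = 0 by apply/eqP; rewrite eq_le s1 s0.
rewrite psumr_eq0 => [/allP xi0|i _]; last exact: sqr_ge0.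
apply/eqP/rowP => i; rewrite mxE.
by have /eqP/eqP := xi0 i (mem_index_enum i); rewrite sqrf_eq0 => /eqP.
Qed.

Lemma enorm_gt0 x : (0 < enorm x) = (x != 0).
Proof. by rewrite lt_def enorm_ge0 andbT enorm_eq0. Qed.

Lemma enormZ a x : enorm (a *: x) = `|a| * enorm x.
Proof.
rewrite /enorm -sqrtr_sqr -sqrtrM ?sqr_ge0//; congr Num.sqrt.
by rewrite mulr_sumr; apply: eq_bigr => i _; rewrite mxE exprMn.
Qed.

Lemma continuous_enorm : continuous (@enorm R n).
Proof.
move=> /= x; have FF : Filter (nbhs (x : vec)) := nbhs_filter _.
apply: (@continuous_comp vec R R _ Num.sqrt x); last exact: sqrt_continuous.
have : (fun y : vec => \sum_i y ord0 i ^+ 2) @ (nbhs (x : vec)) --> \sum_i x ord0 i ^+ 2.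
  apply: (@cvg_big _ _ _ _ _ add_continuous _ _ _ (fun i (y : vec) => y ord0 i ^+ 2)) => i _.
  by apply: (@cvgM _ _ _ _ (fun y : vec => y ord0 i) (fun y : vec => y ord0 i)); exact: coord_continuous.
exact.
Qed.

Lemma cvg_enorm T (F : set_system T) (f : T -> vec) x :
  f @ F --> x -> enorm (f t) @[t --> F] --> enorm x.
Proof. by move=> fx; exact: (@cvg_comp _ _ _ f enorm F (nbhs x) _ fx (@continuous_enorm x)). Qed.

Definition wt b x : R := enorm x `^ b.

Lemma wt_ge0 b x : 0 <= wt b x. Proof. exact: powR_ge0. Qed.

Lemma wt_gt0 b x : x != 0 -> 0 < wt b x.
Proof. by move=> x0; rewrite powR_gt0// enorm_gt0. Qed.

(** Fails at the origin: for [b2 = - b1] nonzero the left-hand side is 1 there and the product is 0.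
    Compositions of time changes are therefore compared at living times only. *)
Lemma wtD b1 b2 x : x != 0 -> wt (b1 + b2) x = wt b1 x * wt b2 x.
Proof. by move=> x0; rewrite /wt powRD// enorm_eq0 x0 implybT. Qed.

Lemma wt0 x : wt 0 x = 1. Proof. exact: powRr0. Qed.

Lemma wtZ b a x : 0 <= a -> wt b (a *: x) = a `^ b * wt b x.
Proof. by move=> a0; rewrite /wt enormZ ger0_norm// powRM// enorm_ge0. Qed.

Lemma measurable_wt b : measurable_fun setT (wt b : borel vec -> R).
Proof. exact: (measurableT_comp (measurable_powR _) measurable_enorm). Qed.

Lemma continuous_wt b x : x != 0 -> {for x, continuous (wt b)}.
Proof.
move=> x0; rewrite /continuous_at.
have xgt : 0 < enorm x by rewrite enorm_gt0.
have FF : Filter (nbhs (x : vec)) := nbhs_filter _.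
have nx : \forall y \near x, 0 < enorm y.
  exact: (cvgr_gt _ (@continuous_enorm x) _ xgt).
suff : wt b y @[y --> x] --> wt b x by [].
rewrite /wt [X in _ --> X]/powR gt_eqF//.
have E : {near nbhs (x : vec), (fun y : vec => expR (b * ln (enorm y))) =1
    (fun y => enorm y `^ b)}.
  by apply: filterS nx => y y0; rewrite /powR gt_eqF.
apply: cvg_trans (near_eq_cvg E) _.
apply: (@cvg_comp _ _ _ (fun y : vec => b * ln (enorm y)) (@expR R) _ (nbhs (b * ln (enorm x)))); last exact: continuous_expR.
apply: cvgMr; apply: (@cvg_comp _ _ _ (fun y : vec => enorm y) (@ln R) _ (nbhs (enorm x))); last exact: continuous_ln.
exact: continuous_enorm.
Qed.

Lemma cvg_wt b T (F : set_system T) (f : T -> vec) x : x != 0 ->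
  f @ F --> x -> wt b (f t) @[t --> F] --> wt b x.
Proof. by move=> x0 fx; exact: (@cvg_comp _ _ _ f (wt b) F (nbhs x) _ fx (@continuous_wt b x x0)). Qed.

Lemma inversion0 : inversion (0 : vec) = 0.
Proof. by rewrite /inversion scaler0. Qed.

Lemma inversion_eq0 x : (inversion x == 0) = (x == 0).
Proof.
rewrite /inversion scaler_eq0 invr_eq0 expf_eq0/= enorm_eq0.
by case: eqP.
Qed.

Lemma enorm_inversion x : enorm (inversion x) = (enorm x)^-1.
Proof.
rewrite /inversion enormZ ger0_norm ?invr_ge0 ?sqr_ge0//.
have [->|x0] := eqVneq x 0.
  have /eqP -> : enorm (0 : vec) == 0 by rewrite enorm_eq0.
  by rewrite mulr0 invr0.
have : enorm x != 0 by rewrite enorm_eq0.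
by move=> e0; field.
Qed.

Lemma inversionK : involutive (@inversion R n).
Proof.
move=> x; have [->|x0] := eqVneq x 0; first by rewrite !inversion0.
rewrite {1}/inversion enorm_inversion /inversion scalerA exprVn invrK divff ?scale1r//.
by rewrite expf_neq0// enorm_eq0.
Qed.

Lemma inversionZ a x : inversion (a *: x) = a^-1 *: inversion x.
Proof.
rewrite /inversion enormZ exprMn -normrX ger0_norm ?sqr_ge0// scalerA scalerA invfM; congr (_ *: _).
have [->|a0] := eqVneq a 0; first by rewrite invr0 mulr0 mul0r.
by rewrite mulrAC expr2 invfM -[_ * _ * a]mulrA mulVf// mulr1.
Qed.

Lemma wt_inversion b x : wt b (inversion x) = wt (- b) x.
Proof. by rewrite /wt enorm_inversion powRN -powR_inv1 ?enorm_ge0// -powRrM mulN1r powRN. Qed.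

Lemma measurable_inversion :
  measurable_fun setT (@inversion R n : borel vec -> borel vec).
Proof.
apply: measurable_fun_borel_vec => i; under eq_fun do rewrite mxE.
apply: measurable_funM; last exact: measurable_coord.
have -> : (fun x : borel vec => (enorm x ^+ 2)^-1) = (fun x => wt (- 2) x).
  apply/funext => x.
  by rewrite /wt powRN; congr (_ ^-1); rewrite (powR_mulrn 2)// enorm_ge0.
exact: measurable_wt.
Qed.

Lemma continuous_inversion x : x != 0 -> {for x, continuous (@inversion R n)}.
Proof.
move=> x0; rewrite /continuous_at /inversion;
have FF : Filter (nbhs (x : vec)) := nbhs_filter _.
have C : (enorm y ^+ 2)^-1 @[y --> x] --> (enorm x ^+ 2)^-1.
  apply: (@cvgV _ _ _ _ (fun y => enorm y ^+ 2) (enorm x ^+ 2)).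
    by rewrite expf_neq0// enorm_eq0.
  by apply: cvgM; exact: continuous_enorm.
exact: (cvgZ C cvg_id).
Qed.

End enorm.

(** * Measurability of right-continuous processes *)

Section mesh.
Context {R : realType}.

(** The first multiple of [1 / (k + 1)] strictly after [u >= 0]. Strictness matters: the meshes then
    converge in the punctured filter [u^'+], the one of right continuity. For negative [u] the value
    is still a legitimate time. *)
Definition mesh (k : nat) (u : R) : R :=
  (Num.truncn (u * k.+1%:R)).+1%:R / k.+1%:R.

Lemma mesh_ge0 k u : 0 <= mesh k u.
Proof. by rewrite divr_ge0. Qed.

Lemma mesh_gt k u : u < mesh k u.
Proof. by rewrite ltr_pdivlMr// truncnS_gt. Qed.

Lemma mesh_le k u : 0 <= u -> mesh k u <= u + k.+1%:R^-1.
Proof.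
move=> u0; rewrite ler_pdivrMr// mulrDl mulVf// -natr1 lerD2r.
by rewrite truncn_le mulr_ge0.
Qed.

Lemma cvg_mesh u : 0 <= u -> mesh ^~ u @ \oo --> u^'+.
Proof.
move=> u0 A; rewrite /at_right withinE/= => -[B /nbhs_ballP[e /= e0 uB] BA].
have [k ke] : exists k, forall l, (k <= l)%N -> l.+1%:R^-1 < e.
  have := near_infty_natSinv_lt (PosNum e0).
  by move=> [k _ kP]; exists k => l kl; exact: kP.
exists k => // l /= kl.
have : B (mesh l u) /\ u < mesh l u.
  split; last exact: mesh_gt.
  apply: uB; rewrite /ball/= ltr_distlC.
  have := mesh_gt l u; have := mesh_le l u0; have := ke _ kl.
  by move: (l.+1%:R^-1) => v h1 h2 h3; apply/andP; split; lra.
have : (B `&` [set v | u < v]) (mesh l u) <-> (A `&` [set v | u < v]) (mesh l u).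
  by rewrite BA.
by move=> [+ _] => /[apply] -[].
Qed.

(** For fixed [k] the mesh takes countably many values, and on each level set the process is read at
    one fixed time. *)
Lemma measurable_mesh_comp d (T : measurableType d) d' (V : measurableType d')
    (Z : R -> T -> V) k :
  (forall t, 0 <= t -> measurable_fun setT (Z t)) ->
  measurable_fun setT (fun z : measurableTypeR R * T => Z (mesh k z.1) z.2).
Proof.
move=> mZ _ B mB; rewrite setTI.
rewrite (_ : _ @^-1` B = \bigcup_j
    ([set u : measurableTypeR R | Num.truncn (u * k.+1%:R) = j] `*`
     (Z (j.+1%:R / k.+1%:R) @^-1` B))); last first.
  apply/seteqP; split=> [[u w] /= BZ|[u w] /= [j _ [/= <- //]]].
  by exists (Num.truncn (u * k.+1%:R)).
apply: bigcupT_measurable => j; apply: measurableX; last first.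
  by rewrite -[X in measurable X]setTI; apply: mZ => //; rewrite divr_ge0.
have mT (i : nat) : measurable [set u : measurableTypeR R | (Num.truncn (u * k.+1%:R) <= i)%N].
  rewrite (_ : [set _ | _] = `]-oo, i.+1%:R / k.+1%:R[%classic)//.
  apply/seteqP; split=> u /=; rewrite in_itv/= truncn_le_nat.
    by rewrite ltr_pdivlMr.
  by rewrite ltr_pdivlMr.
case: j => [|j].
  by rewrite (_ : [set _ | _] = [set u | (Num.truncn (u * k.+1%:R) <= 0)%N])//;
    apply/seteqP; split=> u /=; rewrite leqn0 => /eqP.
rewrite (_ : [set _ | _] = [set u | (Num.truncn (u * k.+1%:R) <= j.+1)%N] `\`
    [set u | (Num.truncn (u * k.+1%:R) <= j)%N]); first exact: measurableD.
apply/seteqP; split=> u /=.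
  by move=> ->; rewrite leqnn ltnn.
by move=> [h1 /negP]; rewrite -ltnNge => h2; apply/eqP; rewrite eqn_leq h1 h2.
Qed.

End mesh.

Section reg.
Context {R : realType} {n : nat} d (T : measurableType d).
Local Notation vec := 'rV[R]_n.+1.
Implicit Types (Z : R -> T -> vec).

(* Reads a right-continuous process off its values at the times of the meshes,
   which makes it jointly measurable in time and chance. *)
Definition reg Z (z : measurableTypeR R * T) : vec :=
  \row_i fine (limn_esup (fun k => (Z (mesh k z.1) z.2 ord0 i)%:E)).

Lemma measurable_reg Z :
  (forall t, 0 <= t -> measurable_fun setT (Z t : T -> borel vec)) ->
  measurable_fun setT (reg Z : _ -> borel vec).
Proof.
move=> mZ; apply: measurable_fun_borel_vec => i.
under eq_fun do rewrite mxE.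
apply: (measurableT_comp (@fine_measurable R setT measurableT)).
apply: measurable_fun_limn_esup => k; apply/measurable_EFinP.
apply: (measurableT_comp (measurable_coord i)).
exact: measurable_mesh_comp.
Qed.

Lemma reg_right Z u w : 0 <= u -> Z s w @[s --> u^'+] --> Z u w ->
  reg Z (u, w) = Z u w.
Proof.
move=> u0 ZR; apply/rowP => i; rewrite mxE /=.
have C : (Z (mesh k u) w ord0 i)%:E @[k --> \oo] --> (Z u w ord0 i)%:E.
  apply: cvg_EFin; first exact: nearW.
  apply: (@cvg_comp _ _ _ (fun k => Z (mesh k u) w) (fun v : vec => v ord0 i) _ (nbhs (Z u w))); last exact: coord_continuous.
  exact: cvg_comp (cvg_mesh u0) ZR.
by rewrite (cvg_limn_einf_sup C).2.
Qed.

End reg.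

(** * Time changes of a path *)

Section path.
Context {R : realType} {n : nat}.
Local Notation vec := 'rV[R]_n.+1.
Local Notation mu := (@lebesgue_measure R).
Implicit Types (p : R -> vec) (b s t : R).

(** Left limits are asked only at times when the path is alive, and they are nonzero: this keeps the
    weights bounded up to such a time whatever the sign of the exponent. Nothing is asked at the
    time of death, where the path may explode. *)
Record good p : Prop := Good {
  good_absorbed : forall s t, 0 <= s -> s <= t -> p s = 0 -> p t = 0;
  good_right : forall t, 0 <= t -> p u @[u --> t^'+] --> p t;
  good_left : forall t, 0 < t -> p t != 0 ->
    exists2 v : vec, v != 0 & p u @[u --> t^'-] --> v }.

Definition alive p : set (measurableTypeR R) := [set u : R | 0 <= u /\ p u != 0].

(** With [total], [gam] and [tc], the clocks and the time change of the statement for a single path.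
    Their properties are deterministic, and probability enters later. *)
Definition clk b p s : \bar R := (\int[mu]_(u in `[0%R, s]) (wt b (p u))%:E)%E.

Definition total b p : \bar R := (\int[mu]_(u in alive p) (wt b (p u))%:E)%E.

Definition gam b p t : R := inf [set s : R | 0 <= s /\ (t%:E < clk b p s)%E].

Definition tc b p t : vec := if (t%:E < total b p)%E then p (gam b p t) else 0.

Lemma measurable_path p : good p ->
  measurable_fun (`[0, +oo[ : set (measurableTypeR R)) (p : measurableTypeR R -> borel vec).
Proof.
(* The path is regarded as a process that does not depend on chance, so that the measurability of
   [reg] applies. *)
move=> gp; pose Z (t : R) (_ : measurableTypeR R) := p t.
apply: (@eq_measurable_fun _ _ _ _ _ (fun u : measurableTypeR R => reg Z (u, 0) : borel vec)).
  move=> u; rewrite inE/= in_itv/= andbT => u0.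
  by rewrite reg_right//; exact: good_right.
apply: measurable_funTS; apply: (measurableT_comp (measurable_reg _)).
  by move=> t t0; exact: measurable_cst.
exact: measurable_fun_pair.
Qed.

Lemma measurable_wt_path b p (D : set (measurableTypeR R)) : good p ->
  measurable D -> D `<=` `[0, +oo[ -> measurable_fun D (fun u => (wt b (p u))%:E).
Proof.
move=> gp mD D0; apply/measurable_EFinP.
apply: (measurable_comp measurableT _ (measurable_wt b)) => //.
exact: measurable_funS (measurable_path gp).
Qed.

Lemma measurable_wt_patch b p (D : set (measurableTypeR R)) : good p ->
  measurable D -> D `<=` `[0, +oo[ ->
  measurable_fun setT ((fun u => (wt b (p u))%:E) \_ D).
Proof.
move=> gp mD D0; exact: (iffLR (measurable_restrictT _ mD)) (measurable_wt_path b gp mD D0).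
Qed.

Lemma measurable_set1_vec (x : vec) : measurable ([set x] : set (borel vec)).
Proof.
rewrite -[X in measurable X]setCK; apply: measurableC; apply: sub_sigma_algebra.
apply: closed_openC; apply: accessible_closed_set1.
exact: hausdorff_accessible (@norm_hausdorff _ _).
Qed.

Lemma measurable_alive p : good p -> measurable (alive p).
Proof.
move=> gp; rewrite (_ : alive p = `[0, +oo[ `&` p @^-1` (~` [set 0])).
  apply: (measurable_path gp) => //.
  by apply: measurableC; exact: measurable_set1_vec.
apply/seteqP; split=> u /=; rewrite in_itv/= andbT.
  by move=> [u0 /eqP].
by move=> [u0 /eqP].
Qed.

Lemma alive0 p : alive p `<=` `[0, +oo[.
Proof. by move=> u []; rewrite /= in_itv/= andbT. Qed.

Lemma alive_le p s t : good p -> 0 <= s -> s <= t -> p t != 0 -> p s != 0.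
Proof.
by move=> gp s0 st; apply: contraNN => /eqP ps; rewrite (good_absorbed gp s0 st ps).
Qed.

Lemma near_alive p s : good p -> 0 <= s -> p s != 0 ->
  \forall u \near s^'+, p u != 0.
Proof.
move=> gp s0 ps.
have : enorm (p u) @[u --> s^'+] --> enorm (p s).
  by apply: cvg_enorm; exact: good_right.
have e0 : 0 < enorm (p s) by rewrite enorm_gt0.
by move=> /cvgr_gt /(_ _ e0); apply: filterS => u; rewrite enorm_gt0.
Qed.

Lemma alive_right p s e : good p -> 0 <= s -> p s != 0 -> s < e ->
  exists2 s', s < s' < e & p s' != 0.
Proof.
move=> gp s0 ps se.
have H : \forall u \near s^'+, p u != 0 /\ s < u < e.
  near=> u; split; first by near: u; exact: near_alive.
  apply/andP; split; near: u; first exact: nbhs_right_gt.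
  exact: nbhs_right_lt.
have [u [pu su]] := @filter_ex _ _ (at_right_proper_filter s) _ H.
by exists u.
Unshelve. all: by end_near. Qed.

(** At each time of [[0, s]] the path has nonzero one-sided limits, where [wt b] is continuous, so
    the weight is locally bounded; compactness makes the bound uniform. *)
Lemma wt_path_bounded b p s : good p -> 0 <= s -> p s != 0 ->
  exists M, forall u, 0 <= u <= s -> wt b (p u) <= M.
Proof.
move=> gp s0 ps.
have cvgb (v : vec) (F : set_system R) : Filter F -> v != 0 -> p @ F --> v ->
    \forall u \near F, wt b (p u) < wt b v + 1.
  move=> FF v0 pv; have : wt b (p u) @[u --> F] --> wt b v.
    exact: cvg_wt.
  by move=> /cvgr_lt /(_ (wt b v + 1)); apply; rewrite ltrDl.
have /compact_near_coveringP/near_covering_withinP := @segment_compact R 0 s.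
move=> /(_ R (pinfty_nbhs R) (fun M u => wt b (p u) <= M)) H.
have : \forall M \near +oo, `[0, s] `<=` (fun u => wt b (p u) <= M).
  apply: H => x /=; rewrite in_itv/= => /andP[x0 xs].
  have px : p x != 0 by exact: alive_le ps.
  have /cvgb/(_ px (good_right gp x0)) : Filter x^'+ by exact: at_right_proper_filter.
  rewrite /at_right near_withinE => hr.
  (* At time 0 no [u >= 0] lies to the left, and any bound does. *)
  have [M1 hl] : exists M1, \forall u \near x^'-, 0 <= u -> wt b (p u) < M1.
    have [x1|x1] := ltP 0 x.
      have [v v0 pv] := good_left gp x1 px; exists (wt b v + 1).
      by apply: filterS (cvgb _ _ _ v0 pv) => u + _.
    exists 0; rewrite /at_left near_withinE; apply: nearW => u ux u0.
    by have := lt_le_trans ux x1; rewrite ltNge u0.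
  move: hl; rewrite /at_left near_withinE => hl.
  pose M := Num.max (wt b (p x) + 1) M1.
  exists ([set u | (x < u -> wt b (p u) < wt b (p x) + 1) /\
             (u < x -> 0 <= u -> wt b (p u) < M1)], [set M' | M <= M']) => /=.
    by split; [exact: (filterI hr hl)|exact: (nbhs_pinfty_ge (num_real _))].
  move=> [u M'] /= [[ur ul] MM']; rewrite in_itv/= => /andP[u0 us].
  apply: le_trans MM'; rewrite /M le_max.
  case: (ltgtP u x) => [/ul/(_ u0)/ltW->|/ur/ltW->|->]; rewrite ?orbT//.
  by rewrite lerDl ler01.
move=> /filter_ex[M HM]; exists M => u us; exact: HM.
Qed.

Local Open Scope ereal_scope.

Lemma clk_ge0 b p s : 0 <= clk b p s.
Proof. by apply: integral_ge0 => u _; rewrite lee_fin wt_ge0. Qed.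

Lemma le_clk b p s t : good p -> (s <= t)%R -> clk b p s <= clk b p t.
Proof.
move=> gp st; apply: ge0_subset_integral => //.
- apply: measurable_wt_path => // u /=; rewrite !in_itv/= => /andP[-> //].
- by move=> u _; rewrite lee_fin wt_ge0.
- move=> u /=; rewrite !in_itv/= => /andP[-> us]; exact: le_trans us st.
Qed.

Lemma clkD b p s t : good p -> (0 <= s <= t)%R ->
  clk b p t = clk b p s + \int[mu]_(u in `]s, t]) (wt b (p u))%:E.
Proof.
move=> gp /andP[s0 st]; rewrite -ge0_integral_setU//=.
- by congr (integral mu); rewrite -itv_bndbnd_setU//= bnd_simp.
- apply: measurable_wt_path => //; first exact: measurableU.
  move=> u /= []; rewrite !in_itv/= andbT; first by case/andP.
  by move=> /andP[/ltW + _]; exact: le_trans.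
- by move=> u _; rewrite lee_fin wt_ge0.
- apply/disj_setPS => u /= []; rewrite !in_itv/= => /andP[_ us] /andP[su _].
  by move: (lt_le_trans su us); rewrite ltxx.
Qed.

Lemma integral_wt_path_le b p s t M : good p -> (0 <= s <= t)%R ->
  (forall u, 0 <= u <= t -> wt b (p u) <= M)%R ->
  \int[mu]_(u in `]s, t]) (wt b (p u))%:E <= (M * (t - s))%:E.
Proof.
move=> gp /andP[s0 st] HM.
have -> : (M * (t - s))%:E = \int[mu]_(u in `]s, t]) M%:E.
  rewrite integral_cst//= lebesgue_measure_itv/= lte_fin.
  by case: ltP => // ts; rewrite (@le_anti _ _ s t) ?st// subrr mule0 mulr0.
apply: ge0_le_integral => //=.
- by move=> u _; rewrite lee_fin wt_ge0.
- apply: measurable_wt_path => // u /=; rewrite !in_itv/= andbT.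
  by move=> /andP[/ltW + _]; exact: le_trans.
- move=> u; rewrite in_itv/= lee_fin => /andP[su ut]; apply: HM.
  by rewrite ut (le_trans s0 (ltW su)).
Qed.

(** The weight is positive on []s, t]] because the path is alive there. If its integral vanished it
    would be null almost everywhere on a set of measure [t - s]. *)
Lemma integral_wt_path_gt0 b p s t : good p -> (0 <= s < t)%R -> p t != 0%R ->
  0 < \int[mu]_(u in `]s, t]) (wt b (p u))%:E.
Proof.
move=> gp /andP[s0 st] pt.
have i0 : 0 <= \int[mu]_(u in `]s, t]) (wt b (p u))%:E.
  by apply: integral_ge0 => u _; rewrite lee_fin wt_ge0.
rewrite lt_def i0 andbT; apply/eqP => i1.
have mD : measurable (`]s, t] : set (measurableTypeR R)) by [].
have mw : measurable_fun (`]s, t] : set (measurableTypeR R)) (fun u => (wt b (p u))%:E).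
  apply: measurable_wt_path => // u /=; rewrite !in_itv/= andbT.
  by move=> /andP[/ltW + _]; exact: le_trans.
have [/(_ _)] := ae_eq_integral_abs mu mD mw.
under eq_integral do rewrite gee0_abs ?lee_fin ?wt_ge0//.
move=> /(_ i1)[N [mN N0 DN]] _.
have : mu `]s, t] <= mu N.
  apply: le_measure; rewrite ?inE// => u /= us; apply: DN => /= /(_ us) [].
  move/eqP; rewrite gt_eqF// wt_gt0//; apply: alive_le pt => //.
    by move: us; rewrite in_itv/= => /andP[/ltW + _]; exact: le_trans.
  by move: us; rewrite in_itv/= => /andP[_].
rewrite lebesgue_measure_itv/= lte_fin st N0 EFinN -EFinB lee_fin.
by rewrite leNgt subr_gt0 st.
Qed.

Lemma clk0 b p : clk b p 0 = 0.
Proof. by rewrite /clk set_itv1 integral_set1. Qed.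

Lemma clk_fin b p s : good p -> (0 <= s)%R -> p s != 0%R ->
  clk b p s \is a fin_num.
Proof.
move=> gp s0 ps; have [M HM] := wt_path_bounded b gp s0 ps.
rewrite ge0_fin_numE ?clk_ge0//.
have /(clkD b gp) -> : (0 <= (0 : R) <= s)%R by rewrite lexx.
rewrite clk0 add0e; apply: le_lt_trans (ltry _).
by apply: integral_wt_path_le HM => //; rewrite lexx.
Qed.

Lemma lt_clk b p s t : good p -> (0 <= s)%R -> (s < t)%R -> p t != 0%R ->
  clk b p s < clk b p t.
Proof.
move=> gp s0 st pt; rewrite [ltRHS](@clkD _ _ s)//; last by rewrite s0 ltW.
rewrite lteDl ?integral_wt_path_gt0// ?s0//.
by apply: clk_fin => //; apply: alive_le pt => //; exact: ltW.
Qed.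

Lemma ltr_clk b p s t : good p -> (0 <= s)%R -> (0 <= t)%R -> p s != 0%R ->
  p t != 0%R -> (clk b p s < clk b p t) = (s < t)%R.
Proof.
move=> gp s0 t0 ps pt; apply/idP/idP; last by move=> st; exact: lt_clk.
by apply: contraTT; rewrite -!leNgt => ts; exact: le_clk.
Qed.

(** The bound [M] on the weight makes the clock Lipschitz, hence continuous, and the intermediate
    value theorem applies. *)
Lemma clk_onto b p t s1 : good p -> (0 <= s1)%R -> p s1 != 0%R -> (0 <= t)%R ->
  t%:E <= clk b p s1 -> exists2 s, (0 <= s <= s1)%R & clk b p s = t%:E.
Proof.
move=> gp s10 ps1 t0 ts1; have [M HM] := wt_path_bounded b gp s10 ps1.
have M0 : (0 <= M)%R.
  by apply: le_trans (HM 0%R _); rewrite ?wt_ge0// lexx.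
(* Clamping the time to [[0, s1]] extends the clock to a function that is finite and Lipschitz on
   the whole line. *)
pose cl (x : R) := Num.min (Num.max x 0%R) s1.
have cl0 x : (0 <= cl x)%R by rewrite /cl le_min le_max lexx orbT.
have cls x : (cl x <= s1)%R by rewrite /cl ge_min lexx orbT.
have pcl x : p (cl x) != 0%R by exact: alive_le ps1.
pose a x := fine (clk b p (cl x)).
have aE x : (a x)%:E = clk b p (cl x) by rewrite fineK// clk_fin.
have lip x y : (x <= y)%R -> (`|a x - a y| <= M * `|x - y|)%R.
  move=> xy; have clxy : (cl x <= cl y)%R.
    by rewrite /cl le_min2// le_max2.
  have cly : (cl y - cl x <= y - x)%R.
    by rewrite /cl; case: (leP x 0%R) => ?; case: (leP y 0%R) => ?; do ?[case: (leP _ s1) => ?]; lra.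
  have cxy : (0 <= cl x <= cl y)%R by rewrite cl0.
  have E := clkD b gp cxy; rewrite -!aE in E.
  have I0 : 0 <= \int[mu]_(u in `]cl x, cl y]) (wt b (p u))%:E.
    by apply: integral_ge0 => u _; rewrite lee_fin wt_ge0.
  have I1 : \int[mu]_(u in `]cl x, cl y]) (wt b (p u))%:E <= (M * (cl y - cl x))%:E.
    apply: integral_wt_path_le => // u /andP[u0 uy]; apply: HM.
    by rewrite u0 (le_trans uy).
  move: (\int[mu]_(u in _) _) E I0 I1 => -[r| |] // E I0 I1.
  move: E I0 I1;
  rewrite -EFinD !lee_fin => -[E] r0 r1.
  rewrite distrC E addrAC subrr add0r ger0_norm// [X in (_ * X)%R]distrC.
  rewrite [X in (_ * X)%R]ger0_norm ?subr_ge0//.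
  by apply: le_trans r1 _; rewrite ler_wpM2l.
have ca : continuous (a : R -> R).
  move=> x; apply/cvgrPdist_lt => e e0.
  have d0 : (0 < e / (M + 1))%R by rewrite divr_gt0// ltr_wpDl.
  near=> y.
  have H : (`|a x - a y| <= M * `|x - y|)%R.
    have [/lip//|/ltW/lip] := leP x y.
    by rewrite distrC [X in (_ <= _ * X)%R]distrC.
  apply: (le_lt_trans H).
  have : (`|x - y| < e / (M + 1))%R.
    by near: y; apply: (@cvgr_dist_lt _ _ _ _ _ id x) => //; exact: cvg_id.
  rewrite ltr_pdivlMr ?ltr_wpDl// => h.
  apply: le_lt_trans h; rewrite mulrDr mulr1 mulrC lerDl.
  exact: normr_ge0.
have cl00 : cl 0%R = 0%R by rewrite /cl maxxx min_l.
have cls1 : cl s1 = s1 by rewrite /cl max_l// minxx.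
have [] := @IVT R a 0%R s1 t s10 (continuous_subspaceT ca).
  have a0 : a 0%R = 0%R by rewrite /a cl00 clk0.
  have as1 : (t <= a s1)%R by rewrite -lee_fin aE cls1.
  by rewrite a0 ge_min t0/= le_max as1 orbT.
move=> c; rewrite in_itv/= => /andP[c0 cs] act; exists c; first by rewrite c0.
have clc : cl c = c by rewrite /cl max_l// min_l.
by rewrite -clc -aE act.
Unshelve. all: by end_near. Qed.

Lemma clk_le_total b p s : good p -> (0 <= s)%R -> p s != 0%R ->
  clk b p s < total b p.
Proof.
move=> gp s0 ps; have [s' /andP[ss' _] ps'] := alive_right gp s0 ps (ltr_pwDr ltr01 (lexx s)).
apply: lt_le_trans (lt_clk b gp s0 ss' ps') _.
apply: ge0_subset_integral => //.
- exact: measurable_alive.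
- by apply: measurable_wt_path => //; [exact: measurable_alive|exact: alive0].
- by move=> u _; rewrite lee_fin wt_ge0.
- move=> u /=; rewrite in_itv/= => /andP[u0 us]; split=> //.
  exact: alive_le ps'.
Qed.

Lemma total_gt_clk b p t : good p -> (0 <= t)%R -> t%:E < total b p ->
  exists s, [/\ (0 <= s)%R, p s != 0%R & t%:E < clk b p s].
Proof.
move=> gp t0; apply: contraPP => H; apply/negP; rewrite -leNgt.
have {}H s : (0 <= s)%R -> p s != 0%R -> clk b p s <= t%:E.
  by move=> s0 ps; rewrite leNgt; apply/negP => ts; apply: H; exists s.
have [p0|p0] := eqVneq (p 0%R) 0%R.
  rewrite /total (_ : alive p = set0) ?integral_set0//.
  apply/seteqP; split=> // u [u0 /eqP []].
  exact: (good_absorbed gp (lexx 0%R)).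
pose q (j : nat) : R := ratr (odflt 0%R (unpickle j : option rat)).
pose G j : set (measurableTypeR R) :=
  if (0 <= q j)%R && (p (q j) != 0%R) then `[0%R, q j]%classic else set0.
pose F i := \big[setU/set0]_(j < i) G j.
have GA j : G j `<=` alive p.
  rewrite /G; case: ifPn => // /andP[q0 pq] u /=; rewrite in_itv/= => /andP[u0 uq].
  by split => //; exact: alive_le pq.
have mG j : measurable (G j) by rewrite /G; case: ifPn.
have mF i : measurable (F i) by apply: bigsetU_measurable.
have FU : alive p = \bigcup_i F i.
  apply/seteqP; split=> [u [u0 pu]|u [i _]]; last first.
    by rewrite /F -bigcup_mkord => -[j _]; exact: GA.
  have [s' /andP[us' _] ps'] := alive_right gp u0 pu (ltr_pwDr ltr01 (lexx u)).
  have [r] := rat_in_itvoo us'; rewrite in_itv/= => /andP[ur rs].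
  have qr : q (pickle r) = ratr r by rewrite /q pickleK.
  exists (pickle r).+1 => //; rewrite /F -bigcup_mkord; exists (pickle r) => //=.
  rewrite /G qr (le_trans u0 (ltW ur))/= (alive_le gp _ (ltW rs) ps')//.
    by rewrite /= in_itv/= u0 ltW.
  exact: le_trans u0 (ltW ur).
(* A finite union of intervals starting at 0 is contained in the longest one, where the bound on the
   clock is available. *)
have Fs i : exists s, [/\ (0 <= s)%R, p s != 0%R & F i `<=` `[0%R, s]].
  elim: i => [|i [s [s0 ps Fis]]].
    by exists 0%R; split => //; rewrite /F big_ord0.
  rewrite /F big_ord_recr/= -/(F i) /G; case: ifPn => [/andP[q0 pq]|_]; last first.
    by exists s; rewrite setU0.
  have [sq|qs] := leP s (q i).
    exists (q i); split => // u [/Fis|//]/=; rewrite !in_itv/= => /andP[-> us].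
    exact: le_trans us sq.
  exists s; split => // u [/Fis//|]/=; rewrite !in_itv/= => /andP[-> us].
  exact: le_trans us (ltW qs).
have ndF : nondecreasing_seq F by move=> i j ij; exact/subsetPset/subset_bigsetU.
have FA i : F i `<=` alive p by move=> u Fu; rewrite FU; exists i.
have := @ge0_nondecreasing_set_cvg_integral _ _ _ F (fun u => (wt b (p u))%:E) mu ndF mF.
rewrite -FU => C; apply: (cvge_le _ (C _ _)).
- apply: nearW => i; have [s [s0 ps Fis]] := Fs i.
  apply: le_trans (H _ s0 ps); apply: ge0_subset_integral => //.
  + by apply: measurable_wt_path => // u /=; rewrite !in_itv/= => /andP[->].
  + by move=> u _; rewrite lee_fin wt_ge0.
- move=> i; apply: measurable_wt_path => //.
  exact: subset_trans (FA i) (@alive0 p).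
- by move=> i u _; rewrite lee_fin wt_ge0.
Qed.

End path.

(** * Inverse of the clock, and the time change under inversion, shift and scaling *)

Section time_change.
Context {R : realType} {n : nat}.
Local Notation vec := 'rV[R]_n.+1.
Local Notation mu := (@lebesgue_measure R).
Implicit Types (p : R -> vec) (b s t : R).

Lemma at_rightP (s : R) (A : set R) :
  s^'+ A -> exists2 e, s < e & forall v, s < v < e -> A v.
Proof.
rewrite /at_right withinE /= => -[B /nbhs_ballP[e /= e0 sB] AB].
exists (s + e); first by rewrite ltrDl.
move=> v /andP[sv ve].
have : (B `&` [set u | s < u]) v.
  split => //; apply: sB; rewrite /ball/= ltr_distlC ve andbT.
  by rewrite (lt_trans _ sv)// gtrBl.
by rewrite -AB => -[].
Qed.

Lemma at_leftP (s : R) (A : set R) :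
  s^'- A -> exists2 e, e < s & forall v, e < v < s -> A v.
Proof.
rewrite /at_left withinE /= => -[B /nbhs_ballP[e /= e0 sB] AB].
exists (s - e); first by rewrite gtrBl.
move=> v /andP[ev vs].
have : (B `&` [set u | u < s]) v.
  split => //; apply: sB; rewrite /ball/= ltr_distlC ev/=.
  by rewrite (lt_trans vs)// ltrDl.
by rewrite -AB => -[].
Qed.

(** The clock has no flat stretch after a living time, since by right continuity the path stays
    alive a little longer. Hence the times at which it exceeds [t] are exactly those after [s]. *)
Lemma gam_clk b p s t : good p -> 0 <= s -> p s != 0 -> clk b p s = t%:E ->
  gam b p t = s.
Proof.
move=> gp s0 ps st; rewrite /gam (_ : [set _ | _] = `]s, +oo[%classic).
  by rewrite inf_itv// bnd_simp.
apply/seteqP; split=> u /=; rewrite in_itv/= andbT.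
  by move=> [u0]; rewrite -st; apply: contraTT; rewrite -!leNgt => us; exact: le_clk.
move=> su; split; first exact: le_trans s0 (ltW su).
have [s' /andP[ss' s'u] ps'] := alive_right gp s0 ps su.
by rewrite -st (lt_le_trans (lt_clk b gp s0 ss' ps'))// le_clk// ltW.
Qed.

Lemma tcE b p s t : good p -> 0 <= s -> p s != 0 -> clk b p s = t%:E ->
  tc b p t = p s.
Proof.
move=> gp s0 ps st; rewrite /tc -st (clk_le_total b gp s0 ps).
by rewrite (gam_clk gp s0 ps st).
Qed.

(** Together with [tcE] this replaces the infimum in [gam]: a living time of [tc b p] is the value
    of the clock at a living time of [p]. *)
Lemma tc_alive b p t : good p -> 0 <= t -> (t%:E < total b p)%E ->
  exists s, [/\ 0 <= s, p s != 0, clk b p s = t%:E & tc b p t = p s].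
Proof.
move=> gp t0 tt; have [s1 [s10 ps1 ts1]] := total_gt_clk gp t0 tt.
have [s /andP[s0 ss1] st] := clk_onto gp s10 ps1 t0 (ltW ts1).
have ps : p s != 0 by exact: alive_le ps1.
by exists s; split => //; exact: tcE.
Qed.

Lemma tc_dead b p t : (total b p <= t%:E)%E -> tc b p t = 0.
Proof. by move=> tt; rewrite /tc ltNge tt. Qed.

Lemma tc_neq0 b p t : good p -> 0 <= t ->
  (tc b p t != 0) = (t%:E < total b p)%E.
Proof.
move=> gp t0; apply/idP/idP.
  by apply: contraNT; rewrite -leNgt => /tc_dead ->.
by move=> /(tc_alive gp t0)[s [_ ps _ ->]].
Qed.

Lemma clk_gt0 b p s t : 0 < t -> 0 <= s -> clk b p s = t%:E -> 0 < s.
Proof.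
move=> t0 s0 st; rewrite lt_def s0 andbT; apply/eqP => s00.
by move: st t0; rewrite s00 clk0 => -[<-]; rewrite ltxx.
Qed.

(** Stated for a given left limit [v] so that membership of [v] in the state space, and not only
    [v != 0], passes to the time-changed process. *)
Lemma tc_left b p s t (v : vec) : good p -> 0 <= s -> p s != 0 -> clk b p s = t%:E ->
  p u @[u --> s^'-] --> v -> 0 < t -> tc b p u @[u --> t^'-] --> v.
Proof.
move=> gp s0 ps st pv t0 A /pv/at_leftP[e es eA].
have s_gt0 := clk_gt0 t0 s0 st.
have e'0 : 0 <= Num.max e 0 by rewrite le_max lexx orbT.
have e's : Num.max e 0 < s by rewrite gt_max es.
have pe' : p (Num.max e 0) != 0 by exact: alive_le (ltW e's) ps.
have t'E : (fine (clk b p (Num.max e 0)))%:E = clk b p (Num.max e 0).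
  by rewrite fineK// clk_fin.
have t't : fine (clk b p (Num.max e 0)) < t by rewrite -lte_fin t'E -st ltr_clk.
apply: filterS2 (nbhs_left_lt t) (nbhs_left_gt t't) => u ut t'u.
have u0 : 0 <= u.
  by rewrite -lee_fin (le_trans (clk_ge0 b p (Num.max e 0)))// -t'E lee_fin ltW.
have us : (u%:E <= clk b p s)%E by rewrite st lee_fin ltW.
have [w /andP[w0 ws] wu] := clk_onto gp s0 ps u0 us.
have pw : p w != 0 by exact: alive_le ps.
rewrite /= (tcE gp w0 pw wu); apply: eA; apply/andP; split.
  apply: le_lt_trans (_ : Num.max e 0 < _); first by rewrite le_max lexx.
  by rewrite -(ltr_clk b gp e'0 w0)// wu -t'E lte_fin.
by rewrite -(ltr_clk b gp w0 s0)// wu st lte_fin.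
Qed.

Lemma good_tc b p : good p -> good (tc b p).
Proof.
move=> gp; split.
- move=> s t s0 st /eqP; rewrite -[_ == _]negbK tc_neq0// -leNgt => ts.
  by apply: tc_dead; apply: le_trans ts _; rewrite lee_fin.
- move=> t t0; have [tt|tt] := leP (total b p) t%:E.
    move=> A; rewrite tc_dead// => /nbhs_singleton A0.
    apply: filterS (nbhs_right_gt t) => u tu /=.
    by rewrite tc_dead//; apply: le_trans tt _; rewrite lee_fin ltW.
  have [s [s0 ps st ->]] := tc_alive gp t0 tt.
  move=> A /(good_right gp s0)/at_rightP[e se eA].
  have [s' /andP[ss' s'e] ps'] := alive_right gp s0 ps se.
  have s'0 : 0 <= s' by exact: le_trans (ltW ss').
  have t'E : (fine (clk b p s'))%:E = clk b p s' by rewrite fineK// clk_fin.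
  have tt' : t < fine (clk b p s') by rewrite -lte_fin t'E -st ltr_clk.
  apply: filterS2 (nbhs_right_gt t) (nbhs_right_lt tt') => u tu ut'.
  have u0 : 0 <= u by exact: le_trans (ltW tu).
  have us' : (u%:E <= clk b p s')%E by rewrite -t'E lee_fin ltW.
  have [v /andP[v0 vs'] vu] := clk_onto gp s'0 ps' u0 us'.
  have pv : p v != 0 by exact: alive_le ps'.
  rewrite /= (tcE gp v0 pv vu); apply: eA.
  rewrite -(ltr_clk b gp s0 v0)// st vu lte_fin tu/=.
  apply: lt_trans s'e; rewrite -(ltr_clk b gp v0 s'0)// vu -t'E lte_fin.
  exact: ut'.
- move=> t t0; rewrite tc_neq0 ?ltW// => tt.
  have [s [s0 ps st _]] := tc_alive gp (ltW t0) tt.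
  have [v v0 pv] := good_left gp (clk_gt0 t0 s0 st) ps; exists v => //.
  exact: (tc_left gp s0 ps st pv).
Qed.

Lemma tc_inversion b p t :
  tc b (inversion \o p) t = inversion (tc (- b) p t).
Proof.
have E (D : set R) : (\int[mu]_(u in D) (wt b ((inversion \o p) u))%:E =
    \int[mu]_(u in D) (wt (- b) (p u))%:E)%E.
  by apply: eq_integral => u _; rewrite /= wt_inversion.
have A : alive (inversion \o p) = alive p.
  by apply/seteqP; split=> u [u0 pu]; split => //; move: pu; rewrite /= inversion_eq0.
rewrite /tc /total A E; case: ifPn => _; last by rewrite inversion0.
have C : clk b (inversion \o p) = clk (- b) p.
  by apply/funext => s; rewrite /clk E.
by rewrite /gam C.
Qed.

Lemma good_inversion p : good p -> good (inversion \o p).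
Proof.
move=> gp; have ci (T : Type) (F : set_system T) (f : T -> vec) (v : vec) : v != 0 ->
    f @ F --> v -> inversion (f x) @[x --> F] --> inversion v.
  move=> v0 fv.
  exact: (@cvg_comp _ _ _ f (@inversion R n) F (nbhs v) _ fv (@continuous_inversion _ _ v v0)).
split=> [s t s0 st /eqP|t t0|t t0] /=.
- by rewrite inversion_eq0 => /eqP/(good_absorbed gp s0 st) ->; rewrite inversion0.
- have [pt|pt] := eqVneq (p t) 0; last by apply: ci => //; exact: good_right.
  move=> A; rewrite pt inversion0 => /nbhs_singleton A0.
  apply: filterS (nbhs_right_gt t) => u tu /=.
  by rewrite (good_absorbed gp t0 (ltW tu) pt) inversion0.
- rewrite inversion_eq0 => /(good_left gp t0)[v v0 pv].
  exists (inversion v); first by rewrite inversion_eq0.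
  exact: ci.
Qed.

Local Open Scope ereal_scope.

Lemma good_shift p s : good p -> (0 <= s)%R -> good (fun u => p (s + u)%R).
Proof.
move=> gp s0; split=> [u t u0 ut|t t0|t t0 pt].
- by apply: (good_absorbed gp); rewrite ?addr_ge0// lerD2l.
- move=> A /(good_right gp (addr_ge0 s0 t0))/at_rightP[e te eA].
  have te' : (t < e - s)%R by rewrite ltrBrDl.
  apply: filterS2 (nbhs_right_gt t) (nbhs_right_lt te') => u tu ue.
  by apply: eA; rewrite ltrD2l tu -ltrBrDl.
- have st : (0 < s + t)%R by rewrite ltr_wpDl.
  have [v v0 pv] := good_left gp st pt.
  exists v => // A /pv/at_leftP[e te eA].
  have te' : (e - s < t)%R by rewrite ltrBlDl.
  apply: filterS2 (nbhs_left_lt t) (nbhs_left_gt te') => u ut eu.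
  by apply: eA; rewrite ltrD2l ut -ltrBlDl eu.
Qed.

Lemma clk_shift b p s u : good p -> (0 <= s)%R -> (0 <= u)%R ->
  clk b p (s + u) = clk b p s + clk b (fun v => p (s + v)%R) u.
Proof.
move=> gp s0 u0; have /(clkD b gp) -> : (0 <= s <= s + u)%R by rewrite s0 lerDl.
have -> : \int[mu]_(v in `]s, (s + u)%R]) (wt b (p v))%:E =
  clk b (fun v => p (s + v)%R) u; last by [].
pose D : set (measurableTypeR R) := `]s, (s + u)%R]%classic.
have mf : measurable_fun setT ((fun v => (wt b (p v))%:E) \_ D : measurableTypeR R -> _).
  apply: (measurable_wt_patch b gp (measurable_itv _)) => v /=.
  by rewrite !in_itv/= andbT => /andP[/ltW + _]; exact: le_trans.
have f0 v : 0 <= ((fun v => (wt b (p v))%:E) \_ D) v.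
  by rewrite patchE; case: ifPn => // _; rewrite lee_fin wt_ge0.
rewrite integral_mkcond (ge0_integral_affine s ltr01 mf f0) mul1e /clk -integral_itv_obnd_cbnd; last first.
  apply: (measurable_wt_path b (good_shift gp s0)) => // v /=.
  by rewrite !in_itv/= andbT => /andP[/ltW].
rewrite [RHS]integral_mkcond; apply: eq_integral => v _; rewrite !patchE mul1r addrC.
rewrite (_ : (_ \in `]s, _]%classic) = (v \in `]0%R, u]%classic))//.
by apply/idP/idP; rewrite !inE/= !in_itv/= ltrDl lerD2l.
Qed.

(** The clock is additive along the path, so the future of the time-changed path is the time change
    of the future. This is what lets the strong Markov property pass through the time change. *)
Lemma tc_shift b p s t r : good p -> (0 <= s)%R -> p s != 0%R ->
  clk b p s = t%:E -> (0 <= r)%R ->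
  tc b p (t + r) = tc b (fun u => p (s + u)%R) r.
Proof.
move=> gp s0 ps st r0; have gp' := good_shift gp s0.
have t0 : (0 <= t)%R by rewrite -lee_fin -st clk_ge0.
have [rt|rt] := leP (total b (fun u => p (s + u)%R)) r%:E.
  rewrite [RHS]tc_dead// tc_dead// leNgt; apply/negP.
  move=> /(tc_alive gp (addr_ge0 t0 r0))[s' [s'0 ps' s't _]].
  have ss' : (s <= s')%R.
    by rewrite leNgt -(ltr_clk b gp s'0 s0)// s't st lte_fin -leNgt lerDl.
  have := @clk_le_total _ _ b _ (s' - s)%R gp'; rewrite subr_ge0 addrC subrK => /(_ ss' ps').
  have := @clk_shift b p s (s' - s)%R gp s0; rewrite subr_ge0 => /(_ ss').
  rewrite addrC subrK s't st EFinD => E.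
  have <- : r%:E = clk b (fun v => p (s + v)%R) (s' - s).
    by move: E => /(congr1 (fun x => x - t%:E)); rewrite ![t%:E + _]addeC !addeK.
  by rewrite ltNge rt.
have [u [u0 pu ur ->]] := tc_alive gp' r0 rt.
by apply: tcE => //; [exact: addr_ge0|rewrite clk_shift// st ur].
Qed.

Lemma good_scale k r p : (0 < k)%R -> (0 < r)%R -> good p ->
  good (fun u => k *: p (r * u))%R.
Proof.
move=> k0 r0 gp; pose p' u := (k *: p (r * u)%R)%R.
have p'0 u : (p' u != 0)%R = (p (r * u) != 0)%R.
  by rewrite /p' scaler_eq0 (gt_eqF k0).
change (good p').
split=> [u v u0 uv /eqP|u u0|u u0].
- rewrite -[_ == _]negbK p'0 negbK => /eqP pu; apply/eqP; rewrite -[_ == _]negbK p'0 negbK.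
  by rewrite (good_absorbed gp _ _ pu)// ?mulr_ge0 ?(ltW r0)// ler_pM2l.
- apply: cvgZl_tmp => A /(good_right gp (mulr_ge0 (ltW r0) u0))/at_rightP[e te eA].
  have te' : (u < r^-1 * e)%R by rewrite ltr_pdivlMl.
  apply: filterS2 (nbhs_right_gt u) (nbhs_right_lt te') => v tv ve.
  by apply: eA; rewrite ltr_pM2l// tv -ltr_pdivlMl.
- rewrite p'0 => pu; have [v v0 pv] := good_left gp (mulr_gt0 r0 u0) pu.
  exists (k *: v)%R; first by rewrite scaler_eq0 (gt_eqF k0).
  apply: cvgZl_tmp => A /pv/at_leftP[e te eA].
  have te' : (r^-1 * e < u)%R by rewrite ltr_pdivrMl.
  apply: filterS2 (nbhs_left_lt u) (nbhs_left_gt te') => w wu ew.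
  by apply: eA; rewrite ltr_pM2l// wu andbT -ltr_pdivrMl.
Qed.

(** The weight of the dilated path is [k ^ b] times the original one and its time runs at speed [r],
    whence the factor [r / k ^ b] on the clock. For [b = - alpha] and [r = k ^ (- alpha)] this
    factor is 1. *)
Lemma tc_scale b k r p t : (0 < k)%R -> (0 < r)%R -> good p -> (0 <= t)%R ->
  tc b (fun u => k *: p (r * u)%R) t = (k *: tc b p (r * t / k `^ b))%R.
Proof.
move=> k0 r0 gp t0; pose p' u := (k *: p (r * u)%R)%R.
have kb : (0 < k `^ b)%R by rewrite powR_gt0.
have p'0 u : (p' u != 0)%R = (p (r * u) != 0)%R.
  by rewrite /p' scaler_eq0 (gt_eqF k0).
have gp' : good p' by exact: good_scale.
have clk' s : (0 <= s)%R -> clk b p (r * s) = (r / k `^ b)%:E * clk b p' s.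
  move=> s0; pose D : set (measurableTypeR R) := `[0%R, (r * s)%R]%classic.
  have mf : measurable_fun setT ((fun v => (wt b (p v))%:E) \_ D : measurableTypeR R -> _).
    apply: (measurable_wt_patch b gp (measurable_itv _)) => v /=.
    by rewrite !in_itv/= andbT => /andP[].
  have f0 v : 0 <= ((fun v => (wt b (p v))%:E) \_ D) v.
    by rewrite patchE; case: ifPn => // _; rewrite lee_fin wt_ge0.
  rewrite /clk integral_mkcond (ge0_integral_affine 0 r0 mf f0) EFinM -muleA; congr (_ * _).
  have mw : measurable_fun (`[0%R, s] : set (measurableTypeR R)) (fun u => (wt b (p' u))%:E).
    by apply: (measurable_wt_path b gp') => // v /=; rewrite !in_itv/= andbT => /andP[].
  have w0 u : `[0%R, s]%classic u -> 0 <= (wt b (p' u))%:E.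
    by move=> _; rewrite lee_fin wt_ge0.
  rewrite -(ge0_integralZl mu _ mw w0)//; last by rewrite lee_fin invr_ge0 ltW.
  rewrite [RHS]integral_mkcond; apply: eq_integral => u _.
  rewrite !patchE addr0.
  have -> : ((r * u)%R \in D) = (u \in `[0%R, s]%classic).
    by apply/idP/idP; rewrite /D !inE/= !in_itv/= ler_pM2l// pmulr_rge0.
  by case: ifP => // _; rewrite -EFinM wtZ ?(ltW k0)// mulKf// gt_eqF.
have r' : (0 <= r / k `^ b)%R by rewrite divr_ge0// ltW.
have [tt|tt] := leP (total b p') t%:E.
  rewrite tc_dead// tc_dead ?scaler0// leNgt mulrAC; apply/negP.
  move=> /(tc_alive gp (mulr_ge0 r' t0))[s [s0 ps st _]].
  have s0' : (0 <= s / r)%R by rewrite divr_ge0// ltW.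
  have rs : (r * (s / r) = s)%R by rewrite mulrC divfK// gt_eqF.
  have ps' : p' (s / r)%R != 0%R by rewrite p'0 rs.
  have cE : clk b p' (s / r) = (fine (clk b p' (s / r)))%:E by rewrite fineK// clk_fin.
  have r'n0 : (r / k `^ b != 0)%R by rewrite gt_eqF// divr_gt0.
  have := clk' _ s0'; rewrite rs st cE -EFinM => -[/(mulfI r'n0) E].
  have := clk_le_total b gp' s0' ps'.
  by rewrite cE -E ltNge tt.
have [s [s0 ps st ->]] := tc_alive gp' t0 tt; rewrite /p'.
rewrite (@tcE _ _ (r * s))// ?mulr_ge0 ?(ltW r0)//; first by rewrite -p'0.
by rewrite clk'// st -EFinM mulrAC.
Qed.

End time_change.

(** * Substitution of the clock, and composition of time changes *)

Section change_of_time.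
Context {R : realType} {n : nat}.
Local Notation vec := 'rV[R]_n.+1.
Local Notation mu := (@lebesgue_measure R).
Implicit Types (p : R -> vec) (b s t : R).
Local Open Scope ereal_scope.

Definition wt_alive b p : measurableTypeR R -> R :=
  fun u => if u \in alive p then wt b (p u) else 0%R.

Lemma measurable_wt_alive b p : good p -> measurable_fun setT (wt_alive b p).
Proof.
move=> gp; have mA := measurable_alive gp.
have /measurable_EFinP := measurable_wt_path b gp mA (@alive0 _ _ p).
by move=> /(iffLR (measurable_restrictT _ mA)).
Qed.

Lemma wt_alive_ge0 b p u : (0 <= wt_alive b p u)%R.
Proof. by rewrite /wt_alive; case: ifP => // _; exact: wt_ge0. Qed.

Lemma integral_wt_alive b p (D : set (measurableTypeR R)) (F : R -> \bar R) :
  \int[mu]_(u in D) (F u * (wt_alive b p u)%:E) =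
  \int[mu]_(u in D `&` alive p) (F u * (wt b (p u))%:E).
Proof.
rewrite integral_mkcondr; apply: eq_integral => u _.
by rewrite patchE /wt_alive; case: ifP => // _; rewrite mule0.
Qed.

(** The weight is cut off at death, so that this real function of [s] is measurable by Tonelli; it
    is the clock at living times. *)
Definition rclk b p s : R := fine (\int[mu]_u ((\1_(`[0%R, s]%classic) u)%:E * (wt_alive b p u)%:E)).

Lemma rclkE b p s : good p -> (0 <= s)%R -> p s != 0%R -> (rclk b p s)%:E = clk b p s.
Proof.
move=> gp s0 ps; rewrite /rclk integral_wt_alive setTI.
suff -> : \int[mu]_(u in alive p) ((\1_(`[0%R, s]%classic) u)%:E * (wt b (p u))%:E) = clk b p s.
  by rewrite fineK// clk_fin.
rewrite /clk [LHS]integral_mkcond [RHS]integral_mkcond.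
apply: eq_integral => u _; rewrite !patchE indicE.
case: ifPn => uA; case: ifPn => us; rewrite ?us ?mul1e ?mul0e//.
move: uA; rewrite notin_setE => -[]; move: us; rewrite inE/= in_itv/= => /andP[u0 us].
by split => //; exact: alive_le ps.
Qed.

Lemma measurable_rclk b p : good p ->
  measurable_fun setT (rclk b p : measurableTypeR R -> measurableTypeR R).
Proof.
move=> gp; apply: (measurableT_comp (@fine_measurable R setT measurableT)).
pose f (z : measurableTypeR R * measurableTypeR R) : \bar R :=
  (if (0 <= z.2)%R && (z.2 <= z.1)%R then wt_alive b p z.2 else 0%R)%:E.
have mf : measurable_fun setT f.
  apply/measurable_EFinP; apply: measurable_fun_ifT => //.
    by apply: measurable_and; apply: measurable_fun_ler.
  by apply: (measurableT_comp (measurable_wt_alive b gp)).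
have f0 z : 0 <= f z by rewrite lee_fin; case: ifP => // _; exact: wt_alive_ge0.
have := @measurable_fun_fubini_tonelli_F _ _ _ _ _ mu f mf f0.
apply: eq_measurable_fun => s _; apply: eq_integral => u _.
rewrite /f /= indicE (_ : (u \in `[0%R, s]%classic) = (0 <= u)%R && (u <= s)%R).
  by case: ifP => _; rewrite ?mul1e ?mul0e.
by apply/idP/idP; rewrite inE/= in_itv.
Qed.

(** The image under the clock of the measure with density [wt b (p s)] on the living times of [p] is
    Lebesgue measure on those of [tc b p]. It suffices to compare the two on half-lines, a
    generating class stable under intersection. *)
Lemma ge0_change_of_time b p (F : R -> \bar R) : good p ->
  measurable_fun setT (F : measurableTypeR R -> _) -> (forall t, 0 <= F t) ->
  \int[mu]_(t in alive (tc b p)) F t =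
  \int[mu]_(s in alive p) (F (fine (clk b p s)) * (wt b (p s))%:E).
Proof.
move=> gp mF F0; have gq := good_tc b gp.
pose h1 : {mfun (measurableTypeR R) >-> R} := HB.pack (\1_(alive (tc b p)) : measurableTypeR R -> R)
  (isMeasurableFun.Build _ _ _ _ _ (measurable_indic (measurable_alive gq))).
pose h2 : {mfun (measurableTypeR R) >-> R} := HB.pack (wt_alive b p)
  (isMeasurableFun.Build _ _ _ _ _ (measurable_wt_alive b gp)).
have mA := measurable_rclk b gp.
pose I x : set (measurableTypeR R) := `]-oo, x[%classic.
have H1 x : mdensity mu h1 (I x) = mu (alive (tc b p) `&` I x).
  rewrite /mdensity -integral_indic//; [|exact: measurable_itv|exact: measurable_alive].
  by apply: eq_integral => u _; rewrite /= ger0_norm.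
have H2 x : pushm (mdensity mu h2) mA (I x) =
    \int[mu]_(u in rclk b p @^-1` I x `&` alive p) (1 * (wt b (p u))%:E).
  rewrite -integral_wt_alive; apply: eq_integral => u _.
  by rewrite mul1e /= ger0_norm// wt_alive_ge0.
have H3 x : rclk b p @^-1` I x `&` alive p = [set u | alive p u /\ clk b p u < x%:E].
  apply/seteqP; split=> u; rewrite /I /=.
    by move=> [+ [u0 pu]]; rewrite in_itv/= -lte_fin rclkE.
  by move=> [[u0 pu]]; rewrite -rclkE// lte_fin in_itv/=.
have H4 x : alive (tc b p) `&` I x = [set t | [/\ (0 <= t)%R, t%:E < total b p & (t < x)%R]].
  apply/seteqP; split=> u; rewrite /I /alive /= in_itv/=.
    by move=> [[u0]]; rewrite tc_neq0.
  by move=> [u0 ut ux]; rewrite tc_neq0.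
(* Three positions of the half-line: its end inside []0, total[], here, where both masses are [x];
   beyond the total clock, where both are the total; and at most 0, where both vanish. *)
have H5 x : (0 < x)%R -> x%:E < total b p -> mdensity mu h1 (I x) = pushm (mdensity mu h2) mA (I x).
  move=> x0 xt; have [s [s0 ps sx _]] := tc_alive gp (ltW x0) xt.
  rewrite H1 H2 H4 H3; transitivity x%:E.
    rewrite (_ : [set _ | _] = `[0%R, x[%classic).
      by rewrite lebesgue_measure_itv/= lte_fin x0 EFinN sube0.
    apply/seteqP; split=> u; rewrite /= in_itv/=; first by move=> [-> _ ->].
    by move=> /andP[u0 ux]; split => //; apply: lt_trans xt; rewrite lte_fin.
  rewrite -sx (_ : [set _ | _] = `[0%R, s[%classic :> set (measurableTypeR R)).
    under eq_integral do rewrite mul1e.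
    rewrite /clk -integral_itv_bndo_bndc//; apply: measurable_wt_path => // u /=.
    by rewrite !in_itv/= => /andP[->].
  apply/seteqP; split=> u; rewrite /= in_itv/=.
    by move=> [[u0 pu]]; rewrite ltr_clk// u0.
  move=> /andP[u0 us]; have pu : p u != 0%R by exact: alive_le (ltW us) ps.
  by rewrite ltr_clk.
have H6 x : total b p <= x%:E -> mdensity mu h1 (I x) = pushm (mdensity mu h2) mA (I x).
  move=> tx; rewrite H1 H2 H4 H3; transitivity (total b p).
    have tot0 : 0 <= total b p by apply: integral_ge0 => u _; rewrite lee_fin wt_ge0.
    have totf : total b p \is a fin_num.
      by rewrite ge0_fin_numE// (le_lt_trans tx)// ltry.
    rewrite (_ : [set _ | _] = `[0%R, fine (total b p)[%classic).
      rewrite lebesgue_measure_itv/= lte_fin EFinN sube0 fineK//.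
      case: ltP => // h; apply/eqP; rewrite eq_le tot0/= -(fineK totf) lee_fin.
      by rewrite h.
    apply/seteqP; split=> u; rewrite /= in_itv/= -[(u < fine _)%R]lte_fin fineK//; first by move=> [-> -> _].
    move=> /andP[u0 ut]; split => //; rewrite -lte_fin; exact: lt_le_trans ut tx.
  rewrite (_ : [set _ | _] = alive p).
    by apply: eq_integral => u _; rewrite mul1e.
  apply/seteqP; split=> u; first by case.
  by move=> [u0 pu]; split => //; apply: lt_le_trans tx; exact: clk_le_total.
have H7 x : (x <= 0)%R -> mdensity mu h1 (I x) = pushm (mdensity mu h2) mA (I x).
  move=> x0; rewrite H1 H2 H4 H3.
  rewrite (_ : [set t | _] = set0) ?measure0; last first.
    apply/seteqP; split=> // t [t0 _ tx].
    by have := lt_le_trans tx x0; rewrite ltNge t0.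
  rewrite (_ : [set t | _] = set0) ?integral_set0//.
  apply/seteqP; split=> // t [_]; apply/negP; rewrite -leNgt.
  by apply: le_trans (clk_ge0 b p t); rewrite lee_fin.
have E : forall A, measurable A -> mdensity mu h1 A = pushm (mdensity mu h2) mA A.
  apply: (@measure_unique _ R (measurableTypeR R) (@RGenInftyO.G R) (fun k => I k%:R)).
  - exact: RGenInftyO.measurableE.
  - move=> _ _ [x ->] [y ->]; exists (Num.min x y).
    apply/seteqP; split => u; rewrite /= !in_itv/= lt_min; first by move=> [-> ->].
    by move=> /andP[].
  - by move=> k; exists k%:R.
  - apply/seteqP; split => // x _; exists (Num.truncn x).+1 => //=.
    by rewrite /I /= in_itv/=; exact: truncnS_gt.
  - move=> _ [x ->]; rewrite -/(I x); have [/H7//|x0] := leP x 0%R.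
    by have [/H6//|/(H5 _ x0)//] := leP (total b p) x%:E.
  - move=> k; rewrite [X in X < _]H1; apply: (@le_lt_trans _ _ (mu `[0%R, k%:R])).
      apply: le_measure; rewrite ?inE//.
        exact: (measurableI _ _ (measurable_alive gq) (measurable_itv _)).
      by move=> u [[u0 _]]; rewrite /I /= !in_itv/= u0 => /ltW.
    by rewrite lebesgue_measure_itv/=; case: ifP => _; rewrite ?ltry// -EFinD ltry.
transitivity (\int[mdensity mu h1]_t F t).
  rewrite [LHS]integral_mkcond ge0_integral_mdensity//; apply: eq_integral => t _.
  by rewrite patchE /= indicE; case: ifP => _; rewrite ?normr1 ?mule1 ?normr0 ?mule0.
transitivity (\int[pushm (mdensity mu h2) mA]_t F t).
  by apply: eq_measure_integral => A mA' _; exact: E.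
rewrite ge0_integral_pushforward//= preimage_setT ge0_integral_mdensity//; last first.
  exact: measurableT_comp.
transitivity (\int[mu]_u ((F \o rclk b p) u * (wt_alive b p u)%:E)).
  by apply: eq_integral => u _ /=; rewrite ger0_norm ?wt_alive_ge0.
rewrite integral_wt_alive setTI; apply: eq_integral => u; rewrite inE => -[u0 pu].
by rewrite /= -rclkE.
Qed.

(** Chain rule: under [dr = wt b1 ds] the integrand [wt b2 dr] becomes [wt (b1 + b2) ds]. *)
Lemma clk_tc b1 b2 p s t : good p -> (0 <= s)%R -> p s != 0%R ->
  clk b1 p s = t%:E -> clk b2 (tc b1 p) t = clk (b1 + b2) p s.
Proof.
move=> gp s0 ps st; have gq := good_tc b1 gp.
have t0 : (0 <= t)%R by rewrite -lee_fin -st clk_ge0.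
pose D : set (measurableTypeR R) := `[0%R, t]%classic.
have D0 : D `<=` `[0%R, +oo[ by move=> u; rewrite /D/= !in_itv/= andbT => /andP[].
have mf := measurable_wt_patch b2 gq (measurable_itv _ : measurable D) D0.
have f0 u : 0 <= ((fun v => (wt b2 (tc b1 p v))%:E) \_ D) u.
  by rewrite patchE; case: ifPn => // _; rewrite lee_fin wt_ge0.
have tq : (t%:E < total b1 p) by rewrite -st clk_le_total.
have DA : alive (tc b1 p) `&` D = D.
  apply/setIidr => u; rewrite /D/= in_itv/= => /andP[u0 ut]; split => //.
  by rewrite tc_neq0// (le_lt_trans _ tq).
rewrite /clk -/D -DA integral_mkcondr ge0_change_of_time//.
have -> : [set` `[0%R, s]] = alive p `&` `[0%R, s]%classic :> set (measurableTypeR R).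
  apply/esym/setIidr => u; rewrite /= in_itv/= => /andP[u0 us]; split => //.
  exact: alive_le ps.
rewrite [RHS]integral_mkcondr; apply: eq_integral => u; rewrite inE => -[u0 pu].
have uE : clk b1 p u = (fine (clk b1 p u))%:E by rewrite fineK// clk_fin.
rewrite !patchE; have -> : (fine (clk b1 p u) \in D) = (u \in `[0%R, s]%classic).
  apply/idP/idP; rewrite /D !inE/= !in_itv/= u0/= -!lee_fin -uE -st ?clk_ge0/=.
    by rewrite leNgt ltr_clk// -leNgt.
  by rewrite lee_fin => us; rewrite leNgt ltr_clk// -leNgt.
case: ifP => _; rewrite ?mul0e// (tcE gp u0 pu uE) -EFinM mulrC -wtD//.
Qed.

Lemma total_tc b1 b2 p : good p -> total b2 (tc b1 p) = total (b1 + b2) p.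
Proof.
move=> gp; have gq := good_tc b1 gp.
pose D : set (measurableTypeR R) := `[0%R, +oo[%classic.
have mf := measurable_wt_patch b2 gq (measurable_itv _ : measurable D) (@subset_refl _ _).
have f0 u : 0 <= ((fun v => (wt b2 (tc b1 p v))%:E) \_ D) u.
  by rewrite patchE; case: ifPn => // _; rewrite lee_fin wt_ge0.
have DA : alive (tc b1 p) = alive (tc b1 p) `&` D.
  by apply/esym/setIidl; exact: alive0.
rewrite /total DA integral_mkcondr ge0_change_of_time//.
apply: eq_integral => u; rewrite inE => -[u0 pu].
have uE : clk b1 p u = (fine (clk b1 p u))%:E by rewrite fineK// clk_fin.
rewrite patchE mem_set; last by rewrite /D/= in_itv/= andbT fine_ge0// clk_ge0.
by rewrite (tcE gp u0 pu uE) -EFinM mulrC -wtD.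
Qed.

Lemma tc_tc b1 b2 p t : good p -> (0 <= t)%R ->
  tc b2 (tc b1 p) t = tc (b1 + b2) p t.
Proof.
move=> gp t0; have gq := good_tc b1 gp.
have [tt|tt] := leP (total (b1 + b2) p) t%:E.
  by have -> := tc_dead tt; apply: tc_dead; rewrite total_tc.
have [s [s0 ps st ->]] := tc_alive gp t0 tt.
have sE : clk b1 p s = (fine (clk b1 p s))%:E by rewrite fineK// clk_fin.
have qs := tcE gp s0 ps sE; rewrite -qs.
have c0 : (0 <= fine (clk b1 p s))%R by rewrite fine_ge0// clk_ge0.
have q0 : tc b1 p (fine (clk b1 p s)) != 0%R by rewrite qs.
exact: (tcE gq c0 q0 (etrans (clk_tc b2 gp s0 ps sE) st)).
Qed.

Lemma tc0 p t : good p -> (0 <= t)%R -> tc 0 p t = p t.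
Proof.
move=> gp t0; have clk0E s : (0 <= s)%R -> clk 0 p s = s%:E.
  move=> s0; rewrite /clk; under eq_integral do rewrite wt0.
  rewrite integral_cst//= mul1e lebesgue_measure_itv/= lte_fin EFinN.
  by case: ltP => [_|s0']; [rewrite sube0|rewrite (@le_anti _ _ s 0%R) ?s0'].
have [pt|pt] := eqVneq (p t) 0%R; last by rewrite (tcE gp t0 pt (clk0E _ t0)).
rewrite pt tc_dead// /total; under eq_integral do rewrite wt0.
rewrite integral_cst ?mul1e; last exact: measurable_alive.
have -> : t%:E = mu `[0%R, t].
  rewrite lebesgue_measure_itv/= lte_fin EFinN.
  by case: ltP => [_|t0']; [rewrite sube0|rewrite (@le_anti _ _ t 0%R) ?t0'].
apply: le_measure; rewrite ?inE//; first exact: measurable_alive.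
move=> u [u0 /eqP pu]; rewrite /= in_itv/= u0/= leNgt; apply/negP => tu.
by apply: pu; exact: (good_absorbed gp t0 (ltW tu)).
Qed.

End change_of_time.

(** * Measurable dependence of the time change on the path *)

Section measurable_time_change.
Context {R : realType} {n : nat} d (T : measurableType d).
Local Notation vec := 'rV[R]_n.+1.
Local Notation mu := (@lebesgue_measure R).
Variable Z : R -> T -> vec.
Hypothesis mZ : forall t, 0 <= t -> measurable_fun setT (Z t : T -> borel vec).
Implicit Types (b t s : R) (w : T).
Local Open Scope ereal_scope.

Definition path_reg w (u : R) : vec := reg Z (u, w).

Lemma path_regE w u : good (Z ^~ w) -> (0 <= u)%R -> path_reg w u = Z u w.
Proof. by move=> gw u0; rewrite /path_reg reg_right//; exact: good_right. Qed.

Lemma measurable_integral_path_reg (f : vec -> \bar R) (D : set (measurableTypeR R)) :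
  measurable_fun setT (f : borel vec -> \bar R) -> (forall x, 0 <= f x) ->
  measurable D ->
  measurable_fun setT (fun w => \int[mu]_(u in D) f (path_reg w u)).
Proof.
move=> mf f0 mD.
pose g (z : measurableTypeR R * T) : \bar R := f (reg Z z) * (\1_D z.1)%:E.
have mg : measurable_fun setT g.
  apply: emeasurable_funM.
    exact: (measurableT_comp mf (measurable_reg mZ)).
  apply/measurable_EFinP; apply: (measurableT_comp (measurable_indic mD)).
  exact: measurable_fst.
have g0 z : 0 <= g z by rewrite mule_ge0// lee_fin.
have := measurable_fun_fubini_tonelli_G (m1 := mu) g mg g0.
apply: eq_measurable_fun => w _; rewrite /fubini_G [RHS]integral_mkcond.
apply: eq_integral => u _; rewrite /g patchE indicE.
by case: ifP => _; rewrite ?mule1 ?mule0.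
Qed.

Lemma measurable_clk_reg b s :
  measurable_fun setT (fun w => clk b (path_reg w) s).
Proof.
apply: (measurable_integral_path_reg (f := fun x => (wt b x)%:E)) => //.
- by apply/measurable_EFinP; exact: measurable_wt.
- by move=> x; rewrite lee_fin wt_ge0.
Qed.

Lemma clk_regE b s w : good (Z ^~ w) -> clk b (path_reg w) s = clk b (Z ^~ w) s.
Proof.
move=> gw; apply: eq_integral => u; rewrite inE/= in_itv/= => /andP[u0 _].
by rewrite path_regE.
Qed.

Lemma measurable_clk b s : (forall w, good (Z ^~ w)) ->
  measurable_fun setT (fun w => clk b (Z ^~ w) s).
Proof.
move=> gZ; apply: eq_measurable_fun (measurable_clk_reg b s) => w _.
exact: clk_regE.
Qed.

(** The restriction to living times is written as an indicator of the position, which makes the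
    integrand a function of the position alone, over a fixed range of times. *)
Definition total_reg b w := \int[mu]_(u in `[0%R, +oo[)
  ((wt b (path_reg w u))%:E * (\1_(~` [set 0%R]) (path_reg w u))%:E).

Lemma measurable_total_reg b : measurable_fun setT (total_reg b).
Proof.
apply: (measurable_integral_path_reg
  (f := fun x => (wt b x)%:E * (\1_(~` [set 0%R]) x)%:E)) => //.
- apply: emeasurable_funM; apply/measurable_EFinP; first exact: measurable_wt.
  apply: measurable_indic; apply: measurableC; exact: measurable_set1_vec.
- by move=> x; rewrite mule_ge0// lee_fin// wt_ge0.
Qed.

Lemma total_regE b w : good (Z ^~ w) -> total_reg b w = total b (Z ^~ w).
Proof.
move=> gw; rewrite /total_reg /total [LHS]integral_mkcond [RHS]integral_mkcond.
apply: eq_integral => u _; rewrite !patchE; case: ifPn => u0.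
  move: u0; rewrite inE/= in_itv/= andbT => u0; rewrite path_regE// indicE.
  case: ifPn => uA; first by rewrite mem_set ?mule1//; case: (set_mem uA) => _ /eqP.
  rewrite memNset ?mule0// => /= /eqP zu; move: uA; rewrite notin_setE; apply.
  by split.
case: ifPn => // uA; case/negP: u0; rewrite inE /= in_itv/= andbT.
by case: (set_mem uA).
Qed.

Definition enum_rat (j : nat) : R := ratr (odflt 0%R (unpickle j : option rat)).

Lemma enum_rat_itv (s t : R) : (s < t)%R -> exists j, (s < enum_rat j < t)%R.
Proof.
move=> st; have [r] := rat_in_itvoo st; rewrite in_itv/= => srt.
by exists (pickle r); rewrite /enum_rat pickleK.
Qed.

(** The infimum defining [gam], over rational times only: a countable infimum of measurable
    functions. Strict growth of the clock makes it the same number. *)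
Definition gam_reg b t w : R := fine (einfs (fun j =>
  if (0 <= enum_rat j)%R && (t%:E < clk b (path_reg w) (enum_rat j))
  then (enum_rat j)%:E else +oo) 0%N).

Lemma measurable_gam_reg b t : measurable_fun setT (gam_reg b t : T -> measurableTypeR R).
Proof.
apply: (measurableT_comp (@fine_measurable R setT measurableT)).
apply: measurable_fun_einfs => j; apply: measurable_fun_ifT => //.
apply: measurable_and => //; apply: measurable_fun_lte => //.
exact: measurable_clk_reg.
Qed.

Lemma gam_regE b s t w : good (Z ^~ w) -> (0 <= s)%R -> Z s w != 0%R ->
  clk b (Z ^~ w) s = t%:E -> gam_reg b t w = s.
Proof.
move=> gw s0 ps st; rewrite /gam_reg; set u := (fun j => _).
have -> : einfs u 0%N = ereal_inf (range u).
  by congr ereal_inf; apply/seteqP; split => [_ [j _ <-]|_ [j _ <-]]; exists j.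
suff -> : ereal_inf (range u) = s%:E by [].
have clks r : (0 <= r)%R -> (t%:E < clk b (path_reg w) r) = (s < r)%R.
  move=> r0; rewrite clk_regE// -st; apply/idP/idP.
    by apply: contraTT; rewrite -!leNgt; exact: le_clk.
  move=> sr; have [s' /andP[ss' s'r] ps'] := alive_right gw s0 ps sr.
  by rewrite (lt_le_trans (lt_clk b gw s0 ss' ps'))// le_clk// ltW.
apply/eqP; rewrite eq_le; apply/andP; split; last first.
  apply: le_ereal_inf_tmp => _ [j _ <-]; rewrite /u; case: ifPn => [/andP[j0]|_]; last exact: leey.
  by rewrite clks// lee_fin => /ltW.
apply/lee_addgt0Pr => e e0.
have [j /andP[sj je]] := enum_rat_itv (ltr_pwDr e0 (lexx s)).
apply: (@le_trans _ _ (enum_rat j)%:E); last by rewrite -EFinD lee_fin ltW.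
apply: ereal_inf_lbound; exists j => //; rewrite /u.
have j0 : (0 <= enum_rat j)%R by rewrite (le_trans s0)// ltW.
by rewrite j0/= clks// sj.
Qed.

Definition tc_reg b t w : vec :=
  if t%:E < total_reg b w then path_reg w (gam_reg b t w) else 0%R.

Lemma measurable_tc_reg b t : measurable_fun setT (tc_reg b t : T -> borel vec).
Proof.
apply: measurable_fun_ifT => //.
  by apply: measurable_fun_lte => //; exact: measurable_total_reg.
apply: (measurableT_comp (measurable_reg mZ)).
by apply: measurable_fun_pair => //; exact: measurable_gam_reg.
Qed.

Lemma tc_regE b t w : good (Z ^~ w) -> (0 <= t)%R ->
  tc_reg b t w = tc b (Z ^~ w) t.
Proof.
move=> gw t0; rewrite /tc_reg total_regE//; case: ltP => tt; last by rewrite tc_dead.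
have [s [s0 ps st ->]] := tc_alive gw t0 tt.
by rewrite (gam_regE gw s0 ps st) path_regE.
Qed.

End measurable_time_change.

(** * The space of paths with its product sigma-algebra *)

Section path_space.
Context {R : realType} {n : nat}.
Local Notation vec := 'rV[R]_n.+1.

Definition path_gen : set (set (R -> vec)) :=
  [set C | exists t : R, exists B : set (borel vec),
     [/\ 0 <= t, measurable B & C = [set p | B (p t)]] ].

Definition path_space := g_sigma_algebraType path_gen.

Definition eval_path (t : R) (p : path_space) : vec := p t.

Lemma path_sigma_algebraE :
  (@path_sigma_algebra R n) = (measurable : set (set path_space)).
Proof. by []. Qed.

Lemma measurable_eval_path t : 0 <= t ->
  measurable_fun setT (eval_path t : path_space -> borel vec).
Proof.
move=> t0 _ B mB; rewrite setTI; apply: sub_sigma_algebra.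
by exists t, B.
Qed.

Lemma measurable_paths d (T : measurableType d) (Z : T -> R -> vec) :
  (forall t, 0 <= t -> measurable_fun setT (fun w => Z w t : borel vec)) ->
  measurable_fun setT (Z : T -> path_space).
Proof.
move=> mZ; apply: (@measurability _ _ T path_space setT Z path_gen) => //.
by move=> _ [_ [t [B [t0 mB ->]]] <-]; exact: mZ.
Qed.

(** A version of [tc] that is measurable on the space of all paths; the two agree on good paths. It
    turns events about the time-changed path into events about the path. *)
Definition tc_path b (t : R) (p : path_space) : vec := tc_reg eval_path b t p.

Lemma measurable_tc_path b t :
  measurable_fun setT (tc_path b t : path_space -> borel vec).
Proof. by apply: measurable_tc_reg => s s0; exact: measurable_eval_path. Qed.

Lemma tc_pathE b t p : good p -> 0 <= t -> tc_path b t p = tc b p t.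
Proof.
by move=> gp t0; exact: (@tc_regE _ _ _ path_space eval_path b t p gp t0).
Qed.

End path_space.

(** * Markov processes absorbed at the origin *)

Section vector_markov.
Context {R : realType} {n : nat} {d : measure_display} {Omega : measurableType d}.
Local Notation vec := 'rV[R]_n.+1.
Implicit Types (E : set vec) (F : R -> set (set Omega)) (X : R -> Omega -> vec)
  (P : vec -> probability Omega R).

Definition state E : set vec := E `|` [set 0].

(* [markov_process E F (absorb X) (absorb_law P)] read on [X] itself, the vector 0
   playing the role of the isolated state. *)
Record vmarkov E F X P : Prop := VMarkov {
  vm_locally_compact : locally_compact [set: set_type E] ;
  vm_second_countable : @second_countable (set_type E) ;
  vm_filtration : usual_filtration E F (absorb_law P) ;
  vm_adapted : forall (t : R) (B : set (borel vec)), 0 <= t -> measurable B ->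
    F t (X t @^-1` B) ;
  vm_state : forall (t : R) w, 0 <= t -> state E (X t w) ;
  vm_start : forall x, state E x -> P x [set w | X 0 w = x] = 1%E ;
  vm_good : forall w, good (X ^~ w) ;
  vm_left : forall (t : R) w, 0 < t -> X t w != 0 ->
    exists2 v : vec, E v & X s w @[s --> t^'-] --> v ;
  vm_kernel : forall (t : R) (B : set (borel vec)), 0 <= t -> measurable B ->
    measurable_fun (E : set (borel vec)) (fun x : borel vec => P x (X t @^-1` B)) ;
  vm_strong : forall T, stopping_time F T ->
    forall x (s : R) A (B : set (borel vec)), state E x -> 0 <= s ->
    stopped_sigma_algebra F T A -> measurable B ->
    P x (A `&` [set w | (T w < +oo)%E] `&` [set w | B (X (fine (T w) + s) w)]) =
    (\int[P x]_(w in A `&` [set w | (T w < +oo)%E])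
       P (X (fine (T w)) w) (X s @^-1` B))%E ;
  vm_quasi_left_continuous : forall (Tn : nat -> Omega -> \bar R) T,
    (forall k, stopping_time F (Tn k)) -> stopping_time F T ->
    (forall w, {homo Tn ^~ w : k l / (k <= l)%N >-> (k <= l)%E}) ->
    (forall w, Tn ^~ w @ \oo --> T w) ->
    forall x, state E x ->
    {ae P x, forall w, (T w < +oo)%E -> X (fine (T w)) w != 0 ->
      X (fine (Tn k w)) w @[k --> \oo] --> X (fine (T w)) w} ;
  vm_reference_measure :
    exists mu : {sigma_finite_measure set (borel vec) -> \bar R},
    forall v, E v -> forall B : set (borel vec), measurable B -> B `<=` E ->
      (\int[P v]_w \int[lebesgue_measure]_(t in [set t : R | (0 <= t)%R])
         (\1_B (X t w))%:E = 0)%E <-> mu B = 0%E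
}.

Lemma nbhs_neq0 (v : vec) : v != 0 -> nbhs v [set x | x != 0].
Proof.
move=> v0; have e0 : 0 < enorm v by rewrite enorm_gt0.
have FF : Filter (nbhs (v : vec)) := nbhs_filter _.
have := @cvgr_gt _ _ _ FF _ _ (@continuous_enorm R n v) _ e0.
by apply: filterS => x /=; rewrite enorm_gt0.
Qed.

Definition kill (x : vec) : option vec := if x == 0 then None else Some x.

(** The nonzero vectors form a neighbourhood of [v], so near a living state the isolated cemetery
    and the vector 0 are equally out of reach. *)
Lemma cvg_kill (T : Type) (G : set_system T) (f : T -> vec) (v : vec) :
  Filter G -> v != 0 ->
  kill (f s) @[s --> G] --> cemetery_nbhs (Some v) <-> f @ G --> v.
Proof.
move=> FG v0; split=> [H A vA|H A /= vA].
  have : cemetery_nbhs (Some v) [set o | if o is Some x then A x else False] by [].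
  move=> /H; rewrite /nbhs/=; apply: filterS => s /=; rewrite /kill.
  by case: ifP.
have h1 : G (f @^-1` [set x | A (Some x)]) by exact: H.
have h2 : G (f @^-1` [set x | x != 0]) by apply: H; exact: nbhs_neq0.
have K s : f s != 0 -> kill (f s) = Some (f s) by rewrite /kill => /negbTE ->.
suff: G (fun s => A (kill (f s))) by [].
by apply: filterS2 h1 h2 => s As s0; rewrite (K s s0).
Qed.

Lemma lt_lifetime X w (t : R) : good (X ^~ w) -> 0 <= t ->
  (t%:E < lifetime (absorb X) w)%E = (X t w != 0).
Proof.
move=> gw t0; apply/idP/idP.
  apply: contraTneq => xt; rewrite -leNgt; apply: ereal_inf_lbound.
  by exists t => //; rewrite /= /absorb xt eqxx.
move=> xt; have [s /andP[ts _] xs] := alive_right gw t0 xt (ltr_pwDr ltr01 (lexx t)).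
apply: (@lt_le_trans _ _ s%:E); first by rewrite lte_fin.
apply: le_ereal_inf_tmp => _ [r [r0 xr] <-]; rewrite lee_fin leNgt.
apply/negP => rs; move: xr; rewrite /absorb; case: ifP => // /eqP xr _.
by case/eqP : xs; exact: (good_absorbed gw r0 (ltW rs)).
Qed.

Lemma indic_absorb X (B : set vec) t w : ~ B 0 ->
  \1_(Some @` B) (absorb X t w) = \1_B (X t w) :> R.
Proof.
move=> B0; rewrite !indicE; congr (nat_of_bool _)%:R; rewrite /absorb.
case: eqVneq => [->|xt].
  by apply/idP/idP; rewrite !inE => //; case.
apply/idP/idP; rewrite !inE; last by move=> Bx; exists (X t w).
by move=> [v Bv [<-]].
Qed.

Lemma potential_absorb X P v (B : set vec) : ~ B 0 ->
  potential (absorb X) (absorb_law P) v B =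
  (\int[P v]_w \int[lebesgue_measure]_(t in [set t : R | (0 <= t)%R])
     (\1_B (X t w))%:E)%E.
Proof.
move=> B0; apply: eq_integral => w _; apply: eq_integral => t _.
by rewrite indic_absorb.
Qed.

Lemma with_cemetery_state E o : with_cemetery E o -> state E (if o is Some x then x else 0).
Proof. by case: o => [x|] /=; [left|right]. Qed.

Lemma state_with_cemetery E x : ~ E 0 -> state E x ->
  with_cemetery E (kill x) /\ (if kill x is Some y then y else 0) = x.
Proof.
move=> E0 [Ex|->]; rewrite /kill; last by rewrite eqxx.
by case: eqVneq => // x0; move: Ex; rewrite x0.
Qed.

(** The two topologies differ only at the cemetery, isolated in [option vec] but not as the vector
    0. This is harmless: left limits lie in [E], hence are nonzero, and a dead path is constant. *)
Lemma vmarkov_of E F X P : ~ E 0 ->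
  markov_process E F (absorb X) (absorb_law P) -> vmarkov E F X P.
Proof.
move=> E0 [lc sc filt ada sta start abso rc ll ker str qlc ref].
have kb (B : set (borel vec)) : measurable B ->
    cemetery_borel [set o | B (if o is Some v then v else 0)] by [].
have kE (B : set vec) s w : (if absorb X s w is Some v then v else 0) = X s w.
  by rewrite /absorb; case: eqVneq.
have kS (B : set vec) s :
    absorb X s @^-1` [set o | B (if o is Some v then v else 0)] = X s @^-1` B.
  by apply/seteqP; split=> w; rewrite /preimage/= kE.
have alt (t : R) w : 0 <= t -> X t w != 0 -> (t%:E < lifetime (absorb X) w)%E.
  move=> t0 xt; rewrite ltNge; apply/negP => /(abso _ _ t0).
  by rewrite /absorb (negbTE xt).
have ab (s t : R) w : 0 <= s -> s <= t -> X s w = 0 -> X t w = 0.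
  move=> s0 st xs; apply/eqP; apply: contraT => /(alt _ _ (le_trans s0 st)).
  rewrite ltNge (@le_trans _ _ s%:E) ?lee_fin//.
  by apply: ereal_inf_lbound; exists s => //; rewrite /= /absorb xs eqxx.
have ll' (t : R) w : 0 < t -> X t w != 0 ->
    exists2 v : vec, E v & X s w @[s --> t^'-] --> v.
  move=> t0 xt; have [v Ev /cvg_kill xv] := ll _ _ t0 (alt _ _ (ltW t0) xt).
  by exists v => //; apply: xv; apply/eqP => v0; apply: E0; rewrite -v0.
have gw w : good (X ^~ w).
  split=> [s t|t t0|t t0 xt].
  - exact: ab.
  - have [xt|xt] := eqVneq (X t w) 0; last first.
      have := rc _ _ t0 (alt _ _ t0 xt); rewrite {2}/absorb (negbTE xt).
      by move/cvg_kill; exact.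
    move=> A; rewrite xt => /nbhs_singleton A0.
    by apply: filterS (nbhs_right_gt t) => u tu /=; rewrite (ab t u)// ltW.
  - have [v Ev xv] := ll' _ _ t0 xt; exists v => //.
    by apply/eqP => v0; apply: E0; rewrite -v0.
split; [exact: lc|exact: sc|exact: filt| | | |exact: gw|exact: ll'| | | |].
- by move=> t B t0 mB; have := ada t _ t0 (kb _ mB); rewrite kS.
- move=> t w t0; have := sta t w t0; rewrite /absorb; case: eqVneq => [->|_ /=]; by [right|left].
- move=> x Ex; have [Ek xE] := state_with_cemetery E0 Ex.
  have := start _ Ek; rewrite /absorb_law xE => <-; congr (P x _).
  apply/seteqP; split=> w /=; rewrite /absorb; first by move=> ->.
  move=> H; rewrite -xE -H; by case: eqVneq.
- by move=> t B t0 mB; have := ker t _ t0 (kb _ mB); rewrite kS.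
- move=> T sT x s A B Ex s0 FA mB; have [Ek xE] := state_with_cemetery E0 Ex.
  have := str T sT _ s A _ Ek s0 FA (kb _ mB); rewrite /absorb_law xE.
  rewrite kS (_ : [set w | _ (absorb _ _ _)] = [set w | B (X (fine (T w) + s) w)]).
    by move=> ->; apply: eq_integral => w _; rewrite /at_time kE.
  by apply/seteqP; split => w /=; rewrite kE.
- move=> Tn T sTn sT nd cv x Ex; have [Ek xE] := state_with_cemetery E0 Ex.
  have := qlc Tn T sTn sT nd cv _ Ek; rewrite /absorb_law xE.
  apply: filterS => w H Too xT; have T0 := sT.1 w.
  have Tf : T w = (fine (T w))%:E by rewrite fineK// ge0_fin_numE.
  have : (T w < lifetime (absorb X) w)%E.
    by rewrite Tf; apply: alt => //; rewrite fine_ge0.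
  by move=> /H; rewrite /at_time {2}/absorb (negbTE xT) => /cvg_kill; exact.
- have [mu muP] := ref; exists mu => v Ev B mB BE; rewrite -(muP v Ev B mB BE).
  by rewrite potential_absorb// => /BE.
Qed.

Lemma markov_of_vmarkov E F X P : ~ E 0 ->
  vmarkov E F X P -> markov_process E F (absorb X) (absorb_law P).
Proof.
move=> E0 [lc sc filt ada sta start gw ll ker str qlc ref].
(* The preimage under [kill] of a Borel set is its living part, with the point 0 added when the
   cemetery belongs to it. *)
have mk (B : set (option vec)) : cemetery_borel B ->
    measurable ([set v | B (kill v)] : set (borel vec)).
  move=> mB; rewrite (_ : [set v | _] = (Some @^-1` B `\` [set 0]) `|`
      ([set 0] `&` [set v | B None])).
    apply: measurableU; first by apply: measurableD => //; exact: measurable_set1_vec.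
    apply: measurableI; first exact: measurable_set1_vec.
    have [BN|BN] := pselect (B None).
      by rewrite (_ : [set _ | _] = setT)//; apply/seteqP; split.
    by rewrite (_ : [set _ | _] = set0)//; apply/seteqP; split.
  apply/seteqP; split=> v /=; rewrite /kill.
    by case: eqVneq => [->|v0 Bv]; [right|left; split => //; exact/eqP].
  by case=> [[Bv /eqP/negbTE ->]//|[-> BN]]; rewrite eqxx.
have alt (t : R) w : 0 <= t -> (t%:E < lifetime (absorb X) w)%E = (X t w != 0).
  by move=> t0; exact: lt_lifetime.
split; [exact: lc|exact: sc|exact: filt| | | | | | | | | |].
- by move=> t B t0 mB; exact: (ada t _ t0 (mk _ mB)).
- move=> t w t0; have := sta t w t0; rewrite /absorb.
  by case: eqVneq => [//|x0 []// x00]; move: x0; rewrite x00 eqxx.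
- move=> [x|] /= Ex; rewrite /absorb_law.
    rewrite -(start x (or_introl Ex)); congr (P x _); apply/seteqP; split => w /=.
      by rewrite /absorb; case: ifP => // _ [].
    by rewrite /absorb => ->; case: eqVneq => // x0; case: E0; rewrite -x0.
  rewrite -(start 0 (or_intror erefl)); congr (P 0 _); apply/seteqP; split => w /=.
    by rewrite /absorb; case: eqVneq.
  by rewrite /absorb => ->; rewrite eqxx.
- by move=> t w t0; rewrite leNgt alt// negbK /absorb => ->.
- move=> t w t0; rewrite alt// => xt; rewrite {2}/absorb (negbTE xt).
  by apply/cvg_kill => //; exact: good_right.
- move=> t w t0; rewrite alt ?ltW// => xt; have [v Ev xv] := ll _ _ t0 xt.
  exists v => //; apply/cvg_kill => //.
  by apply/eqP => v0; apply: E0; rewrite -v0.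
- by move=> t B t0 mB; exact: (ker t _ t0 (mk _ mB)).
- move=> T sT o s A B /with_cemetery_state Ex s0 FA mB; rewrite /absorb_law.
  have := str T sT _ s A _ Ex s0 FA (mk _ mB) => ->; apply: eq_integral => w _.
  by rewrite /at_time {1}/absorb; case: eqVneq => [->|].
- move=> Tn T sTn sT nd cv o /with_cemetery_state Ex; rewrite /absorb_law.
  apply: filterS (qlc Tn T sTn sT nd cv _ Ex) => w H Tl.
  have Too : (T w < +oo)%E by rewrite (lt_le_trans Tl)// leey.
  have Tf : T w = (fine (T w))%:E by rewrite fineK// ge0_fin_numE// (sT.1 w).
  have xT : X (fine (T w)) w != 0 by rewrite -alt ?fine_ge0 ?(sT.1 w)// -Tf.
  by rewrite /at_time {2}/absorb (negbTE xT); apply/cvg_kill => //; exact: H.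
- have [mu muP] := ref; exists mu => v Ev B mB BE; rewrite -(muP v Ev B mB BE).
  by rewrite potential_absorb// => /BE.
Qed.

End vector_markov.

Section borel_state.
Context {R : realType} {n : nat}.
Local Notation vec := 'rV[R]_n.+1.

(** Such a set is a countable union of compact sets: each point has a compact neighbourhood, which
    contains a basic open set around the point. Compactness passes to the ambient space, where
    compact sets are closed. *)
Lemma measurable_locally_compact (E : set vec) :
  locally_compact [set: set_type E] -> @second_countable (set_type E) ->
  measurable (E : set (borel vec)).
Proof.
move=> lc [B cB [oB bB]].
pose G (b : set (set_type E)) := [set K | compact K /\ b `<=` K].
(* One compact set is chosen for each basic open set contained in some compact set, and the empty
   set is taken otherwise, so that the union is indexed by the countable base. *)
pose K b := if pselect (exists K, G b K) is left h then
  set_val @` (proj1_sig (cid h)) else set0.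
have -> : E = \bigcup_(b in [set: set_type B]) K (set_val b).
  apply/seteqP; split=> [x Ex|x [b _]]; last first.
    by rewrite /K; case: pselect => // h [[y Ey] _ <-]; exact: set_mem.
  have [U + [cU _]] := lc (exist _ x (mem_set Ex)) I.
  move=> wU; have /bB[b /= [Bb bx] bU] : nbhs (exist _ x (mem_set Ex) : set_type E) U.
    rewrite /within/= in wU.
    by apply: (@filterS _ _ (nbhs_filter (exist _ x (mem_set Ex) : set_type E)) _ _ _ wU) => y; apply.
  exists (exist _ b (mem_set Bb)) => //; rewrite /set_val/= /K; case: pselect => [h|[]]; last by exists U.
  by exists (exist _ x (mem_set Ex)) => //; apply: (proj2_sig (cid h)).2.
apply: countable_bigcupT_measurable; first by rewrite (eq_countable (card_setT B)).
move=> b; rewrite /K; case: pselect => // h.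
have [cK _] := proj2_sig (cid h); rewrite -[X in measurable X]setCK.
apply: measurableC; apply: sub_sigma_algebra; apply: closed_openC.
apply: compact_closed; first exact: norm_hausdorff.
apply: continuous_compact => //; apply: continuous_subspaceT.
exact: initial_continuous.
Qed.

End borel_state.

(** * Cylinder sets and uniqueness of measures on paths *)

Section cylinders.
Context {R : realType} {n : nat}.
Local Notation vec := 'rV[R]_n.+1.

Definition cyl (l : seq (R * set vec)) : set (R -> vec) :=
  [set p | forall x, x \in l -> x.2 (p x.1)].

Definition cyl_wf (l : seq (R * set vec)) :=
  forall x, x \in l -> 0 <= x.1 /\ measurable (x.2 : set (borel vec)).

Lemma cyl_nil : cyl [::] = setT.
Proof. by apply/seteqP; split. Qed.

Lemma cyl_cons x l : cyl (x :: l) = [set p | x.2 (p x.1)] `&` cyl l.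
Proof.
apply/seteqP; split=> p /= H.
  by split=> [|y yl]; apply: H; rewrite inE ?eqxx// yl orbT.
by move=> y; rewrite inE => /orP[/eqP ->|]; [exact: H.1|exact: H.2].
Qed.

Lemma cyl_cat l1 l2 : cyl (l1 ++ l2) = cyl l1 `&` cyl l2.
Proof.
by elim: l1 => [|x l IH]; rewrite ?cyl_nil ?setTI//= !cyl_cons IH setIA.
Qed.

Lemma cyl_sort r l : cyl (sort r l) = cyl l.
Proof. by apply/seteqP; split=> p H x xl; apply: H; rewrite ?mem_sort// -(mem_sort r). Qed.

Lemma measurable_cyl l : cyl_wf l -> measurable (cyl l : set (path_space)).
Proof.
elim: l => [_|x l IH wl]; first by rewrite cyl_nil; exact: measurableT.
rewrite cyl_cons; apply: measurableI; last first.
  by apply: IH => y yl; apply: wl; rewrite inE yl orbT.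
have [x0 mx] := wl x (mem_head _ _).
by apply: sub_sigma_algebra; exists x.1, x.2.
Qed.

Definition cyl_gen : set (set (R -> vec)) := [set cyl l | l in [set l | cyl_wf l]].

Lemma measurable_cyl_gen : (measurable : set (set (@path_space R n))) = <<s cyl_gen >>.
Proof.
apply/seteqP; split.
  apply: smallest_sub; first exact: smallest_sigma_algebra.
  move=> _ [t [B [t0 mB ->]]]; apply: sub_sigma_algebra.
  exists [:: (t, B)]; first by move=> x; rewrite inE => /eqP ->.
  by rewrite cyl_cons cyl_nil setIT.
apply: smallest_sub; first exact: sigma_algebra_measurable.
by move=> _ [l wl <-]; exact: measurable_cyl.
Qed.

Lemma cyl_gen_setI : setI_closed cyl_gen.
Proof.
move=> _ _ [l1 w1 <-] [l2 w2 <-]; exists (l1 ++ l2); last by rewrite cyl_cat.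
by move=> x; rewrite mem_cat => /orP[/w1|/w2].
Qed.

(** Cylinders generate and are stable under intersection. They do not depend on the order of the
    list, so increasing times suffice; the exhaustion by sets of finite measure is through the
    starting point. *)
Lemma path_measure_unique_sigma_finite (g : nat -> set (borel vec))
    (m1 m2 : {measure set (@path_space R n) -> \bar R}) :
  (forall k, measurable (g k)) -> \bigcup_k g k = setT ->
  (forall k, (m1 [set p : path_space | g k (p 0%R)] < +oo)%E) ->
  (forall l, cyl_wf l -> sorted <=%R (map fst l) -> m1 (cyl l) = m2 (cyl l)) ->
  forall C, measurable C -> m1 C = m2 C.
Proof.
move=> mg gT m1oo m12.
have cE k : cyl [:: (0, g k)] = [set p | g k (p 0%R)] by rewrite cyl_cons cyl_nil setIT.
apply: (@measure_unique _ R path_space cyl_gen (fun k => cyl [:: (0, g k)])).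
- exact: measurable_cyl_gen.
- exact: cyl_gen_setI.
- by move=> k; exists [:: (0, g k)] => // x; rewrite inE => /eqP ->; split=> //; exact: mg.
- apply/seteqP; split=> // p _; have : (\bigcup_k g k) (p 0) by rewrite gT.
  by move=> [k _ gp]; exists k => //; have := cE k => ->.
- move=> _ [l wl <-]; pose r := fun x y : R * set vec => x.1 <= y.1.
  rewrite -(cyl_sort r); apply: m12; first by move=> x; rewrite mem_sort; exact: wl.
  by rewrite sorted_map; apply: sort_sorted => x y; exact: le_total.
- by move=> k; rewrite cE.
Qed.

Lemma path_measure_unique (m1 m2 : {measure set (@path_space R n) -> \bar R}) :
  (m1 setT < +oo)%E ->
  (forall l, cyl_wf l -> sorted <=%R (map fst l) -> m1 (cyl l) = m2 (cyl l)) ->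
  forall C, measurable C -> m1 C = m2 C.
Proof.
move=> m1oo; apply: (@path_measure_unique_sigma_finite (fun=> setT)) => //.
by apply/seteqP; split=> // x _; exists 0%N.
Qed.

End cylinders.

(** * Stopped sigma-algebras and the strong Markov property for paths *)

Section strong_markov.
Context {R : realType} {n : nat} {d : measure_display} {Omega : measurableType d}.
Local Notation vec := 'rV[R]_n.+1.
Variables (E : set vec) (F : R -> set (set Omega)) (X : R -> Omega -> vec)
  (P : vec -> probability Omega R).
Hypotheses (mE : measurable (E : set (borel vec))) (vm : vmarkov E F X P).
Implicit Types (T : Omega -> \bar R) (A : set Omega) (s t : R).

Lemma measurable_state : measurable (state E : set (borel vec)).
Proof. by apply: measurableU => //; exact: measurable_set1_vec. Qed.

Lemma sigma_algebra_F t : 0 <= t -> <<s F t >> = F t.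
Proof.
move=> t0; apply: sigma_algebra_id.
exact: filtration_sigma_algebra (vm_filtration vm) _ t0.
Qed.

Lemma measurable_sub t A : 0 <= t ->
  measurable (A : set (g_sigma_algebraType (F t))) -> F t A.
Proof. by move=> t0; rewrite /measurable/= sigma_algebra_F. Qed.

Lemma sub_measurable t A : F t A -> measurable (A : set (g_sigma_algebraType (F t))).
Proof. exact: sub_sigma_algebra. Qed.

Lemma F_measurable t A : 0 <= t -> F t A -> measurable A.
Proof. by move=> t0; exact: filtration_measurable (vm_filtration vm) _ t0 _. Qed.

Lemma F_le s t A : 0 <= s -> s <= t -> F s A -> F t A.
Proof. by move=> s0 st; exact: (filtration_nondecreasing (vm_filtration vm) s0 st). Qed.

Lemma F_setI t A B : 0 <= t -> F t A -> F t B -> F t (A `&` B).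
Proof.
by move=> t0 /sub_measurable mA /sub_measurable mB; apply: measurable_sub => //; exact: measurableI.
Qed.

Lemma F_set0 t : 0 <= t -> F t set0.
Proof. by move=> t0; apply: measurable_sub => //; exact: measurable0. Qed.

Lemma F_setT t : 0 <= t -> F t setT.
Proof. by move=> t0; apply: measurable_sub => //; exact: measurableT. Qed.

Lemma F_setC t A : 0 <= t -> F t A -> F t (~` A).
Proof. by move=> t0 /sub_measurable mA; apply: measurable_sub => //; exact: measurableC. Qed.

Lemma F_bigcup t (A : nat -> set Omega) : 0 <= t -> (forall k, F t (A k)) ->
  F t (\bigcup_k A k).
Proof.
move=> t0 FA; apply: measurable_sub => //; apply: bigcupT_measurable => k.
exact: sub_measurable.
Qed.

Lemma measurable_X t : 0 <= t -> measurable_fun setT (X t : Omega -> borel vec).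
Proof.
move=> t0 _ B mB; rewrite setTI; apply: (F_measurable t0).
exact: vm_adapted vm _ _ t0 mB.
Qed.

Lemma measurable_X_path : measurable_fun setT (fun w => X ^~ w : path_space).
Proof. by apply: measurable_paths => t; exact: measurable_X. Qed.

Lemma measurable_X_at (tau : Omega -> R) :
  measurable_fun setT (tau : Omega -> measurableTypeR R) -> (forall w, 0 <= tau w) ->
  measurable_fun setT (fun w => X (tau w) w : borel vec).
Proof.
move=> mt t0; apply: (@eq_measurable_fun _ _ _ _ _ (fun w => reg X (tau w, w) : borel vec)).
  by move=> w _; rewrite reg_right//; exact: (good_right (vm_good vm w) (t0 w)).
by apply: (measurableT_comp (measurable_reg measurable_X)); exact: measurable_fun_pair.
Qed.

Lemma good_stop (p : R -> vec) t : good p -> 0 <= t ->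
  good (fun u => p (Num.min u t)).
Proof.
move=> gp t0; split=> [s u s0 su|u u0|u u0].
- by apply: (good_absorbed gp); [rewrite le_min s0|exact: le_min2].
- have [ut|tu] := ltP u t.
    move=> A /(good_right gp u0)/at_rightP[e ue eA].
    apply: filterS2 (nbhs_right_gt u) (nbhs_right_lt (_ : u < Num.min e t)) => [v uv|].
      rewrite lt_min => /andP[ve vt] /=; rewrite min_l ?ltW//.
      by apply: eA; rewrite uv.
    by rewrite lt_min ue.
  move=> A /nbhs_singleton A0.
  by apply: filterS (nbhs_right_gt u) => v uv /=; rewrite min_r// (le_trans tu)// ltW.
- have [ut|tu] := leP u t.
    move=> /(good_left gp u0)[v v0 pv]; exists v => // A /pv/at_leftP[e eu eA].
    apply: filterS2 (nbhs_left_lt u) (nbhs_left_gt eu) => s su es /=.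
    rewrite min_l ?(le_trans (ltW su))//; by apply: eA; rewrite es.
  move=> pt; exists (p t) => // A /nbhs_singleton A0.
  by apply: filterS (nbhs_left_gt tu) => s ts /=; rewrite min_r// ltW.
Qed.

(** The process stopped at [t] is a process on the sigma-algebra [F t]. The meshes look strictly to
    the right of the time they approximate; stopping keeps what they read inside [F t], which gives
    progressive measurability. *)
Lemma stop_measurable t : 0 <= t -> forall u, 0 <= u ->
  measurable_fun setT (fun w => X (Num.min u t) w : borel vec) /\
  measurable_fun setT (X (Num.min u t) : g_sigma_algebraType (F t) -> borel vec).
Proof.
move=> t0 u u0; have m0 : 0 <= Num.min u t by rewrite le_min u0.
split; first exact: measurable_X.
move=> _ B mB; rewrite setTI; apply: sub_measurable.
apply: (F_le m0); first by rewrite ge_min lexx orbT.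
exact: vm_adapted vm _ _ m0 mB.
Qed.

Lemma measurable_stopping_time T : stopping_time F T -> measurable_fun setT T.
Proof.
move=> sT; apply: (measurability (@ErealGenOInfty.G R)).
  exact: ErealGenOInfty.measurableE.
move=> _ [_ [x ->] <-]; rewrite setTI.
have [x0|x0] := ltP x 0.
  rewrite (_ : _ @^-1` _ = setT)//; apply/seteqP; split=> // w _ /=.
  by rewrite in_itv/= andbT (lt_le_trans _ (sT.1 w))// lte_fin.
rewrite (_ : _ @^-1` _ = ~` [set w | (T w <= x%:E)%E]).
  by apply: measurableC; apply: (F_measurable x0); exact: sT.2.
apply/seteqP; split=> w /=; rewrite in_itv/= andbT; first by rewrite ltNge => /negP.
by move=> /negP; rewrite ltNge.
Qed.

Lemma measurable_min_stopping_time T t : stopping_time F T -> 0 <= t ->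
  measurable_fun setT ((fun w => fine (mine (T w) t%:E)) :
    g_sigma_algebraType (F t) -> measurableTypeR R).
Proof.
move=> sT t0; apply: (measurability (@RGenOInfty.G R)).
  exact: RGenOInfty.measurableE.
move=> _ [_ [x ->] <-]; rewrite setTI; apply: sub_measurable.
have mf w : mine (T w) t%:E = (fine (mine (T w) t%:E))%:E.
  have T0 := sT.1 w; rewrite fineK// ge0_fin_numE ?le_min ?T0//.
  by rewrite gt_min ltry orbT.
have [tx|xt] := leP t x.
  rewrite (_ : _ @^-1` _ = set0); first exact: F_set0.
  apply/seteqP; split=> // w /=; rewrite in_itv/= andbT -lte_fin -mf.
  by rewrite lt_min lte_fin => /andP[_]; rewrite ltNge tx.
have [x0|x0] := ltP x 0.
  rewrite (_ : _ @^-1` _ = setT); first exact: F_setT.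
  apply/seteqP; split=> // w _ /=; rewrite in_itv/= andbT (lt_le_trans x0)//.
  by rewrite fine_ge0// le_min (sT.1 w).
rewrite (_ : _ @^-1` _ = ~` [set w | (T w <= x%:E)%E]).
  by apply: F_setC => //; apply: (F_le x0 (ltW xt)); exact: sT.2.
apply/seteqP; split=> w /=; rewrite in_itv/= andbT -lte_fin -mf lt_min lte_fin xt andbT.
  by rewrite ltNge => /negP.
by move=> /negP; rewrite ltNge.
Qed.

(** On [T <= t] the value at [T] is that of the process stopped at [t], read at the [F t]-measurable
    time [min (T, t)]. *)
Lemma stopped_X T t (B : set (borel vec)) : stopping_time F T -> 0 <= t ->
  measurable B -> F t ([set w | (T w <= t%:E)%E] `&` [set w | B (X (fine (T w)) w)]).
Proof.
move=> sT t0 mB; pose Z u w := X (Num.min u t) w.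
have mZ u : 0 <= u -> measurable_fun setT (Z u : g_sigma_algebraType (F t) -> borel vec).
  by move=> u0; have [] := stop_measurable t0 u0.
have H := measurableT_comp (measurable_reg mZ)
  (measurable_fun_pair (measurable_min_stopping_time sT t0) (@measurable_id _ _ _)).
have : F t ((fun w => reg Z (fine (mine (T w) t%:E), w)) @^-1` B).
  by apply: measurable_sub => //; rewrite -[X in measurable X]setTI; exact: H.
move=> /(F_setI t0 (sT.2 _ t0)); congr (F t _); apply/seteqP; split=> w /= [Tt].
  rewrite min_l// reg_right ?fine_ge0 ?(sT.1 w)//; last first.
    by apply: (good_right (good_stop (vm_good vm w) t0)); rewrite fine_ge0 ?(sT.1 w).
  rewrite /Z min_l// -lee_fin fineK// ge0_fin_numE ?(sT.1 w)//.
  by rewrite (le_lt_trans Tt)// ltry.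
rewrite min_l// reg_right ?fine_ge0 ?(sT.1 w)//; last first.
  by apply: (good_right (good_stop (vm_good vm w) t0)); rewrite fine_ge0 ?(sT.1 w).
rewrite /Z min_l// -lee_fin fineK// ge0_fin_numE ?(sT.1 w)//.
by rewrite (le_lt_trans Tt)// ltry.
Qed.

Lemma stopping_timeD T s : stopping_time F T -> 0 <= s ->
  stopping_time F (fun w => T w + s%:E)%E.
Proof.
move=> sT s0; split=> [w|t t0]; first by rewrite adde_ge0 ?(sT.1 w)// lee_fin.
have [st|ts] := leP s t.
  have ts0 : 0 <= t - s by rewrite subr_ge0.
  rewrite (_ : [set _ | _] = [set w | (T w <= (t - s)%:E)%E]).
    by apply: (F_le ts0); [rewrite gerBl|exact: sT.2].
  by apply/seteqP; split=> w /=; rewrite EFinB leeBrDr.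
rewrite (_ : [set _ | _] = set0); first exact: F_set0.
apply/seteqP; split=> // w /=; apply/negP; rewrite -ltNge.
by apply: (@lt_le_trans _ _ s%:E); rewrite ?lte_fin// leeDr// (sT.1 w).
Qed.

Lemma stopping_time_fin T : stopping_time F T -> measurable [set w | (T w < +oo)%E].
Proof.
move=> sT; rewrite (_ : [set _ | _] = \bigcup_k [set w | (T w <= k%:R%:E)%E]).
  by apply: bigcupT_measurable => k; apply: (F_measurable (ler0n _ k)); exact: sT.2.
apply/seteqP; split=> w /=; last first.
  by move=> [k _] /= Tk; rewrite (le_lt_trans Tk)// ltry.
move=> Too; have Tf : T w = (fine (T w))%:E by rewrite fineK// ge0_fin_numE ?(sT.1 w).
exists (Num.truncn (fine (T w))).+1 => //=; rewrite Tf lee_fin.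
by apply: ltW; exact: truncnS_gt.
Qed.

(** An event known at [T] combined with one about the position at [T + s] is known at [T + s]. It
    feeds the induction on the times of a cylinder. *)
Lemma stopped_stepP T s A (B : set (borel vec)) : stopping_time F T -> 0 <= s ->
  stopped_sigma_algebra F T A -> measurable B ->
  stopped_sigma_algebra F (fun w => T w + s%:E)%E
    (A `&` [set w | (T w < +oo)%E] `&` [set w | B (X (fine (T w) + s) w)]).
Proof.
move=> sT s0 [mA FA] mB; have sTs := stopping_timeD sT s0.
have E1 w : (T w < +oo)%E -> fine (T w + s%:E)%E = fine (T w) + s.
  by move=> Too; rewrite fineD// ge0_fin_numE ?(sT.1 w).
have H t : 0 <= t -> F t ((A `&` [set w | (T w < +oo)%E] `&` [set w | B (X (fine (T w) + s) w)])
    `&` [set w | (T w + s%:E <= t%:E)%E]).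
  move=> t0; have [st|ts] := leP s t; last first.
    rewrite (_ : _ `&` [set w | (T w + s%:E <= t%:E)%E] = set0); first exact: F_set0.
    apply/seteqP; split=> // w /= [_]; apply/negP; rewrite -ltNge.
    by apply: (@lt_le_trans _ _ s%:E); rewrite ?lte_fin// leeDr// (sT.1 w).
  have ts0 : 0 <= t - s by rewrite subr_ge0.
  have F1 : F t (A `&` [set w | (T w <= (t - s)%:E)%E]).
    by apply: (F_le ts0); [rewrite gerBl|exact: FA].
  have F2 := stopped_X sTs t0 mB.
  have := F_setI t0 F1 F2; congr (F t _); apply/seteqP; split=> w /=.
    move=> [[Aw Tt] [Tst Bw]].
    have Too : (T w < +oo)%E by rewrite (le_lt_trans Tt)// ltry.
    by split=> //; split=> //; rewrite -E1.
  move=> [[[Aw Too] Bw] Tst]; split; first by split=> //; rewrite EFinB leeBrDr.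
  by split=> //; rewrite E1.
split; last exact: H.
rewrite (_ : _ `&` _ = \bigcup_k ((A `&` [set w | (T w < +oo)%E] `&`
    [set w | B (X (fine (T w) + s) w)]) `&` [set w | (T w + s%:E <= k%:R%:E)%E])).
  by apply: bigcupT_measurable => k; apply: (F_measurable (ler0n _ k)); exact: H.
rewrite -setI_bigcupr; apply/esym/setIidl => w [[_ /= Too] _].
have Tf : T w = (fine (T w))%:E by rewrite fineK// ge0_fin_numE ?(sT.1 w).
exists (Num.truncn (fine (T w) + s)).+1 => //=; rewrite Tf -EFinD lee_fin.
by apply: ltW; exact: truncnS_gt.
Qed.

End strong_markov.

Section strong_markov_paths.
Context {R : realType} {n : nat} {d : measure_display} {Omega : measurableType d}.
Local Notation vec := 'rV[R]_n.+1.
Variables (E : set vec) (F : R -> set (set Omega)) (X : R -> Omega -> vec)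
  (P : vec -> probability Omega R).
Hypotheses (mE : measurable (E : set (borel vec))) (vm : vmarkov E F X P).
Implicit Types (T : Omega -> \bar R) (A : set Omega) (s t : R).
Local Open Scope ereal_scope.

Let mst := measurable_state mE.

Lemma measurable_kernel_state t (B : set (borel vec)) : (0 <= t)%R -> measurable B ->
  measurable_fun (state E : set (borel vec)) (fun x : borel vec => P x (X t @^-1` B)).
Proof.
move=> t0 mB; apply/measurable_funU => //; first exact: measurable_set1_vec.
split; first exact: vm_kernel vm _ _ t0 mB.
exact: measurable_fun_set1.
Qed.

Definition law t (t0 : (0 <= t)%R) (x : vec) : {measure set (borel vec) -> \bar R} :=
  pushm (P x) (measurable_X vm t0).

(** Set to 0 outside the state space, where the kernel has no measurability, so that the result is
    measurable everywhere and can be iterated. *)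
Definition trans t (f : vec -> \bar R) (x : vec) : \bar R :=
  if x \in state E then \int[P x]_w f (X t w) else 0.

Lemma trans_ge0 t f x : (forall y, 0 <= f y) -> 0 <= trans t f x.
Proof.
by move=> f0; rewrite /trans; case: ifP => // _; exact: integral_ge0.
Qed.

Lemma transE t f x : state E x -> trans t f x = \int[P x]_w f (X t w).
Proof. by move=> Ex; rewrite /trans mem_set. Qed.

Lemma measurable_trans t (f : vec -> \bar R) : (0 <= t)%R ->
  measurable_fun setT (f : borel vec -> \bar R) -> (forall y, 0 <= f y) ->
  measurable_fun setT (trans t f : borel vec -> \bar R).
Proof.
move=> t0 mf f0.
have H : measurable_fun (state E : set (borel vec)) (fun x : borel vec => \int[law t0 x]_y f y).
  apply: measurable_integral_kernel => // B mB.
  exact: measurable_kernel_state.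
have := iffLR (measurable_restrictT _ mst) H; apply: eq_measurable_fun => x _.
rewrite patchE /trans; case: ifP => // _.
by rewrite ge0_integral_pushforward//; exact: measurable_X vm _ t0.
Qed.

Lemma measurable_X_stop T s : stopping_time F T -> (0 <= s)%R ->
  measurable_fun setT (fun w => X (fine (T w) + s)%R w : borel vec).
Proof.
move=> sT s0; apply: (measurable_X_at vm).
  apply: measurable_funD => //.
  apply: (measurableT_comp (@fine_measurable R setT measurableT)).
  exact: measurable_stopping_time vm _ sT.
by move=> w; rewrite addr_ge0// fine_ge0// (sT.1 w).
Qed.

Lemma measurable_stopped T A : stopping_time F T -> stopped_sigma_algebra F T A ->
  measurable (A `&` [set w | T w < +oo]).
Proof.
by move=> sT [mA _]; apply: measurableI => //; exact: stopping_time_fin vm _ sT.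
Qed.

Lemma strong_markov_fun T A s x (f : vec -> \bar R) : stopping_time F T ->
  stopped_sigma_algebra F T A -> (0 <= s)%R -> state E x ->
  measurable_fun setT (f : borel vec -> \bar R) -> (forall y, 0 <= f y) ->
  \int[P x]_(w in A `&` [set w | T w < +oo]) f (X (fine (T w) + s)%R w) =
  \int[P x]_(w in A `&` [set w | T w < +oo]) trans s f (X (fine (T w)) w).
Proof.
move=> sT FA s0 Ex mf f0.
have mD := measurable_stopped sT FA.
have mY := measurable_X_stop sT s0.
have mX : measurable_fun setT (fun w => X (fine (T w)) w : borel vec).
  apply: eq_measurable_fun (measurable_X_stop sT (lexx 0%R)) => w _.
  by rewrite addr0.
have XE w : state E (X (fine (T w)) w).
  by apply: vm_state vm _ _ _; rewrite fine_ge0// (sT.1 w).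
rewrite -[LHS](ge0_integral_mrestr (P x) mD (f := fun w => f (X (fine (T w) + s)%R w)))//; last first.
  exact: measurableT_comp mf mY.
transitivity (\int[pushm (mrestr (P x) mD) mY]_y f y).
  by rewrite ge0_integral_pushforward.
have [||_ ->] := @ge0_integral_mixture _ _ _ _ _ (P x) _
    (fun w => law s0 (X (fine (T w)) w)) (pushm (mrestr (P x) mD) mY) mD _ _ f mf f0.
- move=> B mB; apply: (@measurable_comp _ _ _ _ _ _ (state E : set (borel vec))
    (fun y : borel vec => P y (X s @^-1` B))) => //.
  + by move=> _ [w _ <-].
  + exact: measurable_kernel_state.
  + exact: measurable_funTS.
- move=> B mB; rewrite /pushm /= /pushforward /mrestr setIC.
  exact: (vm_strong vm sT Ex s0 FA mB).
- apply: eq_integral => w _; rewrite transE//.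
  by rewrite ge0_integral_pushforward//; exact: measurable_X vm _ s0.
Qed.

(** The iterated integral of finite-dimensional laws: the probability of passing the windows of [l]
    for a process that sits at the argument at time [t]. *)
Fixpoint cyl_trans t (l : seq (R * set vec)) : vec -> \bar R :=
  if l is (t1, B) :: l' then
    trans (t1 - t) (fun y => (\1_B y)%:E * cyl_trans t1 l' y)
  else cst 1.

Lemma cyl_trans_ge0 t l y : 0 <= cyl_trans t l y.
Proof.
elim: l t y => [//|[t1 B] l IH] t y; rewrite /= trans_ge0// => z.
by rewrite mule_ge0// lee_fin.
Qed.

Lemma cyl_wf_cons t B l : cyl_wf ((t, B) :: l) ->
  [/\ (0 <= t)%R, measurable (B : set (borel vec)) & cyl_wf l].
Proof.
move=> wl; have [t0 mB] := wl _ (mem_head _ _); split => //.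
by move=> x xl; apply: wl; rewrite inE xl orbT.
Qed.

Lemma measurable_cyl_trans t l : cyl_wf l -> path <=%R t (map fst l) ->
  measurable_fun setT (cyl_trans t l : borel vec -> \bar R).
Proof.
elim: l t => [//|[t1 B] l IH] t /cyl_wf_cons[_ mB wl] /= /andP[tt1 pl].
apply: measurable_trans; first by rewrite subr_ge0.
  apply: emeasurable_funM; last exact: IH.
  by apply/measurable_EFinP; exact: measurable_indic.
by move=> y; rewrite mule_ge0 ?lee_fin// cyl_trans_ge0.
Qed.

(** Induction on the windows: the first one is absorbed into the event [A] and the stopping time
    moves on to [T + (t1 - t)]. The induction hypothesis leaves a function of the position there, to
    which the one-time strong Markov property applies. *)
Lemma strong_markov_cyl l t T A x : cyl_wf l -> path <=%R t (map fst l) ->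
  stopping_time F T -> stopped_sigma_algebra F T A -> state E x ->
  P x (A `&` [set w | T w < +oo] `&`
    [set w | cyl l (fun u => X (fine (T w) + (u - t))%R w)]) =
  \int[P x]_(w in A `&` [set w | T w < +oo]) cyl_trans t l (X (fine (T w)) w).
Proof.
elim: l t T A => [|[t1 B] l IH] t T A.
  move=> _ _ sT FA Ex /=; rewrite integral_cst ?mul1e; last exact: measurable_stopped.
  congr (P x _); rewrite (_ : [set w | cyl [::] _] = setT) ?setIT//.
  by apply/seteqP; split=> // w _; rewrite /= cyl_nil.
move=> /cyl_wf_cons[_ mB wl] /= /andP[tt1 pl] sT FA Ex.
have s0 : (0 <= t1 - t)%R by rewrite subr_ge0.
have FA' := stopped_stepP vm sT s0 FA mB.
have sT' := stopping_timeD vm sT s0.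
have fE w : T w < +oo -> fine (T w + (t1 - t)%:E) = (fine (T w) + (t1 - t))%R.
  by move=> Too; rewrite fineD// ge0_fin_numE// (sT.1 w).
have := IH t1 _ _ wl pl sT' FA' Ex.
have DE : A `&` [set w | T w < +oo] `&` [set w | B (X (fine (T w) + (t1 - t))%R w)]
    `&` [set w | T w + (t1 - t)%:E < +oo] =
    A `&` [set w | T w < +oo] `&` [set w | B (X (fine (T w) + (t1 - t))%R w)].
  apply/setIidl => w [[_ /= Too] _].
  by rewrite lte_add_pinfty// ltry.
rewrite DE; set C := [set w | cyl l _]; move=> H.
have -> : A `&` [set w | T w < +oo] `&`
    [set w | cyl ((t1, B) :: l) (fun u => X (fine (T w) + (u - t))%R w)] =
    A `&` [set w | T w < +oo] `&` [set w | B (X (fine (T w) + (t1 - t))%R w)] `&` C.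
  apply/seteqP; split=> w; rewrite cyl_cons /C /=.
    move=> [[Aw Too] [Bw Cw]]; split; first by split.
    rewrite fE//; move: Cw; congr (cyl l _); apply/funext => u.
    by congr (X _ w); lra.
  move=> [[[Aw Too] Bw] Cw]; split; first by split.
  split => //; move: Cw; rewrite fE//; congr (cyl l _); apply/funext => u.
  by congr (X _ w); lra.
rewrite H -(strong_markov_fun sT FA s0 Ex)//; last 2 first.
- apply: emeasurable_funM; last exact: measurable_cyl_trans.
  by apply/measurable_EFinP; exact: measurable_indic.
- by move=> y; rewrite mule_ge0 ?lee_fin// cyl_trans_ge0.
rewrite integral_mkcondr; apply: eq_integral => w; rewrite inE => -[_ /= Too].
rewrite patchE indicE fE//.
have -> : (w \in [set w0 | B (X (fine (T w0) + (t1 - t))%R w0)]) =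
  (X (fine (T w) + (t1 - t))%R w \in B) by apply/idP/idP; rewrite !inE.
by case: ifP => _; rewrite ?mul1e ?mul0e.
Qed.

Lemma stopping_time0 : stopping_time F (cst 0).
Proof.
split=> // t t0; rewrite (_ : [set _ | _] = setT); first exact: F_setT vm _ t0.
by apply/seteqP; split=> // w _ /=; rewrite lee_fin.
Qed.

Lemma stopped_setT T : stopping_time F T -> stopped_sigma_algebra F T setT.
Proof. by move=> sT; split => // t t0; rewrite setTI; exact: sT.2. Qed.

Lemma integral_start x (f : vec -> \bar R) : state E x ->
  measurable_fun setT (f : borel vec -> \bar R) -> (forall y, 0 <= f y) ->
  \int[P x]_w f (X 0 w) = f x.
Proof.
move=> Ex mf f0; have mX0 := measurable_X vm (lexx 0%R).
transitivity (\int[P x]_w f x); last first.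
  transitivity (f x * P x setT); first exact: integral_cst.
  by rewrite probability_setT mule1.
apply: ge0_ae_eq_integral => //.
- exact: measurableT_comp mf mX0.
- have mS : measurable [set w | X 0 w = x].
    have -> : [set w | X 0 w = x] = X 0 @^-1` [set x] by [].
    by rewrite -[X in measurable X]setTI; apply: mX0 => //; exact: measurable_set1_vec.
  exists (~` [set w | X 0 w = x]); split; first exact: measurableC.
    apply: etrans (probability_setC (P x) mS) _.
    by rewrite (vm_start vm Ex) subee.
  by apply: subsetC => w /= ->.
Qed.

Lemma cyl_law l x : cyl_wf l -> path <=%R 0%R (map fst l) -> state E x ->
  P x [set w | cyl l (X ^~ w)] = cyl_trans 0 l x.
Proof.
move=> wl pl Ex.
have := strong_markov_cyl wl pl stopping_time0 (stopped_setT stopping_time0) Ex.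
rewrite setTI (_ : [set w | cst 0 w < +oo] = setT); last first.
  by apply/seteqP; split=> // w _ /=; rewrite ltry.
rewrite setTI integral_start//; last 2 first.
- exact: measurable_cyl_trans.
- exact: cyl_trans_ge0.
move=> <-; congr (P x _); apply/seteqP; split=> w /=; congr (cyl l _);
  by apply/funext => u; rewrite subr0 add0r.
Qed.

Lemma measurable_kernel_path (C : set path_space) : measurable C ->
  measurable_fun (state E : set (borel vec)) (fun x : borel vec => P x [set w | C (X ^~ w)]).
Proof.
have mS (S : set path_space) : measurable S -> measurable [set w | S (X ^~ w)].
  move=> mS; rewrite -[X in measurable X]setTI.
  exact: (measurable_X_path vm measurableT mS).
move=> mC; have : <<s @cyl_gen R n >> C by rewrite -measurable_cyl_gen.
apply: (@dynkin_induction _ (@path_space R n) cyl_gen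
  (fun C => measurable_fun (state E : set (borel vec)) (fun x : borel vec => P x [set w | C (X ^~ w)]))
  (@measurable_cyl_gen R n) (@cyl_gen_setI R n)).
- rewrite (_ : (fun _ => _) = cst 1)//; apply/funext => x.
  by rewrite (_ : [set w | _] = setT) ?probability_setT//; apply/seteqP; split.
- move=> _ [l wl <-]; pose r := fun x y : R * set vec => (x.1 <= y.1)%R.
  have wl' : cyl_wf (sort r l) by move=> x; rewrite mem_sort; exact: wl.
  have pl' : path <=%R 0%R (map fst (sort r l)).
    rewrite path_sortedE; last by move=> x y z; exact: le_trans.
    apply/andP; split.
      by apply/allP => _ /mapP[x xl ->]; have [] := wl' x xl.
    by rewrite sorted_map; apply: sort_sorted => x y; exact: le_total.
  apply: (@eq_measurable_fun _ _ (borel vec) (\bar R) _ (cyl_trans 0 (sort r l))).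
    by move=> x; rewrite inE => Ex; rewrite -cyl_law// cyl_sort.
  by apply: measurable_funTS; exact: measurable_cyl_trans.
- move=> S S1 mPS; apply: (eq_measurable_fun (fun x : borel vec => 1 - P x [set w | S (X ^~ w)])).
    by move=> x _; rewrite -probability_setC//; exact: mS.
  by apply: emeasurable_funB.
- move=> S mSk tS H.
  apply: (eq_measurable_fun (fun x : borel vec => \sum_(0 <= k <oo) P x [set w | S k (X ^~ w)])).
    move=> x _; apply/cvg_lim => //.
    rewrite (_ : [set w | _] = \bigcup_k [set w | S k (X ^~ w)]); last first.
      by apply/seteqP; split=> w [k]; exists k.
    apply: measure_semi_sigma_additive.
    + by move=> k; exact: mS.
    + apply/trivIsetP => i j _ _ ij; apply/seteqP; split=> // w [/= Si Sj].
      have SS : (S i `&` S j) (X ^~ w) by [].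
      by move/trivIsetP : tS => /(_ i j I I ij) S0; rewrite S0 in SS.
    + by apply: bigcupT_measurable => k; exact: mS.
  by apply: ge0_emeasurable_sum => // k x _ _; exact: measure_ge0.
Qed.

(** As functions of [C] both sides are finite measures, and they agree on cylinders. Events on whole
    paths are needed because a time-changed future depends on all of the future. *)
Lemma strong_markov_path T A x (C : set path_space) : stopping_time F T ->
  stopped_sigma_algebra F T A -> state E x -> measurable C ->
  P x (A `&` [set w | T w < +oo] `&` [set w | C (fun u => X (fine (T w) + u)%R w)]) =
  \int[P x]_(w in A `&` [set w | T w < +oo]) P (X (fine (T w)) w) [set w' | C (X ^~ w')].
Proof.
move=> sT FA Ex; have mD := measurable_stopped sT FA.
have mX : measurable_fun setT (fun w => X (fine (T w)) w : borel vec).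
  apply: eq_measurable_fun (measurable_X_stop sT (lexx 0%R)) => w _.
  by rewrite addr0.
have XE w : state E (X (fine (T w)) w).
  by apply: vm_state vm _ _ _; rewrite fine_ge0// (sT.1 w).
have mS : measurable_fun setT (fun w => (fun u => X (fine (T w) + u)%R w) : path_space).
  by apply: measurable_paths => u u0; exact: measurable_X_stop.
have mk (B : set path_space) : measurable B -> measurable_fun (A `&` [set w | T w < +oo])
    (fun w => pushm (P (X (fine (T w)) w)) (measurable_X_path vm) B).
  move=> mB; apply: (@measurable_comp _ _ _ _ _ _ (state E : set (borel vec))
    (fun y : borel vec => P y [set w' | B (X ^~ w')])) => //.
  + by move=> _ [w _ <-].
  + exact: measurable_kernel_path.
  + exact: measurable_funTS.
have E1 (B : set path_space) : pushm (mrestr (P x) mD) mS B =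
  P x (A `&` [set w | T w < +oo] `&` [set w | B (fun u => X (fine (T w) + u)%R w)]).
  by rewrite /pushm /= /pushforward /mrestr setIC.
move=> mC; rewrite -E1.
apply: (path_measure_unique (m2 := mixm (P x) mD mk)) => //.
  rewrite [X in X < _]E1; apply: (@le_lt_trans _ _ 1); last exact: ltry.
  apply: probability_le1; apply: measurableI => //.
  rewrite (_ : [set w | _] = setT)//; exact: measurableT.
move=> l wl sl; rewrite E1.
have pl : path <=%R 0%R (map fst l).
  rewrite path_sortedE; last by move=> a b c; exact: le_trans.
  by rewrite sl andbT; apply/allP => _ /mapP[y yl ->]; have [] := wl y yl.
have := strong_markov_cyl wl pl sT FA Ex; rewrite (_ : [set w | cyl l _] =
    [set w | cyl l (fun u => X (fine (T w) + u)%R w)]); last first.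
  apply/seteqP; split=> w /=; congr (cyl l _);
    by apply/funext => u; rewrite subr0.
move=> ->; apply: eq_integral => w _.
by rewrite /pushm /= /pushforward -cyl_law.
Qed.

End strong_markov_paths.

(** * Stopping times for a right-continuous filtration *)

Section filtrations.
Context {R : realType} {n : nat} {d : measure_display} {Omega : measurableType d}.
Local Notation vec := 'rV[R]_n.+1.
Variables (E : set vec) (F : R -> set (set Omega)) (X : R -> Omega -> vec)
  (P : vec -> probability Omega R).
Hypothesis vm : vmarkov E F X P.
Implicit Types (S T : Omega -> \bar R) (A : set Omega) (s t u : R).
Local Open Scope ereal_scope.

Lemma right_continuousF t A : (0 <= t)%R -> (forall s, (t < s)%R -> F s A) -> F t A.
Proof.
by move=> t0 FA; apply: filtration_right_continuous (vm_filtration vm) _ t0 _ _ => s /FA.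
Qed.

(** The event [T < s] is the union over rationals [q < s] of the events [T <= q]. *)
Lemma le_setI_lt T A s : (0 < s)%R -> (forall w, 0 <= T w) ->
  (forall t, (0 <= t)%R -> F t (A `&` [set w | T w <= t%:E])) ->
  F s (A `&` [set w | T w < s%:E]).
Proof.
move=> s0 T0 FA.
rewrite (_ : A `&` [set w | T w < s%:E] = \bigcup_j (if ((0 : R) <= enum_rat j < s)%R
  then A `&` [set w | T w <= ((enum_rat j : R))%:E] else set0)).
  apply: (F_bigcup vm (ltW s0)) => j; case: ifPn => [/andP[j0 js]|_].
    by apply: (F_le vm j0 (ltW js)); exact: FA.
  exact: F_set0 vm _ (ltW s0).
apply/seteqP; split=> w /=.
  move=> [Aw Ts]; have Tf : T w = (fine (T w))%:E.
    by rewrite fineK// ge0_fin_numE// (lt_trans Ts)// ltry.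
  move: Ts; rewrite Tf lte_fin => /enum_rat_itv[j /andP[Tj js]].
  exists j => //; rewrite js (ltW (le_lt_trans _ Tj)) ?fine_ge0//=; split => //.
  by rewrite Tf lee_fin ltW.
move=> [j _]; case: ifPn => // /andP[j0 js] [Aw Tj]; split => //.
by rewrite (le_lt_trans Tj)// lte_fin.
Qed.

(** The converse uses right continuity of the filtration: [T <= t] is the intersection of the events
    [T < e] for [e] decreasing to [t], all known at any [s > t]. *)
Lemma lt_setI_le T A t : (0 <= t)%R ->
  (forall s, (0 < s)%R -> F s (A `&` [set w | T w < s%:E])) ->
  F t (A `&` [set w | T w <= t%:E]).
Proof.
move=> t0 FA; apply: right_continuousF => // s ts.
have s0 : (0 <= s)%R := ltW (le_lt_trans t0 ts).
(* A sequence decreasing to [t] inside []t, s]], so that all the events [T < e k] lie in [F s]. *)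
pose e k : R := (t + (s - t) / k.+1%:R)%R.
have st0 : (0 < s - t)%R by rewrite subr_gt0.
have te k : (t < e k)%R by rewrite ltrDl divr_gt0.
have es k : (e k <= s)%R.
  rewrite -lerBrDl ler_pdivrMr// ler_peMr ?(ltW st0)//.
  by rewrite (ler_nat R 1).
rewrite (_ : _ `&` _ = ~` \bigcup_k ~` (A `&` [set w | T w < (e k)%:E])).
  apply: (F_setC vm s0); apply: (F_bigcup vm s0) => k; apply: (F_setC vm s0).
  have e0 := le_lt_trans t0 (te k).
  by apply: (F_le vm (ltW e0) (es k)); exact: FA.
rewrite setC_bigcup; under eq_bigcapr do rewrite setCK.
apply/seteqP; split=> w.
  by move=> [Aw Tt] k _; split => //=; rewrite (le_lt_trans Tt)// lte_fin.
move=> H; split; first by have [] := H 0%N I.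
rewrite /= leNgt; apply/negP => tT.
have [u tu uT] : exists2 u, (t < u)%R & u%:E <= T w.
  case: (T w) tT => [r|_|//]; first by rewrite lte_fin => tr; exists r.
  by exists (t + 1)%R; rewrite ?leey// ltrDl.
have [k ke] : exists k, (e k < u)%R.
  exists (Num.truncn ((s - t) / (u - t))) ; rewrite -ltrBrDl ltr_pdivrMr//.
  by rewrite mulrC -ltr_pdivrMr ?subr_gt0//; exact: truncnS_gt.
have [_ /= ] := H k I; apply/negP; rewrite -leNgt (le_trans _ uT)// lee_fin.
exact: ltW.
Qed.

Lemma stopping_time_lt T : (forall w, 0 <= T w) ->
  (forall s, (0 < s)%R -> F s [set w | T w < s%:E]) -> stopping_time F T.
Proof.
move=> T0 FT; split => // t t0; rewrite -[X in F _ X]setTI; apply: lt_setI_le => // s s0.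
by rewrite setTI; exact: FT.
Qed.

Lemma stopped_sigma_algebra_lt T A s : (0 < s)%R -> stopping_time F T ->
  stopped_sigma_algebra F T A -> F s (A `&` [set w | T w < s%:E]).
Proof. by move=> s0 [T0 _] [_ FA]; exact: le_setI_lt. Qed.

Lemma le_stopped_sigma_algebra S T A : stopping_time F T -> (forall w, S w <= T w) ->
  stopped_sigma_algebra F S A -> stopped_sigma_algebra F T A.
Proof.
move=> [_ FT] ST [mA FA]; split => // t t0.
rewrite (_ : _ `&` _ = (A `&` [set w | S w <= t%:E]) `&` [set w | T w <= t%:E]).
  by apply: (F_setI vm t0); [exact: FA|exact: FT].
apply/seteqP; split=> w /=; last by move=> [[]].
by move=> [Aw Tt]; split => //; split => //; exact: le_trans (ST w) Tt.
Qed.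

Lemma sigma_algebra_stopped T : stopping_time F T ->
  sigma_algebra setT (stopped_sigma_algebra F T).
Proof.
move=> sT; split.
- by split=> // t t0; rewrite set0I; exact: F_set0 vm _ t0.
- move=> A [mA FA]; rewrite setTD; split; first exact: measurableC.
  move=> t t0; rewrite (_ : _ `&` _ = [set w | T w <= t%:E] `&` ~` (A `&` [set w | T w <= t%:E])).
    apply: (F_setI vm t0); first exact: sT.2.
    by apply: (F_setC vm t0); exact: FA.
  apply/seteqP; split=> w /=; first by move=> [Aw Tt]; split => // -[].
  by move=> [Tt H]; split => // Aw; apply: H.
- move=> A FA; split; first by apply: bigcupT_measurable => k; have [] := FA k.
  by move=> t t0; rewrite setI_bigcupl; apply: (F_bigcup vm t0) => k; have [_] := FA k; exact.
Qed.

Lemma complete_stopped T (N : set Omega) : stopping_time F T -> F 0%R N ->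
  stopped_sigma_algebra F T N.
Proof.
move=> sT FN; split; first exact: (F_measurable vm (lexx 0%R) FN).
by move=> t t0; apply: (F_setI vm t0); [exact: (F_le vm (lexx 0%R))|exact: sT.2].
Qed.

Lemma stopping_time_sup (Tn : nat -> Omega -> \bar R) :
  (forall k, stopping_time F (Tn k)) ->
  stopping_time F (fun w => ereal_sup (range (Tn ^~ w))).
Proof.
move=> sT; split=> [w|t t0].
  by apply: le_trans ((sT 0%N).1 w) _; apply: ereal_sup_ubound; exists 0%N.
rewrite (_ : [set _ | _] = ~` \bigcup_k ~` [set w | Tn k w <= t%:E]).
  apply: (F_setC vm t0); apply: (F_bigcup vm t0) => k; apply: (F_setC vm t0).
  exact: (sT k).2.
rewrite setC_bigcup; under eq_bigcapr do rewrite setCK.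
apply/seteqP; split=> w /= H; first last.
  by apply: ge_ereal_sup => _ [k _ <-]; exact: H.
by move=> k _; apply: le_trans H; apply: ereal_sup_ubound; exists k.
Qed.

End filtrations.

(** A nonnegative function has integral 0 exactly when it vanishes almost everywhere, so only its
    zero set matters. This is how a positive weight preserves the reference measure. *)
Lemma ge0_integral_eq0 {R : realType} d (T : measurableType d)
    (mu : {measure set T -> \bar R}) (D : set T) (f g : T -> \bar R) :
  measurable D -> measurable_fun D f -> measurable_fun D g ->
  (forall x, D x -> 0 <= f x)%E -> (forall x, D x -> 0 <= g x)%E ->
  (forall x, D x -> f x = 0%E <-> g x = 0%E) ->
  (\int[mu]_(x in D) f x = 0)%E <-> (\int[mu]_(x in D) g x = 0)%E.
Proof.
move=> mD mf mg f0 g0 fg.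
have H (h : T -> \bar R) : measurable_fun D h -> (forall x, D x -> 0 <= h x)%E ->
    (\int[mu]_(x in D) h x = 0)%E <-> ae_eq mu D h (cst 0%E).
  move=> mh h0; have := ae_eq_integral_abs mu mD mh.
  rewrite (_ : (\int[mu]_(x in D) `|h x|)%E = (\int[mu]_(x in D) h x)%E)//.
  by apply: eq_integral => x; rewrite inE => Dx; rewrite gee0_abs// h0.
rewrite H// H//; split; apply: filterS => x xD Dx; by apply/fg => //; exact: xD.
Qed.

(** * The time change of a Markov process is a Markov process *)

Section time_change.
Context {R : realType} {n : nat} {d : measure_display} {Omega : measurableType d}.
Local Notation vec := 'rV[R]_n.+1.
Local Notation mu := (@lebesgue_measure R).
Variables (E : set vec) (F : R -> set (set Omega)) (X : R -> Omega -> vec)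
  (P : vec -> probability Omega R) (b : R).
Hypotheses (E0 : ~ E 0) (mE : measurable (E : set (borel vec))) (vm : vmarkov E F X P).
Implicit Types (S T : Omega -> \bar R) (A : set Omega) (s t u : R).
Local Open Scope ereal_scope.

Let gw w : good (X ^~ w) := vm_good vm w.

Definition tcX t w : vec := tc b (X ^~ w) t.

(* The time of [X] which corresponds to the time [t] of [tcX]. *)
Definition gtime t w : \bar R :=
  if t%:E < total b (X ^~ w) then (gam b (X ^~ w) t)%:E else +oo.

Lemma gtimeP t w : (0 <= t)%R -> t%:E < total b (X ^~ w) ->
  exists s, [/\ (0 <= s)%R, X s w != 0%R, clk b (X ^~ w) s = t%:E,
    gtime t w = s%:E & tcX t w = X s w].
Proof.
move=> t0 tt; have [s [s0 xs st ts]] := tc_alive (gw w) t0 tt; exists s; split => //.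
by rewrite /gtime tt (gam_clk (gw w) s0 xs st).
Qed.

Lemma gtime_ge0 t w : (0 <= t)%R -> 0 <= gtime t w.
Proof.
move=> t0; have [tt|tt] := ltP t%:E (total b (X ^~ w)).
  by have [s [s0 _ _ -> _]] := gtimeP t0 tt; rewrite lee_fin.
by rewrite /gtime ltNge tt leey.
Qed.

Lemma gtime_lty t w : (gtime t w < +oo) = (t%:E < total b (X ^~ w)).
Proof. by rewrite /gtime; case: ifP => _; rewrite ?ltry ?ltxx. Qed.

Lemma tcX_gtime t w : (0 <= t)%R -> gtime t w < +oo ->
  tcX t w = X (fine (gtime t w)) w.
Proof.
by move=> t0; rewrite gtime_lty => /(gtimeP t0)[s [_ _ _ -> ->]].
Qed.

(** Expresses a statement about the inverse clock by the clock itself at rational times before [u],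
    hence by events known before [u]. *)
Lemma gtime_ltP t u w : (0 <= t)%R -> gtime t w < u%:E <->
  exists j, [/\ (0 <= (enum_rat j : R) < u)%R, X (enum_rat j) w != 0%R &
    t%:E < clk b (X ^~ w) (enum_rat j)].
Proof.
move=> t0; split.
  move=> tu; have : gtime t w < +oo by rewrite (lt_trans tu)// ltry.
  rewrite gtime_lty => /(gtimeP t0)[s [s0 xs st tE _]].
  move: tu; rewrite tE lte_fin => su.
  have [s' /andP[ss' s'u] xs'] := alive_right (gw w) s0 xs su.
  have [j /andP[sj js']] := enum_rat_itv ss'; exists j.
  have j0 : (0 <= (enum_rat j : R))%R := le_trans s0 (ltW sj).
  have xj := alive_le (gw w) j0 (ltW js') xs'.
  by split => //; [rewrite j0 (lt_trans js')|rewrite -st ltr_clk].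
move=> [j [/andP[j0 ju] xj tj]].
have [s /andP[s0 sj] st] := clk_onto (gw w) j0 xj t0 (ltW tj).
have xs := alive_le (gw w) s0 sj xj.
have tt : t%:E < total b (X ^~ w) by rewrite -st clk_le_total.
rewrite /gtime tt (gam_clk (gw w) s0 xs st) lte_fin.
by apply: lt_trans ju; move: tj; rewrite -st ltr_clk.
Qed.

Lemma le_gtime s t w : (0 <= s)%R -> (s <= t)%R -> gtime s w <= gtime t w.
Proof.
move=> s0 st; have t0 := le_trans s0 st; rewrite leNgt; apply/negP => ts.
have : gtime t w < +oo by rewrite (lt_le_trans ts)// leey.
rewrite gtime_lty => /(gtimeP t0)[u [u0 _ _ tE _]].
move: ts; rewrite tE => ts.
have tl : gtime t w < (gtime s w) by rewrite tE.
have : exists2 u' : R, gtime t w < u'%:E & u'%:E <= gtime s w.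
  rewrite tE; case: (gtime s w) ts => [r|_|//]; first by exists r.
  by exists (u + 1)%R; rewrite ?leey// lte_fin ltrDl.
move=> [u' tu' u's]; have [j [ju xj tj]] := (gtime_ltP _ _ t0).1 tu'.
have : gtime s w < u'%:E.
  by apply/(gtime_ltP _ _ s0); exists j; split => //; apply: le_lt_trans tj; rewrite lee_fin.
by rewrite ltNge u's.
Qed.

(** Right continuity of [t -> gtime t]: a clock that exceeds [t] at some time also exceeds a
    slightly larger rational. It yields the right continuity of the time-changed filtration. *)
Lemma gtime_right t u w : (0 <= t)%R -> gtime t w < u%:E <->
  exists2 j, (t < (enum_rat j : R))%R & gtime (enum_rat j) w < u%:E.
Proof.
move=> t0; split.
  move=> /(gtime_ltP _ _ t0)[j [ju xj tj]].
  have cf : clk b (X ^~ w) (enum_rat j) \is a fin_num.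
    by apply: clk_fin => //; have /andP[] := ju.
  have : (t < fine (clk b (X ^~ w) (enum_rat j)))%R by rewrite -lte_fin fineK.
  move=> /enum_rat_itv[i /andP[ti ij]]; exists i => //.
  apply/gtime_ltP; first by rewrite (le_trans t0)// ltW.
  by exists j; split => //; rewrite -(fineK cf) lte_fin.
by move=> [j tj]; apply: le_lt_trans; apply: le_gtime => //; exact: ltW.
Qed.

(** Up to time [q] the clock only sees the process stopped at [q], which lives on the sigma-algebra
    [F q]; the general measurability of the clock is applied there. *)
Lemma F_clk_alive t q : (0 <= q)%R ->
  F q ([set w | X q w != 0%R] `&` [set w | t%:E < clk b (X ^~ w) q]).
Proof.
move=> q0; apply: (F_setI vm q0).
  rewrite (_ : [set w | _] = ~` (X q @^-1` [set 0%R])); last first.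
    by apply/seteqP; split=> w /= /eqP.
  by apply: (F_setC vm q0); apply: (vm_adapted vm q0); exact: measurable_set1_vec.
apply: (measurable_sub vm q0); pose Z u w := X (Num.min u q) w.
have mZ u : (0 <= u)%R -> measurable_fun setT (Z u : g_sigma_algebraType (F q) -> borel vec).
  by move=> u0; have [] := stop_measurable vm q0 u0.
have gZ w : good (Z ^~ w) by exact: (good_stop (gw w) q0).
have -> : [set w | t%:E < clk b (X ^~ w) q] = [set w | t%:E < clk b (Z ^~ w) q].
  apply/seteqP; split=> w /=; suff -> : clk b (X ^~ w) q = clk b (Z ^~ w) q by [].
    apply: eq_integral => u; rewrite inE/= in_itv/= => /andP[_ uq].
    by rewrite /Z min_l.
  apply: eq_integral => u; rewrite inE/= in_itv/= => /andP[_ uq].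
  by rewrite /Z min_l.
have := measurable_clk mZ b q gZ; rewrite -[X in measurable X]setTI => mc.
exact: (emeasurable_fun_o_infty measurableT mc).
Qed.

Lemma F_gtime t u : (0 <= t)%R -> (0 < u)%R -> F u [set w | gtime t w < u%:E].
Proof.
move=> t0 u0; rewrite (_ : [set _ | _] = \bigcup_j (if (0 <= (enum_rat j : R) < u)%R then
  [set w | X (enum_rat j) w != 0%R] `&` [set w | t%:E < clk b (X ^~ w) (enum_rat j)]
  else set0)).
  apply: (F_bigcup vm (ltW u0)) => j; case: ifPn => [/andP[j0 ju]|_].
    by apply: (F_le vm j0 (ltW ju)); exact: F_clk_alive.
  exact: F_set0 vm _ (ltW u0).
apply/seteqP; split=> w /=.
  by move=> /(gtime_ltP _ _ t0)[j [ju xj tj]]; exists j => //; rewrite ju.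
move=> [j _]; case: ifPn => // ju [xj tj]; apply/gtime_ltP => //.
by exists j.
Qed.

Lemma stopping_gtime t : (0 <= t)%R -> stopping_time F (gtime t).
Proof.
move=> t0; apply: (stopping_time_lt vm) => [w|s s0]; first exact: gtime_ge0.
exact: F_gtime.
Qed.

(** What is known of [X] at the random time that corresponds to [t]; it is larger than the
    filtration generated by [tcX], and stopping times of [G] translate into stopping times of
    [F]. *)
Definition G t : set (set Omega) := stopped_sigma_algebra F (gtime t).

Lemma usual_filtration_G : usual_filtration E G (absorb_law P).
Proof.
split.
- by move=> t t0; apply: (sigma_algebra_stopped vm); exact: stopping_gtime.
- by move=> t t0 A [].
- move=> s t s0 st A; apply: (le_stopped_sigma_algebra vm).
    exact: stopping_gtime (le_trans s0 st).
  by move=> w; exact: le_gtime.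
- move=> t t0 A GA; have [mA _] : G (t + 1) A by apply: GA; rewrite /= ltrDl.
  split => // u u0; apply: (lt_setI_le vm) => // s s0.
  rewrite (_ : _ `&` _ = \bigcup_j (if (t < (enum_rat j : R))%R then
      A `&` [set w | gtime (enum_rat j) w < s%:E] else set0)).
    apply: (F_bigcup vm (ltW s0)) => j; case: ifPn => [tj|_]; last exact: F_set0 vm _ (ltW s0).
    apply: (stopped_sigma_algebra_lt vm s0); last exact: GA.
    by apply: stopping_gtime; rewrite (le_trans t0)// ltW.
  apply/seteqP; split=> w /=.
    by move=> [Aw /(gtime_right _ _ t0)[j tj js]]; exists j => //; rewrite tj.
  move=> [j _]; case: ifPn => // tj [Aw js]; split => //.
  by apply/gtime_right => //; exists j.
- move=> N /(filtration_complete (vm_filtration vm)) FN.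
  exact: (complete_stopped vm (stopping_gtime (lexx _))).
Qed.

Lemma measurable_tcX t : (0 <= t)%R -> measurable_fun setT (tcX t : Omega -> borel vec).
Proof.
move=> t0; apply: (@eq_measurable_fun _ _ Omega (borel vec) _ (tc_reg X b t)).
  by move=> w _; rewrite tc_regE.
by apply: measurable_tc_reg; exact: measurable_X vm.
Qed.

Lemma adapted_tcX t (B : set (borel vec)) : (0 <= t)%R -> measurable B ->
  G t (tcX t @^-1` B).
Proof.
move=> t0 mB; split; first by rewrite -[X in measurable X]setTI; exact: measurable_tcX.
move=> u u0; have := stopped_X vm (stopping_gtime t0) u0 mB; congr (F u _).
apply/seteqP; split=> w /= [].
  move=> tu Bw; split => //; rewrite tcX_gtime//.
  by rewrite (le_lt_trans tu)// ltry.
by move=> Bw tu; split => //; rewrite -tcX_gtime// (le_lt_trans tu)// ltry.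
Qed.

Lemma tcX0 w : tcX 0 w = X 0 w.
Proof.
have [x0|x0] := eqVneq (X 0%R w) 0%R; last by rewrite /tcX (tcE (gw w) (lexx _) x0)// clk0.
rewrite x0; apply/eqP; apply: contraT; rewrite (tc_neq0 b (gw w) (lexx _)).
move=> /(tc_alive (gw w) (lexx _))[s [s0 /eqP xs _ _]].
by case: xs; exact: (good_absorbed (gw w) (lexx _) s0).
Qed.

Lemma state_tcX t w : (0 <= t)%R -> state E (tcX t w).
Proof.
move=> t0; have [tt|tt] := ltP t%:E (total b (X ^~ w)).
  by have [s [s0 _ _ _ ->]] := gtimeP t0 tt; exact: (vm_state vm).
by rewrite /tcX tc_dead//; right.
Qed.

Lemma left_tcX t w : (0 < t)%R -> tcX t w != 0%R ->
  exists2 v : vec, E v & tcX s w @[s --> t^'-] --> v.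
Proof.
move=> t0; rewrite (tc_neq0 _ (gw w) (ltW t0)) => tt.
have [s [s0 xs st _ _]] := gtimeP (ltW t0) tt.
have [v Ev xv] := vm_left vm (clk_gt0 t0 s0 st) xs; exists v => //.
exact: (tc_left (gw w) s0 xs st xv t0).
Qed.

Lemma kernel_tcX t (B : set (borel vec)) : (0 <= t)%R -> measurable B ->
  measurable_fun (state E : set (borel vec)) (fun x : borel vec => P x (tcX t @^-1` B)).
Proof.
move=> t0 mB.
apply: (@eq_measurable_fun _ _ (borel vec) (\bar R) _
    (fun x => P x [set w | B (tc_path b t (X ^~ w))])).
  move=> x _; congr (P x _); apply/seteqP; split=> w /=.
    by rewrite tc_pathE.
  by rewrite tc_pathE.
apply: (measurable_kernel_path mE vm (C := tc_path b t @^-1` B)).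
by rewrite -[X in measurable X]setTI; exact: measurable_tc_path.
Qed.

Definition gstop T w : \bar R := if T w < +oo then gtime (fine (T w)) w else +oo.

(** A random time is replaced by a countable union over deterministic times [q >= T]; monotony of
    [gtime] gives one direction and its right continuity the other. *)
Lemma gstop_ltP T u w : 0 <= T w -> gstop T w < u%:E <->
  exists j, [/\ (0 <= (enum_rat j : R))%R, T w <= (enum_rat j)%:E &
    gtime (enum_rat j) w < u%:E].
Proof.
move=> T0; rewrite /gstop; case: ifPn => Too.
  have T0' : (0 <= fine (T w))%R by rewrite fine_ge0.
  have Tf : T w = (fine (T w))%:E by rewrite fineK// ge0_fin_numE.
  split.
    move=> /(gtime_right _ _ T0')[j tj js]; exists j; split => //.
      by rewrite (le_trans T0')// ltW.
    by rewrite Tf lee_fin ltW.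
  move=> [j [j0 Tj ju]]; apply: le_lt_trans ju; apply: le_gtime => //.
  by rewrite -lee_fin -Tf.
split=> [|[j [_ Tj _]]]; first by rewrite ltNge leey.
by move: Too; rewrite (le_lt_trans Tj)// ltry.
Qed.

(** The event [gstop T < u] is the union over rationals [q] of the events [T <= q] and
    [gtime q < u]. The first lies in [G q], that is, it is known at [gtime q], so its intersection
    with the second is in [F u]. *)
Lemma stopping_gstop T : stopping_time G T -> stopping_time F (gstop T).
Proof.
move=> sT; apply: (stopping_time_lt vm) => [w|u u0].
  rewrite /gstop; case: ifPn => Too; last exact: leey.
  by apply: gtime_ge0; rewrite fine_ge0// (sT.1 w).
rewrite (_ : [set _ | _] = \bigcup_j (if (0 <= (enum_rat j : R))%R then
    [set w | T w <= (enum_rat j)%:E] `&` [set w | gtime (enum_rat j) w < u%:E] else set0)).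
  apply: (F_bigcup vm (ltW u0)) => j; case: ifPn => [j0|_]; last exact: F_set0 vm _ (ltW u0).
  apply: (stopped_sigma_algebra_lt vm u0); first exact: stopping_gtime.
  exact: sT.2.
apply/seteqP; split=> w /=.
  by move=> /(gstop_ltP _ (sT.1 w))[j [j0 Tj ju]]; exists j => //; rewrite j0.
move=> [j _]; case: ifPn => // j0 [Tj ju]; apply/gstop_ltP; first exact: sT.1.
by exists j.
Qed.

Lemma stopped_gstop T A : stopping_time G T -> stopped_sigma_algebra G T A ->
  stopped_sigma_algebra F (gstop T) A.
Proof.
move=> sT [mA GA]; split => // t t0; apply: (lt_setI_le vm) => // u u0.
rewrite (_ : _ `&` _ = \bigcup_j (if (0 <= (enum_rat j : R))%R then
    (A `&` [set w | T w <= (enum_rat j)%:E]) `&` [set w | gtime (enum_rat j) w < u%:E]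
    else set0)).
  apply: (F_bigcup vm (ltW u0)) => j; case: ifPn => [j0|_]; last exact: F_set0 vm _ (ltW u0).
  apply: (stopped_sigma_algebra_lt vm u0); first exact: stopping_gtime.
  exact: GA.
apply/seteqP; split=> w /=.
  by move=> [Aw /(gstop_ltP _ (sT.1 w))[j [j0 Tj ju]]]; exists j => //; rewrite j0.
move=> [j _]; case: ifPn => // j0 [[Aw Tj] ju]; split => //; apply/gstop_ltP; first exact: sT.1.
by exists j.
Qed.

Lemma P0_tcX s (B : set (borel vec)) : (0 <= s)%R -> measurable B ->
  P 0%R (tcX s @^-1` B) = (\1_B (0%R : vec))%:E.
Proof.
move=> s0 mB; have mY := measurable_tcX s0.
have m0 : measurable [set w | X 0%R w = 0%R].
  have -> : [set w | X 0%R w = 0%R] = X 0%R @^-1` [set 0%R] by [].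
  rewrite -[X in measurable X]setTI; apply: (measurable_X vm) => //.
  exact: measurable_set1_vec.
have dead w : X 0%R w = 0%R -> tcX s w = 0%R.
  by rewrite -tcX0; exact: (good_absorbed (good_tc b (gw w)) (lexx _) s0).
have P0 (A : set Omega) : measurable A -> A `&` [set w | X 0%R w = 0%R] = set0 -> P 0%R A = 0.
  move=> mA A0; apply/eqP; rewrite -measure_le0.
  apply: (@le_trans _ _ (P 0%R (~` [set w | X 0%R w = 0%R]))).
    apply: le_measure; rewrite ?inE//; first exact: measurableC.
    by move=> w Aw /= xw; have : (A `&` [set w | X 0%R w = 0%R]) w by []; rewrite A0.
  rewrite le_eqVlt; apply/orP; left; apply/eqP.
  apply: etrans (probability_setC (P 0%R) m0) _.
  by rewrite (vm_start vm) ?subee//; right.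
have mYB : measurable (tcX s @^-1` B) by rewrite -[X in measurable X]setTI; exact: mY.
rewrite indicE; have [B0|B0] := pselect (B (0%R : vec)).
  rewrite mem_set//.
  have H := probability_setC (P 0%R) (measurableC mYB); rewrite setCK in H.
  apply: etrans H _; rewrite P0 ?sube0//; first exact: measurableC.
  by apply/seteqP; split => // w [/= nB /dead]; apply: contra_not nB => ->.
rewrite memNset// P0//; apply/seteqP; split => // w [/= Bw /dead Yw].
by move: Bw; rewrite Yw.
Qed.

(** Splits according to whether the time-changed process is alive at [T]. If it is, [tc_shift] makes
    the event one about the path of [X] after [gstop T], and the strong Markov property for paths
    applies. If not, it stays at 0, as it does under [P 0]. *)
Lemma strong_tcX T x s A (B : set (borel vec)) : stopping_time G T -> state E x ->
  (0 <= s)%R -> stopped_sigma_algebra G T A -> measurable B ->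
  P x (A `&` [set w | T w < +oo] `&` [set w | B (tcX (fine (T w) + s) w)]) =
  \int[P x]_(w in A `&` [set w | T w < +oo]) P (tcX (fine (T w)) w) (tcX s @^-1` B).
Proof.
move=> sT Ex s0 GA mB; have mA : measurable A by have [] := GA.
have sS := stopping_gstop sT; have FA := stopped_gstop sT GA.
have mS := stopping_time_fin vm sS.
have T0 w : (0 <= fine (T w))%R by rewrite fine_ge0// (sT.1 w).
have mT : measurable [set w | T w < +oo].
  rewrite (_ : [set w | T w < +oo] = \bigcup_k [set w | T w <= k%:R%:E]).
    by apply: bigcupT_measurable => k; have [] := sT.2 _ (ler0n R k).
  apply/seteqP; split=> w /=; last first.
    by move=> [k _] /= Tk; rewrite (le_lt_trans Tk)// ltry.
  move=> Too; have Tf : T w = (fine (T w))%:E by rewrite fineK// ge0_fin_numE ?(sT.1 w).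
  exists (Num.truncn (fine (T w))).+1 => //=; rewrite Tf lee_fin.
  by apply: ltW; exact: truncnS_gt.
have ST w : gstop T w < +oo -> T w < +oo by rewrite /gstop; case: ifP.
pose D1 := A `&` [set w | gstop T w < +oo].
pose D2 := (A `&` [set w | T w < +oo]) `\` [set w | gstop T w < +oo].
have mD1 : measurable D1 by exact: measurableI.
have mD2 : measurable D2 by apply: measurableD => //; exact: measurableI.
have DE : A `&` [set w | T w < +oo] = D1 `|` D2.
  apply/seteqP; split=> w /=.
    by move=> [Aw Too]; have [H|H] := pselect (gstop T w < +oo); [left|right].
  by move=> [[Aw /= /ST]|[]].
have D12 : [disjoint D1 & D2].
  by apply/disj_setPLR => w [_ /= H] []; rewrite /=; auto.
have tcT w : D1 w -> tcX (fine (T w)) w = X (fine (gstop T w)) w.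
  by move=> [_]; rewrite /= /gstop; case: ifPn => // Too; apply: tcX_gtime.
have tcTs w : D1 w -> tcX (fine (T w) + s)%R w =
    tc_path b s (fun u => X (fine (gstop T w) + u)%R w).
  move=> [_]; rewrite /= /gstop; case: ifPn => // Too; rewrite gtime_lty => tt.
  have [r [r0 xr rt -> _]] := gtimeP (T0 w) tt.
  by rewrite /tcX (tc_shift (gw w) r0 xr rt s0) tc_pathE//; exact: (good_shift (gw w)).
have dead w r : D2 w -> (0 <= r)%R -> tcX (fine (T w) + r)%R w = 0%R.
  move=> [[_ /= Too]]; rewrite /= /gstop Too => /negP; rewrite gtime_lty -leNgt => tt r0.
  by rewrite /tcX tc_dead// (le_trans tt)// lee_fin lerDl.
have mC : measurable (tc_path b s @^-1` B : set path_space).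
  by rewrite -[X in measurable X]setTI; exact: measurable_tc_path.
have mk : measurable_fun (A `&` [set w | T w < +oo])
    (fun w => P (tcX (fine (T w)) w) (tcX s @^-1` B)).
  rewrite DE; apply/measurable_funU => //; split.
    apply: (@eq_measurable_fun _ _ _ _ _ (fun w => P (X (fine (gstop T w)) w) (tcX s @^-1` B))).
      by move=> w; rewrite inE => D1w; rewrite tcT.
    apply: (@measurable_comp _ _ _ _ _ _ (state E : set (borel vec))
      (fun y : borel vec => P y (tcX s @^-1` B))).
    - exact: measurable_state.
    - by move=> _ [w _ <-]; apply: (vm_state vm); rewrite fine_ge0// (sS.1 w).
    - exact: kernel_tcX.
    - apply: measurable_funTS; apply: (@eq_measurable_fun _ _ Omega (borel vec) _
        (fun w => X (fine (gstop T w) + 0)%R w)); first by move=> w _; rewrite addr0.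
      exact: (measurable_X_stop vm sS (lexx 0%R)).
  apply: (@eq_measurable_fun _ _ _ _ _ (cst (P 0%R (tcX s @^-1` B)))) => [w|]; last exact: measurable_cst.
  by rewrite inE => /(fun h => dead w 0%R h (lexx _)); rewrite addr0 => ->.
rewrite DE ge0_integral_setU//=; last by rewrite -DE.
rewrite setIUl measureU; last 3 first.
- rewrite (_ : D1 `&` _ = D1 `&` [set w | (tc_path b s @^-1` B : set path_space) (fun u => X (fine (gstop T w) + u)%R w)]).
    have mp := @measurable_paths _ _ _ _ (fun w u => X (fine (gstop T w) + u)%R w)
      (fun u => @measurable_X_stop _ _ _ _ _ _ _ _ vm _ u sS) measurableT _ mC.
    by apply: measurableI; [exact: mD1|rewrite setTI in mp; exact: mp].
  by apply/seteqP; split=> w [D1w /=]; rewrite tcTs.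
- rewrite (_ : D2 `&` _ = D2 `&` [set w | B (0%R : vec)]).
    apply: measurableI => //; have [B0|B0] := pselect (B (0%R : vec)).
      by rewrite (_ : [set _ | _] = setT)//; apply/seteqP; split.
    by rewrite (_ : [set _ | _] = set0)//; apply/seteqP; split.
  by apply/seteqP; split=> w [D2w /=]; rewrite dead.
- apply/seteqP; split=> // w [[D1w _] [D2w _]].
  by move/disj_setPLR : D12 => /(_ w D1w).
congr (_ + _).
  transitivity (P x (A `&` [set w | gstop T w < +oo] `&`
      [set w | (tc_path b s @^-1` B : set path_space) (fun u => X (fine (gstop T w) + u)%R w)])).
    by congr (P x _); apply/seteqP; split=> w [D1w /=]; rewrite tcTs.
  rewrite (strong_markov_path mE vm sS FA Ex mC); apply: eq_integral => w; rewrite inE => D1w.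
  rewrite tcT//; congr (P _ _); apply/seteqP; split=> w' /=; rewrite tc_pathE//.
transitivity (\int[P x]_(w in D2) (\1_B (0%R : vec))%:E).
  rewrite integral_cst// indicE; have [B0|B0] := pselect (B (0%R : vec)).
    rewrite mem_set// mul1e; congr (P x _); apply/setIidl => w D2w /=.
    by rewrite dead.
  rewrite memNset// mul0e (_ : _ `&` _ = set0) ?measure0//.
  by apply/seteqP; split=> // w [D2w /=]; rewrite dead.
apply: eq_integral => w; rewrite inE => D2w.
by have := dead w 0%R D2w (lexx _); rewrite addr0 => ->; rewrite P0_tcX.
Qed.

(** Left continuity of the inverse clock before the total clock. If the supremum were some [r]
    smaller than the limit time, the clock at [r] would be less than [t], hence less than some
    [tn k], whose time would then exceed [r]. *)
Lemma gtime_sup (tn : nat -> \bar R) (t : \bar R) w :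
  (forall k, 0 <= tn k) -> {homo tn : k l / (k <= l)%N >-> k <= l} ->
  tn @ \oo --> t -> t < +oo -> (fine t)%:E < total b (X ^~ w) ->
  let g (u : \bar R) := if u < +oo then gtime (fine u) w else +oo in
  ereal_sup (range (g \o tn)) = g t.
Proof.
move=> tn0 tnd tnt too tt g.
have supt : ereal_sup (range tn) = t.
  by apply: (cvg_unique _ _ tnt) => //; exact: ereal_nondecreasing_cvgn.
have tnt' k : tn k <= t by rewrite -supt; apply: ereal_sup_ubound; exists k.
have t0 : 0 <= t by exact: le_trans (tn0 0%N) (tnt' 0%N).
have tf : t = (fine t)%:E by rewrite fineK// ge0_fin_numE.
have tnoo k : tn k < +oo by exact: le_lt_trans (tnt' k) too.
have tnf k : tn k = (fine (tn k))%:E by rewrite fineK// ge0_fin_numE.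
have ft0 : (0 <= fine t)%R by rewrite fine_ge0.
have [s [s0 xs st gE _]] := gtimeP ft0 tt.
rewrite {2}/g too gE; apply/eqP; rewrite eq_le; apply/andP; split.
  apply: ge_ereal_sup => _ [k _ <-]; rewrite /= /g tnoo -gE; apply: le_gtime.
    by rewrite fine_ge0.
  by rewrite -lee_fin -tnf -tf.
rewrite leNgt; apply/negP => H.
have gk k : g (tn k) <= ereal_sup (range (g \o tn)) by apply: ereal_sup_ubound; exists k.
have S0 : 0 <= ereal_sup (range (g \o tn)).
  apply: le_trans (gk 0%N); rewrite /g tnoo; apply: gtime_ge0; exact: fine_ge0.
have Sf : ereal_sup (range (g \o tn)) = (fine (ereal_sup (range (g \o tn))))%:E.
  by rewrite fineK// ge0_fin_numE// (lt_trans H)// ltry.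
move: H gk; rewrite Sf; set r := fine _; rewrite lte_fin => rs gk.
have r0 : (0 <= r)%R by rewrite fine_ge0.
have xr := alive_le (gw w) r0 (ltW rs) xs.
have : clk b (X ^~ w) r < t by rewrite tf -st ltr_clk.
rewrite -supt => /ereal_sup_gt[_ [k _ <-]] rk.
have tk : (fine (tn k))%:E < total b (X ^~ w) by rewrite -tnf (le_lt_trans (tnt' k))// tf.
have fk0 : (0 <= fine (tn k))%R by rewrite fine_ge0.
have [u [u0 xu uk gu _]] := gtimeP fk0 tk.
have := gk k; rewrite /g tnoo gu lee_fin leNgt => /negP; apply.
by rewrite -(ltr_clk b (gw w) r0 u0)// uk -tnf.
Qed.

Lemma quasi_left_continuous_tcX (Tn : nat -> Omega -> \bar R) T :
  (forall k, stopping_time G (Tn k)) -> stopping_time G T ->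
  (forall w, {homo Tn ^~ w : k l / (k <= l)%N >-> k <= l}) ->
  (forall w, Tn ^~ w @ \oo --> T w) -> forall x, state E x ->
  {ae P x, forall w, T w < +oo -> tcX (fine (T w)) w != 0%R ->
    tcX (fine (Tn k w)) w @[k --> \oo] --> tcX (fine (T w)) w}.
Proof.
move=> sTn sT Tnd Tcv x Ex.
(* Quasi-left continuity of [X] is applied at the supremum of the translated times and not at
   [gstop T]: when [T] is not before death, [gstop T] is infinite whereas the supremum may be
   finite. The two agree where the conclusion asks something. *)
pose S w := ereal_sup (range (fun k => gstop (Tn k) w)).
have sS := stopping_time_sup vm (fun k => stopping_gstop (sTn k)).
have Snd w : {homo (fun k => gstop (Tn k) w) : k l / (k <= l)%N >-> k <= l}.
  move=> k l kl; rewrite {2}/gstop; case: ifPn => Too; last exact: leey.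
  have koo : Tn k w < +oo by exact: le_lt_trans (Tnd w _ _ kl) Too.
  rewrite /gstop koo; apply: le_gtime; first by rewrite fine_ge0// ((sTn k).1 w).
  by apply: fine_le (Tnd w _ _ kl); rewrite ge0_fin_numE ?((sTn _).1 w).
have := vm_quasi_left_continuous vm (fun k => stopping_gstop (sTn k)) sS Snd
  (fun w => ereal_nondecreasing_cvgn (Snd w)) Ex.
apply: filterS => w H Too; rewrite (tc_neq0 b (gw w)) ?fine_ge0 ?(sT.1 w)// => tt.
have T0 : (0 <= fine (T w))%R by rewrite fine_ge0// (sT.1 w).
have [s [s0 xs st gE tE]] := gtimeP T0 tt.
have SE : ereal_sup (range (fun k => gstop (Tn k) w)) = s%:E.
  rewrite -gE; have := gtime_sup (fun k => (sTn k).1 w) (Tnd w) (Tcv w) Too tt.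
  by rewrite /= Too.
move: H; rewrite SE ltry tE => /(_ isT xs); apply: cvg_trans; apply: near_eq_cvg.
have Tk k : Tn k w <= T w.
  have -> : T w = ereal_sup (range (Tn ^~ w)).
    apply: (cvg_unique _ (Tcv w)) => //; exact: ereal_nondecreasing_cvgn (Tnd w).
  by apply: ereal_sup_ubound; exists k.
apply: nearW => k; have koo : Tn k w < +oo by exact: le_lt_trans (Tk k) Too.
rewrite /gstop koo tcX_gtime//; first by rewrite fine_ge0// ((sTn k).1 w).
rewrite gtime_lty; apply: le_lt_trans tt; rewrite lee_fin; apply: fine_le (Tk k);
  by rewrite ge0_fin_numE ?((sTn _).1 w) ?(sT.1 w).
Qed.

Lemma tcX_indic_integral (B : set (borel vec)) w : measurable B -> ~ B (0%R : vec) ->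
  \int[mu]_(t in [set t : R | (0 <= t)%R]) (\1_B (tcX t w))%:E =
  \int[mu]_(t in `[0%R, +oo[) ((\1_B (path_reg X w t))%:E * (wt b (path_reg X w t))%:E).
Proof.
move=> mB B0.
pose D : set (measurableTypeR R) := `[0%R, +oo[%classic.
pose f : measurableTypeR R -> \bar R := (fun t => (\1_B (tcX t w))%:E) \_ D.
have mf : measurable_fun setT f.
  have mD : measurable D by exact: measurable_itv.
  apply: (iffLR (measurable_restrictT _ mD)); apply/measurable_EFinP.
  have mI : measurable_fun setT (\1_B : borel vec -> R) by exact: measurable_indic.
  exact: (measurableT_comp mI (measurable_path (good_tc b (gw w)))).
have f0 t : 0 <= f t by rewrite /f patchE; case: ifP => // _; rewrite lee_fin.
have AE (p : R -> vec) (g : R -> \bar R) : (forall t, (0 <= t)%R -> p t = 0%R -> g t = 0) ->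
    \int[mu]_(t in `[0%R, +oo[) g t = \int[mu]_(t in alive p) g t.
  move=> gp; rewrite [LHS]integral_mkcond [RHS]integral_mkcond; apply: eq_integral => t _.
  rewrite !patchE; have [t0|t0] := leP 0%R t.
    rewrite mem_set/= ?in_itv/= ?t0//.
    have [pt|pt] := eqVneq (p t) 0%R; last by rewrite mem_set.
    by rewrite memNset ?gp// => -[_]; rewrite pt eqxx.
  rewrite !memNset//; first by move=> [t0' _]; move: t0; rewrite ltNge t0'.
  by rewrite /= in_itv/= andbT; apply/negP; rewrite -ltNge.
have NB t (p : R -> vec) : p t = 0%R -> (\1_B (p t))%:E = 0 :> \bar R.
  by move=> ->; rewrite indicE memNset.
transitivity (\int[mu]_(t in alive (tcX ^~ w)) f t).
  rewrite -(AE (tcX ^~ w)); last first.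
    by move=> t t0 tt; rewrite /f patchE; case: ifP => // _; exact: (NB t (tcX ^~ w)).
  have -> : [set t : R | (0 <= t)%R] = `[0%R, +oo[%classic :> set R.
    by apply/seteqP; split=> t; rewrite /= in_itv/= andbT.
  by apply: eq_integral => t t0; rewrite /f patchE t0.
apply: etrans (ge0_change_of_time b (gw w) mf f0) _.
rewrite [RHS](AE (X ^~ w)); last first.
  by move=> t t0 xt; rewrite path_regE// (NB t (X ^~ w))// mul0e.
apply: eq_integral => s; rewrite inE => -[s0 xs]; rewrite path_regE//; congr (_ * _).
have cE : (fine (clk b (X ^~ w) s))%:E = clk b (X ^~ w) s by rewrite fineK// clk_fin.
rewrite /f patchE mem_set; last first.
  by rewrite /D/= in_itv/= andbT -lee_fin cE clk_ge0.
by rewrite /tcX (tcE (gw w) s0 xs)//.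
Qed.

Lemma vmarkov_tc : vmarkov E G tcX P.
Proof.
have nE x : E x -> x != 0%R by move=> Ex; apply/eqP => x0; apply: E0; rewrite -x0.
split.
- exact: vm_locally_compact vm.
- exact: vm_second_countable vm.
- exact: usual_filtration_G.
- exact: adapted_tcX.
- by move=> t w; exact: state_tcX.
- move=> x Ex; rewrite (_ : [set w | _] = [set w | X 0%R w = x]); first exact: (vm_start vm).
  by apply/seteqP; split=> w /=; rewrite tcX0.
- by move=> w; exact: (good_tc b (gw w)).
- by move=> t w; exact: left_tcX.
- move=> t B t0 mB; apply: measurable_funS (kernel_tcX t0 mB).
    exact: measurable_state.
  exact: subsetUl.
- by move=> T sT x s A B Ex s0 GA mB; exact: strong_tcX.
- exact: quasi_left_continuous_tcX.
(* The same reference measure serves: the occupation integral of [tcX] is that of [X] with the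
   weight [wt b], positive on [E], so the null sets are unchanged. *)
have [m mP] := vm_reference_measure vm; exists m => v Ev B mB BE.
have B0 : ~ B (0%R : vec) by move=> /BE.
rewrite -(mP v Ev B mB BE).
have tE : [set t : R | (0 <= t)%R] = `[0%R, +oo[%classic :> set R.
  by apply/seteqP; split=> t; rewrite /= in_itv/= andbT.
have m1 : measurable_fun setT (fun x : borel vec => (\1_B x)%:E : \bar R).
  by apply/measurable_EFinP; exact: measurable_indic.
have m2 : measurable_fun setT (fun x : borel vec => (\1_B x)%:E * (wt b x)%:E : \bar R).
  by apply: emeasurable_funM => //; apply/measurable_EFinP; exact: measurable_wt.
have g1 (x : vec) : 0 <= (\1_B x)%:E :> \bar R by rewrite lee_fin.
have g2 (x : vec) : 0 <= (\1_B x)%:E * (wt b x)%:E :> \bar R.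
  by rewrite mule_ge0 ?lee_fin// wt_ge0.
have mX := measurable_X vm.
have mreg (f : vec -> \bar R) w : measurable_fun setT (f : borel vec -> \bar R) ->
    measurable_fun (`[0%R, +oo[ : set (measurableTypeR R)) (fun t => f (path_reg X w t)).
  move=> mf; apply: measurable_funTS; apply: measurableT_comp mf _.
  apply: (measurableT_comp (measurable_reg mX)).
  by apply: measurable_fun_pair.
rewrite (_ : (\int[P v]_w _)%E = \int[P v]_w
    \int[mu]_(t in `[0%R, +oo[) ((\1_B (path_reg X w t))%:E * (wt b (path_reg X w t))%:E)); last first.
  by apply: eq_integral => w _; exact: tcX_indic_integral.
rewrite (_ : (\int[P v]_w \int[mu]_(t in [set t : R | (0 <= t)%R]) (\1_B (X t w))%:E)%E =
    \int[P v]_w \int[mu]_(t in `[0%R, +oo[) (\1_B (path_reg X w t))%:E); last first.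
  apply: eq_integral => w _; rewrite tE; apply: eq_integral => t.
  by rewrite inE/= in_itv/= andbT => t0; rewrite path_regE.
apply: ge0_integral_eq0 => //.
- exact: (measurable_integral_path_reg mX m2).
- exact: (measurable_integral_path_reg mX m1).
- by move=> w _; apply: integral_ge0 => t _; exact: g2.
- by move=> w _; apply: integral_ge0 => t _; exact: g1.
move=> w _; apply: ge0_integral_eq0 => //; [exact: mreg m2|exact: mreg m1|].
move=> t _; set y := path_reg X w t; rewrite indicE; have [By|By] := pselect (B y).
  rewrite mem_set// mul1e; split => -[] y0; last by move: y0 => /eqP; rewrite oner_eq0.
  by have := wt_gt0 b (nE _ (BE _ By)); rewrite y0 ltxx.
by rewrite memNset// mul0e.
Qed.

End time_change.

(** * Image of a Markov process under an involution of the state space *)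

Section involution.
Context {R : realType} {V : ptopologicalType} {d : measure_display} {Omega : measurableType d}.
Variables (E : set V) (h : V -> V).
Hypotheses (hK : involutive h) (hE : forall v, E v -> E (h v))
  (ch : forall v, E v -> {for v, continuous h})
  (mh : measurable_fun setT (h : borel V -> borel V)).
Variables (F : R -> set (set Omega)) (Z : R -> Omega -> option V)
  (P : option V -> probability Omega R).
Implicit Types (o : option V) (t : R) (w : Omega).

Let oK o : omap h (omap h o) = o.
Proof. by case: o => //= v; rewrite hK. Qed.

Let oE o : with_cemetery E o -> with_cemetery E (omap h o).
Proof. by case: o => //= v; exact: hE. Qed.

Let imZ t w : (omap h (Z t w) = None) <-> (Z t w = None).
Proof. by case: (Z t w). Qed.

Lemma lifetime_omap w : lifetime (fun t w => omap h (Z t w)) w = lifetime Z w.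
Proof.
rewrite /lifetime; congr ereal_inf; apply/seteqP; split=> _ [t [t0 /imZ zt] <-];
  by exists t.
Qed.

Lemma cemetery_borel_omap B : cemetery_borel B -> cemetery_borel (omap h @^-1` B).
Proof.
move=> mB; rewrite /cemetery_borel /=.
have -> : Some @^-1` (omap h @^-1` B) = h @^-1` (Some @^-1` B) by [].
by rewrite -[X in measurable X]setTI; exact: mh.
Qed.

Lemma cvg_omap (T : Type) (G : set_system T) (f : T -> option V) o : Filter G ->
  with_cemetery E o -> f s @[s --> G] --> cemetery_nbhs o ->
  omap h (f s) @[s --> G] --> cemetery_nbhs (omap h o).
Proof.
move=> FG; case: o => [v|] /= Ev fv A.
  move=> hA; have : cemetery_nbhs (Some v) [set o | A (omap h o)] by exact: (ch Ev hA).
  exact: fv.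
move=> /principal_filterP AN; apply: (fv [set o | A (omap h o)]).
exact/principal_filterP.
Qed.

Section pushforward.
Variable mu : {sigma_finite_measure set (borel V) -> \bar R}.

Definition involm := pushforward mu (h : borel V -> borel V).

HB.instance Definition _ := Measure.copy involm (pushm mu mh).

Let involm_sigma_finite : sigma_finite setT involm.
Proof.
have [A AT mA] := sigma_finiteT mu; exists (fun k => h @^-1` A k).
  by rewrite -preimage_bigcup -AT preimage_setT.
move=> k; have [mAk Ak] := mA k; split.
  by rewrite -[X in measurable X]setTI; exact: mh.
rewrite /involm /pushforward (_ : h @^-1` (h @^-1` A k) = A k)//.
by apply/seteqP; split=> v /=; rewrite hK.
Qed.

HB.instance Definition _ := Measure_isSigmaFinite.Build _ _ _ involm involm_sigma_finite.

Definition sigma_finite_involm : {sigma_finite_measure set (borel V) -> \bar R} := involm.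

End pushforward.

(** States and laws are relabelled, while the filtration and the lifetime stay the same. It serves
    for the inversion of the cone and for [(y, z) -> (y, - z)]. Continuity is asked on [E] only,
    since the inversion is not continuous at 0. *)
Lemma markov_involution : markov_process E F Z P ->
  markov_process E F (fun t w => omap h (Z t w)) (fun o => P (omap h o)).
Proof.
move=> [lc sc [fs fm fn fr fc] ada sta start abso rc ll ker str qlc ref].
split => //.
- split => // N NN; apply: fc => o oo; have := NN (omap h o) (oE oo); by rewrite oK.
- by move=> t B t0 mB; exact: (ada t _ t0 (cemetery_borel_omap mB)).
- by move=> t w t0; apply: oE; exact: sta.
- move=> o /oE oo; rewrite -(start _ oo); congr (P _ _).
  by apply/seteqP; split=> w /=; [move=> <-; rewrite oK|move=> ->; rewrite oK].
- by move=> t w t0; rewrite lifetime_omap => /(abso _ _ t0) ->.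
- move=> t w t0; rewrite lifetime_omap => /(rc _ _ t0).
  by apply: cvg_omap; exact: sta.
- move=> t w t0; rewrite lifetime_omap => /(ll _ _ t0)[v Ev Zv]; exists (h v); first exact: hE.
  exact: (cvg_omap (o := Some v)).
- move=> t B t0 mB mE Y mY; have := ker t _ t0 (cemetery_borel_omap mB) mE Y mY.
  move=> /(mh measurableT); rewrite setTI; congr measurable.
  apply/seteqP; split=> v /= [Ev].
    by move=> Yv; split => //; rewrite -[v]hK; exact: hE.
  by move=> Yv; split => //; exact: hE.
- move=> T sT o s A B /oE oo s0 FA mB.
  rewrite (str T sT _ s A _ oo s0 FA (cemetery_borel_omap mB)).
  by apply: eq_integral => w _; rewrite /at_time oK.
- move=> Tn T sTn sT nd cv o /oE oo; apply: filterS (qlc Tn T sTn sT nd cv _ oo).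
  move=> w H; rewrite lifetime_omap => Tl; have := H Tl; apply: cvg_omap.
  by apply: sta; rewrite fine_ge0// (sT.1 w).
- have [mu muP] := ref; exists (sigma_finite_involm mu).
  move=> v Ev B mB BE; have hB : h @^-1` B `<=` E.
    by move=> x /BE/hE; rewrite hK.
  have mhB : measurable (h @^-1` B : set (borel V)).
    by rewrite -[X in measurable X]setTI; exact: mh.
  rewrite -(muP (h v) (hE Ev) _ mhB hB); rewrite /potential.
  suff -> : (fun w => (\int[lebesgue_measure]_(t in [set t : R | (0 <= t)%R])
     (\1_(Some @` B) (omap h (Z t w)))%:E)%E) = (fun w => (\int[lebesgue_measure]_(t in [set t : R | (0 <= t)%R])
     (\1_(Some @` (h @^-1` B)) (Z t w))%:E)%E) by [].
  apply/funext => w; apply: eq_integral => t _; rewrite !indicE; congr ((nat_of_bool _)%:R%:E).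
  case: (Z t w) => [z|] /=; last by apply/idP/idP; rewrite !inE => -[].
  apply/idP/idP; rewrite !inE.
    by move=> [x Bx [xE]]; exists z => //=; rewrite -xE.
  by move=> [x Bx [<-]]; exists (h x).
Qed.

End involution.

(** * The cone in polar coordinates *)

Section cone.
Context {R : realType} {n : nat}.
Local Notation vec := 'rV[R]_n.+1.
Variable S : set vec.
Hypothesis SS : S `<=` sphere.

Lemma enorm_phi (y : vec) z : S y -> enorm (phi (y, z)) = expR z.
Proof. by move=> /SS yS; rewrite /phi enormZ ger0_norm ?expR_ge0// yS mulr1. Qed.

Lemma cone_neq0 (x : vec) : cone S x -> x != 0.
Proof.
by move=> [[y z] [/= Sy _] <-]; rewrite -enorm_gt0 enorm_phi// expR_gt0.
Qed.

Lemma cone0 : ~ cone S 0.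
Proof. by move/cone_neq0; rewrite eqxx. Qed.

Lemma inversion_phi (y : vec) z : S y -> inversion (phi (y, z)) = phi (y, - z).
Proof.
move=> Sy; rewrite /inversion enorm_phi// /phi/= scalerA; congr (_ *: _).
by rewrite expRN expr2 invfM -mulrA mulVf ?mulr1// gt_eqF// expR_gt0.
Qed.

Lemma cone_inversion (x : vec) : cone S x -> cone S (inversion x).
Proof.
by move=> [[y z] [/= Sy _] <-]; exists (y, - z) => //; rewrite inversion_phi.
Qed.

Lemma coneZ (a : R) (x : vec) : 0 < a -> cone S x -> cone S (a *: x).
Proof.
move=> a0 [[y z] [/= Sy _] <-]; exists (y, ln a + z) => //.
by rewrite /phi/= expRD lnK// scalerA.
Qed.

Definition polar (x : vec) : option (vec * R) :=
  if x == 0 then None else Some ((enorm x)^-1 *: x, ln (enorm x)).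

End cone.

Lemma polar_inversion {R : realType} {n : nat} (x : 'rV[R]_n.+1) :
  polar (inversion x) = opp_xi (polar x).
Proof.
rewrite /polar inversion_eq0; case: eqVneq => // x0 /=.
have e0 : 0 < enorm x by rewrite enorm_gt0.
rewrite enorm_inversion lnV// invrK /inversion scalerA; congr (Some (_ *: _, _)).
by rewrite expr2 invfM mulrA divff ?mul1r// gt_eqF.
Qed.

(** The generators only read times [t >= 0], and the sets that do not separate [p] from [q] form a
    sigma-algebra. *)
Lemma path_measurable_eq {R : realType} {n : nat} (C : set (@path_space R n))
  (p q : R -> 'rV[R]_n.+1) : measurable C -> (forall t, 0 <= t -> p t = q t) ->
  C p <-> C q.
Proof.
move=> mC pq; pose G := [set C : set (R -> 'rV[R]_n.+1) | C p <-> C q].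
suff : path_sigma_algebra `<=` G by rewrite path_sigma_algebraE; exact.
apply: smallest_sub; last by move=> _ [t [B [t0 mB ->]]]; rewrite /G/= pq.
split; first by [].
- by move=> A GA; rewrite setTD; split=> nA /GA.
- by move=> A GA; split=> -[k _ /GA]; exists k.
Qed.

Section lamperti_time_change.
Context {R : realType} {n : nat} {d : measure_display} {Omega : measurableType d}.
Local Notation vec := 'rV[R]_n.+1.
Variables (E : set vec) (F : R -> set (set Omega)) (X : R -> Omega -> vec)
  (P : vec -> probability Omega R).
Implicit Types (t : R) (w : Omega).

Lemma total_clockE b w : good (X ^~ w) -> total_clock b X w = total b (X ^~ w).
Proof.
move=> gw; rewrite /total_clock /total; congr (integral _ _ _).
by apply/seteqP; split=> u [u0]; rewrite ?lt_lifetime// => xu; split; rewrite ?lt_lifetime.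
Qed.

Lemma hatE alpha w : good (X ^~ w) ->
  hat alpha X ^~ w = inversion \o tc (- (2 * alpha)) (X ^~ w).
Proof.
move=> gw; apply/funext => t; rewrite /hat /tc /= total_clockE//.
by case: ifP; rewrite // inversion0.
Qed.

Lemma lampertiE alpha t w : good (X ^~ w) -> 0 <= t ->
  lamperti alpha X t w = polar (tc (- alpha) (X ^~ w) t).
Proof.
move=> gw t0; have := tc_neq0 (- alpha) gw t0; rewrite /lamperti total_clockE//.
rewrite /tc; case: ifP => [_ x0|_ _]; first by rewrite /polar (negbTE x0).
by rewrite /polar eqxx.
Qed.

Lemma good_hat alpha w : good (X ^~ w) -> good (hat alpha X ^~ w).
Proof. by move=> gw; rewrite hatE//; apply: good_inversion; exact: good_tc. Qed.

Lemma total_ge0 b (p : R -> vec) : (0 <= total b p)%E.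
Proof. by apply: integral_ge0 => u _; rewrite lee_fin wt_ge0. Qed.

(** The dead times form the half-line that starts at the total clock, its end included; it is empty,
    with infimum infinite, when the total is infinite. *)
Lemma lifetime_hat alpha w : good (X ^~ w) ->
  lifetime (absorb (hat alpha X)) w = total_clock (- (2 * alpha)) X w.
Proof.
move=> gw; rewrite total_clockE// /lifetime.
have gX := good_hat alpha gw.
have -> : [set t | 0 <= t /\ absorb (hat alpha X) t w = None] =
    [set t : R | 0 <= t /\ (total (- (2 * alpha)) (X ^~ w) <= t%:E)%E].
  apply/seteqP; split=> t [t0 H]; split => //; move: H; rewrite /absorb.
    have -> : hat alpha X t w = inversion (tc (- (2 * alpha)) (X ^~ w) t).
      by rewrite -[LHS]/((hat alpha X ^~ w) t) hatE.
    rewrite inversion_eq0; case: ifP => // /negPn; rewrite tc_neq0// -leNgt //.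
  move=> tt; rewrite -[hat alpha X t w]/((hat alpha X ^~ w) t) hatE//=.
  by rewrite inversion_eq0 tc_dead// eqxx.
apply/eqP; rewrite eq_le; apply/andP; split; last first.
  by apply: le_ereal_inf_tmp => _ [t [_ tt] <-].
have := total_ge0 (- (2 * alpha)) (X ^~ w); case: (total _ _) => [r|_|//].
  by rewrite lee_fin => r0; apply: ereal_inf_lbound; exists r.
exact: leey.
Qed.

End lamperti_time_change.

(** * The inverted process: self-similarity and associated MAP *)

Section hat_process.
Context {R : realType} {n : nat} {d : measure_display} {Omega : measurableType d}.
Local Notation vec := 'rV[R]_n.+1.
Variables (S : set vec) (alpha : R) (X : R -> Omega -> vec)
  (P : vec -> probability Omega R).
Hypothesis SS : S `<=` sphere.
Implicit Types (t : R) (w : Omega).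

Lemma measurable_cone F : vmarkov (cone S) F X P -> measurable (cone S : set (borel vec)).
Proof.
move=> vm; apply: measurable_locally_compact.
  exact: vm_locally_compact vm.
exact: vm_second_countable vm.
Qed.

Lemma markov_hat F : vmarkov (cone S) F X P ->
  markov_process (cone S) (G F X (- (2 * alpha))) (absorb (hat alpha X)) (absorb_law (hat_law P)).
Proof.
move=> vm; have gw := vm_good vm.
have vt := vmarkov_tc (- (2 * alpha)) (cone0 SS) (measurable_cone vm) vm.
have := markov_involution (@inversionK R n) (@cone_inversion _ _ _ SS)
  (fun v cv => continuous_inversion (cone_neq0 SS cv)) (@measurable_inversion R n)
  (markov_of_vmarkov (cone0 SS) vt).
congr (markov_process _ _ _ _).
  apply/funext => t; apply/funext => w; rewrite /absorb.
  rewrite -[hat alpha X t w]/((hat alpha X ^~ w) t) hatE//= inversion_eq0.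
  by rewrite -/(tcX X (- (2 * alpha)) t w); case: ifP.
apply/funext => -[x|] //=; rewrite /absorb_law /= /hat_law inversion0 //.
Qed.

(** A dilation by [a] of the inverted process is a dilation by [1 / a] of [X], so the
    self-similarity of [X] is used with [1 / a], for the event [C'] obtained by pulling [C] back
    along the map from [X] to its inverted time change. *)
Lemma ssMp_hat : is_ssMp S alpha X P -> is_ssMp S alpha (hat alpha X) (hat_law P).
Proof.
move=> [[F mX] ss]; have vm := vmarkov_of (cone0 SS) mX; have gw := vm_good vm.
split; first by exists (G F X (- (2 * alpha))); exact: markov_hat.
move=> a x a0 Sx C; rewrite path_sigma_algebraE => mC; rewrite /hat_law.
set b := - (2 * alpha).
have mh : measurable_fun setT
    (fun p : @path_space R n => (fun t => inversion (tc_path b t p)) : path_space).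
  apply: measurable_paths => t t0.
  apply: (measurableT_comp (@measurable_inversion R n)); exact: (@measurable_tc_path R n b t).
pose C' : set (@path_space R n) := [set p : path_space | C (fun t => inversion (tc_path b t p))].
have mC' : measurable C'.
  by rewrite -[X in measurable X]setTI; exact: mh.
have C'E p : good p -> C' p <-> C (fun t => inversion (tc b p t)).
  move=> gp; apply: (path_measurable_eq mC) => t t0.
  by rewrite (tc_pathE b gp t0).
have a1 : 0 < a^-1 by rewrite invr_gt0.
have := ss _ _ a1 (cone_inversion SS Sx) C'; rewrite path_sigma_algebraE => /(_ mC').
rewrite inversionZ => H.
transitivity (P (inversion x) [set w | C' (X ^~ w)]).
  congr (P _ _); apply/seteqP; split=> w; rewrite /= (hatE alpha (gw w)).
    by move=> Cw; apply/(C'E _ (gw w)).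
  by move=> /(C'E _ (gw w)).
rewrite H; congr (P _ _); apply/seteqP.
have powV c : a^-1 `^ c = a `^ (- c).
  by rewrite -(powR_inv1 (ltW a0)) -powRrM mulN1r.
(* The time scale: [a ^ alpha] from the self-similarity of [X] with factor [1 / a], and
   [a ^ (- 2 * alpha)] from the clock, leave [a ^ (- alpha)]. *)
have aE : a^-1 `^ (- alpha) / a^-1 `^ b = a `^ (- alpha).
  rewrite !powV opprK -powRN opprK -powRD; last by rewrite (gt_eqF a0) implybT.
  by congr (_ `^ _); rewrite /b; ring.
have aa : 0 < a^-1 `^ (- alpha) by rewrite powR_gt0.
have gs w : good (fun t => a^-1 *: X (a^-1 `^ (- alpha) * t) w).
  exact: (good_scale a1 aa (gw w)).
have K w : C' (fun t => a^-1 *: X (a^-1 `^ (- alpha) * t) w) <->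
    C (fun t => a *: hat alpha X (a `^ (- alpha) * t) w).
  apply: iff_trans (C'E _ (gs w)) _; apply: (path_measurable_eq mC) => t t0.
  rewrite (tc_scale b a1 aa (gw w) t0) inversionZ invrK.
  rewrite -[hat alpha X _ w]/((hat alpha X ^~ w) _) (hatE alpha (gw w)) /=.
  congr (_ *: inversion (tc _ _ _)).
  by rewrite mulrAC aE.
by split=> w /K.
Qed.

Lemma lamperti_hat t w : good (X ^~ w) -> 0 <= t ->
  lamperti alpha (hat alpha X) t w = opp_xi (lamperti alpha X t w).
Proof.
move=> gw t0; rewrite lampertiE//; last exact: good_hat.
rewrite (hatE alpha gw) tc_inversion polar_inversion opprK.
rewrite (tc_tc (- (2 * alpha)) alpha gw t0) (lampertiE alpha gw t0).
by rewrite (_ : - (2 * alpha) + alpha = - alpha) //; ring.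
Qed.

Lemma continuous_oppz : continuous (fun p : vec * R => (p.1, - p.2)).
Proof.
move=> p A [[B C] [/= nB nC] BCA]; exists (B, -%R @^-1` C).
  by split=> //=; exact: (@oppr_continuous R R p.2 C nC).
by move=> q [/= Bq Cq]; exact: (BCA (q.1, - q.2)).
Qed.

(** The increments of [- xi] are the opposites of those of [xi], so the defining identity is that of
    the original MAP for the test function composed with the involution. *)
Lemma is_MAP_opp (Y : R -> Omega -> option (vec * R))
    (Q : option (vec * R) -> probability Omega R) :
  is_MAP S Y Q -> is_MAP S (opp_MAP Y) (opp_MAP_law Q).
Proof.
pose h (p : vec * R) := (p.1, - p.2).
have hK : involutive h by move=> [y z]; rewrite /h/= opprK.
have mh : measurable_fun setT (h : borel (vec * R)%type -> borel (vec * R)%type).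
  apply: (@measurability _ _ (borel (vec * R)%type) (borel (vec * R)%type) _ _
    (@open (vec * R)%type)) => // _ [A oA <-].
  rewrite setTI; apply: sub_sigma_algebra; apply: open_comp oA => p _.
  exact: continuous_oppz.
have oE o : opp_xi o = omap h o :> option (vec * R) by case: o => [[]|].
move=> [F mY H]; exists F.
  have := markov_involution hK (E := S `*` setT) _ (fun p _ => @continuous_oppz p) mh mY.
  move=> /(_ (fun p Sp => Sp)); congr (markov_process _ _ _ _).
    by apply/funext => t; apply/funext => w; rewrite /opp_MAP oE.
  by apply/funext => o; rewrite /opp_MAP_law oE.
move=> y z s t f A Sy s0 t0 mf f0 FA.
have := H y (- z) s t (f \o h) A Sy s0 t0 (measurableT_comp mf mh) (fun p => f0 _) FA.
rewrite /opp_MAP_law /= => HH; apply: etrans (etrans HH _).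
  apply: eq_integral => w _; rewrite /opp_MAP.
  case: (Y t w) => [[y0 z0]|//]; case: (Y (t + s) w) => [[y1 z1]|//] /=.
  by rewrite /h/=; congr (f (_, _)); ring.
apply: eq_integral => w _; rewrite /opp_MAP; case: (Y t w) => [[y0 z0]|//] /=.
rewrite /semigroup /= oppr0; apply: eq_integral => w' _.
by rewrite /opp_MAP; case: (Y s w') => [[]|].
Qed.

Lemma associated_MAP_hat Y Q : is_ssMp S alpha X P -> associated_MAP S alpha X P Y Q ->
  associated_MAP S alpha (hat alpha X) (hat_law P) (opp_MAP Y) (opp_MAP_law Q).
Proof.
move=> [[F mX] _] [mY YE QE QN]; have vm := vmarkov_of (cone0 SS) mX.
have gw := vm_good vm; split.
- exact: is_MAP_opp.
- by move=> t w t0; rewrite lamperti_hat// /opp_MAP YE.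
- move=> y z Sy; rewrite /opp_MAP_law /= QE// /hat_law.
  by rewrite -[expR z *: y]/(phi (y, z)) (inversion_phi SS).
- by rewrite /opp_MAP_law /= QN /hat_law inversion0.
Qed.

End hat_process.

(** * Duality and time change *)

Section reflection.
Context (R : realType).
Local Open Scope ereal_scope.
Local Notation mu := (@lebesgue_measure R).

Lemma ge0_integral_reflect (t : R) (f : R -> \bar R) :
  measurable_fun setT (f : measurableTypeR R -> _) -> (forall x, 0 <= f x) ->
  \int[mu]_x f (t - x)%R = \int[mu]_x f x.
Proof.
move=> mf f0.
pose g := (fun x : R => t - x)%R : measurableTypeR R -> measurableTypeR R.
have mg : measurable_fun setT g by exact: measurable_funB.
have E A : measurable A -> mu A = pushm mu mg A.
  move=> mA; have := @lebesgue_measure_unique R (pushm mu mg).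
  apply => // _ [[a b]] _ <- /=.
  rewrite /pushm /= /pushforward (_ : g @^-1` _ = `[(t - b)%R, (t - a)%R[%classic); last first.
    apply/seteqP; split => x /=; rewrite !in_itv/= /g;
      by move=> /andP[h1 h2]; apply/andP; split; lra.
  rewrite !lebesgue_measure_itv/= !lte_fin ltrD2l ltrN2.
  by case: ifPn => // _; rewrite -!EFinB; congr EFin; lra.
rewrite [RHS](_ : _ = \int[pushm mu mg]_x f x).
  by rewrite ge0_integral_pushforward.
by apply: eq_measure_integral => A mA _; exact: E.
Qed.

Lemma ge0_integral_reflect_itv (t : R) (f : R -> \bar R) :
  measurable_fun setT (f : measurableTypeR R -> _) -> (forall x, 0 <= f x) ->
  \int[mu]_(x in `[0%R, t]) f (t - x)%R = \int[mu]_(x in `[0%R, t]) f x.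
Proof.
move=> mf f0; pose D : set (measurableTypeR R) := `[0%R, t]%classic.
have mD : measurable D by exact: measurable_itv.
rewrite [RHS]integral_mkcond -(ge0_integral_reflect t).
- rewrite integral_mkcond; apply: eq_integral => x _; rewrite !patchE.
  have -> : ((t - x)%R \in `[0%R, t]%classic) = (x \in `[0%R, t]%classic); last by [].
  by apply/idP/idP; rewrite !inE /= !in_itv/= => /andP[h1 h2]; apply/andP; split; lra.
- by apply: (iffLR (measurable_restrictT _ mD)); exact: measurable_funTS.
- by move=> x; rewrite patchE; case: ifP.
Qed.

End reflection.

Section riemann.
Context (R : realType).
Local Open Scope ereal_scope.
Local Notation mu := (@lebesgue_measure R).
Variables (h : R -> R) (s M : R).
Hypotheses (s0 : (0 < s)%R)
  (mh : measurable_fun (`[0%R, s] : set (measurableTypeR R)) (h : measurableTypeR R -> R))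
  (h0 : forall u, (0 <= h u)%R) (hM : forall u, (0 <= u <= s)%R -> (h u <= M)%R)
  (hr : forall u, (0 <= u < s)%R -> h v @[v --> u^'+] --> h u).

Let node k i : R := (i%:R * (s / k.+1%:R))%R.

Let step k i : set (measurableTypeR R) := `[node k i, node k i.+1[%classic.

Let riemann k (u : measurableTypeR R) : \bar R :=
  \sum_(i < k.+1) (h (node k i.+1))%:E * (\1_(step k i) u)%:E.

Let d0 k : (0 < s / k.+1%:R)%R. Proof. by rewrite divr_gt0. Qed.

Let node_lt k i : (node k i < node k i.+1)%R.
Proof. by rewrite /node ltr_pM2r// ltr_nat. Qed.

Let integral_riemann k : \int[mu]_(u in `[0%R, s[) riemann k u =
  \sum_(i < k.+1) (h (node k i.+1) * (s / k.+1%:R))%:E.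
Proof.
rewrite ge0_integral_sum//; last 2 first.
- move=> i; apply: emeasurable_funM => //; apply/measurable_EFinP.
  by apply: measurable_indic; exact: measurable_itv.
- by move=> i u _; rewrite mule_ge0// lee_fin.
apply: eq_bigr => i _; rewrite ge0_integralZl_EFin//=; last first.
  by apply/measurable_EFinP; apply: measurable_indic; exact: measurable_itv.
rewrite EFinM; congr (_ * _); rewrite integral_indic//=; last exact: measurable_itv.
rewrite setIidl.
  rewrite lebesgue_measure_itv/= lte_fin node_lt -EFinB /node -natr1.
  by congr EFin; ring.
move=> u; rewrite /step/= !in_itv/= => /andP[u1 u2]; apply/andP; split.
  by apply: le_trans u1; rewrite mulr_ge0// ltW.
apply: lt_le_trans u2 _; rewrite /node mulrCA ger_pMr// ler_pdivrMr// mul1r ler_nat.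
exact: ltn_ord.
Qed.

(** The sum is [h] read at the node strictly to the right of [u], whence convergence by right
    continuity alone. *)
Let riemannE k u : (0 <= u < s)%R ->
  riemann k u = (h (s * mesh k (u / s)))%:E.
Proof.
move=> /andP[u0 us]; set j := Num.truncn (u / s * k.+1%:R).
have us0 : (0 <= u / s * k.+1%:R)%R by rewrite mulr_ge0// divr_ge0// ltW.
have /andP[j1 j2] := truncn_itv us0.
have uE : (u = (u / s * k.+1%:R) * (s / k.+1%:R))%R by field; rewrite !gt_eqF// ltr0n.
have jk : (j < k.+1)%N.
  rewrite -(ltr_nat R) (le_lt_trans j1)// -[ltRHS]mul1r ltr_pM2r//.
  by rewrite ltr_pdivrMr// mul1r.
have stepE (i : nat) : \1_(step k i) u = (i == j)%:R :> R.
  rewrite indicE; congr (nat_of_bool _)%:R; apply/idP/eqP.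
    rewrite inE /step/= in_itv/= uE /node !ler_pM2r ?ltr_pM2r// => /andP[i1 i2].
    apply/eqP; rewrite eqn_leq -ltnS -(ltr_nat R) -[X in _ && X]ltnS -[X in _ && X](ltr_nat R).
    by rewrite (le_lt_trans i1 j2) (le_lt_trans j1 i2).
  by move=> ->; rewrite inE /step/= in_itv/= uE /node ler_pM2r ?ltr_pM2r// j1.
rewrite /riemann (bigD1 (Ordinal jk))//= big1; last first.
  by move=> i ij; rewrite stepE (_ : _ == j = false) ?mule0//; apply: contraNF ij => /eqP ij; apply/eqP/val_inj.
by rewrite stepE eqxx mule1 adde0; congr ((h _)%:E); rewrite /node /mesh -/j; ring.
Qed.

Let cvg_node u : (0 <= u < s)%R -> h (s * mesh k (u / s))%R @[k --> \oo] --> h u.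
Proof.
move=> us; have /andP[u0 _] := us.
have us0 : (0 <= u / s)%R by rewrite divr_ge0// ltW.
apply: (@cvg_comp _ _ _ (fun k => s * mesh k (u / s))%R h _ (u^'+)); last exact: hr.
have H : (fun v => s * v)%R @ (u / s)%R^'+ --> u^'+.
  move=> A /at_rightP[e ue eA]; have ue' : (u / s < e / s)%R by rewrite ltr_pM2r ?invr_gt0.
  apply: filterS2 (nbhs_right_gt (u / s)%R) (nbhs_right_lt ue') => v uv ve; apply: eA.
  by rewrite mulrC -ltr_pdivrMr// uv -ltr_pdivlMr.
exact: cvg_comp (cvg_mesh us0) H.
Qed.

(** Dominated convergence with the constant bound [M]: the step functions converge at every point of
    [[0, s[]. *)
Lemma cvg_riemann :
  (s / k.+1%:R * \sum_(i < k.+2) h (i%:R * (s / k.+1%:R)))%:E @[k --> \oo] -->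
  \int[mu]_(u in `[0%R, s]) (h u)%:E.
Proof.
pose D : set (measurableTypeR R) := `[0%R, s[%classic.
have mD : measurable D by exact: measurable_itv.
have DE u : D u -> (0 <= u < s)%R by rewrite /D/= in_itv.
have M0 : (0 <= M)%R by apply: le_trans (h0 0) (hM _); rewrite lexx ltW.
have mr k : measurable_fun D (riemann k).
  apply: emeasurable_sum => i; apply: emeasurable_funM => //; apply/measurable_EFinP.
  by apply: measurable_indic; exact: measurable_itv.
have mh' : measurable_fun D (fun u => (h u)%:E).
  apply/measurable_EFinP; apply: measurable_funS mh; first exact: measurable_itv.
  by move=> u; rewrite /D/= !in_itv/= => /andP[-> /ltW].
have cv : {ae mu, forall u, D u -> riemann ^~ u @ \oo --> (h u)%:E}.
  apply: aeW => u /DE us; under eq_fun do rewrite riemannE//.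
  by apply: cvg_EFin; [exact: nearW|exact: cvg_node].
have ig : mu.-integrable D (cst M%:E).
  apply/integrableP; split => //.
  rewrite -[X in X < _]/(\int[mu]_(x in D) cst `|M%:E| x) integral_cst//.
  have -> : lebesgue_measure_lebesgue_measure__canonical__measure_function_Measure R D = s%:E.
    by apply: etrans (lebesgue_measure_itv _) _; rewrite /= lte_fin s0 sube0.
  by rewrite -EFinM ltry.
have bd : {ae mu, forall u k, D u -> `|riemann k u| <= cst M%:E u}.
  apply: aeW => u k /DE us; rewrite riemannE// abse_EFin lee_fin ger0_norm// hM//.
  have /andP[u0 us'] := us.
  have us0 : (0 <= u / s)%R by rewrite divr_ge0// ltW.
  have su : (u / s * k.+1%:R < k.+1%:R)%R.
    by rewrite -[ltRHS]mul1r ltr_pM2r// ltr_pdivrMr// mul1r.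
  rewrite mulr_ge0 ?mesh_ge0 ?(ltW s0)//= ger_pMr// /mesh ler_pdivrMr// mul1r ler_nat.
  rewrite -(ltr_nat R); apply: le_lt_trans su.
  by have /andP[] := truncn_itv (mulr_ge0 us0 (ler0n R k.+1)).
have [_ _ H] := dominated_convergence mD mr mh' cv ig bd.
rewrite -integral_itv_bndo_bndc; last exact: mh'.
(* Both ends of [[0, s]] are counted, to make the set of nodes symmetric under [u -> s - u]. The
   extra term at node 0 is [s / (k + 1) * h 0], which tends to 0. *)
have -> : (fun k => (s / k.+1%:R * \sum_(i < k.+2) h (i%:R * (s / k.+1%:R)))%:E) =
    (fun k => (s / k.+1%:R * h 0)%:E + \int[mu]_(u in D) riemann k u).
  apply/funext => k; rewrite big_ord_recl mul0r mulrDr EFinD integral_riemann; congr (_ + _).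
  by rewrite mulr_sumr -sumEFin; apply: eq_bigr => i _; rewrite mulrC.
rewrite -[X in _ --> X]add0e; apply: cvgeD.
- by rewrite fin_num_adde_defr.
- apply: cvg_EFin; first exact: nearW.
  rewrite -[X in _ --> X](mul0r (h 0)); apply: cvgMr_tmp.
  rewrite -[X in _ --> X](mulr0 s); apply: cvgMl_tmp.
  exact: cvg_harmonic.
- exact: H.
Qed.

End riemann.

Section weighted_clock.
Context {R : realType} {n : nat}.
Local Notation vec := 'rV[R]_n.+1.
Implicit Types (p : R -> vec) (b s : R).
Local Open Scope ereal_scope.

(* Being a symmetric function of the path, the limit of these sums is the same for
   a path and for the reversed path. *)
Definition riemann_clk b s k p : R :=
  (s / k.+1%:R * \sum_(i < k.+2) wt b (p (i%:R * (s / k.+1%:R))))%R.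

(** An upper limit is defined and measurable for every path, in particular for reversed ones, which
    are not right continuous. *)
Definition sclk b s (p : @path_space R n) : R :=
  fine (limn_esup (fun k => (riemann_clk b s k p)%:E)).

Lemma measurable_sclk b s : (0 <= s)%R ->
  measurable_fun setT (sclk b s : path_space -> measurableTypeR R).
Proof.
move=> s0; apply: (measurableT_comp (@fine_measurable R setT measurableT)).
apply: measurable_fun_limn_esup => k; apply/measurable_EFinP.
apply: measurable_funM => //; apply: measurable_sum => i.
apply: (measurableT_comp (@measurable_wt R n b)).
apply: (@measurable_eval_path R n); by rewrite mulr_ge0// divr_ge0.
Qed.

(** Frozen after [s], as is [rev_path], so that paths on [[0, s]] are elements of the same path
    space. *)
Definition stop_path s p : R -> vec := fun u => p (Num.min u s).

Definition rev_path s p : R -> vec := fun u => p (s - Num.min u s)%R.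

Lemma stop_path_start s p : (0 <= s)%R -> stop_path s p 0 = p 0%R.
Proof. by move=> s0; rewrite /stop_path min_l. Qed.

Lemma stop_path_end s p : stop_path s p s = p s.
Proof. by rewrite /stop_path minxx. Qed.

Lemma rev_path_start s p : (0 <= s)%R -> rev_path s p 0 = p s.
Proof. by move=> s0; rewrite /rev_path min_l// subr0. Qed.

Lemma rev_path_end s p : rev_path s p s = p 0%R.
Proof. by rewrite /rev_path minxx subrr. Qed.

Let node_le s (k : nat) (i : 'I_k.+2) : (0 <= s)%R ->
  (i%:R * (s / k.+1%:R) <= s :> R)%R.
Proof.
move=> s0; rewrite mulrCA -[leRHS]mulr1 ler_wpM2l// ler_pdivrMr// mul1r ler_nat -ltnS.
exact: ltn_ord.
Qed.

Lemma riemann_clk_stop b s k p : (0 <= s)%R ->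
  riemann_clk b s k (stop_path s p) = riemann_clk b s k p.
Proof.
move=> s0; congr (_ * _)%R; apply: eq_bigr => i _.
by rewrite /stop_path min_l//; exact: node_le.
Qed.

(** Reversal exchanges the nodes [i] and [k + 1 - i]. *)
Lemma riemann_clk_rev b s k p : (0 <= s)%R ->
  riemann_clk b s k (rev_path s p) = riemann_clk b s k p.
Proof.
move=> s0; congr (_ * _)%R; rewrite (reindex_inj rev_ord_inj); apply: eq_bigr => i _.
rewrite /rev_path min_l; last exact: node_le.
have E : ((rev_ord i)%:R = k.+1%:R - i%:R :> R)%R.
  by rewrite /= subSS natrB// -ltnS ltn_ord.
have -> : (s - (rev_ord i)%:R * (s / k.+1%:R) = i%:R * (s / k.+1%:R))%R.
  by rewrite E; field; rewrite addrC natr1 pnatr_eq0.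
by [].
Qed.

Lemma cvg_riemann_clk b s p : good p -> (0 <= s)%R -> p s != 0%R ->
  (riemann_clk b s k p)%:E @[k --> \oo] --> clk b p s.
Proof.
move=> gp; rewrite le_eqVlt => /predU1P[<- _|s0 ps].
  rewrite clk0 /riemann_clk; under eq_fun do rewrite !mul0r.
  exact: cvg_cst.
have [M pM] := wt_path_bounded b gp (ltW s0) ps.
apply: (cvg_riemann s0 (h := fun u => wt b (p u))) => //.
- apply/measurable_EFinP; apply: (measurable_wt_path b gp) => //.
  by move=> u; rewrite /= !in_itv/= andbT => /andP[].
- by move=> u; exact: wt_ge0.
- exact: pM.
- move=> u /andP[u0 us]; apply: cvg_wt; last exact: good_right.
  exact: alive_le (ltW us) ps.
Qed.

Lemma sclk_stop b s p : good p -> (0 <= s)%R -> p s != 0%R ->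
  sclk b s (stop_path s p) = fine (clk b p s).
Proof.
move=> gp s0 ps; rewrite /sclk; under eq_fun do rewrite riemann_clk_stop//.
by rewrite (cvg_limn_einf_sup (cvg_riemann_clk gp s0 ps)).2.
Qed.

Lemma sclk_rev b s p : good p -> (0 <= s)%R -> p s != 0%R ->
  sclk b s (rev_path s p) = fine (clk b p s).
Proof.
move=> gp s0 ps; rewrite /sclk; under eq_fun do rewrite riemann_clk_rev//.
by rewrite (cvg_limn_einf_sup (cvg_riemann_clk gp s0 ps)).2.
Qed.

End weighted_clock.

(** The complement of [E] is added to each set of the exhaustion, which then covers the whole space
    while its traces on [E] keep finite measure. *)
Lemma sigma_finite_cover {R : realType} d (T : measurableType d) (E : set T)
    (m : {measure set T -> \bar R}) : measurable E -> sigma_finite E m -> exists g : nat -> set T,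
  [/\ forall k, measurable (g k), \bigcup_k g k = setT & forall k, (m (E `&` g k) < +oo)%E].
Proof.
move=> mE [A AE mA]; exists (fun k => A k `|` ~` E); split.
- by move=> k; apply: measurableU; [exact: (mA k).1|exact: measurableC].
- apply/seteqP; split=> // x _; have [Ex|Ex] := pselect (E x); last by exists 0%N => //; right.
  by move: Ex; rewrite AE => -[k _ Ak]; exists k => //; left.
- move=> k; rewrite (_ : _ `&` _ = A k); first exact: (mA k).2.
  apply/seteqP; split=> x /=; first by move=> [Ex []].
  by move=> Ax; split; [rewrite AE; exists k|left].
Qed.

(** * The measure on paths with initial measure [m] *)

Section path_law.
Context {R : realType} {n : nat} {d : measure_display} {Omega : measurableType d}.
Local Notation vec := 'rV[R]_n.+1.
Local Notation path := (@path_space R n).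
Local Open Scope ereal_scope.
Variables (E : set vec) (F : R -> set (set Omega)) (X : R -> Omega -> vec)
  (P : vec -> probability Omega R).
Hypotheses (mE : measurable (E : set (borel vec))) (vm : vmarkov E F X P).
Variable m : {measure set (borel vec) -> \bar R}.

Definition path_law (x : borel vec) : {measure set path -> \bar R} :=
  pushm (P x) (measurable_X_path vm).

Lemma measurable_path_law C : measurable C -> measurable_fun (E : set (borel vec)) (path_law ^~ C).
Proof.
move=> mC; have := measurable_kernel_path mE vm mC; apply: measurable_funS.
  exact: measurable_state.
exact: subsetUl.
Qed.

Definition pathm : {measure set path -> \bar R} := mixm m mE measurable_path_law.

Lemma pathmE C : pathm C = \int[m]_(x in E) P x [set w | C (X ^~ w)].
Proof. by []. Qed.

Lemma ge0_integral_path_law x (H : path -> \bar R) :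
  measurable_fun setT H -> (forall p, 0 <= H p) ->
  \int[path_law x]_p H p = \int[P x]_w H (X ^~ w).
Proof.
by move=> mH H0; rewrite ge0_integral_pushforward//; exact: (measurable_X_path vm).
Qed.

Lemma ge0_integral_pathm (H : path -> \bar R) :
  measurable_fun setT H -> (forall p, 0 <= H p) ->
  \int[pathm]_p H p = \int[m]_(x in E) \int[P x]_w H (X ^~ w).
Proof.
move=> mH H0.
have [_ ->] := ge0_integral_mixture mE measurable_path_law (nu := pathm)
  (fun B _ => erefl) mH H0.
by apply: eq_integral => x _; exact: ge0_integral_path_law.
Qed.

Lemma pathm_start (B : set (borel vec)) : measurable B ->
  pathm [set p | B (p 0%R)] = m (E `&` B).
Proof.
move=> mB; rewrite pathmE; transitivity (\int[m]_(x in E) (\1_B x)%:E).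
  apply: eq_integral => x; rewrite inE => Ex.
  have := integral_start vm (or_introl Ex) (f := fun y => (\1_B y)%:E).
  move=> /(_ _ _)/= <-//; last first.
    by apply/measurable_EFinP; exact: measurable_indic.
  rewrite integral_indic// ?setIT//.
  rewrite -[X in measurable X]setTI; exact: (measurable_X vm (lexx _)).
by rewrite integral_indic// setIC.
Qed.

Hypothesis sf : sigma_finite (E : set (borel vec)) m.

Lemma pathm_cover : exists g : nat -> set (borel vec),
  [/\ forall k, measurable (g k), \bigcup_k g k = setT &
      forall k, pathm [set p | g k (p 0%R)] < +oo].
Proof.
have [g [mg gT goo]] := sigma_finite_cover mE sf; exists g; split => // k.
by rewrite pathm_start.
Qed.

Let pathm_sigma_finite : sigma_finite setT pathm.
Proof.
have [g [mg gT goo]] := pathm_cover; exists (fun k => [set p : path | g k (p 0%R)]).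
  apply/seteqP; split=> // p _; have : (\bigcup_k g k) (p 0%R) by rewrite gT.
  by move=> [k _ gp]; exists k.
move=> k; split => //.
by apply: sub_sigma_algebra; exists 0%R, (g k).
Qed.

(** A fresh name that can carry the sigma-finite structure which Fubini requires; the exhaustion is
    by the starting point. *)
Definition pathm_alias : set path -> \bar R := pathm.

HB.instance Definition _ := Measure.copy pathm_alias pathm.
HB.instance Definition _ := Measure_isSigmaFinite.Build _ _ _ pathm_alias pathm_sigma_finite.

Definition sf_pathm : {sigma_finite_measure set path -> \bar R} := pathm_alias.

End path_law.

Section duality.
Context {R : realType} {n : nat}.
Local Notation vec := 'rV[R]_n.+1.
Local Notation path := (@path_space R n).
Local Open Scope ereal_scope.

(** Test functions vanish at 0 since the vector 0 stands for the cemetery. *)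
Definition vdual (E : set vec) (m : set (borel vec) -> \bar R)
    d1 (Omega1 : measurableType d1) (X1 : R -> Omega1 -> vec) (P1 : vec -> probability Omega1 R)
    d2 (Omega2 : measurableType d2) (X2 : R -> Omega2 -> vec) (P2 : vec -> probability Omega2 R) :=
  forall (t : R) (f g : vec -> \bar R), (0 <= t)%R ->
    measurable_fun setT (f : borel vec -> \bar R) ->
    measurable_fun setT (g : borel vec -> \bar R) ->
    (forall x, 0 <= f x) -> (forall x, 0 <= g x) -> f 0%R = 0 -> g 0%R = 0 ->
    \int[m]_(x in E) (g x * \int[P1 x]_w f (X1 t w)) =
    \int[m]_(x in E) (f x * \int[P2 x]_w g (X2 t w)).

Lemma vdualC E m d1 (Omega1 : measurableType d1) (X1 : R -> Omega1 -> vec)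
    (P1 : vec -> probability Omega1 R) d2 (Omega2 : measurableType d2)
    (X2 : R -> Omega2 -> vec) (P2 : vec -> probability Omega2 R) :
  vdual E m X1 P1 X2 P2 -> vdual E m X2 P2 X1 P1.
Proof. by move=> H t f g t0 mf mg f0 g0 fz gz; rewrite (H t g f). Qed.

End duality.

(** * Time reversal of the law of the path on [[0, s]] *)

Section reversal.
Context {R : realType} {n : nat}.
Local Notation vec := 'rV[R]_n.+1.
Local Notation path := (@path_space R n).
Local Open Scope ereal_scope.
Context d1 (Omega1 : measurableType d1) d2 (Omega2 : measurableType d2).
Variables (E : set vec) (F1 : R -> set (set Omega1)) (X1 : R -> Omega1 -> vec)
  (P1 : vec -> probability Omega1 R) (F2 : R -> set (set Omega2))
  (X2 : R -> Omega2 -> vec) (P2 : vec -> probability Omega2 R).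
Hypotheses (E0 : ~ E 0%R) (mE : measurable (E : set (borel vec)))
  (vm1 : vmarkov E F1 X1 P1) (vm2 : vmarkov E F2 X2 P2).
Variable m : {measure set (borel vec) -> \bar R}.
Hypotheses (sf : sigma_finite (E : set (borel vec)) m) (dual : vdual E m X1 P1 X2 P2).
Implicit Types (l : seq (R * set vec)) (s t : R) (g f : vec -> \bar R).

Let trans1 := trans E X1 P1.
Let trans2 := trans E X2 P2.
Let cyl1 := cyl_trans E X1 P1.
Let cyl2 := cyl_trans E X2 P2.

Let ind (B : set vec) (y : vec) : \bar R := (\1_B y)%:E.

Let ind_ge0 B y : 0 <= ind B y. Proof. by rewrite lee_fin. Qed.

Let ind0 B : B `<=` E -> ind B 0%R = 0.
Proof. by move=> BE; rewrite /ind indicE memNset// => /BE. Qed.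

Let measurable_ind B : measurable (B : set (borel vec)) ->
  measurable_fun setT (ind B : borel vec -> \bar R).
Proof. by move=> mB; apply/measurable_EFinP; exact: measurable_indic. Qed.

Let dual_trans t f g : (0 <= t)%R ->
    measurable_fun setT (f : borel vec -> \bar R) ->
    measurable_fun setT (g : borel vec -> \bar R) ->
    (forall x, 0 <= f x) -> (forall x, 0 <= g x) -> f 0%R = 0 -> g 0%R = 0 ->
  \int[m]_(x in E) (g x * trans1 t f x) = \int[m]_(x in E) (f x * trans2 t g x).
Proof.
move=> t0 mf mg f0 g0 fz gz; have := dual t0 mf mg f0 g0 fz gz.
move=> H; apply: etrans (etrans H _); apply: eq_integral => x; rewrite inE => Ex.
  by rewrite /trans1 transE//; left.
by rewrite /trans2 transE//; left.
Qed.

(** Carries [g] forward along the windows by the second semigroup, cutting it to each window on the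
    way. *)
Fixpoint dual_acc t g l : vec -> \bar R :=
  if l is (t1, B) :: l' then dual_acc t1 (fun y => ind B y * trans2 (t1 - t) g y) l'
  else g.

Lemma dual_cyl_trans l t g : cyl_wf l -> path.path <=%R t (map fst l) ->
  (forall x, x \in l -> x.2 `<=` E) ->
  measurable_fun setT (g : borel vec -> \bar R) -> (forall y, 0 <= g y) -> g 0%R = 0 ->
  \int[m]_(x in E) (g x * cyl1 t l x) = \int[m]_(x in E) dual_acc t g l x.
Proof.
elim: l t g => [|[t1 B] l IH] t g.
  by move=> _ _ _ mg g0 gz; apply: eq_integral => x _; rewrite mule1.
move=> /cyl_wf_cons[_ mB wl] /= /andP[tt1 pl] lE mg g0 gz.
have BE : B `<=` E by exact: (lE _ (mem_head _ _)).
have lE' x : x \in l -> x.2 `<=` E by move=> xl; apply: lE; rewrite inE xl orbT.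
have s0 : (0 <= t1 - t)%R by rewrite subr_ge0.
have mC := measurable_cyl_trans mE vm1 wl pl.
have mT := measurable_trans mE vm2 s0 mg g0.
have mi := measurable_ind mB.
have T0 y : 0 <= trans2 (t1 - t) g y by exact: trans_ge0.
rewrite (dual_trans s0 (f := fun y => ind B y * cyl1 t1 l y))//; last 3 first.
- exact: emeasurable_funM.
- by move=> y; rewrite mule_ge0// cyl_trans_ge0.
- by rewrite ind0// mul0e.
rewrite -IH//; last 3 first.
- exact: emeasurable_funM.
- by move=> y; rewrite mule_ge0.
- by rewrite ind0// mul0e.
by apply: eq_integral => x _; rewrite -muleA [X in _ * X]muleC muleA.
Qed.

Let flip s (x : R * set vec) := ((s - x.1)%R, x.2).

(** The carried function is again a cylinder function, for the windows read backwards from [s]; the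
    last window becomes the starting one. *)
Lemma dual_accE s A l t B L :
  dual_acc t (fun y => ind B y * cyl2 (s - t) L y) (rcons l (s, A)) =
  (fun y => ind A y * cyl2 0 (catrev (map (flip s) l) ((s - t, B)%R :: L)) y).
Proof.
elim: l t B L => [|[t1 B1] l IH] t B L /=; first by rewrite subr0.
rewrite -[flip s (t1, B1)]/((s - t1)%R, B1) -IH.
by have -> : (t1 - t = s - t - (s - t1))%R by ring.
Qed.

(** The two ends are exchanged: the window [(s, E)] on one side is the start in [E] on the other,
    and conversely. *)
Lemma dual_cyl l s : cyl_wf l -> sorted <=%R (map fst l) -> (0 <= s)%R ->
  (forall x, x \in l -> (x.1 <= s)%R) -> (forall x, x \in l -> x.2 `<=` E) ->
  \int[m]_(x in E) P1 x [set w | cyl (rcons l (s, E)) (X1 ^~ w)] =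
  \int[m]_(x in E) P2 x [set w | cyl (catrev (map (flip s) l) [:: (s, E)]) (X2 ^~ w)].
Proof.
move=> wl sl s0 ls lE.
have le_tr : transitive (<=%R : rel R) by exact: le_trans.
have wl' : cyl_wf (rcons l (s, E)).
  by move=> x; rewrite mem_rcons inE => /predU1P[->//|]; exact: wl.
have pl' : path.path <=%R 0%R (map fst (rcons l (s, E))).
  rewrite path_sortedE// map_rcons all_rcons s0/=; apply/andP; split.
    by apply/allP => _ /mapP[x xl ->]; have [] := wl x xl.
  rewrite -rev_sorted rev_rcons /= path_sortedE; last by move=> x y z /[swap]; exact: le_trans.
  rewrite rev_sorted sl andbT; apply/allP => y; rewrite mem_rev => /mapP[x xl ->].
  exact: ls.
have lE' x : x \in rcons l (s, E) -> x.2 `<=` E.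
  by rewrite mem_rcons inE => /predU1P[->//|]; exact: lE.
have flipP x : x \in catrev (map (flip s) l) [:: (s, E)] ->
    exists2 y, (y \in l) || (y == (0%R, E)) & x = flip s y.
  rewrite -[X in _ \in X]/(rev ((s, E) :: map (flip s) l)) mem_rev inE.
  move=> /predU1P[->|/mapP[y yl ->]]; last by exists y => //; rewrite yl.
  by exists (0%R, E); rewrite ?eqxx ?orbT// /flip subr0.
have wr : cyl_wf (catrev (map (flip s) l) [:: (s, E)]).
  move=> x /flipP[y /orP[yl|/eqP ->] ->] /=; last by rewrite subr0.
  by rewrite subr_ge0 ls//; have [] := wl y yl.
have pr : path.path <=%R 0%R (map fst (catrev (map (flip s) l) [:: (s, E)])).
  rewrite path_sortedE//; apply/andP; split.
    by apply/allP => _ /mapP[x xl ->]; have [] := wr x xl.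
  rewrite -[catrev _ _]/(rev ((s, E) :: map (flip s) l)) map_rev rev_sorted /=.
  rewrite path_sortedE; last by move=> x y z /[swap]; exact: le_trans.
  apply/andP; split.
    apply/allP => _ /mapP[_ /mapP[x xl ->] ->] /=.
    by rewrite gerBl; have [] := wl x xl.
  rewrite -map_comp; move: sl; rewrite !sorted_map; apply: sub_sorted => x y /=.
  by move=> xy; rewrite /= lerB.
transitivity (\int[m]_(x in E) (ind E x * cyl1 0 (rcons l (s, E)) x)).
  apply: eq_integral => x; rewrite inE => Ex; rewrite /ind indicE mem_set// mul1e.
  by rewrite (cyl_law mE vm1)//; left.
rewrite dual_cyl_trans//; last 2 first.
- exact: measurable_ind.
- exact: ind0.
have -> : ind E = (fun y => ind E y * cyl2 (s - 0) [::] y).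
  by apply/funext => y; rewrite /= mule1.
rewrite dual_accE; apply: eq_integral => x; rewrite inE => Ex.
rewrite /ind indicE mem_set// mul1e subr0.
by rewrite (cyl_law mE vm2)//; left.
Qed.

Lemma measurable_stop_path s : (0 <= s)%R ->
  measurable_fun setT (stop_path s : path -> path).
Proof.
move=> s0; apply: measurable_paths => t t0; apply: (@measurable_eval_path R n).
by rewrite le_min t0.
Qed.

Lemma measurable_rev_path s : (0 <= s)%R ->
  measurable_fun setT (rev_path s : path -> path).
Proof.
move=> s0; apply: measurable_paths => t t0; apply: (@measurable_eval_path R n).
by rewrite subr_ge0 ge_min lexx orbT.
Qed.

Lemma measurable_path_in s : (0 <= s)%R -> measurable [set p : path | E (p s)].
Proof. by move=> s0; apply: sub_sigma_algebra; exists s, E. Qed.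

Let pathE d (Omega : measurableType d) F (X : R -> Omega -> vec) P s t w :
  vmarkov E F X P -> (0 <= t)%R -> (t <= s)%R -> E (X s w) -> E (X t w).
Proof.
move=> vm t0 ts Es; have [//|xt] := vm_state vm w t0.
by case: E0; rewrite -(good_absorbed (vm_good vm w) t0 ts xt).
Qed.

Let pathm1 := pathm mE vm1 m.
Let pathm2 := pathm mE vm2 m.

(** Both sides are measures in [C], so cylinders with increasing times suffice. Being alive at [s]
    is part of the event because duality sees living states only. *)
Lemma pathm_reversal s (C : set path) : (0 <= s)%R -> measurable C ->
  pathm1 [set p | E (p s) /\ C (stop_path s p)] =
  pathm2 [set p | E (p s) /\ C (rev_path s p)].
Proof.
move=> s0 mC; have mS := measurable_path_in s0.
pose m1 := pushm (mrestr pathm1 mS) (measurable_stop_path s0).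
pose m2 := pushm (mrestr pathm2 mS) (measurable_rev_path s0).
have m1E (D : set path) : m1 D = pathm1 [set p | E (p s) /\ D (stop_path s p)].
  by rewrite /m1 /pushm /= /pushforward /mrestr setIC.
have m2E (D : set path) : m2 D = pathm2 [set p | E (p s) /\ D (rev_path s p)].
  by rewrite /m2 /pushm /= /pushforward /mrestr setIC.
have [g [mg gT goo]] := pathm_cover mE vm1 sf.
rewrite -m1E -m2E; apply: (path_measure_unique_sigma_finite (g := g)) => //.
  move=> k; rewrite m1E; apply: le_lt_trans (goo k); apply: le_measure.
  - rewrite inE; apply: measurableI => //.
    rewrite -[X in measurable X]setTI; apply: (measurable_stop_path s0) => //.
    by apply: sub_sigma_algebra; exists 0%R, (g k).
  - by rewrite inE; apply: sub_sigma_algebra; exists 0%R, (g k).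
  - by move=> p [_] /=; rewrite /stop_path min_l.
move=> l wl sl; rewrite m1E m2E.
(* Times after [s] are replaced by [s], where the stopped path is frozen, and windows are cut to
   [E], where a path alive at [s] has been all along. The event is unchanged and [dual_cyl]
   applies. *)
pose l' := [seq (Num.min x.1 s, x.2 `&` E) | x <- l].
have wl' : cyl_wf l'.
  move=> _ /mapP[x xl ->] /=; have [x0 mx] := wl x xl; split; first by rewrite le_min x0.
  exact: measurableI.
have sl' : sorted <=%R (map fst l').
  rewrite -map_comp; move: sl; rewrite !sorted_map; apply: sub_sorted => x y /=.
  by move=> xy; exact: le_min2.
have l's x : x \in l' -> (x.1 <= s)%R.
  by move=> /mapP[y _ ->]; rewrite /= ge_min lexx orbT.
have l'E x : x \in l' -> x.2 `<=` E by move=> /mapP[y _ ->] z [].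
have H := dual_cyl wl' sl' s0 l's l'E.
have S1 : [set w | cyl (rcons l' (s, E)) (X1 ^~ w)] =
    [set w | E (X1 s w) /\ cyl l (stop_path s (X1 ^~ w))].
  apply/seteqP; split=> w.
  - move=> cs; split; first by apply: (cs (s, E)); rewrite mem_rcons mem_head.
    move=> y yl; have := cs (Num.min y.1 s, y.2 `&` E); rewrite mem_rcons inE.
    by rewrite (map_f (fun x => (Num.min x.1 s, x.2 `&` E)) yl) orbT => /(_ isT)[].
  - move=> [Es cs] y; rewrite mem_rcons inE => /predU1P[->//|/mapP[z zl ->]] /=.
    split; first by have := cs _ zl.
    have [z0 _] := wl z zl.
    by apply: (pathE vm1) Es; rewrite ?le_min ?z0// ge_min lexx orbT.
have S2 : [set w | cyl (catrev (map (flip s) l') [:: (s, E)]) (X2 ^~ w)] =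
    [set w | E (X2 s w) /\ cyl l (rev_path s (X2 ^~ w))].
  apply/seteqP; split=> w.
  - move=> cs.
    have cs' y : y \in (s, E) :: [seq ((s - x.1)%R, x.2) | x <- l'] -> y.2 (X2 y.1 w).
      by move=> yl; apply: cs; rewrite -[X in _ \in X]/(rev (_ :: _)) mem_rev.
    split; first by apply: (cs' (s, E)); rewrite mem_head.
    move=> y yl; have := cs' ((s - Num.min y.1 s)%R, y.2 `&` E); rewrite inE -map_comp.
    by rewrite (map_f (fun x => ((s - Num.min x.1 s)%R, x.2 `&` E)) yl) orbT => /(_ isT)[].
  - move=> [Es cs] y; rewrite -[X in _ \in X]/(rev (_ :: _)) mem_rev inE.
    move=> /predU1P[->//|]; rewrite -map_comp => /mapP[z zl ->] /=.
    split; first by have := cs _ zl.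
    have [z0 _] := wl z zl.
    apply: (pathE vm2) Es; first by rewrite subr_ge0 ge_min lexx orbT.
    by rewrite gerBl le_min z0.
by move: H; rewrite S1 S2.
Qed.

Lemma ge0_integral_pathm_reversal s (H : path -> \bar R) : (0 <= s)%R ->
  measurable_fun setT H -> (forall p, 0 <= H p) ->
  \int[pathm1]_(p in [set p | E (p s)]) H (stop_path s p) =
  \int[pathm2]_(p in [set p | E (p s)]) H (rev_path s p).
Proof.
move=> s0 mH H0; have mS := measurable_path_in s0.
have mp := measurable_stop_path s0; have mr := measurable_rev_path s0.
have E1 : \int[pathm1]_(p in [set p | E (p s)]) H (stop_path s p) =
    \int[pushm (mrestr pathm1 mS) mp]_p H p.
  rewrite (ge0_integral_pushm _ mp mH H0); apply/esym.
  exact: (ge0_integral_mrestr pathm1 mS (measurableT_comp mH mp) (fun p => H0 _)).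
have E2 : \int[pathm2]_(p in [set p | E (p s)]) H (rev_path s p) =
    \int[pushm (mrestr pathm2 mS) mr]_p H p.
  rewrite (ge0_integral_pushm _ mr mH H0); apply/esym.
  exact: (ge0_integral_mrestr pathm2 mS (measurableT_comp mH mr) (fun p => H0 _)).
rewrite E1 E2; apply: eq_measure_integral => A mA _.
have := pathm_reversal s0 mA; rewrite /pushm /= /pushforward /mrestr.
by rewrite ![_ @^-1` A `&` _]setIC.
Qed.

End reversal.

(** * Joint measurability and the exchange of integrals over time and chance *)

Section joint_measurability.
Local Open Scope ereal_scope.

(** Dynkin's lemma reduces the claim to rectangles, where the integral is a product. Finiteness of
    the kernel is used for complements. *)
Lemma measurable_integral_kernel_prod {R : realType} d0 (T0 : measurableType d0)
    d1 (T1 : measurableType d1) d2 (T2 : measurableType d2) (D : set T1)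
    (k : T1 -> {measure set T2 -> \bar R}) (f : T0 * T2 -> \bar R) :
  measurable D -> (forall B, measurable B -> measurable_fun D (k ^~ B)) ->
  (forall x, D x -> k x setT < +oo) ->
  measurable_fun setT f -> (forall z, 0 <= f z) ->
  measurable_fun (setT `*` D) (fun z : T0 * T1 => \int[k z.2]_y f (z.1, y)).
Proof.
move=> mD mk koo mf f0.
have mp (z : T0 * T1) : measurable_fun setT (fun y : T2 => (z.1, y)).
  exact: measurable_fun_pair.
pose k2 z := pushm (k z.2) (mp z).
have mTD : measurable (setT `*` D : set (T0 * T1)) by exact: measurableX.
have mk2 B : measurable B -> measurable_fun (setT `*` D) (fun z => k2 z B).
  move=> mB; have : <<s [set A `*` C | A in @measurable _ T0 & C in @measurable _ T2] >> B.
    by rewrite -measurable_prod_measurableType.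
  apply: (@dynkin_induction _ (T0 * T2)%type _
    (fun B => measurable_fun (setT `*` D) (fun z => k2 z B))
    (measurable_prod_measurableType _ _)).
  - move=> _ _ [A1 mA1 [C1 mC1 <-]] [A2 mA2 [C2 mC2 <-]]; rewrite -setXI.
    exists (A1 `&` A2); first exact: measurableI.
    by exists (C1 `&` C2) => //; exact: measurableI.
  - apply: (@measurable_comp _ _ _ _ _ _ D (k ^~ setT)) => //.
    + by move=> _ [z [_ Dz] <-].
    + exact: mk.
    + exact: measurable_funTS.
  - move=> _ [A mA [C mC <-]].
    apply: (@eq_measurable_fun _ _ _ _ _ (fun z => (\1_A z.1)%:E * k z.2 C)).
      move=> z _; rewrite /k2 /pushm /= /pushforward indicE.
      have [Az|Az] := pselect (A z.1).
        by rewrite mem_set// mul1e; congr (k z.2 _); apply/seteqP; split=> y; [|case].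
      rewrite memNset// mul0e (_ : _ @^-1` _ = set0) ?measure0//.
      by apply/seteqP; split=> // y [].
    apply: emeasurable_funM.
      apply/measurable_EFinP; apply: measurable_funTS.
      have mI : measurable_fun setT (\1_A : T0 -> R) by exact: measurable_indic.
      exact: (measurableT_comp mI measurable_fst).
    apply: (@measurable_comp _ _ _ _ _ _ D (k ^~ C)) => //.
    + by move=> _ [z [_ Dz] <-].
    + exact: mk.
    + exact: measurable_funTS.
  - move=> S mS H; apply: (@eq_measurable_fun _ _ _ _ _ (fun z => k z.2 setT - k2 z S)).
      move=> z; rewrite inE => -[_ Dz]; rewrite /k2 /pushm /= /pushforward preimage_setC.
      have mS' : measurable ((fun y : T2 => (z.1, y)) @^-1` S).
        by have := mp z measurableT _ mS; rewrite setTI.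
      have := measureD measurableT mS' (koo _ Dz); rewrite setTD setTI => <-.
      by [].
    apply: emeasurable_funB => //.
    apply: (@measurable_comp _ _ _ _ _ _ D (k ^~ setT)) => //.
    + by move=> _ [z [_ Dz] <-].
    + exact: mk.
    + exact: measurable_funTS.
  - move=> S mS tS H.
    apply: (@eq_measurable_fun _ _ _ _ _ (fun z => \sum_(0 <= i <oo) k2 z (S i))).
      move=> z _; apply/cvg_lim => //; apply: measure_semi_sigma_additive => //.
      exact: bigcupT_measurable.
    by apply: ge0_emeasurable_sum => // i z _ _; exact: measure_ge0.
have := measurable_integral_kernel mTD mk2 mf f0.
by apply: eq_measurable_fun => z _; rewrite ge0_integral_pushm.
Qed.

Context {R : realType} {n : nat} d (T : measurableType d).
Local Notation vec := 'rV[R]_n.+1.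
Local Notation mu := (@lebesgue_measure R).

Lemma measurable_clk_prod (Z : R -> T -> vec) b :
  (forall t, (0 <= t)%R -> measurable_fun setT (Z t : T -> borel vec)) ->
  measurable_fun setT (fun z : measurableTypeR R * T => clk b (path_reg Z z.2) z.1).
Proof.
move=> mZ.
pose f (q : (measurableTypeR R * T) * measurableTypeR R) : \bar R :=
  (((0 <= q.2) && (q.2 <= q.1.1))%R%:R)%:E * (wt b (reg Z (q.2, q.1.2)))%:E.
have mf : measurable_fun setT f.
  apply: emeasurable_funM; apply/measurable_EFinP.
    apply: (@measurableT_comp _ _ _ _ _ _ (fun b : bool => b%:R : R)) => //.
    apply: measurable_and; apply: measurable_fun_ler => //.
    exact: (measurableT_comp measurable_fst measurable_fst).
  apply: (measurableT_comp (measurable_wt b)).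
  apply: (measurableT_comp (measurable_reg mZ)).
  apply: measurable_fun_pair => //.
  exact: (measurableT_comp measurable_snd measurable_fst).
have f0 q : 0 <= f q by rewrite mule_ge0// lee_fin ?wt_ge0.
have := measurable_fun_fubini_tonelli_F (m2 := mu) f mf f0.
apply: eq_measurable_fun => z _; rewrite /fubini_F /clk [RHS]integral_mkcond.
apply: eq_integral => u _; rewrite patchE /f /=.
have -> : (u \in `[0%R, z.1]%classic) = ((0 <= u) && (u <= z.1))%R.
  by apply/idP/idP; rewrite inE/= in_itv.
by case: ifP => _; rewrite ?mul1e ?mul0e.
Qed.

Let halfline (h : measurableTypeR R * T -> \bar R) (z : measurableTypeR R * T) : \bar R :=
  ((0 <= z.1)%R%:R)%:E * h z.

Let measurable_halfline h : measurable_fun setT h -> measurable_fun setT (halfline h).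
Proof.
move=> mh; apply: emeasurable_funM => //; apply/measurable_EFinP.
apply: (@measurableT_comp _ _ _ _ _ _ (fun b : bool => b%:R : R)) => //.
exact: measurable_fun_ler.
Qed.

Let halfline_ge0 h : (forall z, 0 <= h z) -> forall z, 0 <= halfline h z.
Proof. by move=> h0 z; rewrite mule_ge0// lee_fin. Qed.

Let in_halfline (s : R) : (s \in `[0%R, +oo[%classic) = (0 <= s)%R.
Proof. by apply/idP/idP; rewrite inE/= in_itv/= andbT. Qed.

Let integral_halflineE (h : measurableTypeR R * T -> \bar R) p :
  \int[mu]_s halfline h (s, p) = \int[mu]_(s in `[0%R, +oo[) h (s, p).
Proof.
rewrite [RHS]integral_mkcond; apply: eq_integral => s _.
by rewrite patchE in_halfline /halfline /=; case: ifP => s0; rewrite ?mul1e ?mul0e.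
Qed.

Lemma measurable_integral_halfline (h : measurableTypeR R * T -> \bar R) :
  measurable_fun setT h -> (forall z, 0 <= h z) ->
  measurable_fun setT (fun p => \int[mu]_(s in `[0%R, +oo[) h (s, p)).
Proof.
move=> mh h0.
have := measurable_fun_fubini_tonelli_G (m1 := mu) _ (measurable_halfline mh) (halfline_ge0 h0).
by apply: eq_measurable_fun => p _; rewrite /fubini_G integral_halflineE.
Qed.

Lemma ge0_fubini_halfline (m : {sigma_finite_measure set T -> \bar R})
    (h : measurableTypeR R * T -> \bar R) :
  measurable_fun setT h -> (forall z, 0 <= h z) ->
  \int[mu]_(s in `[0%R, +oo[) \int[m]_p h (s, p) =
  \int[m]_p \int[mu]_(s in `[0%R, +oo[) h (s, p).
Proof.
move=> mh h0.
have H := fubini_tonelli (m1 := mu) (m2 := m) _ (measurable_halfline mh) (halfline_ge0 h0).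
apply: etrans (etrans H _).
  rewrite integral_mkcond; apply: eq_integral => s _; rewrite patchE in_halfline /halfline /=.
  case: ifP => s0; first by apply: eq_integral => p _; rewrite mul1e.
  by apply/esym/integral0_eq => p _; rewrite mul0e.
by apply: eq_integral => p _; exact: integral_halflineE.
Qed.

End joint_measurability.

Section halfline.
Context {R : realType} {n : nat}.
Local Notation vec := 'rV[R]_n.+1.
Local Notation mu := (@lebesgue_measure R).
Local Open Scope ereal_scope.

Lemma integral_halfline_alive (p : R -> vec) (h : R -> \bar R) :
  (forall t, (0 <= t)%R -> p t = 0%R -> h t = 0) ->
  \int[mu]_(t in `[0%R, +oo[) h t = \int[mu]_(t in alive p) h t.
Proof.
move=> h0; rewrite [LHS]integral_mkcond [RHS]integral_mkcond; apply: eq_integral => t _.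
rewrite !patchE; have [t0|t0] := leP 0%R t.
  rewrite mem_set/= ?in_itv/= ?t0//.
  have [pt|pt] := eqVneq (p t) 0%R; last by rewrite mem_set.
  by rewrite memNset ?h0// => -[_]; rewrite pt eqxx.
rewrite !memNset//; first by move=> [t0' _]; move: t0; rewrite ltNge t0'.
by rewrite /= in_itv/= andbT; apply/negP; rewrite -ltNge.
Qed.

(** Since [K] vanishes at the dead state, both integrals run over living times only, where
    [r = clk b p s] is a legitimate substitution. *)
Lemma change_of_time_halfline b (p : R -> vec) (K : measurableTypeR R * borel vec -> \bar R) :
  good p -> measurable_fun setT K -> (forall z, 0 <= K z) -> (forall r, K (r, 0%R) = 0) ->
  \int[mu]_(s in `[0%R, +oo[) (K (fine (clk b p s), p s) * (wt b (p s))%:E) =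
  \int[mu]_(r in `[0%R, +oo[) K (r, tc b p r).
Proof.
move=> gp mK K0 Kz; pose D : set (measurableTypeR R) := `[0%R, +oo[%classic.
have mD : measurable D by exact: measurable_itv.
have mp : measurable_fun D (tc b p : measurableTypeR R -> borel vec).
  exact: (measurable_path (good_tc b gp)).
pose q : measurableTypeR R -> borel vec := (tc b p : measurableTypeR R -> borel vec) \_ D.
have mq : measurable_fun setT q by exact: (iffLR (measurable_restrictT _ mD)).
have qE r : (0 <= r)%R -> q r = tc b p r.
  by move=> r0; rewrite /q patchE mem_set// /D/= in_itv/= r0.
pose f (r : measurableTypeR R) : \bar R := K (r, q r).
have mf : measurable_fun setT f.
  by apply: (measurableT_comp mK); exact: measurable_fun_pair.
have f0 r : 0 <= f r by exact: K0.
rewrite [RHS](integral_halfline_alive (p := tc b p)); last by move=> t _ ->.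
rewrite [LHS](integral_halfline_alive (p := p)); last by move=> t _ ->; rewrite Kz mul0e.
rewrite (_ : \int[mu]_(t in alive (tc b p)) _ = \int[mu]_(t in alive (tc b p)) f t); last first.
  by apply: eq_integral => t; rewrite inE => -[t0 _]; rewrite /f qE.
apply/esym; apply: etrans (ge0_change_of_time b gp mf f0) _.
apply: eq_integral => s; rewrite inE => -[s0 ps]; congr (_ * _).
have cE : (fine (clk b p s))%:E = clk b p s by rewrite fineK// clk_fin.
rewrite /f qE; last by rewrite -lee_fin cE clk_ge0.
by rewrite (tcE gp s0 ps (esym cE)).
Qed.

End halfline.

(** * Duality integrated over time *)

Section space_time_duality.
Context {R : realType} {n : nat}.
Local Notation vec := 'rV[R]_n.+1.
Local Notation path := (@path_space R n).
Local Notation mu := (@lebesgue_measure R).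
Local Open Scope ereal_scope.
Variable b : R.

Definition ev (z : measurableTypeR R * path) : vec := reg eval_path z.

Definition tc_ev (z : measurableTypeR R * path) : vec := reg (tc_path b) z.

Definition clk_ev (z : measurableTypeR R * path) : R :=
  fine (clk b (path_reg eval_path z.2) z.1).

Lemma measurable_ev : measurable_fun setT (ev : _ -> borel vec).
Proof. by apply: measurable_reg => t; exact: measurable_eval_path. Qed.

Lemma measurable_tc_ev : measurable_fun setT (tc_ev : _ -> borel vec).
Proof. by apply: measurable_reg => t _; exact: measurable_tc_path. Qed.

Lemma measurable_clk_ev : measurable_fun setT (clk_ev : _ -> measurableTypeR R).
Proof.
apply: (measurableT_comp (@fine_measurable R setT measurableT)).
by apply: measurable_clk_prod => t; exact: measurable_eval_path.
Qed.

Lemma evE s p : good p -> (0 <= s)%R -> ev (s, p) = p s.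
Proof. by move=> gp s0; rewrite /ev reg_right//; exact: good_right. Qed.

Lemma tc_evE s p : good p -> (0 <= s)%R -> tc_ev (s, p) = tc b p s.
Proof.
move=> gp s0; rewrite /tc_ev reg_right//; first exact: tc_pathE.
rewrite tc_pathE//; move=> A /(good_right (good_tc b gp) s0) As.
apply: filterS2 (nbhs_right_gt s) As => u su Au /=.
by rewrite tc_pathE// (le_trans s0)// ltW.
Qed.

Lemma clk_evE s p : good p -> clk_ev (s, p) = fine (clk b p s).
Proof. by move=> gp; rewrite /clk_ev /= clk_regE. Qed.

Context d1 (Omega1 : measurableType d1) d2 (Omega2 : measurableType d2).
Variables (E : set vec) (F1 : R -> set (set Omega1)) (X1 : R -> Omega1 -> vec)
  (P1 : vec -> probability Omega1 R) (F2 : R -> set (set Omega2))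
  (X2 : R -> Omega2 -> vec) (P2 : vec -> probability Omega2 R).
Hypotheses (E0 : ~ E 0%R) (mE : measurable (E : set (borel vec)))
  (vm1 : vmarkov E F1 X1 P1) (vm2 : vmarkov E F2 X2 P2).
Variable m : {measure set (borel vec) -> \bar R}.
Hypotheses (sf : sigma_finite (E : set (borel vec)) m) (dual : vdual E m X1 P1 X2 P2).

Let pathm1 := pathm mE vm1 m.
Let pathm2 := pathm mE vm2 m.

(** The measure is carried by the trajectories of the process, so integrands need only agree there,
    where all versions by meshes coincide with the true quantities. *)
Lemma eq_integral_pathm d (Omega : measurableType d) F (X : R -> Omega -> vec) P
    (vm : vmarkov E F X P) (H H' : path -> \bar R) :
  measurable_fun setT H -> (forall p, 0 <= H p) ->
  measurable_fun setT H' -> (forall p, 0 <= H' p) ->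
  (forall w, H (X ^~ w) = H' (X ^~ w)) ->
  \int[pathm mE vm m]_p H p = \int[pathm mE vm m]_p H' p.
Proof.
move=> mH H0 mH' H'0 HH'; rewrite !ge0_integral_pathm//.
by apply: eq_integral => x _; apply: eq_integral => w _.
Qed.

Variables (g : borel vec -> \bar R) (K : measurableTypeR R * borel vec -> \bar R).
Hypotheses (mg : measurable_fun setT g) (g0 : forall x, 0 <= g x) (gz : g 0%R = 0)
  (mK : measurable_fun setT K) (K0 : forall z, 0 <= K z) (Kz : forall r, K (r, 0%R) = 0).

Let W (x : borel vec) : \bar R := (wt b x)%:E.

Let mW : measurable_fun setT W.
Proof. by apply/measurable_EFinP; exact: measurable_wt. Qed.

Let W0 x : 0 <= W x. Proof. by rewrite lee_fin wt_ge0. Qed.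

Let mp0 : measurable_fun setT (fun p : path => p 0%R : borel vec).
Proof. exact: (@measurable_eval_path R n 0%R (lexx _)). Qed.

Let mp0' : measurable_fun setT (fun z : measurableTypeR R * path => z.2 0%R : borel vec).
Proof. exact: (measurableT_comp mp0 measurable_snd). Qed.

(** The weight at the end is the Jacobian of the substitution of the clock. The weight at the start
    is put in for the other side: reversal exchanges the two ends, and it becomes the Jacobian
    there, in [h2]. *)
Let h1 (z : measurableTypeR R * path) : \bar R :=
  g (z.2 0%R) * W (z.2 0%R) * K (clk_ev z, ev z) * W (ev z).

Let h2 (z : measurableTypeR R * path) : \bar R :=
  W (z.2 0%R) * K (clk_ev z, z.2 0%R) * g (ev z) * W (ev z).

Let mh1 : measurable_fun setT h1.
Proof.
apply: emeasurable_funM; last exact: (measurableT_comp mW measurable_ev).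
apply: emeasurable_funM; last first.
  apply: (measurableT_comp mK).
  exact: (measurable_fun_pair measurable_clk_ev measurable_ev).
by apply: emeasurable_funM; [exact: (measurableT_comp mg mp0')|exact: (measurableT_comp mW mp0')].
Qed.

Let mh2 : measurable_fun setT h2.
Proof.
apply: emeasurable_funM; last exact: (measurableT_comp mW measurable_ev).
apply: emeasurable_funM; last exact: (measurableT_comp mg measurable_ev).
apply: emeasurable_funM; first exact: (measurableT_comp mW mp0').
apply: (measurableT_comp mK).
exact: (measurable_fun_pair measurable_clk_ev mp0').
Qed.

Let h1_ge0 z : 0 <= h1 z. Proof. by rewrite /h1 !mule_ge0. Qed.

Let h2_ge0 z : 0 <= h2 z. Proof. by rewrite /h2 !mule_ge0. Qed.

Let reversal s : (0 <= s)%R ->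
  \int[pathm1]_p h1 (s, p) = \int[pathm2]_p h2 (s, p).
Proof.
(* [H] reads the clock through [sclk], which has the same value on the stopped and on the reversed
   path, so that one functional gives [h1] before reversal and [h2] after it. *)
move=> s0; pose H (q : path) : \bar R :=
  g (q 0%R) * W (q 0%R) * K (sclk b s q, q s) * W (q s).
have mps : measurable_fun setT (fun p : path => p s : borel vec).
  exact: (@measurable_eval_path R n s s0).
have mH : measurable_fun setT H.
  apply: emeasurable_funM; last exact: (measurableT_comp mW mps).
  apply: emeasurable_funM; last first.
    apply: (measurableT_comp mK).
    exact: (measurable_fun_pair (measurable_sclk b s0) mps).
  by apply: emeasurable_funM; [exact: (measurableT_comp mg mp0)|exact: (measurableT_comp mW mp0)].
have H0 q : 0 <= H q by rewrite /H !mule_ge0.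
have mS := measurable_path_in mE s0.
have mI : measurable_fun setT (fun p : path => (\1_[set p : path | E (p s)] p)%:E : \bar R).
  by apply/measurable_EFinP; exact: measurable_indic.
have mst := measurableT_comp mH (measurable_stop_path s0).
have mrv := measurableT_comp mH (measurable_rev_path s0).
have indE (m' : {measure set path -> \bar R}) (f : path -> \bar R) :
    \int[m']_(p in [set p | E (p s)]) f p =
    \int[m']_p ((\1_[set p : path | E (p s)] p)%:E * f p).
  rewrite integral_mkcond; apply: eq_integral => p _; rewrite patchE indicE.
  by case: ifP => _; rewrite ?mul1e ?mul0e.
have i0 (p : path) : 0 <= (\1_[set p : path | E (p s)] p)%:E :> \bar R by rewrite lee_fin.
have mh1s : measurable_fun setT (fun p => h1 (s, p)).
  by apply: (measurableT_comp mh1); exact: measurable_fun_pair.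
have mh2s : measurable_fun setT (fun p => h2 (s, p)).
  by apply: (measurableT_comp mh2); exact: measurable_fun_pair.
transitivity (\int[pathm1]_(p in [set p | E (p s)]) H (stop_path s p)).
  rewrite indE; apply: (eq_integral_pathm vm1 mh1s (fun p => h1_ge0 (s, p))
    (emeasurable_funM mI mst)).
    by move=> p; exact: (mule_ge0 (i0 p) (H0 _)).
  move=> w; have gw := vm_good vm1 w; rewrite indicE.
  have [Es|xs] := vm_state vm1 w s0; last first.
    by rewrite memNset /= ?xs// mul0e /h1 (evE gw s0) xs Kz mule0 mul0e.
  have xs0 : X1 s w != 0%R by apply/eqP => xs; apply: E0; rewrite -xs.
  rewrite mem_set// mul1e /h1 /comp /H (evE gw s0) (clk_evE s gw) (sclk_stop b gw s0 xs0).
  by rewrite (stop_path_start _ s0) stop_path_end.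
rewrite (ge0_integral_pathm_reversal E0 mE vm1 vm2 sf dual s0 mH H0) indE.
apply: (eq_integral_pathm vm2 (emeasurable_funM mI mrv) _ mh2s (fun p => h2_ge0 (s, p))).
  by move=> p; exact: (mule_ge0 (i0 p) (H0 _)).
move=> w; have gw := vm_good vm2 w; rewrite indicE.
have [Es|xs] := vm_state vm2 w s0; last first.
  by rewrite memNset /= ?xs// mul0e /h2 (evE gw s0) xs gz mule0 mul0e.
have xs0 : X2 s w != 0%R by apply/eqP => xs; apply: E0; rewrite -xs.
rewrite mem_set// mul1e /h2 /comp /H (evE gw s0) (clk_evE s gw) (sclk_rev b gw s0 xs0).
rewrite (rev_path_start _ s0) rev_path_end -[LHS]muleA muleC.
by rewrite [X in X * _ = _]muleC muleA.
Qed.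

Let change1 : \int[mu]_(s in `[0%R, +oo[) \int[pathm1]_p h1 (s, p) =
  \int[mu]_(r in `[0%R, +oo[) \int[pathm1]_p
    (g (p 0%R) * W (p 0%R) * K (r, tc_ev (r, p))).
Proof.
pose k (z : measurableTypeR R * path) := g (z.2 0%R) * W (z.2 0%R) * K (z.1, tc_ev z).
have mk : measurable_fun setT k.
  apply: emeasurable_funM; last first.
    apply: (measurableT_comp mK); apply: measurable_fun_pair => //.
    exact: measurable_tc_ev.
  by apply: emeasurable_funM; [exact: (measurableT_comp mg mp0')|exact: (measurableT_comp mW mp0')].
have k0 z : 0 <= k z by rewrite /k !mule_ge0.
have F1' := ge0_fubini_halfline (sf_pathm mE vm1 sf) mh1 h1_ge0.
have F2' := ge0_fubini_halfline (sf_pathm mE vm1 sf) mk k0.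
apply: (etrans F1' (etrans _ (esym F2'))); apply: eq_integral_pathm.
- exact: measurable_integral_halfline.
- by move=> p; apply: integral_ge0 => s _.
- exact: measurable_integral_halfline.
- by move=> p; apply: integral_ge0 => s _.
move=> w; have gw := vm_good vm1 w.
pose K' z := g (X1 0%R w) * W (X1 0%R w) * K z.
have mK' : measurable_fun setT K' by apply: emeasurable_funM.
have := change_of_time_halfline b gw mK' (fun z => _) (fun r => _).
move=> /(_ _ _)H; apply: etrans (etrans (H _ _) _).
- apply: eq_integral => s; rewrite inE/= in_itv/= andbT => s0.
  by rewrite /h1 (evE gw s0) (clk_evE s gw).
- by move=> z; rewrite /K' !mule_ge0.
- by move=> r; rewrite /K' Kz mule0.
apply: eq_integral => r; rewrite inE/= in_itv/= andbT => r0.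
by rewrite /k (tc_evE gw r0).
Qed.

Let change2 : \int[mu]_(s in `[0%R, +oo[) \int[pathm2]_p h2 (s, p) =
  \int[mu]_(r in `[0%R, +oo[) \int[pathm2]_p
    (W (p 0%R) * K (r, p 0%R) * g (tc_ev (r, p))).
Proof.
pose k (z : measurableTypeR R * path) := W (z.2 0%R) * K (z.1, z.2 0%R) * g (tc_ev z).
have mk : measurable_fun setT k.
  apply: emeasurable_funM; last exact: (measurableT_comp mg measurable_tc_ev).
  apply: emeasurable_funM; first exact: (measurableT_comp mW mp0').
  by apply: (measurableT_comp mK); exact: measurable_fun_pair.
have k0 z : 0 <= k z by rewrite /k !mule_ge0.
have F1' := ge0_fubini_halfline (sf_pathm mE vm2 sf) mh2 h2_ge0.
have F2' := ge0_fubini_halfline (sf_pathm mE vm2 sf) mk k0.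
apply: (etrans F1' (etrans _ (esym F2'))); apply: eq_integral_pathm.
- exact: measurable_integral_halfline.
- by move=> p; apply: integral_ge0 => s _.
- exact: measurable_integral_halfline.
- by move=> p; apply: integral_ge0 => s _.
move=> w; have gw := vm_good vm2 w.
pose K' (z : measurableTypeR R * borel vec) := W (X2 0%R w) * K (z.1, X2 0%R w) * g z.2.
have mK' : measurable_fun setT K'.
  apply: emeasurable_funM; last exact: (measurableT_comp mg measurable_snd).
  apply: emeasurable_funM => //; apply: (measurableT_comp mK).
  exact: measurable_fun_pair.
have K'0 z : 0 <= K' z by rewrite /K' !mule_ge0.
have K'z r : K' (r, 0%R) = 0 by rewrite /K' /= gz mule0.
have H := change_of_time_halfline b gw mK' K'0 K'z.
apply: etrans (etrans H _); apply: eq_integral => s; rewrite inE/= in_itv/= andbT => s0.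
  by rewrite /h2 (evE gw s0) (clk_evE s gw).
by rewrite /k (tc_evE gw s0).
Qed.

(* Reverse the path from the time [s], then substitute [r = clk b p s], which turns
   [wt b (p s) ds] into [dr]: reversal does not change the value of the clock. *)
Lemma space_time_duality :
  \int[mu]_(r in `[0%R, +oo[) \int[m]_(x in E)
    \int[P1 x]_w (g (X1 0%R w) * W (X1 0%R w) * K (r, tcX X1 b r w)) =
  \int[mu]_(r in `[0%R, +oo[) \int[m]_(x in E)
    \int[P2 x]_w (W (X2 0%R w) * K (r, X2 0%R w) * g (tcX X2 b r w)).
Proof.
transitivity (\int[mu]_(s in `[0%R, +oo[) \int[pathm1]_p h1 (s, p)).
  rewrite change1; apply: eq_integral => r; rewrite inE/= in_itv/= andbT => r0.
  rewrite /pathm1 (ge0_integral_pathm mE vm1); last 2 first.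
  - apply: emeasurable_funM.
      by apply: emeasurable_funM; [exact: (measurableT_comp mg mp0)|exact: (measurableT_comp mW mp0)].
    apply: (measurableT_comp mK); apply: measurable_fun_pair => //.
    by apply: (measurableT_comp measurable_tc_ev); exact: measurable_fun_pair.
  - by move=> p; rewrite !mule_ge0.
  apply: eq_integral => x _; apply: eq_integral => w _.
  by rewrite (tc_evE (vm_good vm1 w) r0).
transitivity (\int[mu]_(s in `[0%R, +oo[) \int[pathm2]_p h2 (s, p)).
  by apply: eq_integral => s; rewrite inE/= in_itv/= andbT => s0; exact: reversal.
rewrite change2; apply: eq_integral => r; rewrite inE/= in_itv/= andbT => r0.
rewrite /pathm2 (ge0_integral_pathm mE vm2); last 2 first.
- apply: emeasurable_funM; last first.
    apply: (measurableT_comp mg).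
    by apply: (measurableT_comp measurable_tc_ev); exact: measurable_fun_pair.
  apply: emeasurable_funM; first exact: (measurableT_comp mW mp0).
  by apply: (measurableT_comp mK); exact: measurable_fun_pair.
- by move=> p; rewrite !mule_ge0.
apply: eq_integral => x _; apply: eq_integral => w _.
by rewrite (tc_evE (vm_good vm2 w) r0).
Qed.

End space_time_duality.

(** * Transition functions as jointly measurable functions of time and starting point *)

Section transition.
Context {R : realType} {n : nat} {d : measure_display} {Omega : measurableType d}.
Local Notation vec := 'rV[R]_n.+1.
Local Notation path := (@path_space R n).
Local Open Scope ereal_scope.
Variables (E : set vec) (F : R -> set (set Omega)) (X : R -> Omega -> vec)
  (P : vec -> probability Omega R).
Hypotheses (E0 : ~ E 0%R) (mE : measurable (E : set (borel vec))) (vm : vmarkov E F X P).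
Implicit Types (f : vec -> \bar R) (s t u : R).

Let measurable_start x : measurable [set w | X 0%R w = x].
Proof.
have -> : [set w | X 0%R w = x] = X 0%R @^-1` [set x] by [].
rewrite -[X in measurable X]setTI; apply: (measurable_X vm (lexx _)) => //.
exact: measurable_set1_vec.
Qed.

Let started x : state E x -> P x (~` [set w | X 0%R w = x]) = 0.
Proof.
move=> Ex; apply: etrans (probability_setC (P x) (measurable_start x)) _.
by rewrite (vm_start vm Ex) subee.
Qed.

Lemma integral_start_mul x f (v : Omega -> \bar R) : state E x ->
  measurable_fun setT (f : borel vec -> \bar R) -> (forall y, 0 <= f y) ->
  measurable_fun setT v -> (forall w, 0 <= v w) ->
  \int[P x]_w (f (X 0%R w) * v w) = f x * \int[P x]_w v w.
Proof.
move=> Ex mf f0 mv v0; rewrite -ge0_integralZl//.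
have mX0 := measurable_X vm (lexx 0%R).
apply: ge0_ae_eq_integral => //.
- by apply: emeasurable_funM => //; exact: (measurableT_comp mf mX0).
- exact: emeasurable_funM.
- by move=> w _; rewrite mule_ge0.
- by move=> w _; rewrite mule_ge0.
exists (~` [set w | X 0%R w = x]); split; last by apply: subsetC => w /= ->.
  exact: measurableC.
exact: started.
Qed.

Lemma integral_dead s f : (0 <= s)%R ->
  measurable_fun setT (f : borel vec -> \bar R) -> (forall y, 0 <= f y) ->
  \int[P 0%R]_w f (X s w) = f 0%R.
Proof.
move=> s0 mf f0; have E00 : state E 0%R by right.
rewrite -[RHS](integral_start vm E00 mf f0).
have mX t : (0 <= t)%R -> measurable_fun setT (fun w => f (X t w)).
  by move=> t0; exact: (measurableT_comp mf (measurable_X vm t0)).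
apply: ge0_ae_eq_integral => //; [exact: mX|exact: mX|].
exists (~` [set w | X 0%R w = 0%R]); split.
- exact: measurableC.
- exact: started.
- apply: subsetC => w /= Xw _.
  by rewrite (good_absorbed (vm_good vm w) (lexx _) s0 Xw) Xw.
Qed.

(** Zero at negative times and outside [E], which makes it measurable on the whole product; the
    value 0 at negative times also truncates integrals over the half-line. *)
Definition transition f (z : measurableTypeR R * borel vec) : \bar R :=
  if (0 <= z.1)%R && (z.2 \in E) then \int[P z.2]_w f (X z.1 w) else 0.

Lemma transition_ge0 f z : (forall y, 0 <= f y) -> 0 <= transition f z.
Proof. by move=> f0; rewrite /transition; case: ifP => // _; exact: integral_ge0. Qed.

Lemma measurable_transition f : measurable_fun setT (f : borel vec -> \bar R) ->
  (forall y, 0 <= f y) -> measurable_fun setT (transition f).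
Proof.
move=> mf f0.
pose h (z : measurableTypeR R * path) : \bar R := ((0 <= z.1)%R%:R)%:E * f (ev z).
have mh : measurable_fun setT h.
  apply: emeasurable_funM; last exact: (measurableT_comp mf (@measurable_ev R n)).
  apply/measurable_EFinP.
  apply: (@measurableT_comp _ _ _ _ _ _ (fun b : bool => b%:R : R)) => //.
  exact: measurable_fun_ler.
have h0 z : 0 <= h z by rewrite /h mule_ge0// lee_fin.
have koo (x : borel vec) : E x -> path_law vm x setT < +oo.
  by move=> _; rewrite /path_law /pushm /= /pushforward preimage_setT probability_setT ltry.
have := measurable_integral_kernel_prod mE (measurable_path_law mE vm) koo mh h0.
move=> /(iffLR (measurable_restrictT _ _)) H.
have mTE : measurable (setT `*` E : set (measurableTypeR R * borel vec)).
  exact: measurableX.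
move: (H mTE); apply: eq_measurable_fun => -[u x] _; rewrite patchE /transition /=.
have -> : ((u, x) \in setT `*` (E : set (borel vec))) = (x \in E).
  by apply/idP/idP; rewrite !inE; [case|split].
case: ifPn => Ex; last by rewrite andbF.
rewrite andbT (ge0_integral_path_law vm)//; last first.
  by apply: (measurableT_comp mh); exact: measurable_fun_pair.
rewrite /h /=; case: ifPn => u0.
  by apply: eq_integral => w _; rewrite mul1e (evE (vm_good vm w) u0).
by apply: integral0_eq => w _; rewrite mul0e.
Qed.

Lemma transition_trans s f y : (0 <= s)%R -> state E y ->
  measurable_fun setT (f : borel vec -> \bar R) -> (forall y, 0 <= f y) -> f 0%R = 0 ->
  trans E X P s f y = transition f (s, y).
Proof.
move=> s0 Ey mf f0 fz; rewrite transE// /transition /= s0/=.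
case: Ey => [Ey|->]; first by rewrite mem_set.
by rewrite memNset// integral_dead.
Qed.

(** The semigroup property, from the strong Markov property at a constant time. *)
Lemma transitionD s t x f : (0 <= s)%R -> (0 <= t)%R -> E x ->
  measurable_fun setT (f : borel vec -> \bar R) -> (forall y, 0 <= f y) -> f 0%R = 0 ->
  \int[P x]_w transition f (t, X s w) = \int[P x]_w f (X (s + t)%R w).
Proof.
move=> s0 t0 Ex mf f0 fz.
have sT : stopping_time F (cst s%:E).
  split=> [w|u u0]; first by rewrite lee_fin.
  have [su|us] := leP s u.
    rewrite (_ : [set _ | _] = setT); first exact: F_setT vm _ u0.
    by apply/seteqP; split=> // w _; rewrite /= lee_fin.
  rewrite (_ : [set _ | _] = set0); first exact: F_set0 vm _ u0.
  by apply/seteqP; split=> // w /=; rewrite lee_fin leNgt us.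
have := strong_markov_fun mE vm sT (stopped_setT sT) t0 (or_introl Ex) mf f0.
have -> : setT `&` [set w | cst s%:E w < +oo] = setT :> set Omega.
  by apply/seteqP; split=> // w _; split => //=; rewrite ltry.
move=> -> /=; apply: eq_integral => w _; apply/esym.
by apply: transition_trans => //; exact: (vm_state vm).
Qed.

End transition.

(** * Duality of the time-changed processes at a fixed time *)

Section duality_time_change.
Context {R : realType} {n : nat}.
Local Notation vec := 'rV[R]_n.+1.
Local Notation path := (@path_space R n).
Local Notation mu := (@lebesgue_measure R).
Local Open Scope ereal_scope.

Lemma integral_cst_itv (c : \bar R) (t : R) : (0 < t)%R ->
  \int[mu]_(r in `[0%R, t]) c = t%:E * c.
Proof.
move=> t0; pose D : set (measurableTypeR R) := `[0%R, t]%classic.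
rewrite -[LHS]/(\int[mu]_(r in D) cst c r) integral_cst; last exact: measurable_itv.
rewrite muleC; congr (_ * _); apply: etrans (lebesgue_measure_itv _) _.
by rewrite /= lte_fin t0 sube0.
Qed.

Section half.
Context d1 (Omega1 : measurableType d1) d2 (Omega2 : measurableType d2).
Variables (b : R).
Variables (E : set vec) (F1 : R -> set (set Omega1)) (X1 : R -> Omega1 -> vec)
  (P1 : vec -> probability Omega1 R) (F2 : R -> set (set Omega2))
  (X2 : R -> Omega2 -> vec) (P2 : vec -> probability Omega2 R).
Hypotheses (E0 : ~ E 0%R) (mE : measurable (E : set (borel vec)))
  (vm1 : vmarkov E F1 X1 P1) (vm2 : vmarkov E F2 X2 P2).
Variable m : {measure set (borel vec) -> \bar R}.
Hypotheses (sf : sigma_finite (E : set (borel vec)) m) (dual : vdual E m X1 P1 X2 P2).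
Implicit Types (f g : vec -> \bar R) (t r : R).

Let W (x : borel vec) : \bar R := (wt b x)%:E.

Let mW : measurable_fun setT W.
Proof. by apply/measurable_EFinP; exact: measurable_wt. Qed.

Let W0 x : 0 <= W x. Proof. by rewrite lee_fin wt_ge0. Qed.

Let Y1 := tcX X1 b.
Let Y2 := tcX X2 b.

Let vmY1 := vmarkov_tc b E0 mE vm1.
Let vmY2 := vmarkov_tc b E0 mE vm2.

Let U1 := transition E Y1 P1.
Let U2 := transition E Y2 P2.

(* By the semigroup property the left-hand side is an average over [r] in [0, t],
   [r] being the time spent after reversal.  Exchanging the two processes and
   [r] with [t - r] leaves the right-hand side invariant. *)
Lemma time_change_average t f g : (0 < t)%R ->
  measurable_fun setT (f : borel vec -> \bar R) ->
  measurable_fun setT (g : borel vec -> \bar R) ->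
  (forall x, 0 <= f x) -> (forall x, 0 <= g x) -> f 0%R = 0 -> g 0%R = 0 ->
  t%:E * \int[m]_(x in E) (g x * W x * \int[P1 x]_w f (Y1 t w)) =
  \int[mu]_(r in `[0%R, t]) \int[m]_(x in E) (W x * (U1 f (t - r, x)%R * U2 g (r, x))).
Proof.
move=> t0 mf mg f0 g0 fz gz.
pose K (z : measurableTypeR R * borel vec) := U1 f ((t - z.1)%R, z.2).
have mU1 : measurable_fun setT (U1 f) by exact: (measurable_transition mE vmY1 mf f0).
have mK : measurable_fun setT K.
  apply: (measurableT_comp mU1); apply: measurable_fun_pair => //.
  exact: measurable_funB.
have K0 z : 0 <= K z by exact: transition_ge0.
have Kz r : K (r, 0%R) = 0 by rewrite /K /U1 /transition /= memNset// andbF.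
(* No duration longer than [t] can be completed to [t], so the integrals over the half-line stop at
   [t]. *)
have KE r y : (t < r)%R -> K (r, y) = 0.
  by move=> tr; rewrite /K /U1 /transition /= subr_ge0 leNgt tr.
have := space_time_duality b E0 mE vm1 vm2 sf dual mg g0 gz mK K0 Kz.
have mKr r : measurable_fun setT (fun y : borel vec => K (r, y)).
  exact: (measurableT_comp mK (measurable_fun_pair (@measurable_cst _ _ _ _ _ r)
    (@measurable_id _ _ _))).
have half (h : R -> \bar R) : (forall r, (t < r)%R -> h r = 0) ->
    \int[mu]_(r in `[0%R, +oo[) h r = \int[mu]_(r in `[0%R, t]) h r.
  move=> h0; rewrite [LHS]integral_mkcond [RHS]integral_mkcond; apply: eq_integral => r _.
  rewrite !patchE; have [rt|tr] := leP r t.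
    have -> : (r \in `[0%R, +oo[%classic) = (r \in `[0%R, t]%classic); last by [].
    by apply/idP/idP; rewrite !inE/= !in_itv/= rt andbT.
  rewrite [in RHS]memNset; last by rewrite /= in_itv/= => /andP[_]; rewrite leNgt tr.
  by case: ifP => // _; exact: h0.
rewrite half; last first.
  move=> r tr; apply: integral0_eq => x _; apply: integral0_eq => w _.
  by rewrite KE// mule0.
rewrite half; last first.
  move=> r tr; apply: integral0_eq => x _; apply: integral0_eq => w _.
  by rewrite KE// mule0 mul0e.
have mY1 u : (0 <= u)%R -> measurable_fun setT (Y1 u : Omega1 -> borel vec).
  by move=> u0; exact: (measurable_X vmY1 u0).
have mY2 u : (0 <= u)%R -> measurable_fun setT (Y2 u : Omega2 -> borel vec).
  by move=> u0; exact: (measurable_X vmY2 u0).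
move=> H; apply: etrans (etrans H _).
  rewrite -(integral_cst_itv _ t0).
  apply: eq_integral => r; rewrite inE/= in_itv/= => /andP[r0 rt].
  apply: eq_integral => x; rewrite inE => Ex.
  rewrite (integral_start_mul vm1 (or_introl Ex) (f := fun y => g y * W y)
    (v := fun w => K (r, tcX X1 b r w))); last 4 first.
  - exact: emeasurable_funM.
  - by move=> y; rewrite mule_ge0.
  - by have := measurableT_comp mK (measurable_fun_pair (@measurable_cst _ _ _ _ _ r) (mY1 r r0)).
  - by move=> w; exact: K0.
  congr (_ * _); have tr0 : (0 <= t - r)%R by rewrite subr_ge0.
  have := transitionD E0 mE vmY1 r0 tr0 Ex mf f0 fz.
  by rewrite subrKC => ->.
apply: eq_integral => r; rewrite inE/= in_itv/= => /andP[r0 rt].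
apply: eq_integral => x; rewrite inE => Ex.
rewrite (integral_start_mul vm2 (or_introl Ex) (f := fun y => W y * K (r, y))
    (v := fun w => g (tcX X2 b r w))); last 4 first.
- exact: (emeasurable_funM mW (mKr r)).
- by move=> y; exact: (mule_ge0 (W0 y) (K0 _)).
- exact: (measurableT_comp mg (mY2 r r0)).
- by move=> w; exact: g0.
by rewrite -muleA /K /= /U2 /transition /= r0 mem_set.
Qed.

End half.

Section full.
Context d1 (Omega1 : measurableType d1) d2 (Omega2 : measurableType d2).
Variables (b : R).
Variables (E : set vec) (F1 : R -> set (set Omega1)) (X1 : R -> Omega1 -> vec)
  (P1 : vec -> probability Omega1 R) (F2 : R -> set (set Omega2))
  (X2 : R -> Omega2 -> vec) (P2 : vec -> probability Omega2 R).
Hypotheses (E0 : ~ E 0%R) (mE : measurable (E : set (borel vec)))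
  (vm1 : vmarkov E F1 X1 P1) (vm2 : vmarkov E F2 X2 P2).
Variable m : {measure set (borel vec) -> \bar R}.
Hypotheses (sf : sigma_finite (E : set (borel vec)) m) (dual : vdual E m X1 P1 X2 P2).
Implicit Types (f g : vec -> \bar R) (t r : R).

Let W (x : borel vec) : \bar R := (wt b x)%:E.

Let mW : measurable_fun setT W.
Proof. by apply/measurable_EFinP; exact: measurable_wt. Qed.

Let W0 x : 0 <= W x. Proof. by rewrite lee_fin wt_ge0. Qed.

Let Y1 := tcX X1 b.
Let Y2 := tcX X2 b.
Let vmY1 := vmarkov_tc b E0 mE vm1.
Let vmY2 := vmarkov_tc b E0 mE vm2.
Let U1 := transition E Y1 P1.
Let U2 := transition E Y2 P2.

(** The average identity is used for both orders of the two processes. The reflection [r -> t - r]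
    of [[0, t]] identifies the two right-hand sides, and the factor [t > 0] is cancelled; at [t = 0]
    both processes are at their start. *)
Lemma vdual_time_change t f g : (0 <= t)%R ->
  measurable_fun setT (f : borel vec -> \bar R) ->
  measurable_fun setT (g : borel vec -> \bar R) ->
  (forall x, 0 <= f x) -> (forall x, 0 <= g x) -> f 0%R = 0 -> g 0%R = 0 ->
  \int[m]_(x in E) (g x * W x * \int[P1 x]_w f (tcX X1 b t w)) =
  \int[m]_(x in E) (f x * W x * \int[P2 x]_w g (tcX X2 b t w)).
Proof.
rewrite le_eqVlt => /predU1P[<- |t0] mf mg f0 g0 fz gz.
  apply: eq_integral => x; rewrite inE => Ex.
  rewrite (integral_start vmY1 (or_introl Ex) mf f0) (integral_start vmY2 (or_introl Ex) mg g0).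
  by rewrite muleC -[RHS]muleA [W x * _]muleC.
have H1 := time_change_average b E0 mE vm1 vm2 sf dual t0 mf mg f0 g0 fz gz.
have H2 := time_change_average b E0 mE vm2 vm1 sf (vdualC dual) t0 mg mf g0 f0 gz fz.
have tinj (x y : \bar R) : t%:E * x = t%:E * y -> x = y.
  move=> xy; apply/eqP; rewrite eq_le -(lee_pmul2l (x := t%:E))//.
  by rewrite -[X in _ && X](lee_pmul2l (x := t%:E))// xy lexx.
apply: tinj; apply: (etrans H1 (etrans _ (esym H2))).
pose Psi (r : R) : \bar R := \int[m]_(x in E) (W x * (U1 f (t - r, x)%R * U2 g (r, x))).
pose k (z : measurableTypeR R * path) : \bar R :=
  W (z.2 0%R) * (U1 f ((t - z.1)%R, z.2 0%R) * U2 g (z.1, z.2 0%R)).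
have mU1 : measurable_fun setT (U1 f) by exact: (measurable_transition mE vmY1 mf f0).
have mU2 : measurable_fun setT (U2 g) by exact: (measurable_transition mE vmY2 mg g0).
have U10 z : 0 <= U1 f z by exact: transition_ge0.
have U20 z : 0 <= U2 g z by exact: transition_ge0.
have mp0 : measurable_fun setT (fun p : path => p 0%R : borel vec).
  exact: (@measurable_eval_path R n 0%R (lexx _)).
have mp0' : measurable_fun setT (fun z : measurableTypeR R * path => z.2 0%R : borel vec).
  exact: (measurableT_comp mp0 measurable_snd).
have mk : measurable_fun setT k.
  apply: emeasurable_funM; first exact: (measurableT_comp mW mp0').
  apply: emeasurable_funM.
    apply: (measurableT_comp mU1); apply: measurable_fun_pair => //.
    exact: measurable_funB.
  by apply: (measurableT_comp mU2); exact: measurable_fun_pair.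
have k0 z : 0 <= k z by rewrite /k !mule_ge0.
(* Fubini needs a sigma-finite measure on a whole space, while [m] is only known to be so on [E];
   the measure on paths is used instead, with an integrand that depends on the starting point
   alone. *)
have mPsi : measurable_fun setT (Psi : measurableTypeR R -> \bar R).
  have := measurable_fun_fubini_tonelli_F (m2 := sf_pathm mE vm1 sf) k mk k0.
  apply: eq_measurable_fun => r _; rewrite /fubini_F.
  have mkr : measurable_fun setT (fun p => k (r, p)).
    by apply: (measurableT_comp mk); exact: measurable_fun_pair.
  apply: etrans (ge0_integral_pathm mE vm1 m mkr (fun p => k0 (r, p))) _.
  apply: eq_integral => x; rewrite inE => Ex.
  pose h (y : borel vec) := W y * (U1 f ((t - r)%R, y) * U2 g (r, y)).
  have mh : measurable_fun setT h.
    apply: emeasurable_funM => //; apply: emeasurable_funM.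
      by apply: (measurableT_comp mU1); exact: measurable_fun_pair.
    by apply: (measurableT_comp mU2); exact: measurable_fun_pair.
  have h0 y : 0 <= h y by rewrite /h !mule_ge0.
  exact: (integral_start vm1 (or_introl Ex) mh h0).
have Psi0 r : 0 <= Psi r by apply: integral_ge0 => x _; rewrite !mule_ge0.
rewrite -[LHS]/(\int[mu]_(r in `[0%R, t]) Psi r) -(ge0_integral_reflect_itv t mPsi Psi0).
apply: eq_integral => r _; apply: eq_integral => x _; congr (_ * _).
by rewrite muleC subKr.
Qed.

End full.
End duality_time_change.

(** * Polar coordinates and reversibility *)

Section graph_measure.
Local Open Scope ereal_scope.
Context d1 d2 (T1 : measurableType d1) (T2 : measurableType d2) (R : realType).
Variables (m : {measure set T1 -> \bar R}) (D : set T1) (mD : measurable D).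
Variables (k : T1 -> {measure set T2 -> \bar R}).
Hypotheses (mk : forall B, measurable B -> measurable_fun D (k ^~ B))
  (koo : forall x, D x -> k x setT < +oo).

Let mpair (x : T1) : measurable_fun setT (fun y : T2 => (x, y)).
Proof. exact: measurable_fun_pair. Qed.

Let kpair x := pushm (k x) (mpair x).

Let measurable_kpair B : measurable B -> measurable_fun D (kpair ^~ B).
Proof.
move=> mB; have mI : measurable_fun setT (fun z : T1 * T2 => (\1_B z)%:E : \bar R).
  by apply/measurable_EFinP; exact: measurable_indic.
have I0 (z : T1 * T2) : 0 <= (\1_B z)%:E :> \bar R by rewrite lee_fin.
have H := measurable_integral_kernel_prod mD mk koo mI I0.
apply: (@eq_measurable_fun _ _ _ _ _ (fun x => \int[k x]_y (\1_B (x, y))%:E)).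
  move=> x _; rewrite /kpair /pushm /= /pushforward.
  rewrite -[LHS]/(\int[k x]_y (\1_((fun y => (x, y)) @^-1` B) y)%:E) integral_indic ?setIT//.
  by rewrite -[X in measurable X]setTI; exact: mpair.
apply: (@measurable_comp _ _ _ _ _ _ (setT `*` D)
  (fun z : T1 * T1 => \int[k z.2]_y (\1_B (z.1, y))%:E) D (fun x => (x, x))).
- exact: measurableX.
- by move=> _ [x Dx <-].
- exact: H.
- by apply: measurable_funTS; exact: measurable_fun_pair.
Qed.

(** The joint law of a starting point drawn from [m] on [D] and of an endpoint drawn from the
    kernel. *)
Definition graphm : {measure set (T1 * T2)%type -> \bar R} := mixm m mD measurable_kpair.

Lemma graphmE B : graphm B = \int[m]_(x in D) k x [set y | B (x, y)].
Proof. by []. Qed.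

Lemma ge0_integral_graphm (h : T1 * T2 -> \bar R) :
  measurable_fun setT h -> (forall z, 0 <= h z) ->
  \int[graphm]_z h z = \int[m]_(x in D) \int[k x]_y h (x, y).
Proof.
move=> mh h0.
have [_ ->] := ge0_integral_mixture mD measurable_kpair (nu := graphm) (fun B _ => erefl) mh h0.
by apply: eq_integral => x _; rewrite ge0_integral_pushm.
Qed.

Lemma measurable_integral_graph (h : T1 * T2 -> \bar R) :
  measurable_fun setT h -> (forall z, 0 <= h z) ->
  measurable_fun D (fun x => \int[k x]_y h (x, y)).
Proof.
move=> mh h0.
have [+ _] := ge0_integral_mixture mD measurable_kpair (nu := graphm) (fun B _ => erefl) mh h0.
by apply: eq_measurable_fun => x _; rewrite ge0_integral_pushm.
Qed.

End graph_measure.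

(** * [Lambda pi] and [nu alpha pi] in polar coordinates, and their sigma-finiteness *)

Section polar_measure.
Context {R : realType} {n : nat}.
Local Notation vec := 'rV[R]_n.+1.
Local Notation mu := (@lebesgue_measure R).
Local Open Scope ereal_scope.
Variables (S : set vec) (pi : {sigma_finite_measure set (borel vec) -> \bar R}).
Hypotheses (SS : S `<=` sphere) (mE : measurable (cone S : set (borel vec)))
  (piS : pi (~` S) = 0).

(** The base is the set of points of norm 1 of the cone, which is Borel. *)
Lemma measurable_sphere_base : measurable (S : set (borel vec)).
Proof.
have -> : S = cone S `&` (@enorm R n @^-1` [set 1%R]).
  apply/seteqP; split=> x /=.
    by move=> Sx; split; [exists (x, 0%R); rewrite // /phi/= expR0 scale1r|exact: SS].
  move=> [[[y z] [/= Sy _] <-]]; rewrite (enorm_phi SS)// -expR0 => /expR_inj ->.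
  by rewrite /phi/= expR0 scale1r.
apply: measurableI => //; rewrite -[X in measurable X]setTI.
exact: (@measurable_enorm R n).
Qed.

Lemma cone_base x : S x -> cone S x.
Proof. by move=> Sx; exists (x, 0%R); rewrite // /phi/= expR0 scale1r. Qed.

Lemma ge0_integral_Lambda (h : vec -> \bar R) :
  measurable_fun setT (h : borel vec -> \bar R) -> (forall x, 0 <= h x) ->
  \int[Lambda pi]_(x in cone S) h x =
  \int[pi]_(y in S) \int[mu]_z h (expR z *: y)%R.
Proof.
move=> mh h0; pose h' (x : borel vec) := (\1_(cone S) x)%:E * h x.
have mh' : measurable_fun setT h'.
  by apply: emeasurable_funM => //; apply/measurable_EFinP; exact: measurable_indic.
have h'0 x : 0 <= h' x by rewrite mule_ge0// lee_fin.
have hE x : cone S x -> h' x = h x by move=> Ex; rewrite /h' indicE mem_set// mul1e.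
transitivity (\int[Lambda pi]_x h' x).
  rewrite integral_mkcond; apply: eq_integral => x _; rewrite patchE /h' indicE.
  by case: ifP => _; rewrite ?mul1e ?mul0e.
have -> : \int[Lambda pi]_x h' x = \int[(pi \x mu)%E]_p h' (phi p).
  exact: (ge0_integral_pushforward (@measurable_phi R n) (pi \x mu)%E measurableT mh' (fun x _ => h'0 x)).
have mhp : measurable_fun setT (fun p : borel vec * measurableTypeR R => h' (phi p)).
  exact: (measurableT_comp mh' (@measurable_phi R n)).
have -> := fubini_tonelli1 (m1 := pi) (m2 := mu) _ mhp (fun p => h'0 _).
rewrite /fubini_F.
transitivity (\int[pi]_(y in S) \int[mu]_z h' (phi (y, z))).
  have mF := measurable_fun_fubini_tonelli_F (m2 := mu) _ mhp (fun p => h'0 _).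
  have mS := measurable_sphere_base.
  have mSC : measurable (~` S : set (borel vec)) by exact: measurableC.
  rewrite (ge0_negligible_integral (N := ~` S : set (borel vec))) //.
  - by rewrite setTD setCK.
  - by move=> y _; apply: integral_ge0 => z _; exact: h'0.
apply: eq_integral => y; rewrite inE => Sy; apply: eq_integral => z _.
by rewrite hE//; exists (y, z).
Qed.

Definition angle (x : vec) : vec := (enorm x)^-1 *: x.

Lemma measurable_angle : measurable_fun setT (angle : borel vec -> borel vec).
Proof.
apply: measurable_fun_borel_vec => i; under eq_fun do rewrite /angle mxE.
apply: measurable_funM; last exact: measurable_coord.
apply: eq_measurable_fun (measurable_wt (-1)) => x _.
by rewrite /wt powR_inv1 ?enorm_ge0.
Qed.

Lemma measurable_ln_enorm :
  measurable_fun setT (fun x : borel vec => ln (enorm x) : measurableTypeR R).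
Proof. exact: (measurableT_comp (@measurable_ln R) (@measurable_enorm R n)). Qed.

Lemma angle_phi y z : S y -> angle (phi (y, z)) = y.
Proof.
move=> Sy; rewrite /angle (enorm_phi SS)// /phi/= scalerA mulVf ?scale1r// gt_eqF//.
exact: expR_gt0.
Qed.

Lemma ln_enorm_phi y z : S y -> ln (enorm (phi (y, z))) = z.
Proof. by move=> Sy; rewrite (enorm_phi SS)// expRK. Qed.

(** In polar coordinates, a product of [A] and of the bounded interval [[-k, k]] for the logarithm
    of the norm, so its mass is finite as soon as [pi A] is. *)
Definition shell (A : set (borel vec)) (k : nat) : set (borel vec) :=
  cone S `&` (angle @^-1` A `&` [set x | (`|ln (enorm x)| <= k%:R)%R]).

Lemma measurable_shell A k : measurable A -> measurable (shell A k).
Proof.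
move=> mA; apply: measurableI => //; apply: measurableI.
  by rewrite -[X in measurable X]setTI; exact: measurable_angle.
have -> : [set x : borel vec | (`|ln (enorm x)| <= k%:R)%R] =
    (fun x => ln (enorm x)) @^-1` `[(- k%:R)%R, k%:R]%classic.
  by apply/seteqP; split=> x /=; rewrite in_itv/= ler_norml.
by rewrite -[X in measurable X]setTI; apply: measurable_ln_enorm => //; exact: measurable_itv.
Qed.

Lemma Lambda_shell A k : measurable A -> pi A < +oo -> Lambda pi (shell A k) < +oo.
Proof.
move=> mA Aoo; have mSh := measurable_shell k mA.
have mI : measurable_fun setT (fun x : borel vec => (\1_(shell A k) x)%:E : \bar R).
  by apply/measurable_EFinP; exact: measurable_indic.
have -> : Lambda pi (shell A k) = \int[Lambda pi]_(x in cone S) (\1_(shell A k) x)%:E.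
  by rewrite integral_indic// setIidl// => x [].
rewrite ge0_integral_Lambda//.
pose D : set (measurableTypeR R) := `[(- k%:R)%R, k%:R]%classic.
have mD : measurable D by exact: measurable_itv.
have muD : mu D < +oo.
  have -> : mu D = _ := lebesgue_measure_itv _.
  by rewrite /=; case: ifP => _; rewrite -?EFinB ltry.
have E y : S y -> \int[mu]_z (\1_(shell A k) (expR z *: y))%:E = (\1_A y)%:E * mu D.
  move=> Sy; have H z : shell A k (expR z *: y) <-> A y /\ D z.
    rewrite -[(expR z *: y)%R]/(phi (y, z)) /shell/= angle_phi// ln_enorm_phi//.
    rewrite /D/= in_itv/= ler_norml; split=> [[_ []]//|[Ay Dz]]; split => //.
    by exists (y, z).
  have [Ay|Ay] := pselect (A y).
    transitivity (\int[mu]_z (\1_D z)%:E); last first.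
      by rewrite integral_indic// setIT indicE mem_set// mul1e.
    apply: eq_integral => z _; rewrite !indicE; congr (nat_of_bool _)%:R%:E.
    by apply/idP/idP; rewrite !inE; [move=> /H[]|move=> Dz; apply/H].
  rewrite indicE memNset// mul0e; apply: integral0_eq => z _.
  by rewrite indicE memNset// => /H[].
have mS := measurable_sphere_base.
apply: (@le_lt_trans _ _ (\int[pi]_(y in S) ((\1_A y)%:E * mu D))).
  by rewrite le_eqVlt; apply/orP; left; apply/eqP/eq_integral => y; rewrite inE => /E.
rewrite ge0_integralZr//; last first.
  by apply: measurable_funTS; apply/measurable_EFinP; exact: measurable_indic.
rewrite integral_indic//; apply: lte_mul_pinfty => //.
  rewrite ge0_fin_numE//; apply: le_lt_trans Aoo.
  by apply: le_measure; rewrite ?inE//; exact: measurableI.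
Qed.

(** On the shell the norm is at most [expR k], and for [alpha >= 0] the density is at most
    [expR k ^ alpha]. *)
Lemma nu_shell alpha A k : (0 <= alpha)%R -> measurable A -> pi A < +oo ->
  nu alpha pi (shell A k) < +oo.
Proof.
move=> a0 mA Aoo; have mSh := measurable_shell k mA.
pose M : R := (expR k%:R `^ alpha)%R.
apply: (@le_lt_trans _ _ (\int[Lambda pi]_(x in shell A k) cst M%:E x)).
  apply: ge0_le_integral => //.
  - by move=> x _; rewrite lee_fin powR_ge0.
  - apply: measurable_funTS; apply/measurable_EFinP.
    exact: (@measurable_wt R n alpha).
  - move=> x [Ex [_ /= xk]]; rewrite lee_fin; apply: ge0_ler_powR => //.
    + by rewrite nnegrE enorm_ge0.
    + by rewrite nnegrE expR_ge0.
    have e0 : (0 < enorm x)%R by rewrite enorm_gt0; exact: (cone_neq0 SS).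
    rewrite -[leLHS]lnK// ler_expR; apply: le_trans xk; exact: ler_norm.
rewrite integral_cst//; apply: lte_mul_pinfty => //; first by rewrite lee_fin powR_ge0.
exact: Lambda_shell.
Qed.

Lemma shell_cover : exists A : nat -> set (borel vec),
  cone S = \bigcup_k shell (A k) k /\
  forall k, measurable (A k) /\ pi (A k) < +oo.
Proof.
have [A [AT ndA mA]] := (sigma_finiteP setT pi).1 (sigma_finiteT pi); exists A; split => //.
apply/seteqP; split=> [_ [[y z] [/= Sy _] <-]|x [k _ []//]].
have : (\bigcup_i A i) y by rewrite -AT.
(* A single index bounds both coordinates; this uses an exhaustion [A] that is nondecreasing. *)
move=> [i _ Ay]; pose k := maxn i (Num.truncn `|z|%R).+1; exists k => //.
split; first by exists (y, z).
split; rewrite /= ?angle_phi// ?ln_enorm_phi//.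
  by move: Ay; apply/subsetPset; apply: ndA; exact: leq_maxl.
apply: ltW; apply: lt_le_trans (truncnS_gt _) _; rewrite ler_nat; exact: leq_maxr.
Qed.

Lemma sigma_finite_Lambda : sigma_finite (cone S : set (borel vec)) (Lambda pi).
Proof.
have [A [AE mA]] := shell_cover; exists (fun k => shell (A k) k) => // k.
have [mAk Ak] := mA k; split; first exact: measurable_shell.
exact: Lambda_shell.
Qed.

Lemma sigma_finite_nu alpha : (0 <= alpha)%R ->
  sigma_finite (cone S : set (borel vec)) (nu alpha pi).
Proof.
move=> a0; have [A [AE mA]] := shell_cover; exists (fun k => shell (A k) k) => // k.
have [mAk Ak] := mA k; split; first exact: measurable_shell.
exact: nu_shell.
Qed.

Lemma ge0_integral_nu alpha (h : vec -> \bar R) :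
  measurable_fun setT (h : borel vec -> \bar R) -> (forall x, 0 <= h x) ->
  \int[nu alpha pi]_(x in cone S) h x =
  \int[Lambda pi]_(x in cone S) (h x * (wt alpha x)%:E).
Proof.
move=> mh h0; pose h' (x : borel vec) := (\1_(cone S) x)%:E * h x.
have mh' : measurable_fun setT h'.
  by apply: emeasurable_funM => //; apply/measurable_EFinP; exact: measurable_indic.
have h'0 x : 0 <= h' x by rewrite mule_ge0// lee_fin.
have H (m : {measure set (borel vec) -> \bar R}) (u : vec -> \bar R) :
    \int[m]_(x in cone S) u x = \int[m]_x ((\1_(cone S) x)%:E * u x).
  rewrite integral_mkcond; apply: eq_integral => x _; rewrite patchE indicE.
  by case: ifP => _; rewrite ?mul1e ?mul0e.
rewrite H (H (Lambda pi)).
rewrite (@ge0_integral_density _ _ _ (Lambda pi) (nu alpha pi) (wt alpha))//.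
- by apply: eq_integral => x _; rewrite muleA.
- exact: measurable_wt.
- exact: wt_ge0.
Qed.

End polar_measure.

Lemma measurable_scale {R : realType} {n : nat} d (T : measurableType d) (f : T -> measurableTypeR R)
    (g : T -> borel 'rV[R]_n.+1) : measurable_fun setT f -> measurable_fun setT g ->
  measurable_fun setT (fun t => expR (f t) *: (g t : 'rV[R]_n.+1) : borel 'rV[R]_n.+1).
Proof.
by move=> mf mg; exact: (measurableT_comp (@measurable_phi R n) (measurable_fun_pair mg mf)).
Qed.

(** * Self-similarity after the time change of the Lamperti transformation *)

Section scaling.
Context {R : realType} {n : nat} {d : measure_display} {Omega : measurableType d}.
Local Notation vec := 'rV[R]_n.+1.
Local Notation mu := (@lebesgue_measure R).
Local Open Scope ereal_scope.
Variables (S : set vec) (alpha : R) (X : R -> Omega -> vec)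
  (P : vec -> probability Omega R) (F : R -> set (set Omega)).
Hypotheses (SS : S `<=` sphere) (vm : vmarkov (cone S) F X P).
Hypothesis selfsim : forall (a : R) (x : vec), (0 < a)%R -> cone S x ->
  forall C, path_sigma_algebra C -> P x [set w | C (X ^~ w)] =
    P (a^-1 *: x)%R [set w | C (fun t => a *: X (a `^ (- alpha) * t) w)%R].

Let W := tcX X (- alpha).
Let mE := measurable_cone vm.

Definition vmarkov_lamperti := vmarkov_tc (- alpha) (cone0 SS) mE vm.

Let mW t : (0 <= t)%R -> measurable_fun setT (W t : Omega -> borel vec).
Proof. exact: (measurable_X vmarkov_lamperti). Qed.

(** With the exponent [- alpha] the rescaling of time is exactly undone by the clock: dilating the
    start dilates the position at the same time [t]. This is the additivity of the MAP. *)
Lemma scaling_law (a : R) (x : vec) t (B : set (borel vec)) : (0 < a)%R -> cone S x ->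
  (0 <= t)%R -> measurable B ->
  P x (W t @^-1` B) = P (a^-1 *: x)%R [set w | B (a *: W t w)%R].
Proof.
move=> a0 Ex t0 mB; have gw := vm_good vm.
pose C := [set p : @path_space R n | B (tc_path (- alpha) t p)].
have mC : measurable C.
  by rewrite -[X in measurable X]setTI; exact: (@measurable_tc_path R n (- alpha) t).
have := selfsim a0 Ex (C := C); rewrite path_sigma_algebraE => /(_ mC) H.
have aa : (0 < a `^ (- alpha))%R by rewrite powR_gt0.
have E : (a `^ (- alpha) * t / a `^ (- alpha) = t)%R.
  by rewrite mulrAC (divff (lt0r_neq0 aa)) mul1r.
have S1 : W t @^-1` B = [set w | C (X ^~ w)].
  by apply/seteqP; split=> w; rewrite /C /= (tc_pathE (- alpha) (gw w) t0).
have WE w : tc_path (- alpha) t (fun t => a *: X (a `^ (- alpha) * t) w)%R = (a *: W t w)%R.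
  rewrite (tc_pathE (- alpha) (good_scale a0 aa (gw w)) t0).
  by rewrite (tc_scale (- alpha) a0 aa (gw w) t0) E.
have S2 : [set w | B (a *: W t w)%R] =
    [set w | C (fun t => a *: X (a `^ (- alpha) * t) w)%R].
  by apply/seteqP; split=> w; rewrite /C /= WE.
by rewrite S1 S2.
Qed.

Lemma integral_scaling z (y : vec) t (f : vec -> \bar R) : cone S y -> (0 <= t)%R ->
  measurable_fun setT (f : borel vec -> \bar R) -> (forall x, 0 <= f x) ->
  \int[P (expR z *: y)%R]_w f (W t w) = \int[P y]_w f (expR z *: W t w)%R.
Proof.
move=> Ey t0 mf f0; have e0 := expR_gt0 z.
have mz : measurable_fun setT (fun x : borel vec => expR z *: (x : vec) : borel vec)%R.
  exact: (measurable_scale (@measurable_cst _ _ _ _ _ z)).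
have mzW := measurableT_comp mz (mW t0).
rewrite -(ge0_integral_pushm (P (expR z *: y)%R) (mW t0) mf f0).
rewrite -(ge0_integral_pushm (P y) mzW mf f0).
apply: eq_measure_integral => B mB _; rewrite /pushm /= /pushforward.
rewrite (scaling_law e0 (coneZ e0 Ey) t0 mB) scalerA mulVf ?scale1r//.
by rewrite gt_eqF.
Qed.

Variable pi : {sigma_finite_measure set (borel vec) -> \bar R}.
Hypothesis piS : pi (~` S) = 0.

Lemma law_lty t (t0 : (0 <= t)%R) x : law vmarkov_lamperti t0 x setT < +oo.
Proof. by rewrite /law /pushm /= /pushforward preimage_setT probability_setT ltry. Qed.

Lemma measurable_law t (t0 : (0 <= t)%R) (B : set (borel vec)) : measurable B ->
  measurable_fun (cone S : set (borel vec)) (fun x => law vmarkov_lamperti t0 x B).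
Proof. exact: (vm_kernel vmarkov_lamperti). Qed.

(** The start is [expR z] times a point of norm 1. By scaling the endpoint carries the same factor,
    and Tonelli puts the common dilation innermost. *)
Lemma ge0_integral_Lambda_graph t (h : borel vec * borel vec -> \bar R) : (0 <= t)%R ->
  measurable_fun setT h -> (forall z, 0 <= h z) ->
  \int[Lambda pi]_(x in cone S) \int[P x]_w h (x, W t w) =
  \int[pi]_(y in S) \int[P y]_w \int[mu]_z h (expR z *: y, expR z *: W t w)%R.
Proof.
move=> t0 mh h0.
have lawE x (u : vec -> \bar R) : measurable_fun setT (u : borel vec -> \bar R) ->
    (forall y, 0 <= u y) -> \int[law vmarkov_lamperti t0 x]_v u v = \int[P x]_w u (W t w).
  by move=> mu' u0; rewrite (ge0_integral_pushm _ _ mu' u0).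
have mhx x : measurable_fun setT (fun v : borel vec => h (x, v)).
  by apply: (measurableT_comp mh); exact: measurable_fun_pair.
have mI := measurable_integral_graph (Lambda pi) mE (measurable_law t0) (fun x _ => law_lty t0 x) mh h0.
pose u : borel vec -> \bar R := (fun x => \int[law vmarkov_lamperti t0 x]_y h (x, y)) \_ (cone S).
have mu' : measurable_fun setT u by exact: (iffLR (measurable_restrictT _ mE) mI).
have u0 x : 0 <= u x by rewrite /u patchE; case: ifP => // _; exact: integral_ge0.
have uE x : cone S x -> u x = \int[P x]_w h (x, W t w).
  by move=> Ex; rewrite /u patchE mem_set// lawE.
transitivity (\int[Lambda pi]_(x in cone S) u x).
  by apply: eq_integral => x; rewrite inE => Ex; rewrite uE.
rewrite (ge0_integral_Lambda SS mE piS mu' u0); apply: eq_integral => y; rewrite inE => Sy.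
have Ey := cone_base Sy.
pose k (q : measurableTypeR R * Omega) := h (expR q.1 *: y, expR q.1 *: W t q.2)%R.
have mk : measurable_fun setT k.
  apply: (measurableT_comp mh); apply: measurable_fun_pair.
    exact: (measurable_scale measurable_fst (@measurable_cst _ _ _ _ _ (y : borel vec))).
  exact: (measurable_scale measurable_fst (measurableT_comp (mW t0) measurable_snd)).
have k0 q : 0 <= k q by exact: h0.
transitivity (\int[mu]_z \int[P y]_w k (z, w)).
  apply: eq_integral => z _; have Ez := coneZ (expR_gt0 z) Ey.
  rewrite (uE _ Ez); exact: (integral_scaling z Ey t0 (mhx _) (fun v => h0 _)).
exact: (fubini_tonelli (m1 := mu) (m2 := P y) k mk k0).
Qed.

End scaling.

(** * Reversibility of the MAP as duality with respect to [Lambda pi] *)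

Section reversibility.
Context {R : realType} {n : nat} {d : measure_display} {Omega : measurableType d}.
Local Notation vec := 'rV[R]_n.+1.
Local Notation mu := (@lebesgue_measure R).
Local Open Scope ereal_scope.
Variables (S : set vec) (alpha : R) (X : R -> Omega -> vec)
  (P : vec -> probability Omega R).
Hypothesis SS : S `<=` sphere.

Let W := tcX X (- alpha).
Let P2 := hat_law P.
Let W2 := tcX (hat alpha X) (- alpha).

Lemma tcX_hat t w : good (X ^~ w) -> (0 <= t)%R ->
  tcX (hat alpha X) (- alpha) t w = inversion (tcX X (- alpha) t w).
Proof.
move=> gw t0; rewrite /tcX (hatE alpha gw) tc_inversion opprK.
rewrite (tc_tc (- (2 * alpha)) alpha gw t0).
by rewrite (_ : - (2 * alpha) + alpha = - alpha)%R //; ring.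
Qed.

Lemma hat_law_base y : S y -> hat_law P y = P y.
Proof.
move=> Sy; rewrite /hat_law; congr P.
have -> : y = phi (y, 0%R) by rewrite /phi/= expR0 scale1r.
by rewrite (inversion_phi SS)// oppr0.
Qed.

Variables (F F2 : R -> set (set Omega)).
Hypotheses (vm : vmarkov (cone S) F X P)
  (vm2 : vmarkov (cone S) F2 (hat alpha X) P2).
Hypothesis selfsim : forall (a : R) (x : vec), (0 < a)%R -> cone S x ->
  forall C, path_sigma_algebra C -> P x [set w | C (X ^~ w)] =
    P (a^-1 *: x)%R [set w | C (fun t => a *: X (a `^ (- alpha) * t) w)%R].
Hypothesis selfsim2 : forall (a : R) (x : vec), (0 < a)%R -> cone S x ->
  forall C, path_sigma_algebra C -> P2 x [set w | C (hat alpha X ^~ w)] =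
    P2 (a^-1 *: x)%R [set w | C (fun t => a *: hat alpha X (a `^ (- alpha) * t) w)%R].
Variable pi : {sigma_finite_measure set (borel vec) -> \bar R}.
Hypothesis piS : pi (~` S) = 0.

Let mE := measurable_cone vm.
Let mS : measurable (S : set (borel vec)) := measurable_sphere_base SS mE.
Let vmW := vmarkov_lamperti alpha SS vm.
Let vmW2 := vmarkov_lamperti alpha SS vm2.
Let gX w : good (X ^~ w) := vm_good vm w.

Variables (t : R) (t0 : (0 <= t)%R).

Let mW : measurable_fun setT (W t : Omega -> borel vec).
Proof. exact: (measurable_X vmW t0). Qed.

Let mW2 : measurable_fun setT (W2 t : Omega -> borel vec).
Proof. exact: (measurable_X vmW2 t0). Qed.

Let W2E w : W2 t w = inversion (W t w).
Proof. exact: tcX_hat. Qed.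

Let mlawS (B : set (borel vec)) : measurable B ->
  measurable_fun (S : set (borel vec)) (fun x => law vmW t0 x B).
Proof.
move=> mB; apply: measurable_funS (measurable_law alpha SS vm t0 mB); first exact: mE.
by move=> y; exact: cone_base.
Qed.

(** The joint law of start and endpoint at time [t] for a start of norm 1 drawn from [pi]. *)
Let N := graphm pi mS mlawS (fun y _ => law_lty alpha SS vm t0 y).

Let integral_N (h : borel vec * borel vec -> \bar R) :
  measurable_fun setT h -> (forall z, 0 <= h z) ->
  \int[N]_z h z = \int[pi]_(y in S) \int[P y]_w h (y, W t w).
Proof.
move=> mh h0; rewrite ge0_integral_graphm//; apply: eq_integral => y _.
apply: (ge0_integral_pushm (P y) mW (g := fun v => h (y, v))) => //.
by apply: (measurableT_comp mh); exact: measurable_fun_pair.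
Qed.

(** [tau1] and [tau2] read such a pair as the triples of the two sides of reversibility, which
    differ by the exchange of the two angles. *)
Let tau1 (z : borel vec * borel vec) : borel vec * measurableTypeR R * borel vec :=
  (z.1, ln (enorm z.2), angle z.2).

Let tau2 (z : borel vec * borel vec) : borel vec * measurableTypeR R * borel vec :=
  (angle z.2, ln (enorm z.2), z.1).

Let mang : measurable_fun setT (fun z : borel vec * borel vec => angle z.2 : borel vec).
Proof. exact: (measurableT_comp (@measurable_angle R n) measurable_snd). Qed.

Let mln : measurable_fun setT
  (fun z : borel vec * borel vec => ln (enorm z.2) : measurableTypeR R).
Proof. exact: (measurableT_comp (@measurable_ln_enorm R n) measurable_snd). Qed.

Let mtau1 : measurable_fun setT tau1.
Proof. by apply: measurable_fun_pair => //; exact: measurable_fun_pair. Qed.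

Let mtau2 : measurable_fun setT tau2.
Proof. by apply: measurable_fun_pair => //; exact: measurable_fun_pair. Qed.

Let nz : set (borel vec * borel vec) := [set z | z.2 != 0%R :> vec].

Let mnz : measurable nz.
Proof.
have -> : nz = snd @^-1` (~` [set 0%R : vec]).
  by apply/seteqP; split=> z /= /eqP.
rewrite -[X in measurable X]setTI; apply: measurable_snd => //.
by apply: measurableC; exact: measurable_set1_vec.
Qed.

(** The two measures on triples whose equality is reversibility at time [t]; the killed mass is left
    out by the restriction to [nz]. *)
Let kappa1 := pushm (mrestr N mnz) mtau1.
Let kappa2 := pushm (mrestr N mnz) mtau2.

Let kappaE (tau : borel vec * borel vec -> borel vec * measurableTypeR R * borel vec)
    (mtau : measurable_fun setT tau) C :
  pushm (mrestr N mnz) mtau C =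
  \int[pi]_(y in S) P y [set w | W t w != 0%R /\ C (tau (y, W t w))].
Proof.
rewrite /pushm /= /pushforward /mrestr; apply: eq_integral => y _.
rewrite /law /pushm /= /pushforward; congr (P y _).
by apply/seteqP; split=> w /= [? ?]; split.
Qed.

Let Eangle v : state (cone S) v -> v != 0%R -> S (angle v).
Proof.
move=> [[[y z] [/= Sy _] <-] _|->]; last by rewrite eqxx.
by rewrite (angle_phi SS).
Qed.

Let stateW w : state (cone S) (W t w).
Proof. exact: (vm_state vmW). Qed.

Lemma reversible_kappa (Y : R -> Omega -> option (vec * R))
    (Q : option (vec * R) -> probability Omega R) :
  (forall w, Y t w = polar (W t w)) -> (forall y, S y -> Q (Some (y, 0%R)) = P y) ->
  (forall C : set (borel vec * measurableTypeR R * borel vec), measurable C ->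
    C `<=` (S `*` setT) `*` S ->
    \int[pi]_(y in S) Q (Some (y, 0%R))
       [set w | if Y t w is Some (theta, xi) then C (y, xi, theta) else False] =
     \int[pi]_(y1 in S) Q (Some (y1, 0%R))
       [set w | if Y t w is Some (theta, xi) then C (theta, xi, y1) else False]) <->
  (forall C, measurable C -> kappa1 C = kappa2 C).
Proof.
move=> YE QE.
have K (C : set (borel vec * measurableTypeR R * borel vec)) :
    (\int[pi]_(y in S) Q (Some (y, 0%R))
       [set w | if Y t w is Some (theta, xi) then C (y, xi, theta) else False] = kappa1 C) *
    (\int[pi]_(y1 in S) Q (Some (y1, 0%R))
       [set w | if Y t w is Some (theta, xi) then C (theta, xi, y1) else False] = kappa2 C).
  split; rewrite kappaE; apply: eq_integral => y; rewrite inE => Sy; rewrite QE//;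
    congr (P y _); apply/seteqP; split=> w /=; rewrite YE /polar;
    by case: eqVneq => // _ [].
split=> H C mC; last by move=> _; rewrite !K; exact: H.
(* Starts and angles of living endpoints lie in [S], so cutting [C] to triples with both angles in
   [S] changes neither measure. *)
have mC' : measurable (C `&` ((S `*` setT) `*` S)).
  by apply: measurableI => //; apply: measurableX => //; exact: measurableX.
have := H _ mC' (@subIsetr _ _ _); rewrite !K /kappa1 /kappa2 !kappaE => E.
apply: (etrans _ (etrans E _)); apply: eq_integral => y; rewrite inE => Sy; congr (P y _);
  apply/seteqP; split=> w /=.
- by move=> [W0 Cw]; split => //; split => //; split => //; exact: Eangle.
- by move=> [W0 []].
- by move=> [W0 []].
- by move=> [W0 Cw]; split => //; split => //; split => //; split => //; exact: Eangle.
Qed.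

Let expRD_scale (z xi : R) (v : vec) : v != 0%R -> xi = ln (enorm v) ->
  (expR (z + xi) *: angle v = expR z *: v)%R.
Proof.
move=> v0 ->; have e0 : (0 < enorm v)%R by rewrite enorm_gt0.
by rewrite expRD lnK// /angle scalerA -mulrA divff ?mulr1// gt_eqF.
Qed.

Let inversion_angle (z : R) (v : vec) : v != 0%R ->
  (expR z *: inversion v = expR (z - ln (enorm v)) *: angle v)%R.
Proof.
move=> v0; have e0 : (0 < enorm v)%R by rewrite enorm_gt0.
rewrite expRD expRN lnK// /angle /inversion !scalerA; congr (_ *: _).
by rewrite expr2 invfM mulrA.
Qed.

(** Both sides are integrals of one function [H] of the triple, the integral over a common dilation
    of [g] at one end times [f] at the other: against [kappa1] on the left and [kappa2] on the
    right. *)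
Lemma reversible_dual : (forall C, measurable C -> kappa1 C = kappa2 C) ->
  forall f g : vec -> \bar R,
    measurable_fun setT (f : borel vec -> \bar R) ->
    measurable_fun setT (g : borel vec -> \bar R) ->
    (forall x, 0 <= f x) -> (forall x, 0 <= g x) -> f 0%R = 0 -> g 0%R = 0 ->
    \int[Lambda pi]_(x in cone S) (g x * \int[P x]_w f (W t w)) =
    \int[Lambda pi]_(x in cone S) (f x * \int[P2 x]_w g (W2 t w)).
Proof.
move=> kE f g mf mg f0 g0 fz gz.
pose h1 (z : borel vec * borel vec) := g z.1 * f z.2.
pose h2 (z : borel vec * borel vec) := f z.1 * g z.2.
have mh1 : measurable_fun setT h1.
  by apply: emeasurable_funM; [exact: (measurableT_comp mg measurable_fst)|exact: (measurableT_comp mf measurable_snd)].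
have mh2 : measurable_fun setT h2.
  by apply: emeasurable_funM; [exact: (measurableT_comp mf measurable_fst)|exact: (measurableT_comp mg measurable_snd)].
have h10 z : 0 <= h1 z by exact: mule_ge0.
have h20 z : 0 <= h2 z by exact: mule_ge0.
pose k (q : (borel vec * measurableTypeR R * borel vec) * measurableTypeR R) : \bar R :=
  g (expR q.2 *: q.1.1.1)%R * f (expR (q.2 + q.1.1.2) *: q.1.2)%R.
pose H (c : borel vec * measurableTypeR R * borel vec) := \int[mu]_z k (c, z).
have mk : measurable_fun setT k.
  apply: emeasurable_funM.
    apply: (measurableT_comp mg); apply: (measurable_scale measurable_snd).
    exact: (measurableT_comp measurable_fst (measurableT_comp measurable_fst measurable_fst)).
  apply: (measurableT_comp mf); apply: measurable_scale.
    apply: measurable_funD => //.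
    exact: (measurableT_comp measurable_snd (measurableT_comp measurable_fst measurable_fst)).
  exact: (measurableT_comp measurable_snd measurable_fst).
have k0 q : 0 <= k q by exact: mule_ge0.
have mH : measurable_fun setT H by exact: (measurable_fun_fubini_tonelli_F (m2 := mu) k mk k0).
have H0 c : 0 <= H c by apply: integral_ge0 => z _; exact: k0.
have intH (tau : borel vec * borel vec -> borel vec * measurableTypeR R * borel vec)
    (mtau : measurable_fun setT tau) :
    \int[pushm (mrestr N mnz) mtau]_c H c =
    \int[pi]_(y in S) \int[P y]_w ((\1_nz (y, W t w))%:E * H (tau (y, W t w))).
  have mHt := measurableT_comp mH mtau.
  rewrite (ge0_integral_pushm _ mtau mH H0).
  rewrite (ge0_integral_mrestr N mnz mHt (fun z => H0 _)).
  transitivity (\int[N]_z ((\1_nz z)%:E * (H \o tau) z)).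
    rewrite integral_mkcond; apply: eq_integral => z _; rewrite patchE indicE.
    by case: ifP => _; rewrite ?mul1e ?mul0e.
  rewrite integral_N//.
  - apply: emeasurable_funM => //; apply/measurable_EFinP; exact: measurable_indic.
  - by move=> z; apply: mule_ge0; [rewrite lee_fin|exact: H0].
have L1 : \int[Lambda pi]_(x in cone S) (g x * \int[P x]_w f (W t w)) = \int[kappa1]_c H c.
  transitivity (\int[Lambda pi]_(x in cone S) \int[P x]_w h1 (x, W t w)).
    apply: eq_integral => x _; rewrite -ge0_integralZl//.
    exact: (measurableT_comp mf mW).
  rewrite (ge0_integral_Lambda_graph SS vm selfsim piS t0 mh1 h10) /kappa1 intH.
  apply: eq_integral => y _; apply: eq_integral => w _; rewrite indicE.
  have [W0|W0] := eqVneq (W t w) 0%R.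
    rewrite memNset; last by rewrite /nz/= W0 eqxx.
    rewrite mul0e; apply: integral0_eq => z _.
    by rewrite /h1 /= -/W W0 scaler0 fz mule0.
  rewrite mem_set// mul1e; apply: eq_integral => z _.
  by rewrite /h1 /k /tau1 /= -/W expRD_scale.
have L2 : \int[Lambda pi]_(x in cone S) (f x * \int[P2 x]_w g (W2 t w)) = \int[kappa2]_c H c.
  transitivity (\int[Lambda pi]_(x in cone S) \int[P2 x]_w h2 (x, W2 t w)).
    apply: eq_integral => x _; rewrite -ge0_integralZl//.
    exact: (measurableT_comp mg mW2).
  rewrite (ge0_integral_Lambda_graph SS vm2 selfsim2 piS t0 mh2 h20) /kappa2 intH.
  apply: eq_integral => y; rewrite inE => Sy; rewrite /P2 hat_law_base//.
  apply: eq_integral => w _; rewrite indicE -/W2 W2E.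
  have [W0|W0] := eqVneq (W t w) 0%R.
    rewrite memNset; last by rewrite /nz/= W0 eqxx.
    rewrite mul0e; apply: integral0_eq => z _.
    by rewrite /h2 /= W0 inversion0 scaler0 gz mule0.
  rewrite mem_set// mul1e.
  pose u (z : measurableTypeR R) := k (tau2 (y, W t w), z).
  have mu' : measurable_fun setT u by apply: (measurableT_comp mk); exact: measurable_fun_pair.
  have u0 z : 0 <= u z by exact: k0.
  rewrite -[RHS]/(\int[mu]_z u z).
  (* On this side the dilation is measured from the other end of the pair; translating [z] by the
     logarithm of the norm brings it back. *)
  rewrite (ge0_integral_affine (- ln (enorm (W t w)))%R (ltr01 : (0 < 1 :> R)%R) mu' u0) mul1e.
  apply: eq_integral => z _; rewrite /h2 /u /k /tau2 /= mul1r subrK muleC.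
  by rewrite inversion_angle.
by rewrite L1 L2; apply: eq_measure_integral => C mC _; exact: kE.
Qed.

Let ln_enormZ (z : R) (v : vec) : v != 0%R ->
  ln (enorm (expR z *: v)) = (z + ln (enorm v))%R.
Proof.
move=> v0; have e0 : (0 < enorm v)%R by rewrite enorm_gt0.
by rewrite enormZ ger0_norm ?expR_ge0// lnM ?posrE ?expR_gt0// expRK.
Qed.

Let angleZ (z : R) (v : vec) : angle (expR z *: v)%R = angle v.
Proof.
rewrite /angle enormZ ger0_norm ?expR_ge0// invfM scalerA mulrAC.
by rewrite mulVf ?mul1r// gt_eqF// expR_gt0.
Qed.

Let angle_inversion (v : vec) : v != 0%R -> angle (inversion v) = angle v.
Proof.
move=> v0; have e0 : (0 < enorm v)%R by rewrite enorm_gt0.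
rewrite /angle enorm_inversion invrK /inversion scalerA; congr (_ *: _).
by rewrite expr2 invfM mulrA divff ?mul1r// gt_eqF.
Qed.

Let integral_unit_itv (a : R) :
  \int[mu]_z (\1_(`[a, (a + 1)%R[%classic : set (measurableTypeR R)) z)%:E = 1.
Proof.
pose D : set (measurableTypeR R) := `[a, (a + 1)%R[%classic.
have mD : measurable D by exact: measurable_itv.
rewrite -[LHS]/(\int[mu]_z (\1_D z)%:E) integral_indic// setIT.
apply: etrans (lebesgue_measure_itv _) _.
by rewrite /= lte_fin ltrDl ltr01 -EFinB addrC addKr.
Qed.

(* The radial coordinate of the first component lies in an interval of length 1, so
   that integrating out a common dilation of the two components gives 1. *)
Let slab (C : set (borel vec * measurableTypeR R * borel vec)) :
    set (borel vec * borel vec) :=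
  (cone S `*` cone S) `&`
  ((fun z => ln (enorm z.1) : measurableTypeR R) @^-1` `[0%R, 1%R[%classic `&`
   (fun z => (angle z.1 : borel vec, (ln (enorm z.2) - ln (enorm z.1))%R : measurableTypeR R,
     angle z.2 : borel vec)) @^-1` C).

Let mslab C : measurable C -> measurable (slab C).
Proof.
move=> mC; have mln1 : measurable_fun setT
    (fun z : borel vec * borel vec => ln (enorm z.1) : measurableTypeR R).
  exact: (measurableT_comp (@measurable_ln_enorm R n) measurable_fst).
apply: measurableI; first exact: measurableX.
apply: measurableI.
  by rewrite -[X in measurable X]setTI; apply: mln1 => //; exact: measurable_itv.
rewrite -[X in measurable X]setTI.
have ms : measurable_fun setT (fun z : borel vec * borel vec =>
    (angle z.1 : borel vec, (ln (enorm z.2) - ln (enorm z.1))%R : measurableTypeR R,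
     angle z.2 : borel vec)).
  apply: measurable_fun_pair => //; apply: measurable_fun_pair.
    exact: (measurableT_comp (@measurable_angle R n) measurable_fst).
  exact: measurable_funB.
exact: ms.
Qed.

(** The start [expR z *: y] has log-norm [z], so the window for [z] is [[0, 1[]. *)
Let slab1 C (y v : vec) (z : R) : S y -> state (cone S) v ->
  slab C (expR z *: y, expR z *: v)%R <->
  (v != 0%R /\ C (tau1 (y, v))) /\ (z \in `[0%R, (0 + 1)%R[).
Proof.
move=> Sy Ev; have Ey := cone_base Sy; have e0 := expR_gt0 z.
have y0 := cone_neq0 SS Ey.
have yE : y = phi (y, 0%R) by rewrite /phi/= expR0 scale1r.
have ly : ln (enorm y) = 0%R by rewrite yE (ln_enorm_phi SS).
have ay : angle y = y by rewrite [in LHS]yE (angle_phi SS).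
rewrite /slab /tau1 /= !angleZ ln_enormZ// ly addr0 ay add0r; split.
  move=> [[_ Ev'] [zi]]; have v0 : v != 0%R.
    by have := cone_neq0 SS Ev'; rewrite scaler_eq0 negb_or => /andP[].
  rewrite ln_enormZ// addrAC subrr add0r => Cv.
  by split.
move=> [[v0 Cv] zi]; split; first by split; [exact: coneZ|case: Ev => [|/eqP]; [exact: coneZ|rewrite (negbTE v0)]].
by rewrite ln_enormZ// addrAC subrr add0r.
Qed.

(** Here the first component is the endpoint of the dual process, with log-norm [z - ln (enorm v)].
    The window is shifted by [ln (enorm v)] but keeps length 1. *)
Let slab2 C (y v : vec) (z : R) : S y -> state (cone S) v ->
  slab C (expR z *: inversion v, expR z *: y)%R <->
  (v != 0%R /\ C (tau2 (y, v))) /\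
  (z \in `[ln (enorm v), (ln (enorm v) + 1)%R[).
Proof.
move=> Sy Ev; have Ey := cone_base Sy; have e0 := expR_gt0 z.
have y0 := cone_neq0 SS Ey.
have yE : y = phi (y, 0%R) by rewrite /phi/= expR0 scale1r.
have ly : ln (enorm y) = 0%R by rewrite yE (ln_enorm_phi SS).
have ay : angle y = y by rewrite [in LHS]yE (angle_phi SS).
rewrite /slab /tau2 /= !angleZ (ln_enormZ z y0) ly addr0 ay; split.
  move=> [[Ev' _] [+ ]]; have v0 : v != 0%R.
    have := cone_neq0 SS Ev'; rewrite scaler_eq0 negb_or inversion_eq0.
    by move=> /andP[].
  have iv0 : inversion v != 0%R by rewrite inversion_eq0.
  have ve0 : (0 < enorm v)%R by rewrite enorm_gt0.
  have lE : ln (enorm (expR z *: inversion v)%R) = (z - ln (enorm v))%R.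
    by rewrite ln_enormZ// enorm_inversion lnV.
  rewrite lE angle_inversion// (_ : z - (z - ln (enorm v)) = ln (enorm v))%R; last by ring.
  rewrite !in_itv/= => zi Cv; split; first by split.
  by move: zi => /andP[h1 h2]; apply/andP; split; lra.
move=> [[v0 Cv] zi]; have iv0 : inversion v != 0%R by rewrite inversion_eq0.
have ve0 : (0 < enorm v)%R by rewrite enorm_gt0.
split.
  split; last exact: coneZ.
  apply: coneZ => //; apply: (cone_inversion SS).
  by case: Ev => [//|/eqP]; rewrite (negbTE v0).
have lE : ln (enorm (expR z *: inversion v)%R) = (z - ln (enorm v))%R.
  by rewrite ln_enormZ// enorm_inversion lnV.
rewrite lE angle_inversion// (_ : z - (z - ln (enorm v)) = ln (enorm v))%R; last by ring.
split => //.
by move: zi; rewrite !in_itv/= => /andP[h1 h2]; apply/andP; split; lra.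
Qed.

Let integral_slab (D : set (measurableTypeR R)) (a : R) (A : Prop) :
  (forall z, D z <-> A /\ (z \in `[a, (a + 1)%R[)) ->
  \int[mu]_z (\1_D z)%:E = (`[<A>])%:R%:E.
Proof.
move=> DE; case: asboolP => HA.
  rewrite -[RHS](integral_unit_itv a); apply: eq_integral => z _.
  rewrite !indicE; congr (nat_of_bool _)%:R%:E; apply/idP/idP; rewrite !inE.
    by move=> /DE[].
  by move=> za; apply/DE.
by apply: integral0_eq => z _; rewrite indicE memNset// => /DE[].
Qed.

(** Duality says that the joint law of start and endpoint under [Lambda pi] is that of the dual
    process with the two components exchanged. Evaluated on [slab C], where the dilation integrates
    to 1, the two laws give [kappa1 C] and [kappa2 C]. *)
Lemma dual_kappa : (forall f g : vec -> \bar R,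
    measurable_fun setT (f : borel vec -> \bar R) ->
    measurable_fun setT (g : borel vec -> \bar R) ->
    (forall x, 0 <= f x) -> (forall x, 0 <= g x) -> f 0%R = 0 -> g 0%R = 0 ->
    \int[Lambda pi]_(x in cone S) (g x * \int[P x]_w f (W t w)) =
    \int[Lambda pi]_(x in cone S) (f x * \int[P2 x]_w g (W2 t w))) ->
  forall C, measurable C -> kappa1 C = kappa2 C.
Proof.
move=> dual C mC.
pose EE : set (borel vec * borel vec) := cone S `*` cone S.
have mEE : measurable EE by exact: measurableX.
pose sw (z : borel vec * borel vec) : borel vec * borel vec := (z.2, z.1).
have msw : measurable_fun setT sw by exact: measurable_fun_pair.
pose M1 := graphm (Lambda pi) mE (measurable_law alpha SS vm t0) (fun x _ => law_lty alpha SS vm t0 x).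
pose M2 := graphm (Lambda pi) mE (measurable_law alpha SS vm2 t0) (fun x _ => law_lty alpha SS vm2 t0 x).
pose m1 := mrestr M1 mEE.
pose m2 := mrestr (pushm M2 msw) mEE.
have m1E U : m1 U = \int[Lambda pi]_(x in cone S) P x [set w | (U `&` EE) (x, W t w)] by [].
have m2E U : m2 U = \int[Lambda pi]_(x in cone S) P2 x [set w | (U `&` EE) (W2 t w, x)] by [].
have m12 U : measurable U -> m1 U = m2 U.
  (* Two measures on pairs that agree on rectangles; the exhaustion by finite mass comes from the
     start, distributed as [Lambda pi]. *)
  have [g [mg gT goo]] := sigma_finite_cover mE (sigma_finite_Lambda SS mE piS).
  apply: (@measure_unique _ R (borel vec * borel vec)%type
    [set A `*` B | A in measurable & B in measurable] (fun k => g k `*` setT)).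
  - exact: measurable_prod_measurableType.
  - move=> _ _ [A1 mA1 [B1 mB1 <-]] [A2 mA2 [B2 mB2 <-]]; rewrite -setXI.
    exists (A1 `&` A2); first exact: measurableI.
    by exists (B1 `&` B2) => //; exact: measurableI.
  - by move=> k; exists (g k) => //; exists setT.
  - apply/seteqP; split=> // z _; have : (\bigcup_k g k) z.1 by rewrite gT.
    by move=> [k _ gz]; exists k.
  - move=> _ [A mA [B mB <-]]; suff : m1 (A `*` B) = m2 (A `*` B) by []; rewrite m1E m2E.
    (* The sides of the rectangle are cut to the cone, so that the indicators vanish at 0 as the
       test functions of duality must. *)
    pose f (x : vec) : \bar R := (\1_(B `&` cone S) x)%:E.
    pose h (x : vec) : \bar R := (\1_(A `&` cone S) x)%:E.
    have mf : measurable_fun setT (f : borel vec -> \bar R).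
      by apply/measurable_EFinP; apply: measurable_indic; exact: measurableI.
    have mh : measurable_fun setT (h : borel vec -> \bar R).
      by apply/measurable_EFinP; apply: measurable_indic; exact: measurableI.
    have f0 x : 0 <= f x by rewrite lee_fin.
    have h0 x : 0 <= h x by rewrite lee_fin.
    have fz : f 0%R = 0 by rewrite /f indicE memNset// => -[_ /(cone0 SS)].
    have hz : h 0%R = 0 by rewrite /h indicE memNset// => -[_ /(cone0 SS)].
    have ind (P' : probability Omega R) (Z : Omega -> borel vec) (A' B' : set (borel vec)) (x : vec) :
        measurable_fun setT Z -> measurable B' ->
        P' [set w | A' x /\ B' (Z w)] = (\1_A' x)%:E * \int[P']_w (\1_B' (Z w))%:E.
      move=> mZ mB'; have mZB : measurable (Z @^-1` B').
        by rewrite -[X in measurable X]setTI; exact: mZ.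
      have -> : \int[P']_w (\1_B' (Z w))%:E = P' (Z @^-1` B').
        by rewrite -[LHS]/(\int[P']_w (\1_(Z @^-1` B') w)%:E) integral_indic// setIT.
      rewrite indicE; have [Ax|Ax] := pselect (A' x).
        by rewrite mem_set// mul1e; congr (P' _); apply/seteqP; split=> w; [case|split].
      rewrite memNset// mul0e (_ : [set w | _] = set0) ?measure0//.
      by apply/seteqP; split=> // w [].
    have := dual f h mf mh f0 h0 fz hz => D; apply: etrans (etrans D _).
      apply: eq_integral => x _.
      rewrite -(ind (P x) (W t) (A `&` cone S) (B `&` cone S))//; last exact: measurableI.
      congr (P x _); apply/seteqP; split=> w /= [[aA bB] [aE bE]].
        by split; split.
      by split; split.
    apply: eq_integral => x _.
    rewrite -(ind (P2 x) (W2 t) (B `&` cone S) (A `&` cone S))//; last exact: measurableI.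
    congr (P2 x _); apply/seteqP; split=> w /= [[aA bB] [aE bE]].
      by split; split.
    by split; split.
  - move=> k; apply: le_lt_trans (goo k).
    have mgk : measurable (g k `*` setT : set (borel vec * borel vec)) by exact: measurableX.
    have E : Lambda pi (cone S `&` g k) = M1 (g k `*` setT).
      rewrite /M1 graphmE setIC -(integral_indic (Lambda pi) mE (mg k)).
      apply: eq_integral => x _; rewrite /law /pushm /= /pushforward indicE.
      have [gx|gx] := pselect (g k x).
        by rewrite mem_set// (_ : _ @^-1` _ = setT) ?probability_setT//; apply/seteqP; split.
      rewrite memNset// (_ : _ @^-1` _ = set0) ?measure0//.
      by apply/seteqP; split=> // w [].
    suff : m1 (g k `*` setT) <= Lambda pi (cone S `&` g k) by [].
    rewrite E; suff : M1 ((g k `*` setT) `&` EE) <= M1 (g k `*` setT) by [].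
    by apply: le_measure; rewrite ?inE//; exact: measurableI.
pose hs (z : borel vec * borel vec) : \bar R := (\1_(slab C) z)%:E.
have mhs : measurable_fun setT hs.
  by apply/measurable_EFinP; apply: measurable_indic; exact: mslab.
have hs0 z : 0 <= hs z by rewrite lee_fin.
have ind (P' : probability Omega R) (A : Omega -> Prop) :
    measurable [set w | A w] -> P' [set w | A w] = \int[P']_w (`[<A w>])%:R%:E.
  move=> mA; transitivity (\int[P']_w (\1_[set w | A w] w)%:E).
    by rewrite integral_indic// setIT.
  apply: eq_integral => w _; rewrite indicE; have [Aw|Aw] := pselect (A w).
    by rewrite mem_set// asboolT.
  by rewrite memNset// asboolF.
have slabE (P' : probability Omega R) (Z : Omega -> borel vec * borel vec) :
    measurable_fun setT Z ->
    \int[P']_w hs (Z w) = P' [set w | (slab C `&` EE) (Z w)].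
  move=> mZ; have mZC : measurable (Z @^-1` slab C).
    by rewrite -[X in measurable X]setTI; apply: mZ => //; exact: mslab.
  rewrite -[LHS]/(\int[P']_w (\1_(Z @^-1` slab C) w)%:E) integral_indic// setIT.
  by congr (P' _); apply/seteqP; split=> w; [move=> sC; split => //; case: sC|case].
have mWC (tau : borel vec * borel vec -> borel vec * measurableTypeR R * borel vec) y :
    measurable_fun setT tau -> measurable [set w | W t w != 0%R /\ C (tau (y, W t w))].
  move=> mtau.
  have mp : measurable_fun setT (fun w => (y, W t w) : borel vec * borel vec).
    exact: measurable_fun_pair.
  have -> : [set w | W t w != 0%R /\ C (tau (y, W t w))] =
      (fun w => (y, W t w)) @^-1` (nz `&` tau @^-1` C) by [].
  rewrite -[X in measurable X]setTI; apply: mp => //; apply: measurableI => //.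
  by rewrite -[X in measurable X]setTI; exact: mtau.
have K1 : kappa1 C = m1 (slab C).
  rewrite /kappa1 kappaE m1E.
  transitivity (\int[Lambda pi]_(x in cone S) \int[P x]_w hs (x, W t w)).
    rewrite (ge0_integral_Lambda_graph SS vm selfsim piS t0 mhs hs0).
    apply: eq_integral => y; rewrite inE => Sy; rewrite ind; last exact: mWC.
    apply: eq_integral => w _; rewrite /hs -/W; apply/esym.
    exact: (integral_slab (D := [set z | slab C (expR z *: y, expR z *: W t w)%R])
      (fun z => slab1 C z Sy (stateW w))).
  apply: eq_integral => x _.
  apply: (slabE (P x) (fun w => (x, W t w) : borel vec * borel vec)).
  exact: measurable_fun_pair.
have K2 : kappa2 C = m2 (slab C).
  rewrite /kappa2 kappaE m2E.
  pose hw (z : borel vec * borel vec) : \bar R := hs (sw z).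
  have mhw : measurable_fun setT hw by exact: (measurableT_comp mhs msw).
  transitivity (\int[Lambda pi]_(x in cone S) \int[P2 x]_w hw (x, W2 t w)).
    rewrite (ge0_integral_Lambda_graph SS vm2 selfsim2 piS t0 mhw (fun z => hs0 _)).
    apply: eq_integral => y; rewrite inE => Sy; rewrite ind; last exact: mWC.
    rewrite /P2 hat_law_base//.
    apply: eq_integral => w _; rewrite /hw /hs /sw /= -/W2 W2E; apply/esym.
    exact: (integral_slab (D := [set z | slab C (expR z *: inversion (W t w), expR z *: y)%R])
      (fun z => slab2 C z Sy (stateW w))).
  apply: eq_integral => x _.
  apply: (slabE (P2 x) (fun w => (W2 t w, x) : borel vec * borel vec)).
  exact: measurable_fun_pair.
by rewrite K1 K2; apply: m12; exact: mslab.
Qed.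

Lemma reversible_dualE (Y : R -> Omega -> option (vec * R))
    (Q : option (vec * R) -> probability Omega R) :
  (forall w, Y t w = polar (W t w)) -> (forall y, S y -> Q (Some (y, 0%R)) = P y) ->
  (forall C : set (borel vec * measurableTypeR R * borel vec), measurable C ->
    C `<=` (S `*` setT) `*` S ->
    \int[pi]_(y in S) Q (Some (y, 0%R))
       [set w | if Y t w is Some (theta, xi) then C (y, xi, theta) else False] =
     \int[pi]_(y1 in S) Q (Some (y1, 0%R))
       [set w | if Y t w is Some (theta, xi) then C (theta, xi, y1) else False]) <->
  (forall f g : vec -> \bar R,
    measurable_fun setT (f : borel vec -> \bar R) ->
    measurable_fun setT (g : borel vec -> \bar R) ->
    (forall x, 0 <= f x) -> (forall x, 0 <= g x) -> f 0%R = 0 -> g 0%R = 0 ->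
    \int[Lambda pi]_(x in cone S) (g x * \int[P x]_w f (W t w)) =
    \int[Lambda pi]_(x in cone S) (f x * \int[P2 x]_w g (W2 t w))).
Proof.
move=> YE QE; apply: (iff_trans (reversible_kappa YE QE)).
split; [exact: reversible_dual|exact: dual_kappa].
Qed.

End reversibility.

(** Functions on [E] are extended by 0 at the origin. The extension [r] alters a test function only
    at 0, outside [E], which is also where [semigroup] counts the cemetery as 0. *)
Lemma in_duality_vdual {R : realType} {n : nat} (E : set 'rV[R]_n.+1)
    (m : {measure set (borel 'rV[R]_n.+1) -> \bar R})
    d1 (Omega1 : measurableType d1) (X1 : R -> Omega1 -> 'rV[R]_n.+1)
    (P1 : 'rV[R]_n.+1 -> probability Omega1 R)
    d2 (Omega2 : measurableType d2) (X2 : R -> Omega2 -> 'rV[R]_n.+1)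
    (P2 : 'rV[R]_n.+1 -> probability Omega2 R) :
  ~ E 0 -> sigma_finite (E : set (borel 'rV[R]_n.+1)) m ->
  in_duality E m (absorb X1) (absorb_law P1) (absorb X2) (absorb_law P2) <->
  vdual E m X1 P1 X2 P2.
Proof.
move=> E0 sf.
pose r (f : 'rV[R]_n.+1 -> \bar R) x : \bar R := if x == 0 then 0%E else f x.
have sE d (Omega : measurableType d) (X : R -> Omega -> 'rV[R]_n.+1)
    (P : 'rV[R]_n.+1 -> probability Omega R) t f v :
    semigroup (absorb X) (absorb_law P) t f v = (\int[P v]_w r f (X t w))%E.
  by apply: eq_integral => w _; rewrite /absorb /r; case: ifP.
have rE f : f 0 = 0%E -> r f = f.
  by move=> f0; apply/funext => x; rewrite /r; case: eqVneq => [->|].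
have rin f x : x \in E -> r f x = f x.
  by rewrite inE /r; case: eqVneq => [-> /E0|].
split=> [[_ H] t f g t0 mf mg f0 g0 fz gz|H].
  have := H t f g t0 mf mg f0 g0.
  under eq_integral do rewrite sE rE//.
  by under [X in _ = X -> _]eq_integral do rewrite sE rE//.
split=> // t f g t0 mf mg f0 g0.
have mr h : measurable_fun setT (h : borel 'rV[R]_n.+1 -> \bar R) ->
    measurable_fun setT (r h : borel 'rV[R]_n.+1 -> \bar R).
  move=> mh; apply: measurable_fun_ifT => //.
  have m0 : measurable ([set 0] : set (borel 'rV[R]_n.+1)) by exact: measurable_set1_vec.
  apply: (measurable_fun_bool true).
  rewrite setTI (_ : _ @^-1` _ = [set 0])//.
  by apply/seteqP; split=> x /= /eqP.
have r0 h : (forall x, (0 <= h x)%E) -> forall x, (0 <= r h x)%E.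
  by move=> h0 x; rewrite /r; case: ifP.
have rz h : r h 0 = 0%E by rewrite /r eqxx.
have := H t _ _ t0 (mr f mf) (mr g mg) (r0 f f0) (r0 g g0) (rz f) (rz g).
under eq_integral => x xE do rewrite (rin g x xE) -sE.
by under [X in _ = X -> _]eq_integral => x xE do rewrite (rin f x xE) -sE.
Qed.

(** * From [nu alpha pi] to [Lambda pi] by the time change, and back *)

Section duality_lamperti.
Context {R : realType} {n : nat} {d : measure_display} {Omega : measurableType d}.
Local Notation vec := 'rV[R]_n.+1.
Local Open Scope ereal_scope.
Variables (S : set vec) (alpha : R) (F1 F2 : R -> set (set Omega))
  (X1 X2 : R -> Omega -> vec) (P1 P2 : vec -> probability Omega R).
Hypotheses (SS : S `<=` sphere) (a0 : (0 <= alpha)%R)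
  (vm1 : vmarkov (cone S) F1 X1 P1) (vm2 : vmarkov (cone S) F2 X2 P2).
Variable pi : {sigma_finite_measure set (borel vec) -> \bar R}.
Hypothesis piS : pi (~` S) = 0.

Let mE := measurable_cone vm1.
Let wtK (x : vec) (e : \bar R) : cone S x ->
  e * (wt (- alpha) x)%:E * (wt alpha x)%:E = e.
Proof.
move=> /(cone_neq0 SS) x0.
by rewrite -muleA -EFinM -wtD// addNr wt0 mule1.
Qed.

Let tcXK F (X : R -> Omega -> vec) P t w : vmarkov (cone S) F X P -> (0 <= t)%R ->
  tcX (tcX X (- alpha)) alpha t w = X t w.
Proof.
move=> vm t0; have gw := vm_good vm w.
by rewrite /tcX (tc_tc (- alpha) alpha gw t0) addNr tc0.
Qed.

(** The weight of exponent [- alpha] cancels the density of [nu alpha pi]. The transition integral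
    is replaced by [transition], which agrees on the cone and is measurable everywhere. *)
Let integral_nu_transition F (X : R -> Omega -> vec) P t (f g : vec -> \bar R) : vmarkov (cone S) F X P ->
  (0 <= t)%R -> measurable_fun setT (f : borel vec -> \bar R) ->
  measurable_fun setT (g : borel vec -> \bar R) ->
  (forall x, 0 <= f x) -> (forall x, 0 <= g x) ->
  \int[nu alpha pi]_(x in cone S) (g x * (wt (- alpha) x)%:E * \int[P x]_w f (tcX X (- alpha) t w)) =
  \int[Lambda pi]_(x in cone S) (g x * \int[P x]_w f (tcX X (- alpha) t w)).
Proof.
move=> vm t0 mf mg f0 g0; have vmW := vmarkov_lamperti alpha SS vm.
pose u x := transition (cone S) (tcX X (- alpha)) P f (t, x).
have mu' : measurable_fun setT (u : borel vec -> \bar R).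
  apply: (measurableT_comp (measurable_transition mE vmW mf f0)).
  exact: measurable_fun_pair.
have u0 x : 0 <= u x by exact: transition_ge0.
have uE x : x \in cone S -> u x = \int[P x]_w f (tcX X (- alpha) t w).
  by move=> xS; rewrite /u /transition /= t0 xS.
have mwt : measurable_fun setT (fun x : borel vec => (wt (- alpha) x)%:E).
  by apply/measurable_EFinP; exact: measurable_wt.
transitivity (\int[nu alpha pi]_(x in cone S) (g x * (wt (- alpha) x)%:E * u x)).
  by apply: eq_integral => x xS; rewrite (uE x xS).
rewrite (ge0_integral_nu pi mE).
- apply: eq_integral => x xS; rewrite (uE x xS) muleAC wtK//.
  by move: xS; rewrite inE.
- by apply: emeasurable_funM => //; exact: emeasurable_funM.
- by move=> x; rewrite !mule_ge0// lee_fin wt_ge0.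
Qed.

Let integral_Lambda_transition F (X : R -> Omega -> vec) P t (f g : vec -> \bar R) : vmarkov (cone S) F X P ->
  (0 <= t)%R -> measurable_fun setT (f : borel vec -> \bar R) ->
  measurable_fun setT (g : borel vec -> \bar R) ->
  (forall x, 0 <= f x) -> (forall x, 0 <= g x) ->
  \int[Lambda pi]_(x in cone S) (g x * (wt alpha x)%:E *
    \int[P x]_w f (tcX (tcX X (- alpha)) alpha t w)) =
  \int[nu alpha pi]_(x in cone S) (g x * \int[P x]_w f (X t w)).
Proof.
move=> vm t0 mf mg f0 g0.
pose u x := transition (cone S) X P f (t, x).
have mu' : measurable_fun setT (u : borel vec -> \bar R).
  apply: (measurableT_comp (measurable_transition mE vm mf f0)).
  exact: measurable_fun_pair.
have u0 x : 0 <= u x by exact: transition_ge0.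
have uE x : x \in cone S -> u x = \int[P x]_w f (X t w).
  by move=> xS; rewrite /u /transition /= t0 xS.
transitivity (\int[nu alpha pi]_(x in cone S) (g x * u x)); last first.
  by apply: eq_integral => x xS; rewrite (uE x xS).
rewrite (ge0_integral_nu pi mE).
- apply: eq_integral => x xS; rewrite (uE x xS) muleAC; congr (_ * _ * _).
  by apply: eq_integral => w _; rewrite (tcXK w vm t0).
- exact: emeasurable_funM.
- by move=> x; rewrite mule_ge0.
Qed.

(** One implication is the time change with exponent [- alpha]. The other is the same lemma with
    exponent [alpha], applied to the time-changed processes, which it turns back into [X1] and
    [X2]. *)
Lemma vdual_lamperti :
  vdual (cone S) (nu alpha pi) X1 P1 X2 P2 <->
  vdual (cone S) (Lambda pi) (tcX X1 (- alpha)) P1 (tcX X2 (- alpha)) P2.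
Proof.
split=> dual t f g t0 mf mg f0 g0 fz gz.
  have snu := sigma_finite_nu SS mE piS a0.
  have := vdual_time_change (- alpha) (cone0 SS) mE vm1 vm2 snu dual t0 mf mg f0 g0 fz gz.
  rewrite (integral_nu_transition vm1 t0 mf mg f0 g0).
  by rewrite (integral_nu_transition vm2 t0 mg mf g0 f0).
have sL := sigma_finite_Lambda SS mE piS.
have := vdual_time_change alpha (cone0 SS) mE (vmarkov_lamperti alpha SS vm1)
  (vmarkov_lamperti alpha SS vm2) sL dual t0 mf mg f0 g0 fz gz.
rewrite (integral_Lambda_transition vm1 t0 mf mg f0 g0).
by rewrite (integral_Lambda_transition vm2 t0 mg mf g0 f0).
Qed.

End duality_lamperti.

Theorem theorem2 (R : realType) (n : nat) (S : set 'rV[R]_n.+1)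
    (d : measure_display) (Omega : measurableType d) (alpha : R)
    (X : R -> Omega -> 'rV[R]_n.+1) (P : 'rV[R]_n.+1 -> probability Omega R)
    (Y : R -> Omega -> option ('rV[R]_n.+1 * R))
    (Q : option ('rV[R]_n.+1 * R) -> probability Omega R) :
  S `<=` sphere -> locally_compact [set: set_type S] -> 0 <= alpha ->
  is_ssMp S alpha X P -> associated_MAP S alpha X P Y Q ->
  [/\ is_ssMp S alpha (hat alpha X) (hat_law P) /\
        (forall w, lifetime (absorb (hat alpha X)) w =
                   total_clock (- (2 * alpha)) X w),
      associated_MAP S alpha (hat alpha X) (hat_law P)
        (opp_MAP Y) (opp_MAP_law Q) &
      forall pi : {sigma_finite_measure set (borel 'rV[R]_n.+1) -> \bar R},
        pi (~` S) = 0%E ->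
        in_duality (cone S) (nu alpha pi)
          (absorb X) (absorb_law P)
          (absorb (hat alpha X)) (absorb_law (hat_law P)) <->
        reversible S pi Y Q].
Proof.
move=> SS _ a0 ssX mapY; have ssX2 := ssMp_hat SS ssX.
have [[F mX] selfsim] := ssX; have [[F2 mX2] selfsim2] := ssX2.
have vm := vmarkov_of (cone0 SS) mX; have vm2 := vmarkov_of (cone0 SS) mX2.
split; first by split => // w; exact: lifetime_hat (vm_good vm w).
  exact: associated_MAP_hat.
move=> pi piS; have mE := measurable_cone vm.
apply: (iff_trans (in_duality_vdual _ _ _ _ (cone0 SS) (sigma_finite_nu SS mE piS a0))).
apply: (iff_trans (vdual_lamperti SS a0 vm vm2 piS)).
have [_ YE QE _] := mapY.
have YE' t (t0 : 0 <= t) w : Y t w = polar (tcX X (- alpha) t w).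
  by rewrite YE// (lampertiE alpha (vm_good vm w) t0).
have QE' y : S y -> Q (Some (y, 0)) = P y.
  by move=> Sy; rewrite QE// expR0 scale1r.
(* Duality with respect to [Lambda pi] and reversibility are families of identities indexed by [t],
   and they are equivalent at each [t] separately. *)
have key t (t0 : 0 <= t) :=
  reversible_dualE SS vm vm2 selfsim selfsim2 piS t0 (YE' t t0) QE'.
split=> H t.
  by move=> C t0; apply: (iffRL (key t t0)) => f g; exact: H.
by move=> f g t0; apply: (iffLR (key t t0)) => C; exact: H.
Qed.
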